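(* Let $w\in\mathcal W^{\alpha_3}_{\alpha_1,\alpha_2}$ and let $v$ be a doubling weight on $\mathbb R^d$ with doubling constant $C>1$. Let $\mathcal F$ be an admissible continuous wavelet frame, $1\le p,q\le\infty$ ($p<\infty$ in the $F$-case) and $a>0$. Put $\tilde w(x,t)=t^{d/q-d/2}w(x,t)$ for $0<t\le1$, $\tilde w(x,\infty)=w(x,\infty)$, and $B(\mathbb R^d)=L_p(\mathbb R^d,v)$. Then, in the sense of equivalent norms, $$B^w_{p,q,a}(\mathbb R^d,v)=\mathsf{Co}(L^{\tilde w}_{B,q,a},\mathcal F),\qquad F^w_{p,q,a}(\mathbb R^d,v)=\mathsf{Co}(P^{\tilde w}_{B,q,a},\mathcal F).$$
   Context: $X=\mathbb R^d\times[(0,1)\cup\{\infty\}]$ with $\int_XF\,d\mu=\int_{\mathbb R^d}\int_0^1F(y,s)\frac{ds}{s^{d+1}}dy+\int_{\mathbb R^d}F(y,\infty)dy$. $\widehat\varphi(\xi)=(2\pi)^{-d/2}\int e^{-ix\xi}\varphi(x)dx$. $\|F|L_p(\mathbb R^d,v)\|=(\int|F|^pv\,dx)^{1/p}$. Usual modifications for $p$ or $q=\infty$. A weight $v:\mathbb R^d\to(0,\infty)$ is doubling with doubling constant $C$ if $\int_{B(x,2r)}v\le C\int_{B(x,r)}v$ for all $x\in\mathbb R^d$, $r>0$. For $\alpha_1,\alpha_2,\alpha_3\ge0$, $\mathcal W^{\alpha_3}_{\alpha_1,\alpha_2}$ is the class of positive weights $w(x,t)$, $x\in\mathbb R^d$,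 $t\in(0,1]\cup\{\infty\}$, with (W1) $(t/s)^{\alpha_1}w(x,s)\le w(x,t)\le(t/s)^{-\alpha_2}w(x,s)$ for $1\ge s\ge t>0$, $t^{\alpha_1}w(x,\infty)\le w(x,t)\le t^{-\alpha_2}w(x,\infty)$ for $0<t\le1$; (W2) $w(x,t)\le w(y,t)(1+|x-y|/t)^{\alpha_3}$ for finite $t$, $w(x,\infty)\le w(y,\infty)(1+|x-y|)^{\alpha_3}$. Function spaces: put $w_j(x)=w(x,2^{-j})$ ($j\in\mathbb N$), $w_0(x)=w(x,\infty)$. Let $\{\varphi_j\}_{j\in\mathbb N_0}\subset\mathcal S(\mathbb R^d)$ with $\varphi_j=\varphi(2^{-j}\cdot)$ for $j\in\mathbb N$, $\operatorname{supp}\varphi_0\subset\{|x|\le2\}$, $\operatorname{supp}\varphi\subset\{1/2\le|x|\le2\}$, $\sum_j\varphi_j=1$; $\widehat{\theta_j}=\varphi_j$. With $M_jf(x)=\sup_{z\in\mathbb R^d}\frac{|(\theta_j*f)(x+z)|}{(1+2^j|z|)^a}$: $B^w_{p,q,a}(\mathbb R^d,v)$ is the set of $f\in\mathcal S'$ with norm $\big(\sum_{j\ge0}\|w_jM_jf|L_p(\mathbb R^d,v)\|^q\big)^{1/q}<\infty$; $F^w_{p,q,a}(\mathbb R^d,v)$ ($p<\infty$) the set of $f\in\mathcal S'$ with norm $\big\|\big(\sum_{j\ge0}|w_jM_jf|^q\big)^{1/q}|L_p(\mathbb R^d,v)\big\|<\infty$. Peetre spaces on $X$: with $\mathcal P_aF(x,t)=\sup_z\frac{|F(x+z,t)|}{(1+|z|/t)^a}$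 ($0<t<1$), $\mathcal P_aF(x,\infty)=\sup_z\frac{|F(x+z,\infty)|}{(1+|z|)^a}$, $\|F|P^{\tilde w}_{B,q,a}\|=\|\tilde w(\cdot,\infty)\mathcal P_aF(\cdot,\infty)|B\|+\big\|\big(\int_0^1[\tilde w(\cdot,t)\mathcal P_aF(\cdot,t)]^q\frac{dt}{t^{d+1}}\big)^{1/q}|B\big\|$, $\|F|L^{\tilde w}_{B,q,a}\|=\|\tilde w(\cdot,\infty)\mathcal P_aF(\cdot,\infty)|B\|+\big(\int_0^1\|\tilde w(\cdot,t)\mathcal P_aF(\cdot,t)|B\|^q\frac{dt}{t^{d+1}}\big)^{1/q}$. Admissible continuous wavelet frame: $\mathcal F=\{\varphi_{\mathbf x}\}_{\mathbf x\in X}$ with $\varphi_{(x,\infty)}=\Phi_0(\cdot-x)$, $\varphi_{(x,t)}=t^{-d/2}\Phi((\cdot-x)/t)$, where $\Phi\in\mathcal S(\mathbb R^d)$ is radial, $\widehat\Phi>0$ on $\{1/2<|\xi|<2\}$, all moments of $\Phi$ vanish, $\Phi_0\in\mathcal S(\mathbb R^d)$, normalized so that $\mathcal F$ is a tight frame with constant 1: $\int_0^\infty|\widehat\Phi(t\xi)|^2\frac{dt}t=(2\pi)^{-d}$ ($\xi\ne0$), $|\widehat\Phi_0(\xi)|^2+\int_0^1|\widehat\Phi(t\xi)|^2\frac{dt}t=(2\pi)^{-d}$. Coorbits: $V_{\mathcal F}f(\mathbf x)=\langle f,\varphi_{\mathbf x}\rangle$. For $Y=P^{\tilde w}_{B,q,a}$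 or $L^{\tilde w}_{B,q,a}$, $\mathsf{Co}(Y,\mathcal F)=\{f\in(\mathcal H^1_u)^\sim:V_{\mathcal F}f\in Y\}$ with norm $\|V_{\mathcal F}f|Y\|$, where $\mathcal H^1_u=\{f\in L_2(\mathbb R^d):V_{\mathcal F}f\in L_1(X,u\,d\mu)\}$, $(\mathcal H^1_u)^\sim$ is its anti-dual, $V_{\mathcal F}f(\mathbf x)=f(\varphi_{\mathbf x})$ for $f\in(\mathcal H^1_u)^\sim$, and $u=v_{\tilde w,B,q}$: $u(x,t)=t^{-|\tilde\alpha_1-d/q|}(1+|x|/t)^{\alpha_3+(\log_2C)/p}$ ($0<t\le1$), $u(x,\infty)=(1+|x|)^{\alpha_3+(\log_2C)/p}$, $\tilde\alpha_1=\max\{\alpha_1+d/q-d/2,0\}$. An element $g\in(\mathcal H^1_u)^\sim$ is identified with the tempered distribution $\varphi\mapsto g(\overline\varphi)$; equivalently $\mathsf{Co}(Y,\mathcal F)=\{f\in\mathcal S'(\mathbb R^d):V_{\mathcal F}f\in Y\}$ with $V_{\mathcal F}f(\mathbf x)=f(\overline{\varphi_{\mathbf x}})$. *)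

(* Defs.v *)
From HB Require Import structures.
From mathcomp Require Import all_boot all_order all_algebra.
From mathcomp Require Import all_classical all_reals all_analysis.
From mathcomp Require Import ess_sup_inf.
From mathcomp Require Import complex.

Set Implicit Arguments.
Unset Strict Implicit.
Unset Printing Implicit Defensive.

Import Order.TTheory GRing.Theory Num.Theory.
Import numFieldNormedType.Exports.

Local Open Scope classical_set_scope.
Local Open Scope ring_scope.

(* 'rV[R]_n carries the sigma-algebra generated by the coordinates, i.e. the
   Borel sets of R^n. *)
Definition rV_display : measure_display. Proof. exact. Qed.

Section measurable_rV.
Context (R : realType) (n : nat).

Definition coord (i : 'I_n) (x : 'rV[R]_n) : measurableTypeR R := x ord0 i.

Let rV_set0 : g_sigma_preimage coord set0.
Proof. exact: sigma_algebra0. Qed.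

Let rV_setC A : g_sigma_preimage coord A -> g_sigma_preimage coord (~` A).
Proof. exact: sigma_algebraC. Qed.

Let rV_bigcup (F : _^nat) : (forall i, g_sigma_preimage coord (F i)) ->
  g_sigma_preimage coord (\bigcup_i (F i)).
Proof. exact: sigma_algebra_bigcup. Qed.

HB.instance Definition _ := @isMeasurable.Build rV_display
  'rV[R]_n (g_sigma_preimage coord) rV_set0 rV_setC rV_bigcup.

End measurable_rV.

Section lebesgue_rV.
Context (R : realType).

Definition rV_cons n (p : measurableTypeR R * 'rV[R]_n) : 'rV[R]_n.+1 :=
  row_mx (const_mx p.1 : 'rV_1) p.2.

Lemma measurable_coord n (i : 'I_n) : measurable_fun [set: 'rV[R]_n] (coord i).
Proof.
move=> _ Y mY; rewrite setTI; apply: sub_sigma_algebra.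
rewrite -bigcup_seq/=; exists i => /=; first by rewrite mem_index_enum.
by exists Y => //; rewrite setTI.
Qed.

Lemma measurable_rV_cons n : measurable_fun [set: _] (@rV_cons n).
Proof.
have mcoord (i : 'I_n.+1) : measurable_fun setT (coord i \o @rV_cons n).
  case: (split_ordP (i : 'I_(1 + n))) => j ij.
    rewrite (_ : _ \o _ = fst); first exact: measurable_fst.
    by apply/funext => p; rewrite /coord/= /rV_cons ij; rewrite (@row_mxEl _ 1 1 n) mxE.
  rewrite (_ : _ \o _ = coord j \o snd).
    exact: measurableT_comp (measurable_coord j) measurable_snd.
  by apply/funext => p; rewrite /coord/= /rV_cons ij; rewrite (@row_mxEr _ 1 1 n).
move=> _ Y; rewrite setTI; move: Y.
apply: (@smallest_sub _ _ _ [set Y | measurable (@rV_cons n @^-1` Y)]).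
  split => /=.
  - by rewrite preimage_set0.
  - by move=> A mA; rewrite setTD -preimage_setC; exact: measurableC.
  - by move=> F mF; rewrite preimage_bigcup; exact: bigcup_measurable.
rewrite -bigcup_seq; apply: bigcup_sub => i _ A [B mB <-] /=.
by rewrite setTI -comp_preimage -[X in measurable X]setTI; exact: mcoord.
Qed.

Definition lebesgue_rVS n (mu : {measure set 'rV[R]_n -> \bar R}) :
    {measure set 'rV[R]_n.+1 -> \bar R} :=
  measure_function_pushforward__canonical__measure_function_Measure
    (product_measure2 lebesgue_measure mu) (@measurable_rV_cons n).

(* Lebesgue measure on R^n, as the n-fold product of Lebesgue measure on R. *)
Fixpoint lebesgue_rV n : {measure set 'rV[R]_n -> \bar R} :=
  if n is n.+1 then lebesgue_rVS (lebesgue_rV n) else dirac (0 : 'rV[R]_0).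

End lebesgue_rV.

Section euclidean.
Context (R : realType) (d : nat).
Implicit Types x y : 'rV[R]_d.

Definition dotp x y : R := \sum_i x ord0 i * y ord0 i.

(* The library norm `|x| on 'rV[R]_d is the sup norm. *)
Definition enorm x : R := Num.sqrt (dotp x x).

Definition eball x (r : R) : set 'rV[R]_d := [set y | enorm (y - x) < r].

Definition radial (T : Type) (f : 'rV[R]_d -> T) :=
  forall x y, enorm x = enorm y -> f x = f y.

End euclidean.

Section schwartz.
Context (R : realType) (d : nat).
Local Notation Rd := 'rV[R]_d.
Implicit Types f g : Rd -> R[i].

Definition cabs (z : R[i]) : R := ComplexField.Normc.normc z.

(* Iterated partial derivative in the directions listed in s. *)
Definition pderiv (s : seq 'I_d) (h : Rd -> R) : Rd -> R :=
  foldr (fun i (k : Rd -> R) => 'D_(delta_mx ord0 i) k) h s.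

Definition cpderiv (s : seq 'I_d) f (x : Rd) : R[i] :=
  (pderiv s (@complex.Re R \o f) x +i* pderiv s (@complex.Im R \o f) x)%C.

Definition smooth f := forall s x,
  differentiable (pderiv s (@complex.Re R \o f)) x /\
  differentiable (pderiv s (@complex.Im R \o f)) x.

Definition schwartz_seminorm (N : nat) f : \bar R :=
  ereal_sup [set r | exists s x, (size s <= N)%N /\
    r = ((1 + enorm x) ^+ N * cabs (cpderiv s f x))%:E].

Definition schwartz f :=
  smooth f /\ forall N, (schwartz_seminorm N f < +oo)%E.

(* Tempered distributions are represented by functionals on all functions
   Rd -> R[i], constrained, and only ever evaluated, on Schwartz functions. *)
Record tempered_distribution := TemperedDistribution {
  td_eval :> (Rd -> R[i]) -> R[i];
  td_linear : forall (c : R[i]) f g, schwartz f -> schwartz g ->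
    td_eval (fun x => c * f x + g x) = c * td_eval f + td_eval g;
  td_continuous : exists (N : nat) (K : R), forall f, schwartz f ->
    ((cabs (td_eval f))%:E <= K%:E * schwartz_seminorm N f)%E
}.

Definition csupp f : set Rd := closure [set x | f x != 0].

Definition cintegral f : R[i] :=
  ((\int[lebesgue_rV R d]_x complex.Re (f x)) +i*
   (\int[lebesgue_rV R d]_x complex.Im (f x)))%C.

Definition cis (t : R) : R[i] := (cos t +i* sin t)%C.

Definition fourier f (xi : Rd) : R[i] :=
  ((2 * pi) `^ (- (d%:R / 2)))%:C%C *
  cintegral (fun x => cis (- dotp x xi) * f x).

Definition convolution (f : Rd -> R[i]) (u : tempered_distribution) (x : Rd) :=
  u (fun y => f (x - y)).

End schwartz.

Section norms.
Context (R : realType).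
Local Open Scope ereal_scope.

(* L_p norm on D with respect to the measure v dmu; as v > 0, the null sets of
   v dmu are those of mu. *)
Definition wLnorm dT (T : measurableType dT) (mu : {measure set T -> \bar R})
    (D : set T) (v : T -> R) (p : \bar R) (F : T -> \bar R) : \bar R :=
  if p is r%:E then (\int[mu]_(x in D) (`|F x| `^ r * (v x)%:E)) `^ r^-1
  else ess_sup mu ((abse \o F) \_ D).

Definition LpRd d (v : 'rV[R]_d -> R) (p : \bar R) :=
  wLnorm (lebesgue_rV R d) setT v p.

(* L_q norm on (0,1) with respect to dt/t^{d+1}. *)
Definition scaleLnorm (d : nat) (q : \bar R) (g : R -> \bar R) :=
  wLnorm (@lebesgue_measure R) `]0%R, 1%R[%classic (fun t => (t ^- d.+1)%R) q g.

(* 1/q, with 1/oo = 0. *)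
Definition einv (q : \bar R) : R := if q is r%:E then (r^-1)%R else 0%R.

End norms.

Section weights.
Context (R : realType) (d : nat).
Local Notation Rd := 'rV[R]_d.

Definition doubling_weight (C : R) (v : Rd -> R) :=
  [/\ measurable_fun setT (v : Rd -> measurableTypeR R),
      forall x, 0 < v x &
      forall x r, 0 < r ->
        (\int[lebesgue_rV R d]_(y in eball x (2 * r)) (v y)%:E <=
         C%:E * \int[lebesgue_rV R d]_(y in eball x r) (v y)%:E)%E].

(* Functions of (x, t), where t is a positive real or infinity, take
   t : \bar R; they are only ever evaluated at t = r%:E with 0 < r <= 1 and at
   t = +oo. *)
Record weight_class (al1 al2 al3 : R) (w : Rd -> \bar R -> R) : Prop := {
  wc_pos_fin : forall x t, 0 < t <= 1 -> 0 < w x t%:E;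
  wc_pos_oo : forall x, 0 < w x +oo%E;
  wc_W1_fin : forall x s t, 0 < t -> t <= s -> s <= 1 ->
    (t / s) `^ al1 * w x s%:E <= w x t%:E <= (t / s) `^ (- al2) * w x s%:E;
  wc_W1_oo : forall x t, 0 < t -> t <= 1 ->
    t `^ al1 * w x +oo%E <= w x t%:E <= t `^ (- al2) * w x +oo%E;
  wc_W2_fin : forall x y t, 0 < t -> t <= 1 ->
    w x t%:E <= w y t%:E * (1 + enorm (x - y) / t) `^ al3;
  wc_W2_oo : forall x y,
    w x +oo%E <= w y +oo%E * (1 + enorm (x - y)) `^ al3
}.

Definition wtilde (q : \bar R) (w : Rd -> \bar R -> R) (x : Rd) (t : \bar R) : R :=
  if t is r%:E then r `^ (d%:R * einv q - d%:R / 2) * w x t else w x t.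

Definition wseq (w : Rd -> \bar R -> R) (j : nat) (x : Rd) : R :=
  if j is 0%N then w x +oo%E else w x (2 ^- j)%:E.

End weights.

Section function_spaces.
Context (R : realType) (d : nat).
Local Notation Rd := 'rV[R]_d.

Definition dyadic (phi0 phi : Rd -> R[i]) (j : nat) (xi : Rd) : R[i] :=
  if j is 0%N then phi0 xi else phi (2 ^- j *: xi).

(* The sum of the dyadic pieces converges componentwise to 1: R[i] is not
   equipped with a topology. *)
Record resolution_of_unity (phi0 phi : Rd -> R[i]) (theta : nat -> Rd -> R[i])
    : Prop := {
  ru_schwartz0 : schwartz phi0;
  ru_schwartz : schwartz phi;
  ru_supp0 : csupp phi0 `<=` [set xi | enorm xi <= 2];
  ru_supp : csupp phi `<=` [set xi | 2^-1 <= enorm xi <= 2];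
  ru_sum : forall xi,
    (fun n => complex.Re (\sum_(0 <= j < n) dyadic phi0 phi j xi)) @ \oo --> (1 : R) /\
    (fun n => complex.Im (\sum_(0 <= j < n) dyadic phi0 phi j xi)) @ \oo --> (0 : R);
  ru_theta_schwartz : forall j, schwartz (theta j);
  ru_theta : forall j, fourier (theta j) =1 dyadic phi0 phi j
}.

Definition peetre_seq (theta : nat -> Rd -> R[i]) (a : R)
    (f : tempered_distribution R d) (j : nat) (x : Rd) : \bar R :=
  ereal_sup [set (cabs (convolution (theta j) f (x + z)) /
                  (1 + 2 ^+ j * enorm z) `^ a)%:E | z in [set: Rd]].

Variables (theta : nat -> Rd -> R[i]) (w : Rd -> \bar R -> R) (v : Rd -> R).
Variables (p q : \bar R) (a : R).

Definition Bnorm (f : tempered_distribution R d) : \bar R :=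
  Lnorm counting q (fun j : nat => LpRd v p
    (fun x => (wseq w j x)%:E * peetre_seq theta a f j x)%E).

Definition Fnorm (f : tempered_distribution R d) : \bar R :=
  LpRd v p (fun x => Lnorm counting q
    (fun j : nat => (wseq w j x)%:E * peetre_seq theta a f j x)%E).

End function_spaces.

Section peetre_spaces.
Context (R : realType) (d : nat).
Local Notation Rd := 'rV[R]_d.
Implicit Types F : Rd -> \bar R -> R[i].
Local Open Scope ereal_scope.

Definition peetre (a : R) F (x : Rd) (t : \bar R) : \bar R :=
  ereal_sup [set (cabs (F (x + z)%R t) /
    (1 + enorm z / (if t is r%:E then r else 1)) `^ a)%R%:E | z in [set: Rd]].

Variables (B : (Rd -> \bar R) -> \bar R) (q : \bar R) (a : R).
Variable w : Rd -> \bar R -> R.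

Definition PXnorm F : \bar R :=
  B (fun x => (w x +oo)%:E * peetre a F x +oo) +
  B (fun x => scaleLnorm d q (fun t => (w x t%:E)%:E * peetre a F x t%:E)).

Definition LXnorm F : \bar R :=
  B (fun x => (w x +oo)%:E * peetre a F x +oo) +
  scaleLnorm d q (fun t => B (fun x => (w x t%:E)%:E * peetre a F x t%:E)).

End peetre_spaces.

Section coorbit.
Context (R : realType) (d : nat).
Local Notation Rd := 'rV[R]_d.

Definition wavelet (Phi0 Phi : Rd -> R[i]) (x : Rd) (t : \bar R) : Rd -> R[i] :=
  fun y => if t is r%:E
           then (r `^ (- (d%:R / 2)))%:C%C * Phi (r^-1 *: (y - x))
           else Phi0 (y - x).

Record admissible_frame (Phi0 Phi : Rd -> R[i]) : Prop := {
  af_schwartz0 : schwartz Phi0;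
  af_schwartz : schwartz Phi;
  af_radial : radial Phi;
  af_pos : forall xi, 2^-1 < enorm xi < 2 -> 0 < fourier Phi xi;
  af_moments : forall m : 'I_d -> nat,
    cintegral (fun x => (\prod_i x ord0 i ^+ m i)%:C%C * Phi x) = 0;
  af_tight : forall xi, xi != 0 ->
    (\int[@lebesgue_measure R]_(t in `]0%R, +oo[%classic)
       (cabs (fourier Phi (t *: xi)) ^+ 2 / t)%:E)%E = ((2 * pi) ^- d)%:E;
  af_tight0 : forall xi,
    ((cabs (fourier Phi0 xi) ^+ 2)%:E +
     \int[@lebesgue_measure R]_(t in `]0%R, 1%R[%classic)
       (cabs (fourier Phi (t *: xi)) ^+ 2 / t)%:E)%E = ((2 * pi) ^- d)%:E
}.

Definition voice (Phi0 Phi : Rd -> R[i]) (f : tempered_distribution R d)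
    (x : Rd) (t : \bar R) : R[i] :=
  f (fun y => conjc (wavelet Phi0 Phi x t y)).

Variables (Phi0 Phi : Rd -> R[i]).

(* Co(Y, F), with Y given by its norm, is the set of the tempered distributions
   whose coorbit norm is finite. *)
Definition Conorm (Y : (Rd -> \bar R -> R[i]) -> \bar R)
    (f : tempered_distribution R d) : \bar R := Y (voice Phi0 Phi f).

Definition space (N : tempered_distribution R d -> \bar R)
  : set (tempered_distribution R d) := [set f | (N f < +oo)%E].

Definition equal_with_equivalent_norms
    (N1 N2 : tempered_distribution R d -> \bar R) :=
  space N1 = space N2 /\
  exists c1 c2 : R, [/\ 0 < c1, 0 < c2 &
    forall f, space N1 f -> (c1%:E * N1 f <= N2 f <= c2%:E * N1 f)%E].

End coorbit.

(* Main.v *)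
Require Import Defs.
From HB Require Import structures.
From mathcomp Require Import all_boot all_order all_algebra.
From mathcomp Require Import all_classical all_reals all_analysis.
From mathcomp Require Import ess_sup_inf measurable_realfun.
From mathcomp Require Import complex.
From mathcomp Require Import lra ring.
Set Implicit Arguments.
Unset Strict Implicit.
Unset Printing Implicit Defensive.
Import Order.TTheory GRing.Theory Num.Theory.
Import numFieldNormedType.Exports.
Local Open Scope classical_set_scope.
Local Open Scope ring_scope.

(** Both kinds of norm measure a distribution [f] through Peetre maximal
    functions [pmax a f lam t x] of its convolutions with the dilates of an
    analysing function [lam], together with one smooth part at the scale 1. The
    dyadic norms use the function with Fourier transform [phi] at the scales
    2^-j with counting measure; the coorbit norms use the conjugate reflection of
    the wavelet at the scales t of the unit interval. There, the factor
    t^(d/q - d/2) of the modified weight, the factor t^(d/2) of the wavelets and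
    the measure dt/t^(d+1) combine into the measure dt/t. The theorem is therefore
    a comparison of two analysing systems, each over its own space of scales.

    Each system is completed by a dual pair to a Calderon identity: for the
    wavelets the dual is the frame itself and the identity is the tightness of the
    frame; for the dyadic functions the dual is the sum of the neighbouring pieces
    and the identity is the resolution of unity. On the Fourier side the identity
    says that every rapidly decreasing function g is the superposition, over the
    scales t, of its convolutions with (kap * lam)_t ([calderon_reproducing]).

    Apply this to g_s, where g is an analysing function of the other system, and
    test [f] against the formula. The kernel g_s * kap_t is smaller than every
    power of min(s/t, t/s), since all moments of the function at the smaller scale
    vanish ([kernel_bound]). A fixed number of these powers pays for the growth of
    the maximal function, so that the maximal function of one system is bounded
    pointwise by the superposition of those of the other, with a kernel that is an
    arbitrary power of min(s/t, t/s) ([pmax_bound]). Finitely many more powers pay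
    for the variation of the weight in t, and one remains: min(s/t, t/s) itself is
    a kernel with bounded row and column sums. Minkowski's inequality and Schur's
    test turn the pointwise bound into a bound of norms ([change_of_system]), with
    the norm in x either inside or outside the norm in t. Exchanging the two
    systems gives the converse bound.

    Two points of the argument are of a technical nature. The distribution is
    moved under the integral sign in the form of an inequality
    |F(int G)| <= int |F(G)|, proved by Riemann sums over small cells of scales or
    positions ([tempered_le_integral]); this is what the cover in the definition
    of a space of scales is for. And the weighted maximal functions are lower
    semicontinuous, hence measurable, which gives Tonelli's theorem access to
    their norms ([measurable_weighted_pmax]). *)

(** * Borel sets and Lebesgue measure on row vectors *)

Section open_measurable.
Context (R : realType) (d : nat).
Local Notation Rd := 'rV[R]_d.

(** An open set is a countable union of boxes with rational centres and sizes, and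
    boxes belong to the product of the coordinate sigma-algebras. *)
Lemma open_measurable_rVR (U : set (Rd * measurableTypeR R)) :
  open (U : set (Rd * R)) -> measurable U.
Proof.
move=> oU.
pose Box (k : 'rV[rat]_d * rat * nat) : set (Rd * measurableTypeR R) :=
  [set y : Rd | forall i, (`|y ord0 i - ratr (k.1.1 ord0 i)| < k.2.+1%:R^-1 :> R)] `*`
  [set s : R | `|s - ratr k.1.2| < k.2.+1%:R^-1].
have mB k : measurable (Box k).
  apply: measurableX.
    rewrite (_ : mkset _ = \bigcap_(i in [set: 'I_d])
       (Defs.coord i @^-1` [set s : R | `|s - ratr (k.1.1 ord0 i)| < k.2.+1%:R^-1])).
      apply: fin_bigcap_measurable => // i _.
      rewrite -[X in measurable X]setTI; apply: measurable_coord => //.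
      rewrite (_ : mkset _ = ball (ratr (k.1.1 ord0 i) : R) k.2.+1%:R^-1); last first.
        by apply/seteqP; split => s /=; rewrite /ball/= distrC.
      by apply: open_measurable; apply: ball_open.
    by apply/seteqP; split => [y h i _|y h i] /=; [exact: h|exact: (h i)].
  rewrite (_ : mkset _ = ball (ratr k.1.2 : R) k.2.+1%:R^-1); last first.
    by apply/seteqP; split => s /=; rewrite /ball/= distrC.
  by apply: open_measurable; apply: ball_open.
have -> : U = \bigcup_(k in [set k | Box k `<=` U]) Box k.
  apply/seteqP; split => [[x t] Uxt|p [k sub /sub]//].
  have [e /= e0 he] : exists2 e, 0 < e & ball (x, t : R) e `<=` (U : set (Rd * R)).
    have /nbhs_ballP[e /= e0 he] : nbhs (x, t : R) (U : set (Rd * R)).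
      by move: oU; rewrite openE => /(_ _ Uxt).
    by exists e.
  pose n := Num.trunc (2 / e).
  have n1 : n.+1%:R^-1 < e / 2.
    rewrite invf_plt ?posrE ?divr_gt0// invf_div.
    by apply: truncnS_gt.
  have q0 (r : R) : exists q : rat, `|r - ratr q| < n.+1%:R^-1.
    have /rat_in_itvoo[q] : r - n.+1%:R^-1 < r + n.+1%:R^-1.
      by rewrite ltrBlDr -addrA ltrDl addr_gt0 ?invr_gt0.
    rewrite in_itv/= => /andP[h1 h2]; exists q.
    by rewrite ltr_norml ltrNl opprB !ltrBlDl h2/= -ltrBlDr h1.
  pose q (r : R) : rat := projT1 (cid (q0 r)).
  have hq r : `|r - ratr (q r)| < n.+1%:R^-1 by rewrite /q; case: cid.
  exists (\row_i q (x ord0 i), q t, n) => /=; last first.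
    by split => /= [i|]; rewrite ?mxE; exact: hq.
  move=> [y s] [/= hy hs]; apply: he; split => /=; last first.
    rewrite /ball/=; rewrite -(subrK (ratr (q t)) t) -addrA.
    rewrite (le_lt_trans (ler_normD _ _))// [ltRHS](splitr e) ltrD//.
      by rewrite (lt_trans (hq _)).
    by rewrite distrC (lt_trans hs).
  split=> // i j; rewrite (ord1 i).
  have := hy j; rewrite mxE => {}hy.
  rewrite /ball/=; rewrite -(subrK (ratr (q (x ord0 j))) (x ord0 j)) -addrA.
  rewrite (le_lt_trans (ler_normD _ _))// [ltRHS](splitr e) ltrD//.
    by rewrite (lt_trans (hq _)).
  by rewrite distrC (lt_trans hy).
have [f hf] : exists f : nat -> option ('rV[rat]_d * rat * nat)%type,
    forall k, exists n, f n = Some k.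
  by exists (@unpickle _) => k; exists (pickle k); exact: pickleK.
rewrite (_ : \bigcup_(k in _) _ = \bigcup_n
   (if f n is Some k then (if `[< Box k `<=` U >] then Box k else set0) else set0)).
  apply: bigcupT_measurable => n; case: (f n) => [k|]; last exact: measurable0.
  by case: ifP => // _; exact: measurable0.
apply/seteqP; split => [p [k sub Bp]|p [n _]].
  by have [n fn] := hf k; exists n => //; rewrite fn asboolT.
case: (f n) => // k; case: asboolP => // sub Bp; by exists k.
Qed.

Lemma open_measurable_rV (U : set Rd) : open U -> measurable U.
Proof.
move=> oU.
have mU : measurable (U `*` setT : set (Rd * measurableTypeR R)).
  apply: open_measurable_rVR; rewrite openE => -[x t] [Ux _].
  have : nbhs x U by move: oU; rewrite openE => /(_ _ Ux).
  by move=> /nbhs_ballP[e e0 he]; apply/nbhs_ballP; exists e => // -[y s] [/= /he].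
rewrite (_ : U = (fun x => (x, 0 : measurableTypeR R)) @^-1` (U `*` setT)).
  rewrite -[X in measurable X]setTI.
  exact: (measurable_fun_pair (f := id)).
by apply/seteqP; split => [x|x [] //] Ux; split.
Qed.

Lemma continuous_measurable_rV (f : Rd -> R) : continuous f ->
  measurable_fun setT (f : Rd -> measurableTypeR R).
Proof.
move=> cf; apply: (measurability _ (RGenOpens.measurableE R)).
move=> _ [_ [a [b ->] <-]]; rewrite setTI; apply: open_measurable_rV.
by move/continuousP : cf; apply; exact: interval_open.
Qed.

(** Lower semicontinuity is the form in which suprema over all translations become
    measurable: the supremum itself is uncountable. *)
Lemma lsc_measurable_rVR (D : set (Rd * measurableTypeR R)) (f : Rd * R -> \bar R) :
  open (D : set (Rd * R)) ->
  (forall r : R, open (D `&` [set x | (r%:E < f x)%E] : set (Rd * R))) ->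
  measurable_fun D (f : (Rd * measurableTypeR R)%type -> \bar R).
Proof.
move=> oD h; apply: (measurability _ (ErealGenOInfty.measurableE R)).
move=> _ [_ [r ->] <-]; apply: open_measurable_rVR.
rewrite (_ : _ `&` _ = D `&` [set x | (r%:E < f x)%E]); first exact: h.
by apply/seteqP; split => x /= []; rewrite in_itv/= ?andbT.
Qed.

Lemma lsc_measurable_rV (f : Rd -> \bar R) :
  (forall r : R, open [set x | (r%:E < f x)%E]) -> measurable_fun setT f.
Proof.
move=> h; apply: (measurability _ (ErealGenOInfty.measurableE R)).
move=> _ [_ [r ->] <-]; rewrite setTI; apply: open_measurable_rV.
rewrite (_ : _ @^-1` _ = [set x | (r%:E < f x)%E]); first exact: h.
by apply/seteqP; split => x /=; rewrite in_itv/= ?andbT.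
Qed.

End open_measurable.
Section lebesgue_rV_theory.
Context (R : realType).
Local Open Scope ereal_scope.

(** The measure [lebesgue_rV] under a name of its own, so that the sigma-finite
    structure can be inferred from it. *)
Definition leb n : set 'rV[R]_n -> \bar R := lebesgue_rV R n.

HB.instance Definition _ n := Measure.copy (@leb n) (lebesgue_rV R n).

Lemma rV_consl n (p : R * 'rV[R]_n) (j : 'I_1) : rV_cons p ord0 (lshift n j) = p.1.
Proof. by rewrite /rV_cons (@row_mxEl _ 1 1 n) mxE. Qed.

Lemma rV_consr n (p : R * 'rV[R]_n) (j : 'I_n) : rV_cons p ord0 (rshift 1 j) = p.2 ord0 j.
Proof. by rewrite /rV_cons (@row_mxEr _ 1 1 n). Qed.

Lemma lebS_rect n (A : set R) (B : set 'rV[R]_n) (C : set 'rV[R]_n.+1) :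
  measurable (A : set (measurableTypeR R)) -> measurable B ->
  (@rV_cons R n) @^-1` C = (A : set (measurableTypeR R)) `*` B ->
  leb C = lebesgue_measure A * leb B.
Proof.
move=> mA mB CAB; rewrite [LHS](_ : _ =
  product_measure2 lebesgue_measure (lebesgue_rV R n) (@rV_cons R n @^-1` C))//.
by rewrite CAB product_measure2E.
Qed.

Lemma leb_cube n (k : nat) : leb [set x : 'rV[R]_n | forall i, (`|x ord0 i| <= k%:R)%R] < +oo.
Proof.
elim: n => [|n ih].
  have -> : [set x : 'rV[R]_0 | forall i, (`|x ord0 i| <= k%:R)%R] = setT.
    by apply/seteqP; split => // x _ [].
  rewrite [ltLHS](_ : _ = dirac (0%R : 'rV[R]_0) setT)//.
  by rewrite diracT ltry.
rewrite (@lebS_rect n `[(- k%:R)%R, k%:R]%classic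
  [set x : 'rV[R]_n | forall i, (`|x ord0 i| <= k%:R)%R]).
- rewrite lebesgue_measure_itv/=; case: ifP => _; last by rewrite mul0e ltry.
  by rewrite -EFinB; apply: lte_mul_pinfty; rewrite // lee_fin; lra.
- exact: measurable_itv.
- rewrite (_ : mkset _ = \bigcap_(i in [set: 'I_n])
       (Defs.coord i @^-1` `[(- k%:R)%R, k%:R]%classic)).
    apply: fin_bigcap_measurable => // i _.
    rewrite -[X in measurable X]setTI; apply: measurable_coord => //.
  by apply/seteqP; split => [y h i _|y h i] /=; [|have := h i I];
    rewrite /Defs.coord /= in_itv/= -ler_norml.
- apply/seteqP; split => -[x y] /=.
    move=> h; split.
      by have := h (lshift n (ord0 : 'I_1)); rewrite rV_consl in_itv/= -ler_norml.
    by move=> i; have := h (rshift 1 i); rewrite rV_consr.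
  rewrite in_itv/= -ler_norml => -[hx hy] i.
  by case: (split_ordP (i : 'I_(1 + n))) => j ->; rewrite ?rV_consl ?rV_consr.
Qed.

Lemma measurable_cube n (k : R) :
  measurable [set x : 'rV[R]_n | forall i, (`|x ord0 i| <= k)%R].
Proof.
rewrite (_ : mkset _ = \bigcap_(i in [set: 'I_n])
       (Defs.coord i @^-1` `[(- k)%R, k]%classic)).
  apply: fin_bigcap_measurable => // i _.
  by rewrite -[X in measurable X]setTI; apply: measurable_coord.
by apply/seteqP; split => [y h i _|y h i] /=; [|have := h i I];
    rewrite /Defs.coord /= in_itv/= -ler_norml.
Qed.

Lemma leb_sigma_finite n : sigma_finite setT (@leb n).
Proof.
exists (fun k => [set x : 'rV[R]_n | forall i, (`|x ord0 i| <= k%:R)%R]).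
  apply/seteqP; split => // x _.
  exists (Num.trunc (\sum_i `|x ord0 i|)).+1 => //= i.
  apply: (@le_trans _ _ (\sum_i `|x ord0 i|)%R).
    by rewrite (bigD1 i)//= lerDl sumr_ge0.
  by apply: ltW; exact: truncnS_gt.
by move=> k; split; [exact: measurable_cube|exact: leb_cube].
Qed.

HB.instance Definition _ n :=
  @Measure_isSigmaFinite.Build _ _ _ (@leb n) (@leb_sigma_finite n).

(** One coordinate at a time: this is what makes inductions on the dimension possible. *)
Lemma ge0_integral_lebS n (f : 'rV[R]_n.+1 -> \bar R) :
  measurable_fun setT f -> (forall x, 0 <= f x) ->
  \int[@leb n.+1]_x f x =
  \int[@lebesgue_measure R]_x \int[@leb n]_y f (rV_cons (x, y)).
Proof.
move=> mf f0.
pose m2 : {measure set (measurableTypeR R * 'rV[R]_n) -> \bar R} :=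
  product_measure2 (@lebesgue_measure R) (@leb n).
rewrite [LHS](_ : _ = \int[pushforward m2 (@rV_cons R n)]_x f x)//.
rewrite ge0_integral_pushforward//=; last exact: measurable_rV_cons.
rewrite preimage_setT.
have mfc : measurable_fun setT (f \o @rV_cons R n).
  by apply: measurableT_comp => //; exact: measurable_rV_cons.
have m12 A : measurable A -> product_measure1 (@lebesgue_measure R) (@leb n) A = m2 A.
  have := @product_measure_unique _ _ _ _ _ (@lebesgue_measure R) (@leb n) m2.
  move=> + mA => /(_ _ _ mA); apply=> B C mB mC.
  by rewrite /m2/= product_measure2E.
transitivity (\int[product_measure1 (@lebesgue_measure R) (@leb n)]_x (f \o @rV_cons R n) x).
  by apply/esym; apply: eq_measure_integral => A mA _; exact: m12.
by rewrite fubini_tonelli1 => [//|//|x /=]; exact: f0.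
Qed.

Lemma ge0_integral_leb0 (f : 'rV[R]_0 -> \bar R) :
  (forall x, 0 <= f x) -> \int[@leb 0]_x f x = f 0%R.
Proof.
move=> f0; rewrite [LHS](_ : _ = \int[dirac (0%R : 'rV[R]_0)]_x f x)//.
rewrite integral_dirac//=; first by rewrite diracT mul1e.
move=> _ Y mY; rewrite setTI.
have [|] := pselect (Y (f 0%R)) => h.
  rewrite (_ : f @^-1` Y = setT); first exact: measurableT.
  by apply/seteqP; split => // x _ /=; rewrite [x](_ : _ = 0%R)//; apply/rowP => -[].
rewrite (_ : f @^-1` Y = set0); first exact: measurable0.
by apply/seteqP; split => // x /=; rewrite [x](_ : _ = 0%R)//; apply/rowP => -[].
Qed.

End lebesgue_rV_theory.

(** * Affine changes of variables and the Euclidean norm *)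

Section affine_change.
Context (R : realType).
Local Open Scope ereal_scope.

(** The pushforward of Lebesgue measure, multiplied by [|a|], has the values of
    Lebesgue measure on half-open intervals, hence equals it. *)
Lemma ge0_integral_leb1_affine (a b : R) (f : R -> \bar R) : a != 0%R ->
  measurable_fun setT (f : measurableTypeR R -> _) -> (forall x, 0 <= f x) ->
  \int[@lebesgue_measure R]_x f (a * x + b)%R =
  (`|a|^-1)%:E * \int[@lebesgue_measure R]_x f x.
Proof.
move=> a0 mf f0.
have mphi : measurable_fun setT ((fun x => a * x + b)%R : measurableTypeR R -> measurableTypeR R).
  by apply: measurable_funD => //; exact: mulrl_measurable.
have na : (0 <= `|a|)%R by [].
pose m : {measure set (measurableTypeR R) -> \bar R} :=
  mscale (NngNum na) (measure_function_pushforward__canonical__measure_function_Measure (@lebesgue_measure R) mphi).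
have me A : measurable A -> lebesgue_measure A = m A.
  apply: lebesgue_measure_unique => _ [[x y] /= xy <-].
  rewrite /m /mscale/= /pushforward.
  have [a_lt0|a_gt0|/eqP] := ltgtP a 0%R; last by rewrite (negbTE a0).
    rewrite (_ : _ @^-1` _ = `[((y - b) / a)%R, ((x - b) / a)%R[%classic); last first.
      apply/seteqP; split => z /=; rewrite !in_itv/=.
        by move=> /andP[h1 h2]; rewrite ler_ndivrMr// ltr_ndivlMr//; apply/andP; split; lra.
      by rewrite ler_ndivrMr// ltr_ndivlMr// => /andP[h1 h2]; apply/andP; split; lra.
    rewrite !lebesgue_measure_itv/= !lte_fin.
    rewrite ltr_ndivrMr// divfK// ltrD2r ltr0_norm//.
    case: ifPn => _; last by rewrite mule0.
    by rewrite -!EFinB -EFinM; congr (_%:E); field.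
  rewrite (_ : _ @^-1` _ = `]((x - b) / a)%R, ((y - b) / a)%R]%classic); last first.
    apply/seteqP; split => z /=; rewrite !in_itv/=.
      by move=> /andP[h1 h2]; rewrite ltr_pdivrMr// ler_pdivlMr//; apply/andP; split; lra.
    by rewrite ltr_pdivrMr// ler_pdivlMr// => /andP[h1 h2]; apply/andP; split; lra.
  rewrite !lebesgue_measure_itv/= !lte_fin.
  rewrite ltr_pdivrMr// divfK// ltrD2r gtr0_norm//.
  case: ifPn => _; last by rewrite mule0.
  by rewrite -!EFinB -EFinM; congr (_%:E); field.
have -> : \int[@lebesgue_measure R]_x f x = \int[m]_x f x.
  by apply: eq_measure_integral => A mA _; have /esym := me A mA.
rewrite /m ge0_integral_mscale//= ge0_integral_pushforward//= preimage_setT.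
by rewrite muleA -EFinM mulVf ?normr_eq0// mul1e.
Qed.

Lemma measurable_affine n (a : R) (b : 'rV[R]_n) :
  measurable_fun setT (fun x : 'rV[R]_n => a *: x + b)%R.
Proof.
move=> _ Y; rewrite setTI; move: Y.
apply: (@smallest_sub _ _ _ [set Y | measurable ((fun x : 'rV[R]_n => a *: x + b)%R @^-1` Y)]).
  split => /=.
  - by rewrite preimage_set0.
  - by move=> A mA; rewrite setTD -preimage_setC; exact: measurableC.
  - by move=> F mF; rewrite preimage_bigcup; exact: bigcup_measurable.
rewrite -bigcup_seq; apply: bigcup_sub => i _ A [B mB <-] /=.
rewrite setTI -comp_preimage -[X in measurable X]setTI.
apply: (_ : measurable_fun setT (Defs.coord i \o _)) => //.
rewrite (_ : _ \o _ = (fun y => a * y + b ord0 i)%R \o Defs.coord i).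
  apply: measurableT_comp; last exact: measurable_coord.
  by apply: measurable_funD => //; exact: mulrl_measurable.
by apply/funext => x; rewrite /= /Defs.coord !mxE.
Qed.

Lemma ge0_integral_leb_affine n (a : R) (b : 'rV[R]_n) (f : 'rV[R]_n -> \bar R) :
  a != 0%R -> measurable_fun setT f -> (forall x, 0 <= f x) ->
  \int[@leb R n]_x f (a *: x + b)%R = ((`|a| ^- n)%R)%:E * \int[@leb R n]_x f x.
Proof.
move=> a0; elim: n b f => [|n ih] b f mf f0.
  by rewrite !ge0_integral_leb0// expr0 invr1 mul1e; congr f; apply/rowP => -[].
rewrite !ge0_integral_lebS//; last first.
  by apply: measurableT_comp => //; exact: measurable_affine.
pose b0 := b ord0 (lshift n (ord0 : 'I_1)); pose b1 : 'rV[R]_n := @rsubmx _ 1 1 n b.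
have mfc : measurable_fun setT (f \o @rV_cons R n).
  by apply: measurableT_comp => //; exact: measurable_rV_cons.
have E x y : f (a *: rV_cons (x, y) + b)%R = f (rV_cons (a * x + b0, a *: y + b1))%R.
  congr f; apply/rowP => i; case: (split_ordP (i : 'I_(1 + n))) => j ->.
    by rewrite rV_consl 2!mxE rV_consl (ord1 j).
  by rewrite rV_consr 2!mxE rV_consr !mxE.
pose g x := \int[@leb R n]_y f (rV_cons (x, y)).
have mg : measurable_fun setT (g : measurableTypeR R -> _).
  by apply: (measurable_fun_fubini_tonelli_F (m2 := @leb R n) (f \o @rV_cons R n)) => // x; exact: f0.
have g0 x : 0 <= g x by exact: integral_ge0.
transitivity (\int[@lebesgue_measure R]_x ((`|a| ^- n)%:E * g (a * x + b0)%R)).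
  apply: eq_integral => x _; under eq_integral do rewrite E.
  rewrite (ih b1 (fun y => f (rV_cons ((a * x + b0)%R, y))))//.
  by apply: (measurableT_comp mfc); exact: measurable_fun_pair.
rewrite ge0_integralZl//.
- rewrite ge0_integral_leb1_affine// muleA -EFinM; congr (_%:E * _).
  by rewrite exprSr invfM.
- apply: (@measurableT_comp _ _ _ _ _ _ (g : measurableTypeR R -> _)) => //.
  by apply: measurable_funD => //; exact: mulrl_measurable.
Qed.

End affine_change.

Lemma locally_lipschitz_continuous (R : realType) (V : normedModType R) (f : V -> R) :
  (forall x, exists C, forall y, `|x - y| <= 1 -> `|f x - f y| <= C * `|x - y|) ->
  continuous f.
Proof.
move=> h x; have [C hC] := h x.
apply/cvgrPdist_lt => e e0; near=> y.
have xy1 : `|x - y| <= 1 by near: y; apply: cvgr_dist_le.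
apply: le_lt_trans (hC _ xy1) _.
have : `|x - y| < e / (`|C| + 1).
  by near: y; apply: cvgr_dist_lt; rewrite // divr_gt0// ltr_wpDl.
rewrite ltr_pdivlMr ?ltr_wpDl// => hxy.
have := normr_ge0 (x - y); have := ler_norm C; nra.
Unshelve. all: by end_near. Qed.

Section euclid.
Context (R : realType) (d : nat).
Local Notation Rd := 'rV[R]_d.
Implicit Types x y : Rd.

Lemma dotp_ge0 x : 0 <= dotp x x.
Proof. by apply: sumr_ge0 => i _; rewrite -expr2 sqr_ge0. Qed.

Lemma enorm_ge0 x : 0 <= enorm x.
Proof. exact: sqrtr_ge0. Qed.

Lemma enorm0 : enorm (0 : Rd) = 0.
Proof.
rewrite /enorm /dotp big1 ?sqrtr0// => i _.
by rewrite mxE mul0r.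
Qed.

Lemma sqr_enorm x : enorm x ^+ 2 = dotp x x.
Proof. by rewrite sqr_sqrtr// dotp_ge0. Qed.

Lemma enormZ (a : R) x : enorm (a *: x) = `|a| * enorm x.
Proof.
rewrite /enorm -sqrtr_sqr -sqrtrM ?sqr_ge0//; congr Num.sqrt.
by rewrite /dotp mulr_sumr; apply: eq_bigr => i _; rewrite !mxE; ring.
Qed.

Lemma enormN x : enorm (- x) = enorm x.
Proof. by rewrite -scaleN1r enormZ normrN1 mul1r. Qed.

Lemma enormB x y : enorm (x - y) = enorm (y - x).
Proof. by rewrite -enormN opprB. Qed.

Lemma cauchy_schwarz x y : dotp x y <= enorm x * enorm y.
Proof.
have key : dotp x y ^+ 2 <= dotp x x * dotp y y.
  rewrite -subr_ge0 -(@pmulr_rge0 _ 2)//.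
  rewrite (_ : 2 * _ = \sum_i \sum_j (x ord0 i * y ord0 j - x ord0 j * y ord0 i) ^+ 2).
    by apply: sumr_ge0 => i _; apply: sumr_ge0 => j _; exact: sqr_ge0.
  have E1 : dotp x x * dotp y y = \sum_i \sum_j x ord0 i ^+ 2 * y ord0 j ^+ 2.
    rewrite /dotp mulr_suml; apply: eq_bigr => i _; rewrite mulr_sumr.
    by apply: eq_bigr => j _; rewrite !expr2.
  have E2 : dotp x x * dotp y y = \sum_i \sum_j x ord0 j ^+ 2 * y ord0 i ^+ 2.
    by rewrite E1 exchange_big.
  have E3 : dotp x y ^+ 2 = \sum_i \sum_j (x ord0 i * y ord0 i) * (x ord0 j * y ord0 j).
    rewrite /dotp expr2 mulr_suml; apply: eq_bigr => i _; rewrite mulr_sumr.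
    by apply: eq_bigr => j _.
  rewrite (_ : 2 * _ = dotp x x * dotp y y + dotp x x * dotp y y - 2 * dotp x y ^+ 2); last by ring.
  rewrite {1}E1 E2 E3 mulr_sumr -big_split -sumrB; apply: eq_bigr => i _ /=.
  by rewrite mulr_sumr -big_split -sumrB; apply: eq_bigr => j _ /=; ring.
apply: le_trans (ler_norm _) _.
rewrite -(@ler_pXn2r _ 2)// ?nnegrE ?mulr_ge0 ?enorm_ge0//.
by rewrite real_normK ?num_real// exprMn !sqr_enorm.
Qed.

Lemma enormD x y : enorm (x + y) <= enorm x + enorm y.
Proof.
rewrite -(@ler_pXn2r _ 2)// ?nnegrE ?addr_ge0 ?enorm_ge0//.
rewrite sqrrD !sqr_enorm.
have -> : dotp (x + y) (x + y) = dotp x x + dotp x y *+ 2 + dotp y y.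
  rewrite /dotp -sumrMnl -!big_split; apply: eq_bigr => i _ /=.
  by rewrite !mxE; ring.
by rewrite lerD2r lerD2l lerMn2r cauchy_schwarz orbT.
Qed.

Lemma coord_enorm x i : `|x ord0 i| <= enorm x.
Proof.
rewrite -sqrtr_sqr ler_wsqrtr// /dotp (bigD1 i)//= expr2 lerDl.
by apply: sumr_ge0 => j _; rewrite -expr2 sqr_ge0.
Qed.

Lemma coord_norm x i : `|x ord0 i| <= `|x|.
Proof.
rewrite [leRHS]mx_normrE.
by apply: (le_bigmax _ (fun ij : 'I_1 * 'I_d => `|x ij.1 ij.2|) (ord0, i)).
Qed.

Lemma enorm_norm x : enorm x <= d%:R * `|x|.
Proof.
rewrite -(@ler_pXn2r _ 2)// ?nnegrE ?mulr_ge0 ?enorm_ge0// sqr_enorm /dotp.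
apply: (@le_trans _ _ (\sum_(i < d) `|x| ^+ 2)).
  by apply: ler_sum => i _; rewrite -expr2 -real_normK ?num_real// lerXn2r ?nnegrE ?coord_norm.
rewrite sumr_const card_ord exprMn -[leLHS]mulr_natl ler_wpM2r ?sqr_ge0//.
by rewrite expr2 -natrM ler_nat; case: d => // n; rewrite leq_pmulr.
Qed.

Lemma enorm_continuous : continuous (@enorm R d).
Proof.
apply: locally_lipschitz_continuous => x; exists d%:R => y _.
apply: le_trans (enorm_norm _); rewrite ler_norml; apply/andP; split.
  by rewrite lerBrDl lerBlDl -{1}(subrK x y) (enormB x) enormD.
by rewrite lerBlDl addrC -{1}(subrK y x) enormD.
Qed.

(** The weight against which rapid decay and polynomial growth are measured. *)
Definition brk x : R := 1 + enorm x.

Lemma brk_ge1 x : 1 <= brk x.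
Proof. by rewrite lerDl enorm_ge0. Qed.

Lemma brk_gt0 x : 0 < brk x.
Proof. exact: lt_le_trans ltr01 (brk_ge1 x). Qed.

Lemma brk_ge0 x : 0 <= brk x.
Proof. exact/ltW/brk_gt0. Qed.

Lemma brkX_gt0 x n : 0 < brk x ^+ n.
Proof. by rewrite exprn_gt0 ?brk_gt0. Qed.

Lemma brkN x : brk (- x) = brk x.
Proof. by rewrite /brk enormN. Qed.

(** Submultiplicativity is what lets weights in [brk] pass through convolutions. *)
Lemma brkD x y : brk (x + y) <= brk x * brk y.
Proof.
rewrite /brk; have := enormD x y; have := enorm_ge0 x; have := enorm_ge0 y.
move=> hy hx h; have := mulr_ge0 hx hy; nra.
Qed.

Lemma brkXD x y n : brk (x + y) ^+ n <= brk x ^+ n * brk y ^+ n.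
Proof. by rewrite -exprMn lerXn2r ?nnegrE ?mulr_ge0 ?brk_ge0 ?brkD. Qed.

Lemma brkXB x y n : brk x ^+ n <= brk (x - y) ^+ n * brk y ^+ n.
Proof. by rewrite -{1}(subrK y x) brkXD. Qed.

Lemma brkX_le x m n : (m <= n)%N -> brk x ^+ m <= brk x ^+ n.
Proof. by move=> mn; rewrite ler_weXn2l ?brk_ge1. Qed.

Lemma enorm_brk x : enorm x <= brk x.
Proof. by rewrite /brk lerDr. Qed.

Lemma brk_continuous : continuous brk.
Proof.
apply: locally_lipschitz_continuous => x; exists d%:R => y _.
apply: le_trans (enorm_norm _); rewrite /brk opprD addrACA subrr add0r ler_norml; apply/andP; split.
  by rewrite lerBrDl lerBlDl -{1}(subrK x y) (enormB x) enormD.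
by rewrite lerBlDl addrC -{1}(subrK y x) enormD.
Qed.

End euclid.

(** * Integrable functions of polynomial decay *)

Section measurable_into_rV.
Context (R : realType) (n : nat) (dT : measure_display) (T : measurableType dT).

Lemma measurable_rV_coord (f : T -> 'rV[R]_n) :
  (forall i, measurable_fun setT ((fun x => f x ord0 i) : T -> measurableTypeR R)) ->
  measurable_fun setT f.
Proof.
move=> h _ Y; rewrite setTI; move: Y.
apply: (@smallest_sub _ _ _ [set Y | measurable (f @^-1` Y)]).
  split => /=.
  - by rewrite preimage_set0.
  - by move=> A mA; rewrite setTD -preimage_setC; exact: measurableC.
  - by move=> F mF; rewrite preimage_bigcup; exact: bigcup_measurable.
rewrite -bigcup_seq; apply: bigcup_sub => i _ A [B mB <-] /=.
by rewrite setTI -comp_preimage -[X in measurable X]setTI; exact: h.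
Qed.

Lemma measurable_rVcoord (f : T -> 'rV[R]_n) i : measurable_fun setT f ->
  measurable_fun setT ((fun x => f x ord0 i) : T -> measurableTypeR R).
Proof. by move=> mf; apply: (measurableT_comp (measurable_coord i) mf). Qed.

Lemma measurable_subZ (f g : T -> 'rV[R]_n) (t : T -> R) :
  measurable_fun setT f -> measurable_fun setT g ->
  measurable_fun setT (t : T -> measurableTypeR R) ->
  measurable_fun setT (fun x => f x - t x *: g x).
Proof.
move=> mf mg mt; apply: measurable_rV_coord => i.
rewrite (_ : (fun x => _) = (fun x => f x ord0 i - t x * g x ord0 i)); last first.
  by apply/funext => x; rewrite !mxE.
apply: measurable_funB; first exact: measurable_rVcoord.
by apply: measurable_funM => //; exact: measurable_rVcoord.
Qed.

End measurable_into_rV.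

Section real_fubini.
Context d1 d2 (T1 : measurableType d1) (T2 : measurableType d2) (R : realType).
Variables (m1 : {sigma_finite_measure set T1 -> \bar R})
          (m2 : {sigma_finite_measure set T2 -> \bar R}).

(** A product bound [A x * B y] gives the integrability on the product space. *)
Lemma Rintegral_fubini_dom (f : T1 -> T2 -> R) (A : T1 -> R) (B : T2 -> R) :
  measurable_fun setT (fun p => f p.1 p.2) ->
  m1.-integrable setT (EFin \o A) -> m2.-integrable setT (EFin \o B) ->
  (forall x y, `|f x y| <= A x * B y) ->
  \int[m1]_x \int[m2]_y f x y = \int[m2]_y \int[m1]_x f x y.
Proof.
move=> mf iA iB h.
have mf1 x : measurable_fun setT (f x).
  exact: (measurableT_comp mf (measurable_pair1 x)).
have mf2 y : measurable_fun setT (f^~ y).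
  exact: (measurableT_comp mf (measurable_pair2 y)).
have i1 x : m2.-integrable setT (EFin \o f x).
  apply: (@le_integrable _ _ _ _ _ _ _ (fun y => ((A x)%:E * (EFin \o B) y)%E)) => //.
  - exact/measurable_EFinP.
  - move=> y _ /=; rewrite lee_fin.
    exact: le_trans (h _ _) (ler_norm _).
  - exact: integrableZl.
have i2 y : m1.-integrable setT (EFin \o f^~ y).
  apply: (@le_integrable _ _ _ _ _ _ _ (fun x => ((B y)%:E * (EFin \o A) x)%E)) => //.
  - exact/measurable_EFinP.
  - move=> x _ /=; rewrite lee_fin mulrC.
    exact: le_trans (h _ _) (ler_norm _).
  - exact: integrableZl.
have iN : (\int[m1]_x \int[m2]_y `|(f x y)%:E| < +oo)%E.
  apply: (@le_lt_trans _ _ (\int[m1]_x (`|(A x)%:E| * \int[m2]_y `|(B y)%:E|))%E).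
    apply: ge0_le_integral => //.
    - by move=> x _; exact: integral_ge0.
    - apply: (measurable_fun_fubini_tonelli_F (m2 := m2) (fun p => `|(f p.1 p.2)%:E|%E)) => //.
      by apply: measurableT_comp => //; exact/measurable_EFinP.
    - apply: emeasurable_funM => //.
      by apply: measurableT_comp => //; exact: measurable_int iA.
    - move=> x _; rewrite -ge0_integralZl//; last first.
        by apply: measurableT_comp => //; exact: measurable_int iB.
      apply: ge0_le_integral => //.
      + by apply: measurableT_comp => //; exact/measurable_EFinP.
      + by apply: emeasurable_funM => //; apply: measurableT_comp => //; exact: measurable_int iB.
      + move=> y _; rewrite -abseM -EFinM !abse_EFin lee_fin.
        exact: le_trans (h _ _) (ler_norm _).
  rewrite ge0_integralZr//; last 2 first.
  - by apply: measurableT_comp => //; exact: measurable_int iA.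
  - exact: integral_ge0.
  case/integrableP : iA => _ iA; case/integrableP : iB => _ iB.
  by apply: lte_mul_pinfty => //; [exact: integral_ge0|rewrite ge0_fin_numE//; exact: integral_ge0].
have iF : (m1 \x m2)%E.-integrable setT (fun p => (f p.1 p.2)%:E).
  by apply/integrable12ltyP => //; exact/measurable_EFinP.
rewrite /Rintegral.
have -> : (\int[m1]_x (fine (\int[m2]_y (f x y)%:E))%:E = \int[m1]_x \int[m2]_y (f x y)%:E)%E.
  apply: eq_integral => x _; rewrite fineK//; exact: (integrable_fin_num measurableT (i1 x)).
have -> : (\int[m2]_y (fine (\int[m1]_x (f x y)%:E))%:E = \int[m2]_y \int[m1]_x (f x y)%:E)%E.
  apply: eq_integral => x _; rewrite fineK//; exact: (integrable_fin_num measurableT (i2 x)).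
by rewrite (Fubini iF).
Qed.

End real_fubini.

Section integral_rV.
Context (R : realType) (d : nat).
Local Notation Rd := 'rV[R]_d.

Definition rint (f : Rd -> R) := (@leb R d).-integrable setT (EFin \o f).

Lemma integral_oneDsqrV_lty :
  (\int[@lebesgue_measure R]_x ((1 + x ^+ 2)^-1)%:E < +oo)%E.
Proof.
rewrite ge0_symfun_integralT.
- rewrite (_ : mkset _ = `[0%R, +oo[%classic); last first.
    by apply/seteqP; split => x /=; rewrite in_itv/= andbT.
  by rewrite [X in (_ * X)%E](@integral0y_oneDsqr R) -EFinM ltry.
- by move=> x; rewrite invr_ge0 addr_ge0// sqr_ge0.
- exact: continuous_oneDsqrV.
- by move=> x /=; rewrite sqrrN.
Qed.

Lemma measurable_oneDsqrV_coord n (i : 'I_n) :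
  measurable_fun setT (fun x : 'rV[R]_n => (1 + x ord0 i ^+ 2)^-1).
Proof.
apply: (@measurableT_comp _ _ _ _ _ _ (fun t : measurableTypeR R => (1 + t ^+ 2)^-1)).
  by apply: continuous_measurable_fun; exact: continuous_oneDsqrV.
exact: measurable_coord.
Qed.

Lemma measurable_prod_oneDsqrV n :
  measurable_fun setT (fun x : 'rV[R]_n => \prod_i (1 + x ord0 i ^+ 2)^-1).
Proof. by apply: measurable_prod => i _; exact: measurable_oneDsqrV_coord. Qed.

Lemma integral_prod_oneDsqrV_lty n :
  (\int[@leb R n]_x (\prod_i (1 + x ord0 i ^+ 2)^-1)%:E < +oo)%E.
Proof.
elim: n => [|n ih].
  rewrite ge0_integral_leb0 ?ltry// => x; rewrite lee_fin; apply: prodr_ge0 => i _.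
  by rewrite invr_ge0 addr_ge0// sqr_ge0.
have p0 m (x : 'rV[R]_m) : 0 <= \prod_i (1 + x ord0 i ^+ 2)^-1.
  by apply: prodr_ge0 => i _; rewrite invr_ge0 addr_ge0// sqr_ge0.
rewrite ge0_integral_lebS; last 2 first.
- by apply/measurable_EFinP; exact: measurable_prod_oneDsqrV.
- by move=> x; rewrite lee_fin p0.
under eq_integral => x _.
  under eq_integral => y _.
    rewrite (_ : \prod_i _ = (1 + x ^+ 2)^-1 * \prod_i (1 + y ord0 i ^+ 2)^-1); last first.
      rewrite (@big_split_ord _ _ _ 1 n) big_ord1 rV_consl; congr (_ * _).
      by apply: eq_bigr => i _; rewrite rV_consr.
    rewrite EFinM; over.
  rewrite ge0_integralZl//; last 3 first.
  - by apply/measurable_EFinP; exact: measurable_prod_oneDsqrV.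
  - by move=> y _; rewrite lee_fin p0.
  - by rewrite lee_fin invr_ge0 addr_ge0// sqr_ge0.
  over.
rewrite ge0_integralZr//.
- have I0 : (0 <= \int[@lebesgue_measure R]_x ((1 + x ^+ 2)^-1)%:E)%E.
    by apply: integral_ge0 => x _; rewrite lee_fin invr_ge0 addr_ge0// sqr_ge0.
  by apply: lte_mul_pinfty => //; rewrite ge0_fin_numE// integral_oneDsqrV_lty.
- by apply/measurable_EFinP; apply: continuous_measurable_fun; exact: continuous_oneDsqrV.
- by move=> x _; rewrite lee_fin invr_ge0 addr_ge0// sqr_ge0.
- by apply: integral_ge0 => x _; rewrite lee_fin p0.
Qed.

Lemma measurable_brkV n : measurable_fun setT (fun x : Rd => brk x ^- n).
Proof.
apply: continuous_measurable_rV => x.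
have h : {for x, continuous (fun y : Rd => brk y ^+ n)}.
  apply: (@continuous_comp _ _ _ (@brk R d) (fun t : R => t ^+ n)).
    exact: brk_continuous.
  exact: exprn_continuous.
have FF : Filter (nbhs x) by exact: nbhs_filter.
by apply: cvgV => //; rewrite lt0r_neq0// brkX_gt0.
Qed.

(** The exponent [2 * d] is crude; it makes [brk x ^- (2 * d)] smaller than a
    product of one-dimensional Cauchy densities. *)
Lemma rint_brkV : rint (fun x => brk x ^- (2 * d)).
Proof.
apply/integrableP; split; first by apply/measurable_EFinP; exact: measurable_brkV.
apply: le_lt_trans (integral_prod_oneDsqrV_lty d).
apply: ge0_le_integral => //.
- by apply: measurableT_comp => //; apply/measurable_EFinP; exact: measurable_brkV.
- by apply/measurable_EFinP; exact: measurable_prod_oneDsqrV.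
- move=> x _ /=; rewrite lee_fin ger0_norm ?invr_ge0 ?exprn_ge0 ?brk_ge0//.
  rewrite prodfV lef_pV2 ?posrE ?brkX_gt0//; last first.
    by apply: prodr_gt0 => i _; rewrite ltr_pwDl// sqr_ge0.
  have -> : brk x ^+ (2 * d) = \prod_(i < d) brk x ^+ 2.
    by rewrite prodr_const card_ord exprM.
  apply: ler_prod => i _.
  rewrite addr_ge0 ?sqr_ge0//=; have := coord_enorm x i.
  rewrite /brk -[x ord0 i ^+ 2]real_normK ?num_real//.
  have := enorm_ge0 x; have := normr_ge0 (x ord0 i); nra.
Qed.

Lemma rint_dom (f : Rd -> R) (C : R) : measurable_fun setT (f : Rd -> measurableTypeR R) ->
  (forall x, `|f x| * brk x ^+ (2 * d) <= C) -> rint f.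
Proof.
move=> mf h.
apply: (@le_integrable _ _ _ _ _ _ _ (fun x => (C%:E * (EFin \o (fun x => brk x ^- (2 * d))) x)%E)) => //.
- exact/measurable_EFinP.
- move=> x _; rewrite /= lee_fin; apply: le_trans (ler_norm _).
  by rewrite ler_pdivlMr ?brkX_gt0.
- by apply: integrableZl => //; exact: rint_brkV.
Qed.

Lemma rint_le (f g : Rd -> R) : measurable_fun setT (f : Rd -> measurableTypeR R) ->
  (forall x, `|f x| <= g x) -> rint g -> rint f.
Proof.
move=> mf h; apply: le_integrable => //; first exact/measurable_EFinP.
by move=> x _ /=; rewrite lee_fin; apply: le_trans (h x) (ler_norm _).
Qed.

Lemma rint_affine (f : Rd -> R) (a : R) (b : Rd) : a != 0 -> rint f ->
  rint (fun x => f (a *: x + b)).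
Proof.
move=> a0 /integrableP[mf hf]; apply/integrableP; split.
  by apply: (measurableT_comp mf); exact: measurable_affine.
rewrite (ge0_integral_leb_affine b (f := fun x => `|(EFin \o f) x|%E))//.
  by rewrite lte_mul_pinfty// lee_fin invr_ge0 exprn_ge0.
exact: measurableT_comp.
Qed.

Lemma Rintegral_affine (f : Rd -> R) (a : R) (b : Rd) : a != 0 -> rint f ->
  \int[@leb R d]_x f (a *: x + b) = (`|a| ^- d) * \int[@leb R d]_x f x.
Proof.
move=> a0 fi; have /integrableP[mf hf] := fi.
rewrite /Rintegral.
have k0 : 0 <= `|a| ^- d by rewrite invr_ge0 exprn_ge0.
have fin_f := integrable_fin_num measurableT fi.
rewrite -[X in _ = X * _]/(fine (`|a| ^- d)%:E) -fineM//; congr fine.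
rewrite [LHS]integralE [in RHS]integralE muleBr//; last first.
  exact: integrable_add_def.
congr (_ - _)%E.
  rewrite -(ge0_integral_leb_affine b a0 (measurable_funepos mf) (fun x => funepos_ge0 _ x)).
  by apply: eq_integral => x _; rewrite !funeposE.
rewrite -(ge0_integral_leb_affine b a0 (measurable_funeneg mf) (fun x => funeneg_ge0 _ x)).
by apply: eq_integral => x _; rewrite !funenegE.
Qed.

Lemma rintD f g : rint f -> rint g -> rint (fun x => f x + g x).
Proof. by move=> hf hg; exact: (integrableD measurableT hf hg). Qed.

Lemma rintB f g : rint f -> rint g -> rint (fun x => f x - g x).
Proof. by move=> hf hg; exact: (integrableB measurableT hf hg). Qed.

Lemma rintZ k f : rint f -> rint (fun x => k * f x).
Proof. by move=> hf; exact: (integrableZl measurableT k hf). Qed.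

Lemma rint_sum (I : Type) (s : seq I) (f : I -> Rd -> R) : (forall i, rint (f i)) ->
  rint (fun x => \sum_(i <- s) f i x).
Proof.
move=> h; rewrite /rint (_ : _ \o _ = (fun x => \sum_(i <- s) (EFin \o f i) x)%E).
  by apply: integrable_sum => // i _; exact: h.
by apply/funext => x; rewrite /= sumEFin.
Qed.

Lemma Rintegral_sum (I : Type) (s : seq I) (f : I -> Rd -> R) : (forall i, rint (f i)) ->
  \int[@leb R d]_x (\sum_(i <- s) f i x) = \sum_(i <- s) \int[@leb R d]_x f i x.
Proof.
move=> h; elim: s => [|i s ih].
  by rewrite big_nil; under eq_Rintegral do rewrite big_nil; rewrite Rintegral_cst// mul0r.
under eq_Rintegral do rewrite big_cons.
by rewrite RintegralD//; [rewrite big_cons ih|exact: h|exact: rint_sum].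
Qed.

(** The constant depends on the dimension only. *)
Lemma Rintegral_dom_bound : exists2 K : R, 0 < K & forall (f : Rd -> R) (C : R),
  measurable_fun setT (f : Rd -> measurableTypeR R) ->
  (forall x, `|f x| * brk x ^+ (2 * d) <= C) ->
  `| \int[@leb R d]_x f x | <= K * C.
Proof.
exists (\int[@leb R d]_x brk x ^- (2 * d) + 1) => [|f C mf h].
  by rewrite ltr_wpDl// Rintegral_ge0// => x _; rewrite invr_ge0 exprn_ge0 ?brk_ge0.
have fi := rint_dom mf h.
have C0 : 0 <= C by apply: le_trans (h 0); rewrite mulr_ge0// exprn_ge0 ?brk_ge0.
apply: (@le_trans _ _ (\int[@leb R d]_x (C * brk x ^- (2 * d)))).
  apply: le_trans (le_normr_Rintegral measurableT fi) _.
  apply: le_Rintegral => //; [exact: integrable_norm|by apply: rintZ; exact: rint_brkV|].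
  by move=> x _; rewrite ler_pdivlMr ?brkX_gt0.
rewrite RintegralZl//; last exact: rint_brkV.
by rewrite mulrC ler_wpM2r// lerDl.
Qed.

End integral_rV.

(** * Rapidly decreasing functions and Taylor's formula *)

(** A quadratic remainder identifies the differential; convolutions are
    differentiated in this way, their remainder being an integral of Taylor remainders. *)
Lemma differentiable_of_quadratic (R : realType) (V : normedModType R) (g : V -> R)
    (L : {linear V -> R}) (u : V) (C r : R) : 0 < r -> continuous (L : V -> R) ->
  (forall v, `|v| <= r -> `|g (u + v) - g u - L v| <= C * `|v| ^+ 2) ->
  differentiable g u /\ 'd g u = L :> (V -> R).
Proof.
move=> r0 Lc hg.
have E : g \o shift u = cst (g u) + (L : V -> R) +o_ (0 : V) id.
  apply/eqaddoP => _/posnumP[e]; near=> x.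
  rewrite [X in `|X|](_ : _ = g (u + x) - g u - L x); last first.
    by rewrite /= !fctE /= [x + u]addrC opprD addrA.
  have xr : `|x| <= r by near: x; apply: nbhs0_le.
  apply: le_trans (hg _ xr) _.
  have xe : `|x| <= e%:num / (`|C| + 1).
    by near: x; apply: nbhs0_le; rewrite divr_gt0// ltr_wpDl.
  move: xe; rewrite ler_pdivlMr ?ltr_wpDl// => xe.
  have := normr_ge0 x; have := ler_norm C; nra.
have Ed := diff_unique Lc E.
by split => //; apply/diff_locallyP; rewrite Ed.
Unshelve. all: by end_near. Qed.

Section calculus.
Context (R : realType) (d : nat).
Local Notation Rd := 'rV[R]_d.
Implicit Types (g h : Rd -> R) (u v : Rd) (s : seq 'I_d).
Local Notation e_ i := (delta_mx ord0 i : Rd).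

Lemma row_sum_coord v : v = \sum_i v ord0 i *: e_ i.
Proof. by rewrite {1}[v]matrix_sum_delta big_ord1. Qed.

Lemma diff_coord g u v : differentiable g u ->
  'd g u v = \sum_i v ord0 i * 'D_(e_ i) g u.
Proof.
move=> dg; rewrite {1}[v]row_sum_coord linear_sum; apply: eq_bigr => i _.
by rewrite linearZ deriveE.
Qed.

Lemma diff_of_quadratic g (c : 'I_d -> R) u C :
  (forall v, enorm v <= 1 ->
     `|g (u + v) - g u - \sum_i v ord0 i * c i| <= C * enorm v ^+ 2) ->
  differentiable g u /\ forall i, 'D_(e_ i) g u = c i.
Proof.
move=> hg.
pose df v := \sum_i v ord0 i * c i.
have dfl : linear df.
  move=> k x y; rewrite /df scaler_sumr -big_split; apply: eq_bigr => i _ /=.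
  by rewrite !mxE mulrDl -mulrA.
pose dfL := GRing.isLinear.Build _ _ _ _ df dfl.
pose L : {linear Rd -> R} := HB.pack df dfL.
have Lc : continuous (L : Rd -> R).
  apply: locally_lipschitz_continuous => x; exists (\sum_i `|c i|) => y _.
  rewrite -linearB /= /df mulr_suml; apply: le_trans (ler_norm_sum _ _ _) _.
  apply: ler_sum => i _; rewrite normrM mulrC ler_wpM2l//.
  exact: coord_norm.
have [dg dgE] : differentiable g u /\ 'd g u = L :> (Rd -> R).
  apply: (@differentiable_of_quadratic _ _ _ _ _ (`|C| * d%:R ^+ 2) d.+1%:R^-1) => //.
  move=> x hx.
  have x1 : d%:R * `|x| <= 1.
    move: hx; rewrite -(@ler_pM2l _ d.+1%:R)// divff// => h1; apply: le_trans h1.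
    by rewrite ler_wpM2r// ler_nat.
  apply: le_trans (hg _ (le_trans (enorm_norm _) x1)) _.
  apply: (@le_trans _ _ (`|C| * enorm x ^+ 2)).
    by rewrite ler_wpM2r ?sqr_ge0// ler_norm.
  rewrite -mulrA ler_wpM2l// -exprMn lerXn2r ?nnegrE ?mulr_ge0 ?enorm_ge0 ?enorm_norm//.
split=> // i; rewrite deriveE// dgE /= /df (bigD1 i)//= !mxE !eqxx mul1r.
by rewrite big1 ?addr0// => j ji; rewrite !mxE (negbTE ji) mul0r.
Qed.


Lemma is_derive_line g u v (t : R) : differentiable g (u + t *: v) ->
  is_derive t 1 (fun t : R => g (u + t *: v)) (\sum_i v ord0 i * 'D_(e_ i) g (u + t *: v)).
Proof.
move=> dg; pose A := (fun t : R => u + t *: v).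
have dA : is_diff t A ( *:%R^~ v).
  apply: (is_diff_eq (is_diffD (is_diff_cst u t) (is_diff_scalel t v))).
  by apply/funext => y; exact: add0r.
have dgA : differentiable (g \o A) t by apply: differentiable_comp.
have h : derivable (g \o A) t 1 by exact: diff_derivable.
apply: (@is_derive_eq _ _ _ _ _ _ _ _ (derivableP h)).
by rewrite deriveE// diff_comp// diff_val /= scale1r diff_coord.
Qed.

Lemma diff_affine g (a : R) (b u : Rd) : differentiable g (a *: u + b) ->
  differentiable (fun x => g (a *: x + b)) u /\
  forall i, 'D_(e_ i) (fun x => g (a *: x + b)) u = a * 'D_(e_ i) g (a *: u + b).
Proof.
move=> dg; pose A := (fun x : Rd => a *: x + b).
have dA : is_diff u A ( *:%R a).
  apply: (is_diff_eq (is_diffD (is_diff_scaler a u) (is_diff_cst b u))).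
  by apply/funext => y; exact: addr0.
have dgA : differentiable (g \o A) u by apply: differentiable_comp.
split=> // i; rewrite [LHS](_ : _ = 'D_(e_ i) (g \o A) u)//.
rewrite deriveE// diff_comp// diff_val /= linearZ -deriveE//.
Qed.

Lemma mvt_bound (f f' : R -> R) (M t : R) : 0 <= t ->
  (forall x, 0 <= x <= t -> is_derive x 1 f (f' x)) ->
  (forall x, 0 <= x <= t -> `|f' x| <= M) -> `|f t - f 0| <= M * t.
Proof.
move=> t0 df hM.
have [||c] := @MVT_segment R f f' 0 t t0.
- by move=> x; rewrite in_itv/= => /andP[x0 xt]; apply: df; rewrite !ltW.
- apply: continuous_in_subspaceT => x; rewrite inE/= in_itv/= => /df xd.
  by apply/differentiable_continuous/derivable1_diffP; case: xd.
rewrite in_itv/= subr0 => ct ->; rewrite normrM (ger0_norm t0).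
by rewrite ler_wpM2r// hM.
Qed.

(** Real-valued Schwartz functions; the order of differentiation and the power of the
    weight are kept apart, so that each estimate can trade one against the other. *)
Definition rsmooth h := forall s x, differentiable (pderiv s h) x.

Definition rsch h := rsmooth h /\
  forall s M, exists C, forall x, `|pderiv s h x| * brk x ^+ M <= C.

Lemma pderiv_cat s t h : pderiv (s ++ t) h = pderiv s (pderiv t h).
Proof. by rewrite /pderiv foldr_cat. Qed.

Lemma pderiv_rcons s i h : pderiv (rcons s i) h = pderiv s ('D_(e_ i) h).
Proof. by rewrite -cats1 pderiv_cat. Qed.

Lemma rsmooth_pderiv s h : rsmooth h -> rsmooth (pderiv s h).
Proof. by move=> hh t x; rewrite -pderiv_cat; exact: hh. Qed.

Lemma rsch_pderiv s h : rsch h -> rsch (pderiv s h).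
Proof.
move=> [sh dh]; split; first exact: rsmooth_pderiv.
by move=> t M; rewrite -pderiv_cat; exact: dh.
Qed.

Lemma pderiv_linear s (a : R) h k : rsmooth h -> rsmooth k ->
  pderiv s (fun x => a * h x + k x) = (fun x => a * pderiv s h x + pderiv s k x).
Proof.
move=> sh sk; elim: s => [//|i s ih]; rewrite /= ih; apply/funext => x.
have dh : derivable (pderiv s h) x (e_ i) by exact: diff_derivable.
have dk : derivable (pderiv s k) x (e_ i) by exact: diff_derivable.
exact: (@derive_val _ _ _ _ _ _ _ (is_deriveD (is_deriveZ a (derivableP dh)) (derivableP dk))).
Qed.

Lemma rsmooth_linear (a : R) h k : rsmooth h -> rsmooth k -> rsmooth (fun x => a * h x + k x).
Proof.
move=> sh sk s x; rewrite pderiv_linear//.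
have -> : (fun x => a * pderiv s h x + pderiv s k x) = a *: pderiv s h + pderiv s k by [].
by apply: differentiableD; [apply: differentiableZ; exact: sh|exact: sk].
Qed.

Lemma rsch_linear (a : R) h k : rsch h -> rsch k -> rsch (fun x => a * h x + k x).
Proof.
move=> [sh dh] [sk dk]; split; first exact: rsmooth_linear.
move=> s M; rewrite pderiv_linear//.
have [C1 h1] := dh s M; have [C2 h2] := dk s M.
exists (`|a| * C1 + C2) => x.
apply: (@le_trans _ _ ((`|a| * `|pderiv s h x| + `|pderiv s k x|) * brk x ^+ M)).
  by rewrite ler_wpM2r ?exprn_ge0 ?brk_ge0// -normrM ler_normD.
by rewrite mulrDl lerD// -mulrA ler_wpM2l.
Qed.

Lemma pderiv0 s : pderiv s (fun _ : Rd => 0 : R) = (fun _ => 0).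
Proof.
by elim: s => [//|i s ih]; rewrite /= ih; apply/funext => x; exact: derive_cst.
Qed.

Lemma rsch0 : rsch (fun _ => 0).
Proof.
split=> [s x|s M]; rewrite pderiv0; first exact: differentiable_cst.
by exists 0 => x; rewrite normr0 mul0r.
Qed.

Lemma rschZ (a : R) h : rsch h -> rsch (fun x => a * h x).
Proof.
move=> hh; rewrite (_ : (fun x => _) = (fun x => a * h x + 0)); last first.
  by apply/funext => x; rewrite addr0.
exact: rsch_linear hh rsch0.
Qed.

Lemma rschD h k : rsch h -> rsch k -> rsch (fun x => h x + k x).
Proof.
move=> hh hk; rewrite (_ : (fun x => _) = (fun x => 1 * h x + k x)); last first.
  by apply/funext => x; rewrite mul1r.
exact: rsch_linear.
Qed.

Lemma pderiv_affine s h (a : R) (b : Rd) : rsmooth h ->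
  pderiv s (fun x => h (a *: x + b)) = (fun x => a ^+ size s * pderiv s h (a *: x + b)).
Proof.
move=> sh; elim: s => [|i s ih] /=; first by apply/funext => x; rewrite mul1r.
rewrite ih; apply/funext => x.
have [dA DA] := diff_affine (sh s (a *: x + b)).
rewrite [LHS](_ : _ = 'D_(e_ i) (a ^+ size s *: (fun x => pderiv s h (a *: x + b))) x)//.
by rewrite deriveZ; [rewrite DA exprSr -mulrA|exact: diff_derivable].
Qed.

Lemma rsch_affine h (a : R) (b : Rd) : a != 0 -> rsch h -> rsch (fun x => h (a *: x + b)).
Proof.
move=> a0 [sh dh]; split=> [s x|s M]; rewrite pderiv_affine//.
  apply: (@differentiableZ _ _ _ (fun x => pderiv s h (a *: x + b))).
  by have [] := diff_affine (sh s (a *: x + b)).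
have [C hC] := dh s M.
have C0 : 0 <= C by apply: le_trans (hC 0); rewrite mulr_ge0// exprn_ge0 ?brk_ge0.
pose K := (1 + `|a|^-1) * brk b.
exists (`|a| ^+ size s * (C * K ^+ M)) => x.
rewrite normrM normrX -mulrA ler_wpM2l ?exprn_ge0//.
apply: (@le_trans _ _ (`|pderiv s h (a *: x + b)| * (brk (a *: x + b) ^+ M * K ^+ M))).
  rewrite ler_wpM2l// -exprMn lerXn2r ?nnegrE ?brk_ge0//.
    by rewrite !mulr_ge0 ?brk_ge0// addr_ge0.
  have e1 : enorm x = `|a|^-1 * enorm (a *: x).
    by rewrite enormZ mulrA mulVf ?mul1r// normr_eq0.
  have e2 : brk (a *: x) <= brk (a *: x + b) * brk b.
    by rewrite -{1}(addrK b (a *: x)) -(brkN b) brkD.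
  have e3 : brk x <= (1 + `|a|^-1) * brk (a *: x).
    rewrite /brk e1; have := enorm_ge0 (a *: x); have : 0 <= `|a|^-1 by []; nra.
  apply: le_trans e3 _; rewrite mulrCA ler_wpM2l// addr_ge0//.
by rewrite mulrA ler_wpM2r// exprn_ge0// mulr_ge0 ?brk_ge0// addr_ge0.
Qed.


(** Coefficients of the Taylor expansion along a line, by recursion on the
    order, so that differentiating the expansion of [g] yields expansions of the
    first partial derivatives of [g]. *)
Fixpoint dpow (n : nat) g v u : R :=
  if n is n'.+1 then \sum_i v ord0 i * dpow n' ('D_(e_ i) g) v u else g u.

Definition taylor_rem (n : nat) g v u : R :=
  g (u + v) - \sum_(k < n) k`!%:R^-1 * dpow k g v u.

(** By induction on the order: the derivative along the line of the remainder of [g]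
    is a combination of remainders of the first partial derivatives of [g], and the mean
    value inequality integrates the bound. *)
Lemma taylor_bound_line (n : nat) g u v b (t : R) : rsmooth g -> 0 <= t <= 1 ->
  (forall s r, size s = n -> 0 <= r <= 1 -> `|pderiv s g (u + r *: v)| <= b) ->
  `|g (u + t *: v) - \sum_(k < n) t ^+ k * (k`!%:R^-1 * dpow k g v u)| <=
  b * (\sum_i `|v ord0 i|) ^+ n.
Proof.
elim: n g t => [|n ih] g t sg t01 hb.
  by rewrite big_ord0 subr0 expr0 mulr1; exact: (hb [::]).
set S := \sum_i `|v ord0 i|.
pose c k := k`!%:R^-1 * dpow k g v u.
pose r (x : R) := g (u + x *: v) - \sum_(k < n.+1) c k * x ^+ k.
pose r' (x : R) := \sum_i v ord0 i * 'D_(e_ i) g (u + x *: v) -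
   \sum_(k < n) x ^+ k * (k`!%:R^-1 * dpow k.+1 g v u).
have dr (x : R) : is_derive x 1 r (r' x).
  have d1 : is_derive x 1 (fun t : R => g (u + t *: v))
      (\sum_i v ord0 i * 'D_(e_ i) g (u + x *: v)).
    by apply: is_derive_line; exact: (sg [::]).
  have d2 : is_derive x 1 (\sum_(k < n.+1) (fun x : R => c k * x ^+ k))
     (\sum_(k < n) x ^+ k * (k`!%:R^-1 * dpow k.+1 g v u)).
    have dk (k : 'I_n.+1) : is_derive x 1 (fun x : R => c k * x ^+ k) (c k * (k%:R * x ^+ k.-1)).
      rewrite (_ : (fun x => _) = c k *: (id : R -> R) ^+ k); last first.
        by apply/funext => y; rewrite !fctE.
      by apply: is_derive_eq; rewrite /GRing.scale/= mulr1.
    apply: is_derive_eq (is_derive_sum dk) _.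
    rewrite big_ord_recl mul0r mulr0 add0r; apply: eq_bigr => k _.
    rewrite /c lift0 factS natrM; set D := dpow _ _ _ _; set kf := (k`!)%:R.
    have kf0 : kf != 0 by rewrite pnatr_eq0 -lt0n fact_gt0.
    have k10 : k.+1%:R != 0 :> R by rewrite pnatr_eq0.
    rewrite succnK; move: k10; move: (k.+1%:R : R) => kk k10; field.
    by rewrite kf0 k10.
  have -> : r = (fun t : R => g (u + t *: v)) - \sum_(k < n.+1) (fun x : R => c k * x ^+ k).
    apply/funext => y; rewrite /r !fctE; congr (_ - _).
    by elim/big_ind2 : _ => // a a' b' b'' -> ->.
  exact: is_deriveB.
have r0 : r 0 = 0.
  rewrite /r scale0r addr0 big_ord_recl expr0 mulr1 big1 => [|k _]; last first.
    by rewrite expr0n/= mulr0.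
  by rewrite /c fact0 invr1 mul1r addr0 subrr.
have [t0 t1] := andP t01.
have hr' (x : R) : 0 <= x <= t -> `|r' x| <= b * S ^+ n.+1.
  move=> /andP[x0 xt].
  rewrite (_ : r' x = \sum_i v ord0 i * ('D_(e_ i) g (u + x *: v) -
    \sum_(k < n) x ^+ k * (k`!%:R^-1 * dpow k ('D_(e_ i) g) v u))); last first.
    rewrite /r'; under [RHS]eq_bigr do rewrite mulrBr.
    rewrite sumrB; congr (_ - _).
    under [RHS]eq_bigr do rewrite mulr_sumr.
    rewrite exchange_big; apply: eq_bigr => k _ /=.
    by rewrite !mulr_sumr; apply: eq_bigr => i _; ring.
  apply: le_trans (ler_norm_sum _ _ _) _.
  rewrite exprS [leRHS]mulrCA [leRHS]mulr_suml; apply: ler_sum => i _.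
  rewrite normrM ler_wpM2l//; apply: ih.
  - exact: (rsmooth_pderiv [:: i]).
  - by rewrite x0 (le_trans xt).
  - move=> s y sn y01; rewrite -(pderiv_rcons s i g); apply: hb => //.
    by rewrite size_rcons sn.
have := @mvt_bound r r' _ t t0 (fun x _ => dr x) hr'.
rewrite r0 subr0 => h.
rewrite (_ : _ - _ = r t); last first.
  by congr (_ - _); apply: eq_bigr => k _; rewrite mulrC.
apply: le_trans h _; rewrite -[leRHS]mulr1 ler_wpM2l//.
by apply: le_trans (hr' 0 _); rewrite // lexx.
Qed.

Lemma sum_coord_enorm v : \sum_i `|v ord0 i| <= d%:R * enorm v.
Proof.
rewrite -[X in X%:R * _](card_ord d) mulr_natl -sumr_const.
by apply: ler_sum => i _; exact: coord_enorm.
Qed.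

Lemma taylor_bound (n : nat) g u v b : rsmooth g -> 0 <= b ->
  (forall s r, size s = n -> 0 <= r <= 1 -> `|pderiv s g (u + r *: v)| <= b) ->
  `|taylor_rem n g v u| <= b * (d%:R * enorm v) ^+ n.
Proof.
move=> sg b0 hb.
have := taylor_bound_line (t := 1) sg _ hb; rewrite lexx ler01 scale1r => /(_ isT) h.
rewrite /taylor_rem (_ : \sum_(k < n) _ = \sum_(k < n) 1 ^+ k * (k`!%:R^-1 * dpow k g v u)).
  apply: le_trans h _; rewrite ler_wpM2l// lerXn2r ?nnegrE ?mulr_ge0 ?enorm_ge0//.
    by apply: sumr_ge0.
  exact: sum_coord_enorm.
by apply: eq_bigr => k _; rewrite expr1n mul1r.
Qed.

(** A bound depending on a multi-index can be taken uniform up to a given order. *)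
Lemma seq_uniform (T : finType) (P : seq T -> R -> Prop) (n : nat) :
  (forall s : seq T, exists C, P s C) -> (forall (s : seq T) C C', C <= C' -> P s C -> P s C') ->
  exists2 C, 0 <= C & forall s : seq T, (size s <= n)%N -> P s C.
Proof.
move=> hP mP; elim: n P hP mP => [|n ih] P hP mP.
  have [C hC] := hP [::]; exists `|C| => // -[|//] _.
  by apply: mP hC; exact: ler_norm.
have hi i : exists C, 0 <= C /\ forall s : seq T, (size s <= n)%N -> P (i :: s) C.
  have [|s C C' CC'|C C0 hC] := ih (fun s : seq T => P (i :: s)); first by move=> s; exact: hP.
    exact: mP.
  by exists C.
have [C0 hC0] := hP [::].
pose f i := projT1 (cid (hi i)).
have f0 i : 0 <= f i by have [] := projT2 (cid (hi i)).
have hf i (s : seq T) : (size s <= n)%N -> P (i :: s) (f i).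
  by have [_] := projT2 (cid (hi i)); exact.
exists (`|C0| + \sum_i f i); first by rewrite addr_ge0// sumr_ge0.
move=> [_|i s]; first by apply: mP hC0; rewrite (le_trans (ler_norm _))// lerDl sumr_ge0.
rewrite /= ltnS => sn; apply: mP (hf i s sn).
rewrite (bigD1 i)//= addrCA lerDl addr_ge0//.
by apply: sumr_ge0 => j _.
Qed.

Lemma rsch_smooth h : rsch h -> rsmooth h. Proof. by case. Qed.

Lemma rsch_bound h M n : rsch h -> exists2 C, 0 <= C &
  forall s x, (size s <= n)%N -> `|pderiv s h x| * brk x ^+ M <= C.
Proof.
move=> [sh dh].
have [s|s C C' CC' hC x|C C0 hC] := @seq_uniform 'I_d
  (fun s C => forall x, `|pderiv s h x| * brk x ^+ M <= C) n.
- exact: dh.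
- exact: le_trans (hC x) CC'.
- by exists C => // s x sn; exact: hC.
Qed.

(** Weighted Taylor estimate: the remainder inherits the decay of the
    derivatives in the base point, at a polynomial cost in the increment. *)
Lemma taylor_rsch g n M : rsch g -> exists2 C, 0 <= C &
  forall u v, `|taylor_rem n g v u| * brk u ^+ M <= C * enorm v ^+ n * brk v ^+ M.
Proof.
move=> hg; have [C C0 hC] := rsch_bound M n hg.
exists (C * d%:R ^+ n) => [|u v]; first by rewrite mulr_ge0// exprn_ge0.
rewrite -ler_pdivlMr ?brkX_gt0//.
have b0 : 0 <= C * brk v ^+ M / brk u ^+ M.
  by rewrite !mulr_ge0// ?invr_ge0 exprn_ge0 ?brk_ge0.
apply: le_trans (taylor_bound (rsch_smooth hg) b0 _) _; last first.
  by rewrite exprMn le_eqVlt; apply/orP; left; apply/eqP; ring.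
move=> s r sn /andP[r0 r1]; rewrite ler_pdivlMr ?brkX_gt0//.
apply: (@le_trans _ _ (`|pderiv s g (u + r *: v)| * (brk (u + r *: v) ^+ M * brk v ^+ M))).
  rewrite ler_wpM2l// -exprMn lerXn2r ?nnegrE ?mulr_ge0 ?brk_ge0//.
  rewrite -{1}(addrK (r *: v) u); apply: le_trans (brkD _ _) _.
  rewrite ler_wpM2l ?brk_ge0// brkN /brk enormZ ger0_norm// lerD2l.
  by rewrite ler_piMl ?enorm_ge0.
by rewrite mulrA ler_wpM2r ?exprn_ge0 ?brk_ge0// hC// sn.
Qed.

Lemma taylor_rem1 g u v : taylor_rem 1 g v u = g (u + v) - g u.
Proof. by rewrite /taylor_rem big_ord_recl big_ord0 /= fact0 invr1 mul1r addr0. Qed.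

Lemma taylor_rem2 g u v :
  taylor_rem 2 g v u = g (u + v) - g u - \sum_i v ord0 i * 'D_(e_ i) g u.
Proof.
rewrite /taylor_rem big_ord_recl big_ord_recl big_ord0 /= addr0 opprD addrA.
by rewrite !factS fact0 invr1 !mul1r.
Qed.

Lemma rsch_continuous h : rsch h -> continuous h.
Proof. by move=> [sh _] x; apply: differentiable_continuous; exact: (sh [::]). Qed.

Lemma rsch_measurable h : rsch h -> measurable_fun setT (h : Rd -> measurableTypeR R).
Proof. by move=> /rsch_continuous; exact: continuous_measurable_rV. Qed.

End calculus.

(** * Convolution with a dilated kernel *)

Section molecules.
Context (R : realType) (d : nat).
Local Notation Rd := 'rV[R]_d.
Local Notation mu := (@leb R d).
Implicit Types (g k : Rd -> R) (u v z : Rd) (t : R).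
Local Notation e_ i := (delta_mx ord0 i : Rd).

(** Integration against a rapidly decreasing function is bounded on functions
    of polynomial growth. *)
Lemma rsch_weight k m : rsch k -> exists2 K, 0 <= K & forall (G : Rd -> R) A,
  measurable_fun setT (G : Rd -> measurableTypeR R) ->
  (forall z, `|G z| <= A * brk z ^+ m) ->
  rint (fun z => G z * k z) /\ `|\int[mu]_z (G z * k z)| <= K * A.
Proof.
move=> hk; have [C C0 hC] := rsch_bound (m + 2 * d) 0 hk.
have [K0 K00 hK] := Rintegral_dom_bound R d.
exists (K0 * C) => [|G A mG hG]; first by rewrite mulr_ge0// ltW.
have mGk : measurable_fun setT ((fun z => G z * k z) : Rd -> measurableTypeR R).
  by apply: measurable_funM => //; exact: rsch_measurable.
have A0 : 0 <= A.
  have := hG 0; rewrite /brk enorm0 addr0 expr1n mulr1; exact: le_trans.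
have h z : `|G z * k z| * brk z ^+ (2 * d) <= C * A.
  rewrite normrM; apply: (@le_trans _ _ (A * brk z ^+ m * `|k z| * brk z ^+ (2 * d))).
    by rewrite ler_wpM2r ?exprn_ge0 ?brk_ge0// ler_wpM2r.
  rewrite (_ : _ * _ = A * (`|k z| * brk z ^+ (m + 2 * d))); last by rewrite exprD; ring.
  by rewrite mulrC ler_wpM2r//; exact: (hC [::]).
split; first exact: rint_dom h.
by rewrite -mulrA; exact: hK.
Qed.

Lemma measurable_comp_affine g (a b : Rd) t : measurable_fun setT (g : Rd -> measurableTypeR R) ->
  measurable_fun setT ((fun z => g (b - t *: z)) : Rd -> measurableTypeR R).
Proof.
by move=> mg; apply: (measurableT_comp mg); apply: measurable_subZ.
Qed.

Lemma brkZ t z : `|t| <= 1 -> brk (t *: z) <= brk z.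
Proof. by move=> t1; rewrite /brk enormZ lerD2l ler_piMl ?enorm_ge0. Qed.

Lemma brkZ_sub t u z m : `|t| <= 1 -> brk u ^+ m <= brk (u - t *: z) ^+ m * brk z ^+ m.
Proof.
move=> t1; apply: le_trans (brkXB u (t *: z) m) _.
by rewrite ler_wpM2l ?exprn_ge0 ?brk_ge0// lerXn2r ?nnegrE ?brk_ge0 ?brkZ.
Qed.

(** The value at [u] of the convolution of [g] with [k] dilated by [t]; unlike
    that dilation it makes sense, and is smooth, for [t = 0]. *)
Definition mol g k t u := \int[mu]_z (g (u - t *: z) * k z).

Lemma rsch_growth g : rsch g -> exists2 A, 0 <= A & forall u, `|g u| <= A.
Proof.
move=> hg; have [C C0 hC] := rsch_bound 0 0 hg; exists C => // u.
by have := hC [::] u isT; rewrite expr0 mulr1.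
Qed.

Lemma rint_mol g k t u : rsch g -> rsch k -> rint (fun z => g (u - t *: z) * k z).
Proof.
move=> hg hk; have [K K0 hK] := rsch_weight 0 hk; have [A A0 hA] := rsch_growth hg.
have [] // := hK (fun z => g (u - t *: z)) A.
  by apply: (measurable_comp_affine u); exact: rsch_measurable.
by move=> z; rewrite expr0 mulr1.
Qed.

Lemma mol_decay g k M : rsch g -> rsch k -> exists2 C, 0 <= C &
  forall t u, `|t| <= 1 -> `|mol g k t u| * brk u ^+ M <= C.
Proof.
move=> hg hk; have [K K0 hK] := rsch_weight M hk.
have [C C0 hC] := rsch_bound M 0 hg.
exists (K * C) => [|t u t1]; first exact: mulr_ge0.
rewrite -ler_pdivlMr ?brkX_gt0// -mulrA.
apply: (hK (fun z => g (u - t *: z)) _ _ _).2.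
  by apply: (measurable_comp_affine u); exact: rsch_measurable.
move=> z; rewrite mulrAC ler_pdivlMr ?brkX_gt0//.
apply: (@le_trans _ _ (`|g (u - t *: z)| * (brk (u - t *: z) ^+ M * brk z ^+ M))).
  by rewrite ler_wpM2l// brkZ_sub.
by rewrite mulrA ler_wpM2r ?exprn_ge0 ?brk_ge0//; exact: (hC [::]).
Qed.

(** The second order Taylor remainder of [g] decays, so it can be integrated
    against [k] and stays quadratic in the increment. *)
Lemma mol_diff g k t u : rsch g -> rsch k ->
  differentiable (mol g k t) u /\
  forall i, 'D_(e_ i) (mol g k t) u = mol ('D_(e_ i) g) k t u.
Proof.
move=> hg hk.
have [K K0 hK] := rsch_weight 0 hk.
have [C C0 hC] := taylor_rsch 2 0 hg.
have hDg i : rsch ('D_(e_ i) g) by exact: (rsch_pderiv [:: i]).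
apply: (@diff_of_quadratic _ _ _ _ _ (K * C)) => v _.
pose G z := taylor_rem 2 g v (u - t *: z).
have mG : measurable_fun setT (G : Rd -> measurableTypeR R).
  rewrite (_ : G = fun z => g ((u + v) - t *: z) - g (u - t *: z) -
     \sum_i v ord0 i * 'D_(e_ i) g (u - t *: z)); last first.
    by apply/funext => z; rewrite /G taylor_rem2 (addrAC u).
  have mc h (b : Rd) : rsch h -> measurable_fun setT ((fun z => h (b - t *: z)) : Rd -> measurableTypeR R).
    by move=> hh; apply: (measurable_comp_affine u); exact: rsch_measurable.
  apply: measurable_funB; first by apply: measurable_funB; exact: mc.
  apply: measurable_sum => i; apply: measurable_funM => //; exact: (mc _ u (hDg i)).
have hG z : `|G z| <= C * enorm v ^+ 2 * brk z ^+ 0.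
  by have := hC (u - t *: z) v; rewrite !expr0 !mulr1.
have [_ hi] := hK G _ mG hG.
apply: le_trans; last by rewrite -mulrA; exact: hi.
rewrite le_eqVlt; apply/orP; left; apply/eqP; congr `|_|.
rewrite /mol -RintegralB//; [|exact: rint_mol|exact: rint_mol].
have <- : \int[mu]_z (\sum_i v ord0 i * ('D_(e_ i) g (u - t *: z) * k z)) =
   \sum_i v ord0 i * \int[mu]_z ('D_(e_ i) g (u - t *: z) * k z).
  rewrite Rintegral_sum => [|i]; last by apply: rintZ; exact: (rint_mol t u (hDg i) hk).
  by apply: eq_bigr => i _; rewrite RintegralZl//; exact: (rint_mol t u (hDg i) hk).
rewrite -RintegralB//.
- apply: eq_Rintegral => z _; rewrite /G taylor_rem2 -(addrAC u) !mulrBl mulr_suml.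
  by congr (_ - _); apply: eq_bigr => i _; rewrite mulrA.
- by apply: rintB; exact: rint_mol.
- by apply: rint_sum => i; apply: rintZ; exact: (rint_mol t u (hDg i) hk).
Qed.

Lemma mol_pderiv s g k t : rsch g -> rsch k ->
  pderiv s (mol g k t) = mol (pderiv s g) k t.
Proof.
move=> hg hk; elim: s => [//|i s ih]; rewrite /= ih; apply/funext => u.
by have [_ ->] := mol_diff t u (rsch_pderiv s hg) hk.
Qed.

Lemma rsch_mol g k t : `|t| <= 1 -> rsch g -> rsch k -> rsch (mol g k t).
Proof.
move=> t1 hg hk; split=> [s u|s M]; rewrite mol_pderiv//.
  by have [] := mol_diff t u (rsch_pderiv s hg) hk.
have [C C0 hC] := mol_decay M (rsch_pderiv s hg) hk.
by exists C => u; exact: hC.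
Qed.

(** Monomials are indexed by lists of coordinates, which matches iterated partial
    derivatives and Taylor coefficients. *)
Definition cancellative k :=
  forall l : seq 'I_d, \int[mu]_z (k z * \prod_(i <- l) z ord0 i) = 0.

(** Measurable functions of at most polynomial growth, the ones that can be
    integrated against any rapidly decreasing function. *)
Definition pgrow (G : Rd -> R) := measurable_fun setT (G : Rd -> measurableTypeR R) /\
  exists A m, forall z, `|G z| <= A * brk z ^+ m.

Lemma pgrow_cst c : pgrow (fun=> c).
Proof. by split => //; exists `|c|, 0 => z; rewrite mulr1. Qed.

Lemma pgrow_coord i : pgrow (fun z => z ord0 i).
Proof.
split; first exact: measurable_coord.
by exists 1, 1%N => z; rewrite mul1r expr1 (le_trans (coord_enorm _ _))// enorm_brk.
Qed.

Lemma pgrowM (G H : Rd -> R) : pgrow G -> pgrow H -> pgrow (fun z => G z * H z).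
Proof.
move=> [mG [A [m hA]]] [mH [B [n hB]]]; split; first exact: measurable_funM.
exists (A * B), (m + n)%N => z; rewrite normrM exprD mulrACA.
by apply: ler_pM.
Qed.

Lemma pgrow_sum (I : Type) (s : seq I) (G : I -> Rd -> R) : (forall i, pgrow (G i)) ->
  pgrow (fun z => \sum_(i <- s) G i z).
Proof.
move=> hG; split; first by apply: measurable_sum => i; have [] := hG i.
elim: s => [|i s [B [n hB]]].
  by exists 0, 0%N => z; rewrite big_nil normr0 mul0r.
have [_ [A [m hA]]] := hG i.
exists (`|A| + `|B|), (m + n)%N => z; rewrite big_cons.
apply: le_trans (ler_normD _ _) _; rewrite mulrDl lerD//.
  apply: le_trans (hA z) _; apply: (@le_trans _ _ (`|A| * brk z ^+ m)).
    by rewrite ler_wpM2r ?exprn_ge0 ?brk_ge0// ler_norm.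
  by rewrite ler_wpM2l// brkX_le// leq_addr.
apply: le_trans (hB z) _; apply: (@le_trans _ _ (`|B| * brk z ^+ n)).
  by rewrite ler_wpM2r ?exprn_ge0 ?brk_ge0// ler_norm.
by rewrite ler_wpM2l// brkX_le// leq_addl.
Qed.

Lemma pgrow_prod (l : seq 'I_d) : pgrow (fun z => \prod_(i <- l) z ord0 i).
Proof.
elim: l => [|i l ih].
  rewrite (_ : (fun z => _) = (fun=> 1)); first exact: pgrow_cst.
  by apply/funext => z; rewrite big_nil.
rewrite (_ : (fun z => _) = (fun z => z ord0 i * \prod_(i <- l) z ord0 i)).
  by apply: pgrowM => //; exact: pgrow_coord.
by apply/funext => z; rewrite big_cons.
Qed.

Lemma pgrow_dpow n g a u : pgrow (fun z => dpow n g (a *: z) u).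
Proof.
elim: n g => [|n ih] g /=; first exact: pgrow_cst.
apply: pgrow_sum => i; rewrite (_ : (fun z => _) =
    (fun z => (a * z ord0 i) * dpow n ('D_(e_ i) g) (a *: z) u)).
  by apply: pgrowM => //; apply: pgrowM; [exact: pgrow_cst|exact: pgrow_coord].
by apply/funext => z; rewrite mxE.
Qed.

Lemma rint_pgrow G k : pgrow G -> rsch k -> rint (fun z => G z * k z).
Proof.
move=> [mG [A [m hA]]] hk; have [K K0 hK] := rsch_weight m hk.
by have [] := hK G A mG hA.
Qed.

(** [dpow n g] is a polynomial in its direction, so [k] integrates it to zero.
    The extra monomial carries the induction on the order. *)
Lemma cancellative_dpow n g k (l : seq 'I_d) a u : rsch k -> cancellative k ->
  \int[mu]_z (\prod_(i <- l) z ord0 i * dpow n g (a *: z) u * k z) = 0.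
Proof.
move=> hk ck; elim: n g l => [|n ih] g l /=.
  rewrite (@eq_Rintegral _ _ _ _ _ (fun z => g u * (k z * \prod_(i <- l) z ord0 i))) => [|z _].
    rewrite RintegralZl ?ck ?mulr0//.
    rewrite (_ : _ \o _ = EFin \o (fun z => (\prod_(i <- l) z ord0 i) * k z)).
      by apply: rint_pgrow => //; exact: pgrow_prod.
    by apply/funext => z /=; rewrite mulrC.
  by ring.
rewrite (@eq_Rintegral _ _ _ _ _ (fun z => \sum_i a *
   (\prod_(j <- i :: l) z ord0 j * dpow n ('D_(e_ i) g) (a *: z) u * k z))) => [|z _]; last first.
  rewrite mulr_sumr mulr_suml; apply: eq_bigr => i _.
  by rewrite mxE big_cons; ring.
have hi i : rint (fun z => \prod_(j <- i :: l) z ord0 j * dpow n ('D_(e_ i) g) (a *: z) u * k z).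
  by apply: rint_pgrow => //; apply: pgrowM; [exact: pgrow_prod|exact: pgrow_dpow].
rewrite Rintegral_sum => [|i]; last exact: rintZ.
by rewrite big1// => i _; rewrite RintegralZl ?ih ?mulr0//; exact: hi.
Qed.

(** Cancellation makes [mol g k t] small, to any order, as [t] tends to 0: the
    Taylor polynomial of [g] integrates to zero against [k]. *)
Lemma mol_cancel g k N M : rsch g -> rsch k -> cancellative k -> exists2 C, 0 <= C &
  forall t u, `|t| <= 1 -> `|mol g k t u| * brk u ^+ M <= C * `|t| ^+ N.
Proof.
move=> hg hk ck; have [K K0 hK] := rsch_weight (N + M) hk.
have [C C0 hC] := taylor_rsch N M hg.
exists (K * C) => [|t u t1]; first exact: mulr_ge0.
pose T z := \sum_(j < N) j`!%:R^-1 * dpow j g (- t *: z) u.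
have gT : pgrow T.
  by apply: pgrow_sum => i; apply: pgrowM; [exact: pgrow_cst|exact: pgrow_dpow].
have E : mol g k t u = \int[mu]_z (taylor_rem N g (- t *: z) u * k z).
  rewrite (@eq_Rintegral _ _ _ _ _ (fun z => g (u - t *: z) * k z - T z * k z)) => [|z _].
    rewrite RintegralB//; [|exact: rint_mol|exact: rint_pgrow].
    rewrite (_ : \int[mu]_x (T x * k x) = 0) ?subr0//.
    rewrite (@eq_Rintegral _ _ _ _ _ (fun z => \sum_(j < N) j`!%:R^-1 *
      (\prod_(i <- [::]) z ord0 i * dpow j g (- t *: z) u * k z))) => [|z _]; last first.
      by rewrite /T mulr_suml; apply: eq_bigr => j _; rewrite big_nil mul1r mulrA.
    have hi (j : 'I_N) : rint (fun z => \prod_(i <- [::]) z ord0 i * dpow j g (- t *: z) u * k z).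
      by apply: rint_pgrow => //; apply: pgrowM; [exact: pgrow_prod|exact: pgrow_dpow].
    rewrite Rintegral_sum => [|j]; last exact: rintZ.
    by rewrite big1// => j _; rewrite RintegralZl ?cancellative_dpow ?mulr0//; exact: hi.
  by rewrite -mulrBl /taylor_rem /T scaleNr.
rewrite E -ler_pdivlMr ?brkX_gt0// -2!mulrA.
apply: (hK (fun z => taylor_rem N g (- t *: z) u) _ _ _).2.
  apply: measurable_funB.
    under eq_fun do rewrite scaleNr.
    by apply: (measurable_comp_affine u); exact: rsch_measurable.
  by have [] := gT.
move=> z; rewrite mulrAC ler_pdivlMr ?brkX_gt0//.
apply: le_trans (hC u (- t *: z)) _.
rewrite enormZ normrN exprMn exprD -!mulrA ler_wpM2l// ler_wpM2l ?exprn_ge0//.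
apply: ler_pM; rewrite ?exprn_ge0 ?enorm_ge0 ?brk_ge0//.
  by rewrite lerXn2r ?nnegrE ?enorm_ge0 ?brk_ge0 ?enorm_brk.
by rewrite lerXn2r ?nnegrE ?brk_ge0// brkZ// normrN.
Qed.

(** Lipschitz dependence on the scale, with decay: this controls the oscillation of
    the layers of the reproducing formula within a small cell of scales. *)
Lemma mol_lip g k M : rsch g -> rsch k -> exists2 C, 0 <= C &
  forall t t' u, `|t| <= 1 -> `|t'| <= 1 ->
  `|mol g k t u - mol g k t' u| * brk u ^+ M <= C * `|t - t'|.
Proof.
move=> hg hk; have [K K0 hK] := rsch_weight (1 + M + M) hk.
have [C C0 hC] := taylor_rsch 1 M hg.
exists (K * (C * 2 ^+ M)) => [|t t' u t1 t1']; first by rewrite !mulr_ge0// exprn_ge0.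
rewrite -ler_pdivlMr ?brkX_gt0// -!mulrA /mol.
rewrite -RintegralB//; [|exact: rint_mol|exact: rint_mol].
rewrite (@eq_Rintegral _ _ _ _ _ (fun z => (g (u - t *: z) - g (u - t' *: z)) * k z)) => [|z _]; last first.
  by rewrite mulrBl.
apply: (hK (fun z => g (u - t *: z) - g (u - t' *: z)) _ _ _).2.
  by apply: measurable_funB; apply: (measurable_comp_affine u); exact: rsch_measurable.
move=> z; rewrite mulrA mulrA mulrAC ler_pdivlMr ?brkX_gt0//.
pose v := (t' - t) *: z.
have vE : u - t *: z = u - t' *: z + v.
  by rewrite /v scalerBl addrA subrK.
rewrite vE -taylor_rem1.
apply: (@le_trans _ _ (`|taylor_rem 1 g v (u - t' *: z)| * (brk (u - t' *: z) ^+ M * brk z ^+ M))).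
  by rewrite ler_wpM2l// brkZ_sub.
rewrite mulrA exprD [leRHS]mulrA ler_wpM2r ?exprn_ge0 ?brk_ge0//.
apply: le_trans (hC (u - t' *: z) v) _.
rewrite expr1 /v enormZ distrC exprD expr1.
have h2 : brk ((t' - t) *: z) ^+ M <= 2 ^+ M * brk z ^+ M.
  rewrite -exprMn lerXn2r ?nnegrE ?mulr_ge0 ?brk_ge0// /brk enormZ.
  have : `|t' - t| <= 2 by apply: le_trans (ler_normB _ _) _; rewrite (natrD _ 1 1) lerD.
  by have := enorm_ge0 z; nra.
rewrite (_ : C * 2 ^+ M * _ * _ = C * `|t - t'| * brk z * (2 ^+ M * brk z ^+ M)); last by ring.
apply: ler_pM => //; rewrite ?mulr_ge0 ?exprn_ge0 ?brk_ge0 ?enorm_ge0//.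
by rewrite -mulrA ler_wpM2l// ler_wpM2l// enorm_brk.
Qed.

Lemma mol_continuous2 g k : rsch g -> rsch k ->
  continuous (fun p : Rd * R => mol g k p.2 p.1).
Proof.
move=> hg hk; have [K K0 hK] := rsch_weight 1 hk.
have [C C0 hC] := taylor_rsch 1 0 hg.
apply: locally_lipschitz_continuous => -[u t].
exists (K * (C * (d%:R + 1))) => -[u' t'] _ /=.
rewrite /mol -RintegralB//; [|exact: rint_mol|exact: rint_mol].
rewrite (@eq_Rintegral _ _ _ _ _ (fun z => (g (u - t *: z) - g (u' - t' *: z)) * k z)) => [|z _]; last first.
  by rewrite mulrBl.
rewrite -!mulrA.
apply: (hK (fun z => g (u - t *: z) - g (u' - t' *: z)) _ _ _).2.
  by apply: measurable_funB; apply: (measurable_comp_affine u); exact: rsch_measurable.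
move=> z; pose v := (u - t *: z) - (u' - t' *: z).
have -> : u - t *: z = (u' - t' *: z) + v by rewrite /v [RHS]addrC subrK.
rewrite -taylor_rem1.
have := hC (u' - t' *: z) v; rewrite !expr0 !mulr1 expr1 => /le_trans; apply.
rewrite expr1 -!mulrA ler_wpM2l//.
have hn1 : `|u - u'| <= `|(u, t) - (u', t')|.
  by rewrite [leRHS]prod_normE le_max lexx.
have hn2 : `|t - t'| <= `|(u, t) - (u', t')|.
  by rewrite [leRHS]prod_normE le_max lexx orbT.
have -> : v = (u - u') + (t' - t) *: z.
  by rewrite /v scalerBl !opprB addrACA [RHS]addrACA; congr (_ + _); rewrite addrC.
apply: le_trans (enormD _ _) _; rewrite enormZ distrC.
have h1 := enorm_norm (u - u'); have h2 := enorm_ge0 z.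
have h3 := @ler0n R d; have h4 := normr_ge0 (t - t').
have h5 := normr_ge0 (u - u').
rewrite /brk; set n := `|(u, t) - (u', t')| in hn1 hn2 *.
apply: (@le_trans _ _ (d%:R * n + n * enorm z)).
  apply: lerD; first by apply: le_trans h1 _; rewrite ler_wpM2l.
  by rewrite ler_wpM2r.
have n0 : 0 <= n := normr_ge0 _.
have : 0 <= d%:R * n * enorm z by rewrite !mulr_ge0.
nra.
Qed.

End molecules.

(** * Injectivity of the Fourier transform *)

Section fejer.
Context (R : realType).
Local Notation lm := (@lebesgue_measure R).
Implicit Types s x y : R.

Lemma cos_lip x y : `|cos x - cos y| <= `|x - y|.
Proof.
wlog xy : x y / x <= y.
  by move=> h; have [/h//|/ltW/h] := leP x y; rewrite distrC (distrC y).
have [|c _ E] := @MVT_segment R cos (fun z => - sin z) x y xy (fun z _ => is_derive_cos z).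
  by apply: continuous_subspaceT => z; exact: continuous_cos.
rewrite distrC E normrM normrN distrC [in leRHS]distrC.
by rewrite distrC ler_piMl// sin_max.
Qed.

Lemma sin_lip x y : `|sin x - sin y| <= `|x - y|.
Proof. by rewrite -!cosBpihalf (le_trans (cos_lip _ _))// opprB addrA subrK. Qed.

(** Half of the triangle function; its cosine transform is the Fejer kernel. *)
Definition tri s : R := \1_`[0%R, 1%R] s * (1 - s).

Lemma tri_ge0 s : 0 <= tri s.
Proof.
rewrite /tri indicE; case: (boolP (s \in _)); rewrite ?mul0r// inE/= in_itv/= mul1r.
by move=> /andP[_]; rewrite subr_ge0.
Qed.

Lemma tri_le s : tri s <= \1_`[0%R, 1%R] s.
Proof.
rewrite /tri indicE; case: (boolP (s \in _)); rewrite ?mul0r// inE/= in_itv/= mul1r.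
by move=> /andP[s0 _]; rewrite gerBl.
Qed.

Lemma measurable_tri : measurable_fun setT (tri : measurableTypeR R -> measurableTypeR R).
Proof. by apply: measurable_funM => //; apply: measurable_funB. Qed.

Lemma integrable_tri : lm.-integrable setT (EFin \o tri).
Proof.
apply: (@le_integrable _ (measurableTypeR R) R lm setT measurableT _ (EFin \o \1_`[0%R, 1%R])) => //.
- by apply/measurable_EFinP; exact: measurable_tri.
- by move=> s _ /=; rewrite lee_fin !ger0_norm ?tri_ge0 ?tri_le.
- exact: integrable_indic_itv.
Qed.

Definition fejer x : R := \int[lm]_s (tri s * cos (s * x)).

Lemma measurable_cosM x : measurable_fun setT ((fun s => cos (s * x)) : measurableTypeR R -> measurableTypeR R).
Proof.
apply: continuous_measurable_fun => s; apply: continuous_comp; last exact: continuous_cos.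
by apply: cvgM; [exact: cvg_id|exact: cvg_cst].
Qed.

Lemma integrable_tri_cos x : lm.-integrable setT (EFin \o (fun s => tri s * cos (s * x))).
Proof.
apply: (@le_integrable _ (measurableTypeR R) R lm setT measurableT _ (EFin \o tri)) => //; last exact: integrable_tri.
- apply/measurable_EFinP; apply: measurable_funM; first exact: measurable_tri.
  exact: measurable_cosM.
- by move=> s _ /=; rewrite lee_fin normrM ler_piMr// cos_max.
Qed.

Lemma int_tri_le1 : \int[lm]_s tri s <= 1.
Proof.
have i1 : lm.-integrable setT (EFin \o (\1_`[0%R, 1%R] : R -> R)).
  exact: integrable_indic_itv.
apply: (@le_trans _ _ (\int[lm]_s (\1_`[0%R, 1%R] s))).
  by apply: le_Rintegral => //; [exact: integrable_tri|move=> s _; exact: tri_le].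
rewrite /Rintegral integral_indic// setIT [X in fine X]lebesgue_measure_itv/=.
by rewrite lte_fin ltr01 oppr0 adde0.
Qed.

Lemma fejer_lip x y : `|fejer x - fejer y| <= `|x - y|.
Proof.
rewrite /fejer -RintegralB//; [|exact: integrable_tri_cos|exact: integrable_tri_cos].
have iB : lm.-integrable setT (EFin \o (fun s => tri s * cos (s * x) - tri s * cos (s * y))).
  exact: (integrableB measurableT (integrable_tri_cos x) (integrable_tri_cos y)).
apply: le_trans (le_normr_Rintegral measurableT iB) _.
apply: (@le_trans _ _ (\int[lm]_s (`|x - y| * tri s))).
  apply: le_Rintegral => //.
  - exact: integrable_norm.
  - exact: (integrableZl measurableT _ integrable_tri).
  - move=> s _; rewrite -mulrBr normrM ger0_norm ?tri_ge0// mulrC.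
    rewrite /tri indicE; case: (boolP (s \in _)); rewrite ?mul0r ?mulr0// inE/= in_itv/= mul1r.
    move=> /andP[s0 s1]; rewrite ler_wpM2r ?subr_ge0// (le_trans (cos_lip _ _))//.
    by rewrite -mulrBr normrM ger0_norm// ler_piMl.
rewrite RintegralZl//; last exact: integrable_tri.
by rewrite ler_piMr// int_tri_le1.
Qed.

Lemma fejer_continuous : continuous fejer.
Proof.
by apply: locally_lipschitz_continuous => x; exists 1 => y _; rewrite mul1r fejer_lip.
Qed.

Lemma fejer_norm_le1 x : `|fejer x| <= 1.
Proof.
apply: le_trans int_tri_le1.
apply: le_trans (le_normr_Rintegral measurableT (integrable_tri_cos x)) _.
apply: le_Rintegral => //; [exact: integrable_norm (integrable_tri_cos x)|exact: integrable_tri|].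
by move=> s _; rewrite normrM ger0_norm ?tri_ge0// ler_piMr ?tri_ge0// cos_max.
Qed.

(** The integrand has an explicit primitive. *)
Lemma fejerE x : x != 0 -> fejer x = (1 - cos x) / x ^+ 2.
Proof.
move=> x0.
pose F s := (1 - s) * (sin (s * x) * x^-1) - cos (s * x) * x ^- 2.
have dF s : is_derive s 1 F ((1 - s) * cos (s * x)).
  have dx : is_derive s 1 (fun s => s * x) x.
    have -> : (fun s => s * x) = x *: (id : R -> R) by apply/funext => y /=; rewrite mulrC.
    by apply: is_derive_eq; rewrite /GRing.scale/= mulr1.
  have dsin : is_derive s 1 (fun s => sin (s * x)) (cos (s * x) * x).
    exact: (@is_derive1_comp R sin (fun s => s * x) s _ _ (is_derive_sin _) dx).
  have dcos : is_derive s 1 (fun s => cos (s * x)) (- sin (s * x) * x).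
    exact: (@is_derive1_comp R cos (fun s => s * x) s _ _ (is_derive_cos _) dx).
  have d1s : is_derive s 1 (fun s => 1 - s) (- 1).
    by apply: (is_derive_eq (is_deriveB (is_derive_cst (1 : R) s 1) (is_derive_id s 1))); rewrite sub0r.
  have d1 : is_derive s 1 (fun s => sin (s * x) * x^-1) (cos (s * x)).
    have -> : (fun s => sin (s * x) * x^-1) = x^-1 *: (fun s => sin (s * x)).
      by apply/funext => y /=; rewrite mulrC.
    by apply: is_derive_eq; rewrite /GRing.scale/= mulrCA mulVf// mulr1.
  have d2 : is_derive s 1 (fun s => cos (s * x) * x ^- 2) (- sin (s * x) * x^-1).
    have -> : (fun s => cos (s * x) * x ^- 2) = x ^- 2 *: (fun s => cos (s * x)).
      by apply/funext => y /=; rewrite mulrC.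
    by apply: is_derive_eq; rewrite /GRing.scale/=; field.
  have -> : F = (fun s => 1 - s) * (fun s => sin (s * x) * x^-1) - (fun s => cos (s * x) * x ^- 2).
    by apply/funext.
  by apply: is_derive_eq; rewrite /GRing.scale/=; field.
have cF : continuous F.
  by move=> s; apply/differentiable_continuous/derivable1_diffP; have [] := dF s.
have := @continuous_FTC2 R (fun s => (1 - s) * cos (s * x)) F 0 1 ltr01.
move=> h.
rewrite /fejer /tri.
rewrite (@eq_Rintegral _ _ _ lm _ ((fun s => (1 - s) * cos (s * x)) \_ `[0%R, 1%R])) => [|s _]; last first.
  by rewrite patchE indicE; case: ifPn => _; rewrite ?mul0r ?mul1r.
rewrite -Rintegral_mkcond /Rintegral h.
- rewrite /F /= mul0r mul1r !sin0 cos0 subrr !mul0r mulr0 !sub0r mul1r opprK.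
  by rewrite mulrBl addrC mul1r.
- apply: continuous_subspaceT => s; apply: cvgM; last first.
    apply: continuous_comp; last exact: continuous_cos.
    by apply: cvgM; [exact: cvg_id|exact: cvg_cst].
  by apply: cvgB; [exact: cvg_cst|exact: cvg_id].
- split=> [s _||]; first by have [] := dF s.
  + exact/cvg_at_right_filter/cF.
  + exact/cvg_at_left_filter/cF.
- by move=> s _; rewrite derive1E; exact: derive_val.
Qed.

Lemma fejer_le x : `|fejer x| * (1 + x ^+ 2) <= 3.
Proof.
have [->|x0] := eqVneq x 0.
  by rewrite expr0n/= addr0 mulr1 (le_trans (fejer_norm_le1 _))// ler1n.
rewrite mulrDr mulr1 (natrD _ 1 2).
apply: lerD; first exact: fejer_norm_le1.
rewrite fejerE// normrM normfV normrX real_normK ?num_real// divfK ?sqrf_eq0//.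
by apply: le_trans (ler_normB _ _) _; rewrite normr1 (natrD _ 1 1) lerD2l cos_max.
Qed.

Lemma fejer_ge0 x : 0 <= fejer x.
Proof.
have [->|x0] := eqVneq x 0.
  by apply: Rintegral_ge0 => s _; rewrite mulr0 cos0 mulr1 tri_ge0.
by rewrite fejerE// divr_ge0 ?sqr_ge0// subr_ge0 cos_le1.
Qed.

Lemma fejer_gt0 x : 0 < x < 1 -> 0 < fejer x.
Proof.
move=> /andP[x0 x1]; rewrite fejerE ?gt_eqF// divr_gt0 ?exprn_gt0//.
have -> : 1 - cos x = 2 * sin (x / 2) ^+ 2.
  have -> : cos x = cos (x / 2 *+ 2) by rewrite -mulr_natr divfK.
  by rewrite cos_mulr2n sin2cos2; ring.
rewrite mulr_gt0// exprn_gt0// sin_gt0_pi//; have := pi_ge2 R; lra.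
Qed.

End fejer.

Section fourier_injectivity.
Context (R : realType) (d : nat).
Local Notation Rd := 'rV[R]_d.
Local Notation mu := (@leb R d).
Local Notation lm := (@lebesgue_measure R).
Implicit Types (h : Rd -> R) (xi x : Rd).

(** Real form of the vanishing of the Fourier transform. *)
Definition trig_null h := rint h /\ forall xi,
  \int[mu]_x (h x * cos (dotp xi x)) = 0 /\ \int[mu]_x (h x * sin (dotp xi x)) = 0.

Lemma dotpDl x y z : dotp (x + y) z = dotp x z + dotp y z :> R.
Proof. by rewrite /dotp -big_split; apply: eq_bigr => i _; rewrite mxE mulrDl. Qed.

Lemma dotpC (x y : Rd) : dotp x y = dotp y x.
Proof. by apply: eq_bigr => i _; rewrite mulrC. Qed.

Lemma dotpZl a (x y : Rd) : dotp (a *: x) y = a * dotp x y.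
Proof. by rewrite /dotp mulr_sumr; apply: eq_bigr => i _; rewrite mxE mulrA. Qed.

Lemma dotpNl (x y : Rd) : dotp (- x) y = - dotp x y.
Proof. by rewrite -scaleN1r dotpZl mulN1r. Qed.

Lemma dotp_delta a i (x : Rd) : dotp (a *: delta_mx ord0 i) x = a * x ord0 i.
Proof.
rewrite dotpZl /dotp (bigD1 i)//= mxE !eqxx mul1r big1 ?addr0// => j ji.
by rewrite mxE (negbTE ji) mul0r.
Qed.

Lemma measurable_dotp xi : measurable_fun setT ((fun x => dotp xi x) : Rd -> measurableTypeR R).
Proof.
by apply: measurable_sum => i; apply: measurable_funM => //; exact: measurable_coord.
Qed.

Lemma measurable_cos_dotp xi : measurable_fun setT ((fun x => cos (dotp xi x)) : Rd -> measurableTypeR R).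
Proof.
apply: (@measurableT_comp _ _ _ _ _ _ (@cos R : measurableTypeR R -> measurableTypeR R)).
  by apply: continuous_measurable_fun; exact: continuous_cos.
exact: measurable_dotp.
Qed.

Lemma measurable_sin_dotp xi : measurable_fun setT ((fun x => sin (dotp xi x)) : Rd -> measurableTypeR R).
Proof.
apply: (@measurableT_comp _ _ _ _ _ _ (@sin R : measurableTypeR R -> measurableTypeR R)).
  by apply: continuous_measurable_fun; exact: continuous_sin.
exact: measurable_dotp.
Qed.

Lemma rintM_bounded h (b : Rd -> R) : rint h -> measurable_fun setT (b : Rd -> measurableTypeR R) ->
  (forall x, `|b x| <= 1) -> rint (fun x => h x * b x).
Proof.
move=> hi mb hb; apply: (@rint_le _ _ _ (fun x => `|h x|)).
- by apply: measurable_funM => //; apply/measurable_EFinP; exact: measurable_int hi.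
- by move=> x; rewrite normrM ler_piMr.
- exact: integrable_norm hi.
Qed.

Lemma measurable_fejer_coord (a : R) i :
  measurable_fun setT ((fun x : Rd => fejer (a * x ord0 i)) : Rd -> measurableTypeR R).
Proof.
apply: (@measurableT_comp _ _ _ _ _ _ (@fejer R : measurableTypeR R -> measurableTypeR R)).
  by apply: continuous_measurable_fun; exact: fejer_continuous.
by apply: measurable_funM => //; exact: measurable_coord.
Qed.

(** The Fejer kernel is a superposition of cosines, so multiplying by it keeps
    all trigonometric integrals zero. *)
Lemma trig_null_fejer h (a : R) i : trig_null h ->
  trig_null (fun x => h x * fejer (a * x ord0 i)).
Proof.
move=> [hi h0].
split; first by apply: rintM_bounded => // [|x]; [exact: measurable_fejer_coord|exact: fejer_norm_le1].
have mh : measurable_fun setT (h : Rd -> measurableTypeR R).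
  by apply/measurable_EFinP; exact: measurable_int hi.
have key (b : Rd -> R) : measurable_fun setT (b : Rd -> measurableTypeR R) ->
    (forall x, `|b x| <= 1) ->
    (forall s, \int[mu]_x (h x * (cos (s * (a * x ord0 i)) * b x)) = 0) ->
    \int[mu]_x (h x * fejer (a * x ord0 i) * b x) = 0.
  move=> mb b1 b0.
  have mc : measurable_fun setT (fun p : Rd * measurableTypeR R => cos (p.2 * (a * p.1 ord0 i))).
    apply: (@measurableT_comp _ _ _ _ _ _ (@cos R : measurableTypeR R -> measurableTypeR R)).
      by apply: continuous_measurable_fun; exact: continuous_cos.
    apply: measurable_funM => //; apply: measurable_funM => //.
    exact: (measurableT_comp (measurable_coord i) measurable_fst).
  transitivity (\int[mu]_x \int[lm]_s (h x * (tri s * (cos (s * (a * x ord0 i)) * b x)))).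
    apply: eq_Rintegral => x _; rewrite /fejer.
    rewrite [RHS](@eq_Rintegral _ _ _ lm _ (fun s => (h x * b x) * (tri s * cos (s * (a * x ord0 i))))) => [|s _]; last by ring.
    by rewrite RintegralZl//; [ring|exact: integrable_tri_cos].
  rewrite (@Rintegral_fubini_dom _ _ _ _ _ mu lm _ (fun x => `|h x|) (@tri R)).
  - rewrite (@eq_Rintegral _ _ _ lm _ (fun=> 0)) => [|s _]; first by rewrite Rintegral_cst// mul0r.
    rewrite (@eq_Rintegral _ _ _ mu _ (fun x => tri s * (h x * (cos (s * (a * x ord0 i)) * b x)))) => [|x _]; last by ring.
    rewrite RintegralZl// ?b0 ?mulr0//; apply: rintM_bounded => // [|x].
      by apply: measurable_funM => //; exact: (measurableT_comp mc (measurable_pair2 s)).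
    by rewrite normrM mulr_ile1// cos_max.
  - apply: measurable_funM; first exact: measurableT_comp measurable_fst.
    apply: measurable_funM; first exact: (measurableT_comp (@measurable_tri R) measurable_snd).
    by apply: measurable_funM => //; exact: measurableT_comp measurable_fst.
  - exact: integrable_norm hi.
  - exact: integrable_tri.
  - move=> x s; rewrite normrM ler_wpM2l// normrM ger0_norm ?tri_ge0// ler_piMr ?tri_ge0//.
    by rewrite normrM mulr_ile1// cos_max.
have sA s xi x : dotp (xi + (s * a) *: delta_mx ord0 i) x = dotp xi x + s * (a * x ord0 i).
  by rewrite dotpDl dotp_delta mulrA.
have sB s xi x : dotp (xi - (s * a) *: delta_mx ord0 i) x = dotp xi x - s * (a * x ord0 i).
  by rewrite dotpDl dotpNl dotp_delta mulrA.
move=> xi; split; apply: key.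
- exact: measurable_cos_dotp.
- by move=> x; exact: cos_max.
- move=> s.
  rewrite (@eq_Rintegral _ _ _ mu _ (fun x =>
    2^-1 * (h x * cos (dotp (xi + (s * a) *: delta_mx ord0 i) x) +
            h x * cos (dotp (xi - (s * a) *: delta_mx ord0 i) x)))) => [|x _]; last first.
    by rewrite sA sB cosD cosB; field.
  have i1 xi' : rint (fun x => h x * cos (dotp xi' x)).
    by apply: rintM_bounded => // [|x]; [exact: measurable_cos_dotp|exact: cos_max].
  rewrite RintegralZl//; last by apply: rintD; exact: i1.
  rewrite RintegralD//; [|exact: i1|exact: i1].
  by rewrite (h0 _).1 (h0 _).1 addr0 mulr0.
- exact: measurable_sin_dotp.
- by move=> x; exact: sin_max.
- move=> s.
  rewrite (@eq_Rintegral _ _ _ mu _ (fun x =>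
    2^-1 * (h x * sin (dotp (xi + (s * a) *: delta_mx ord0 i) x) +
            h x * sin (dotp (xi - (s * a) *: delta_mx ord0 i) x)))) => [|x _]; last first.
    by rewrite sA sB sinD sinB; field.
  have i1 xi' : rint (fun x => h x * sin (dotp xi' x)).
    by apply: rintM_bounded => // [|x]; [exact: measurable_sin_dotp|exact: sin_max].
  rewrite RintegralZl//; last by apply: rintD; exact: i1.
  rewrite RintegralD//; [|exact: i1|exact: i1].
  by rewrite (h0 _).2 (h0 _).2 addr0 mulr0.
Qed.

(** Multiplication by a kernel in each coordinate in turn, then the frequency 0. *)
Lemma trig_null_prod_fejer h (a : R) : trig_null h ->
  \int[mu]_x (h x * \prod_i fejer (a * x ord0 i)) = 0.
Proof.
move=> h0.
have hl (l : seq 'I_d) : trig_null (fun x => h x * \prod_(i <- l) fejer (a * x ord0 i)).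
  elim: l => [|i l ih].
    by rewrite (_ : (fun x => _) = h)//; apply/funext => x; rewrite big_nil mulr1.
  have := trig_null_fejer a i ih; congr trig_null; apply/funext => x.
  by rewrite big_cons; ring.
have [_ /(_ 0)[+ _]] := hl (index_enum 'I_d).
rewrite (@eq_Rintegral _ _ _ mu _ (fun x => h x * \prod_i fejer (a * x ord0 i)))// => x _.
by rewrite (_ : dotp 0 x = 0) ?cos0 ?mulr1// /dotp big1// => i _; rewrite mxE mul0r.
Qed.

Lemma leb_box_gt0 n (c : 'rV[R]_n) (r : R) : 0 < r ->
  (0 < leb [set x : 'rV[R]_n | forall i, (`|x ord0 i - c ord0 i| < r)%R])%E.
Proof.
move=> r0; elim: n c => [|n ih] c.
  rewrite [ltRHS](_ : _ = dirac (0%R : 'rV[R]_0) [set x : 'rV[R]_0 | forall i, `|x ord0 i - c ord0 i| < r])//.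
  by rewrite diracE mem_set//= => -[].
pose c0 := c ord0 (lshift n (ord0 : 'I_1)); pose c1 : 'rV[R]_n := @rsubmx _ 1 1 n c.
rewrite (@lebS_rect _ _ `]c0 - r, c0 + r[%classic
  [set x : 'rV[R]_n | forall i, `|x ord0 i - c1 ord0 i| < r]).
- apply: mule_gt0; last exact: (ih c1).
  by rewrite lebesgue_measure_itv/= lte_fin ifT ?lte_fin; lra.
- exact: measurable_itv.
- rewrite (_ : mkset _ = \bigcap_(i in [set: 'I_n])
       (Defs.coord i @^-1` `]c1 ord0 i - r, c1 ord0 i + r[%classic)).
    apply: fin_bigcap_measurable => // i _.
    by rewrite -[X in measurable X]setTI; apply: measurable_coord.
  by apply/seteqP; split => [y h i _|y h i] /=; [have := h i|have := h i I];
    rewrite /Defs.coord /= in_itv/= ltr_norml => /andP[h1 h2]; apply/andP; split; lra.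
- apply/seteqP; split => -[x y] /=.
    move=> h; split.
      have := h (lshift n (ord0 : 'I_1)); rewrite rV_consl/= in_itv/= ltr_norml -/c0.
      by move=> /andP[h1 h2]; apply/andP; split; lra.
    by move=> i; have := h (rshift 1 i); rewrite rV_consr /c1 mxE.
  rewrite in_itv/= => -[/andP[hx1 hx2] hy] i.
  case: (split_ordP (i : 'I_(1 + n))) => j ->; rewrite ?rV_consl ?rV_consr.
    by rewrite (ord1 j) -/c0 /= ltr_norml; apply/andP; split; lra.
  by have := hy j; rewrite /c1 mxE.
Qed.

Lemma leb_open_gt0 (U : set Rd) (x : Rd) : open U -> U x -> (0 < leb U)%E.
Proof.
move=> oU Ux; have /nbhs_ballP[e /= e0 he] : nbhs x U by move: oU; rewrite openE => /(_ _ Ux).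
apply: lt_le_trans (leb_box_gt0 x e0) _.
have mU := open_measurable_rV oU.
apply: le_measure; rewrite ?inE//.
  rewrite (_ : mkset _ = \bigcap_(i in [set: 'I_d])
       (Defs.coord i @^-1` `]x ord0 i - e, x ord0 i + e[%classic)).
    apply: fin_bigcap_measurable => // i _.
    by rewrite -[X in measurable X]setTI; apply: measurable_coord.
  by apply/seteqP; split => [y h i _|y h i] /=; [have := h i|have := h i I];
    rewrite /Defs.coord /= in_itv/= ltr_norml => /andP[h1 h2]; apply/andP; split; lra.
move=> y hy; apply: he; split=> // i j; rewrite (ord1 i) /ball/= distrC; exact: hy.
Qed.

Lemma rint_prod_fejer : rint (fun x : Rd => \prod_i fejer (x ord0 i)).
Proof.
have mf : measurable_fun setT ((fun x : Rd => \prod_i fejer (x ord0 i)) : Rd -> measurableTypeR R).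
  apply: measurable_prod => i _.
  by have := measurable_fejer_coord 1 i; under eq_fun do rewrite mul1r.
apply: (@rint_le _ _ _ (fun x => 3 ^+ d * \prod_i (1 + x ord0 i ^+ 2)^-1)) => //.
  move=> x; rewrite normr_prod -[in X in _ <= X * _](card_ord d) -prodr_const -big_split /=.
  apply: ler_prod => i _; rewrite normr_ge0/= ler_pdivlMr ?fejer_le//.
  by rewrite ltr_pwDl// sqr_ge0.
apply: rintZ; apply/integrableP; split; first by apply/measurable_EFinP; exact: measurable_prod_oneDsqrV.
apply: le_lt_trans (integral_prod_oneDsqrV_lty R d).
apply: ge0_le_integral => //.
- by apply: measurableT_comp => //; apply/measurable_EFinP; exact: measurable_prod_oneDsqrV.
- by apply/measurable_EFinP; exact: measurable_prod_oneDsqrV.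
- move=> x _ /=; rewrite lee_fin ger0_norm//; apply: prodr_ge0 => i _.
  by rewrite invr_ge0 addr_ge0// sqr_ge0.
Qed.

Lemma int_prod_fejer_gt0 : 0 < \int[mu]_x (\prod_i fejer (x ord0 i)).
Proof.
pose K x := \prod_i fejer (x ord0 i).
have K0 x : 0 <= K x by apply: prodr_ge0 => i _; exact: fejer_ge0.
have iK : rint K := rint_prod_fejer.
have I0 : 0 <= \int[mu]_x K x by apply: Rintegral_ge0.
rewrite lt_neqAle I0 andbT; apply/eqP => E.
have mK := measurable_int _ iK.
have : (\int[mu]_x `|(K x)%:E| = 0)%E.
  rewrite (eq_integral (fun x => (K x)%:E)) => [|x _]; last by rewrite gee0_abs ?lee_fin.
  by rewrite -[LHS]fineK ?(integrable_fin_num measurableT iK)// -[fine _]E.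
move=> /(ae_eq_integral_abs mu measurableT mK)[N [mN N0 sN]].
pose c : Rd := const_mx (2^-1).
have box : [set x : Rd | forall i, `|x ord0 i - c ord0 i| < 2^-1] `<=` N.
  move=> x hx; apply: sN => /= /(_ I) /eqP; apply/negP.
  rewrite eqe gt_eqF// prodr_gt0// => i _; apply: fejer_gt0.
  by have := hx i; rewrite mxE ltr_norml => /andP[h1 h2]; apply/andP; split; lra.
have h2 : 0 < 2^-1 :> R by [].
have := leb_box_gt0 c h2; apply/negP; rewrite -leNgt -N0.
apply: le_measure; rewrite ?inE//.
rewrite (_ : mkset _ = \bigcap_(i in [set: 'I_d])
     (Defs.coord i @^-1` `]c ord0 i - 2^-1, c ord0 i + 2^-1[%classic)).
  apply: fin_bigcap_measurable => // i _.
  by rewrite -[X in measurable X]setTI; apply: measurable_coord.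
by apply/seteqP; split => [y h i _|y h i] /=; [have := h i|have := h i I];
  rewrite /Defs.coord /= in_itv/= ltr_norml => /andP[h1 h2']; apply/andP; split; lra.
Qed.

(** The products of Fejer kernels, rescaled, form an approximate identity at the
    origin: the integrals of [h] against them vanish and tend to a positive multiple of
    [h 0]. *)
Lemma trig_null_eq0_at0 h (C : R) : continuous h -> (forall x, `|h x| <= C) -> trig_null h ->
  h 0 = 0.
Proof.
move=> ch hC h0; have [hi _] := h0.
pose K x := \prod_i fejer (x ord0 i).
have iK : rint K := rint_prod_fejer.
have mK : measurable_fun setT (K : Rd -> measurableTypeR R).
  by apply/measurable_EFinP; exact: measurable_int iK.
have K0 x : 0 <= K x by apply: prodr_ge0 => i _; exact: fejer_ge0.
have C0 : 0 <= C by apply: le_trans (hC 0).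
pose f_ (n : nat) (x : Rd) : \bar R := (h (n.+1%:R^-1 *: x) * K x)%:E.
have mh : measurable_fun setT (h : Rd -> measurableTypeR R) by exact: continuous_measurable_rV.
have mha (n : nat) : measurable_fun setT ((fun x => h (n.+1%:R^-1 *: x)) : Rd -> measurableTypeR R).
  apply: (measurableT_comp mh).
  by have := @measurable_affine R d (n.+1%:R^-1) 0; under eq_fun do rewrite addr0.
have In n : (\int[mu]_x f_ n x = 0)%E.
  have n0 : n.+1%:R != 0 :> R by rewrite pnatr_eq0.
  pose H x := h x * \prod_i fejer (n.+1%:R * x ord0 i).
  have iH : rint H.
    apply: rintM_bounded => //.
      apply: measurable_prod => i _; exact: measurable_fejer_coord.
    move=> x; rewrite normr_prod; apply: prodr_ile1 => i _.
    by rewrite normr_ge0 fejer_norm_le1.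
  have E x : H (n.+1%:R^-1 *: x + 0) = h (n.+1%:R^-1 *: x) * K x.
    rewrite addr0 /H; congr (_ * _); apply: eq_bigr => i _.
    by rewrite mxE mulrA divff// mul1r.
  have iHn : rint (fun x => h (n.+1%:R^-1 *: x) * K x).
    by have := rint_affine 0 (invr_neq0 n0) iH; under [X in rint X]eq_fun do rewrite E.
  have := Rintegral_affine 0 (invr_neq0 n0) iH.
  rewrite trig_null_prod_fejer// mulr0.
  under eq_Rintegral do rewrite E.
  move=> Z; rewrite -[LHS]fineK; first by congr (_%:E); exact: Z.
  exact: (integrable_fin_num measurableT iHn).
have := @dominated_convergence _ _ _ mu setT measurableT f_ (fun x => (h 0 * K x)%:E)
  (fun x => (C * K x)%:E).
case.
- by move=> n; apply/measurable_EFinP; apply: measurable_funM => //; exact: mha.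
- by apply/measurable_EFinP; apply: measurable_funM.
- apply: nearW => x _ /=; apply: cvg_EFin; first exact: nearW.
  rewrite (_ : fine \o _ = (fun n => h (n.+1%:R^-1 *: x) * K x)); last by apply/funext.
  apply: cvgMl; rewrite -[X in _ --> h X](scale0r x).
  have cz : (fun n : nat => n.+1%:R^-1 *: x : Rd) @ \oo --> ((0 : R) *: x : Rd).
    by apply: cvgZl; exact: cvg_harmonic.
  exact: (cvg_comp _ _ cz (ch _)).
- exact: rintZ.
- apply: nearW => x n _ /=; rewrite lee_fin normrM (ger0_norm (K0 x)).
  by rewrite ler_wpM2r.
- move=> _ _ Z.
  have : (\int[mu]_x (h 0 * K x)%:E = 0)%E.
    rewrite -(cvg_lim (@ereal_hausdorff R) Z).
    rewrite (_ : (fun n => _) = cst 0%E) ?lim_cst//; apply/funext => n; exact: In.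
  move=> /(congr1 fine); rewrite -[LHS]/(\int[mu]_x (h 0 * K x)) RintegralZl//= => /eqP.
  by rewrite mulf_eq0 (gt_eqF int_prod_fejer_gt0) orbF => /eqP.
Qed.

Lemma trig_null_translate h y : trig_null h -> trig_null (fun x => h (x + y)).
Proof.
move=> [hi h0]; have E : (fun x => h (x + y)) = (fun x => h (1 *: x + y)).
  by apply/funext => x; rewrite scale1r.
have ti (f : Rd -> R) : rint f -> \int[mu]_x f (x + y) = \int[mu]_x f x.
  move=> fi; have := Rintegral_affine y (oner_neq0 R) fi.
  rewrite normr1 expr1n invr1 mul1r => <-.
  by apply: eq_Rintegral => x _; rewrite scale1r.
split; first by rewrite E; apply: rint_affine => //; exact: oner_neq0.
have ic xi : rint (fun x => h x * cos (dotp xi x)).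
  by apply: rintM_bounded => // [|x]; [exact: measurable_cos_dotp|exact: cos_max].
have is_ xi : rint (fun x => h x * sin (dotp xi x)).
  by apply: rintM_bounded => // [|x]; [exact: measurable_sin_dotp|exact: sin_max].
move=> xi; have Ed x : dotp xi x = dotp xi (x + y) - dotp xi y.
  by rewrite dotpC (dotpC xi (x + y)) dotpDl (dotpC y) addrK.
split.
  pose F z := cos (dotp xi y) * (h z * cos (dotp xi z)) + sin (dotp xi y) * (h z * sin (dotp xi z)).
  rewrite (@eq_Rintegral _ _ _ mu _ (fun x => F (x + y))) => [|x _]; last first.
    by rewrite /F (Ed x) cosB; ring.
  rewrite ti /F; last by apply: rintD; apply: rintZ.
  by rewrite RintegralD ?RintegralZl ?(h0 _).1 ?(h0 _).2 ?mulr0 ?addr0//; first [exact: (rintZ _ (ic _))|exact: (rintZ _ (is_ _))|exact: ic|exact: is_].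
pose F z := cos (dotp xi y) * (h z * sin (dotp xi z)) + (- sin (dotp xi y)) * (h z * cos (dotp xi z)).
rewrite (@eq_Rintegral _ _ _ mu _ (fun x => F (x + y))) => [|x _]; last first.
  by rewrite /F (Ed x) sinB; ring.
rewrite ti /F; last by apply: rintD; apply: rintZ.
by rewrite RintegralD ?RintegralZl ?(h0 _).1 ?(h0 _).2 ?mulr0 ?addr0//; first [exact: (rintZ _ (ic _))|exact: (rintZ _ (is_ _))|exact: ic|exact: is_].
Qed.

Lemma trig_null_eq0 h (C : R) : continuous h -> (forall x, `|h x| <= C) -> trig_null h ->
  forall x, h x = 0.
Proof.
move=> ch hC h0 x.
have := @trig_null_eq0_at0 (fun z => h (z + x)) C _ (fun z => hC _) (trig_null_translate x h0).
rewrite add0r; apply => z.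
have FF : Filter (nbhs z) by exact: nbhs_filter.
have c1 : (fun z : Rd => z + x) @ z --> z + x by apply: cvgD; [exact: cvg_id|exact: cvg_cst].
exact: (cvg_comp _ _ c1 (ch _)).
Qed.

End fourier_injectivity.

(** * Complex-valued functions *)

Section complex_basics.
Context (R : realType).
Implicit Types (z w : R[i]) (b : bool).

(** Indexing the two parts by a boolean lets one statement treat both. *)
Definition part b z : R := if b then complex.Re z else complex.Im z.

Lemma complex_eqP z w : (forall b, part b z = part b w) -> z = w.
Proof. by case: z => a a'; case: w => c c' h; congr (_ +i* _)%C; [exact: (h true)|exact: (h false)]. Qed.

Lemma ReM z w : complex.Re (z * w) = complex.Re z * complex.Re w - complex.Im z * complex.Im w.
Proof. by case: z; case: w. Qed.

Lemma ImM z w : complex.Im (z * w) = complex.Re z * complex.Im w + complex.Im z * complex.Re w.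
Proof. by case: z => a b; case: w => c e /=; rewrite mulrC (mulrC b) addrC mulrC addrC (mulrC e). Qed.

Lemma partM b z w : part b (z * w) =
  complex.Re z * part b w + (if b then - complex.Im z * complex.Im w else complex.Im z * complex.Re w).
Proof. by case: b; rewrite /part ?ReM ?ImM// mulNr. Qed.

Lemma partD b z w : part b (z + w) = part b z + part b w.
Proof. by case: b; case: z; case: w. Qed.

Lemma partN b z : part b (- z) = - part b z.
Proof. by case: b; case: z. Qed.

Lemma part0 b : part b 0 = 0. Proof. by case: b. Qed.

Lemma part_realM b (r : R) z : part b (r%:C%C * z) = r * part b z.
Proof. by case: b; case: z => x y; rewrite /part/= mul0r ?subr0 ?addr0. Qed.

Lemma cabs_ge0 z : 0 <= cabs z.
Proof. by case: z => a b; exact: sqrtr_ge0. Qed.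

Lemma cabs0 : cabs (0 : R[i]) = 0.
Proof. exact: ComplexField.Normc.normc0. Qed.

Lemma cabsM z w : cabs (z * w) = cabs z * cabs w.
Proof. exact: ComplexField.Normc.normcM. Qed.

Lemma cabsD z w : cabs (z + w) <= cabs z + cabs w.
Proof. exact: (@le_normcD R z w). Qed.

Lemma cabsN z : cabs (- z) = cabs z.
Proof. exact: (@normcN R z). Qed.

Lemma cabs_real (r : R) : cabs (r%:C)%C = `|r|.
Proof. by rewrite /cabs/= expr0n/= addr0 sqrtr_sqr. Qed.

Lemma part_cabs b z : `|part b z| <= cabs z.
Proof.
by case: z => x y; rewrite /cabs /part/= -sqrtr_sqr ler_wsqrtr//; case: b; rewrite ?lerDl ?lerDr ?sqr_ge0.
Qed.

Lemma cabs_parts z : cabs z <= `|part true z| + `|part false z|.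
Proof.
case: z => x y; rewrite /cabs/= -(@ler_pXn2r _ 2)// ?nnegrE ?sqrtr_ge0 ?addr_ge0//.
rewrite sqr_sqrtr ?addr_ge0 ?sqr_ge0// sqrrD !real_normK ?num_real//.
by rewrite lerD2r lerDl mulrn_wge0// mulr_ge0.
Qed.

Lemma cabs_parts_le z (A : R) : (forall b, `|part b z| <= A) -> cabs z <= 2 * A.
Proof.
move=> h; apply: le_trans (cabs_parts z) _.
by rewrite mulr_natl mulr2n lerD.
Qed.

Lemma cis0 : cis (0 : R) = 1. Proof. by rewrite /cis cos0 sin0. Qed.

Lemma cisD (s t : R) : cis (s + t) = cis s * cis t.
Proof.
apply: complex_eqP => -[]; rewrite /part/= ?ReM ?ImM/=; first by rewrite cosD.
by rewrite sinD addrC.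
Qed.

End complex_basics.

Section complex_integral.
Context d1 (T : measurableType d1) (R : realType) (m : {measure set T -> \bar R}).
Implicit Types (f : T -> R[i]).

Definition cintg f : R[i] :=
  ((\int[m]_x complex.Re (f x)) +i* (\int[m]_x complex.Im (f x)))%C.

Definition cinteg f := forall b, m.-integrable setT (EFin \o (fun x => part b (f x))).

Lemma part_cintg b f : part b (cintg f) = \int[m]_x part b (f x).
Proof. by case: b. Qed.

Lemma eq_cintg f g : f =1 g -> cintg f = cintg g.
Proof. by move=> fg; congr (_ +i* _)%C; apply: eq_Rintegral => x _; rewrite fg. Qed.

Lemma cintegD f g : cinteg f -> cinteg g -> cinteg (fun x => f x + g x).
Proof.
move=> hf hg b; apply: eq_integrable (integrableD measurableT (hf b) (hg b)) => // x _.
by rewrite /= partD.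
Qed.

Lemma cintgD f g : cinteg f -> cinteg g ->
  cintg (fun x => f x + g x) = cintg f + cintg g.
Proof.
move=> hf hg; apply: complex_eqP => b; rewrite partD !part_cintg -RintegralD//.
by apply: eq_Rintegral => x _; rewrite partD.
Qed.

Lemma integrable_scale (r : R) (h : T -> R) : m.-integrable setT (EFin \o h) ->
  m.-integrable setT (EFin \o (fun x => r * h x)).
Proof. by move=> hh; exact: (integrableZl measurableT r hh). Qed.

Lemma integrable_add (h k : T -> R) : m.-integrable setT (EFin \o h) ->
  m.-integrable setT (EFin \o k) -> m.-integrable setT (EFin \o (fun x => h x + k x)).
Proof. by move=> hh hk; exact: (integrableD measurableT hh hk). Qed.

Lemma cintegZ c f : cinteg f -> cinteg (fun x => c * f x).
Proof.
move=> hf b.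
have -> : (fun x => part b (c * f x)) = (fun x => complex.Re c * part b (f x) +
   (if b then - complex.Im c else complex.Im c) * part (~~ b) (f x)).
  by apply/funext => x; rewrite partM; case: b.
by apply: integrable_add; apply: integrable_scale.
Qed.

Lemma cintgZ c f : cinteg f -> cintg (fun x => c * f x) = c * cintg f.
Proof.
move=> hf; apply: complex_eqP => b; rewrite partM part_cintg.
transitivity (\int[m]_x (complex.Re c * part b (f x) +
   (if b then - complex.Im c else complex.Im c) * part (~~ b) (f x))).
  by apply: eq_Rintegral => x _; rewrite partM; case: b.
rewrite RintegralD//; [|exact: integrable_scale|exact: integrable_scale].
by rewrite !RintegralZl// part_cintg; case: b.
Qed.

End complex_integral.

Section complex_fubini.
Context d1 d2 (T1 : measurableType d1) (T2 : measurableType d2) (R : realType).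
Variables (m1 : {sigma_finite_measure set T1 -> \bar R})
          (m2 : {sigma_finite_measure set T2 -> \bar R}).

Lemma cintg_fubini_dom (f : T1 -> T2 -> R[i]) (A : T1 -> R) (B : T2 -> R) :
  (forall b, measurable_fun setT (fun p => part b (f p.1 p.2))) ->
  m1.-integrable setT (EFin \o A) -> m2.-integrable setT (EFin \o B) ->
  (forall x y, cabs (f x y) <= A x * B y) ->
  cintg m1 (fun x => cintg m2 (f x)) = cintg m2 (fun y => cintg m1 (f^~ y)).
Proof.
move=> mf iA iB h; apply: complex_eqP => b; rewrite !part_cintg.
transitivity (\int[m1]_x \int[m2]_y part b (f x y)).
  by apply: eq_Rintegral => x _; rewrite part_cintg.
rewrite (Rintegral_fubini_dom (mf b) iA iB).
  by apply: eq_Rintegral => x _; rewrite part_cintg.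
by move=> x y; apply: le_trans (part_cabs b _) (h x y).
Qed.

End complex_fubini.

Section complex_schwartz.
Context (R : realType) (d : nat).
Local Notation Rd := 'rV[R]_d.
Local Notation mu := (@leb R d).
Implicit Types (g k f : Rd -> R[i]) (u x xi : Rd) (t : R).

(** Schwartz functions through their real and imaginary parts, so that the real
    theory applies to each part. *)
Definition csch g := forall b, rsch (fun x => part b (g x)).

Lemma cpderiv_part b s g x : part b (cpderiv s g x) = pderiv s (fun x => part b (g x)) x.
Proof. by case: b. Qed.

Lemma schwartz_csch g : schwartz g -> csch g.
Proof.
move=> [sg hg] b; split=> [s x|s M].
  by have [h1 h2] := sg s x; case: b.
have := hg (maxn (size s) M).
have : (0 <= schwartz_seminorm (maxn (size s) M) g)%E.
  apply: le_trans (ereal_sup_ubound _); last by exists [::], 0; split.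
  by rewrite lee_fin mulr_ge0 ?cabs_ge0// exprn_ge0 ?brk_ge0.
case E : schwartz_seminorm => [C| |]// _ _.
exists C => x; rewrite -lee_fin -E.
apply: le_trans (ereal_sup_ubound _); last first.
  by exists s, x; split; [exact: leq_maxl|].
rewrite lee_fin mulrC -cpderiv_part ler_pM ?exprn_ge0 ?brk_ge0 ?part_cabs//.
by apply: brkX_le; exact: leq_maxr.
Qed.

Lemma csch_schwartz g : csch g -> schwartz g.
Proof.
move=> hg; split=> [s x|N].
  by split; [exact: (hg true).1|exact: (hg false).1].
have [C1 C10 h1] := rsch_bound N N (hg true).
have [C2 C20 h2] := rsch_bound N N (hg false).
apply: (@le_lt_trans _ _ (C1 + C2)%:E); last exact: ltry.
apply: ub_ereal_sup => _ [s [x [sN ->]]]; rewrite lee_fin mulrC.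
apply: (@le_trans _ _ ((`|part true (cpderiv s g x)| + `|part false (cpderiv s g x)|) * brk x ^+ N)).
  by rewrite ler_wpM2r ?exprn_ge0 ?brk_ge0// cabs_parts.
by rewrite mulrDl lerD// cpderiv_part; [exact: h1|exact: h2].
Qed.

Lemma cschD g k : csch g -> csch k -> csch (fun x => g x + k x).
Proof.
move=> hg hk b; rewrite (_ : (fun x => _) = (fun x => part b (g x) + part b (k x))).
  exact: rschD.
by apply/funext => x; rewrite partD.
Qed.

Lemma cschZ c g : csch g -> csch (fun x => c * g x).
Proof.
move=> hg b.
have -> : (fun x => part b (c * g x)) = (fun x => complex.Re c * part b (g x) +
   (if b then - complex.Im c else complex.Im c) * part (~~ b) (g x)).
  by apply/funext => x; rewrite partM; case: b.
by apply: rschD; apply: rschZ.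
Qed.

Lemma csch_affine g (a : R) (b : Rd) : a != 0 -> csch g -> csch (fun x => g (a *: x + b)).
Proof. by move=> a0 hg c; apply: (rsch_affine b a0 (hg c)). Qed.

Lemma csch_translate g y : csch g -> csch (fun u => g (u - y)).
Proof.
move=> hg; have := csch_affine (- y) (oner_neq0 R) hg.
by under [X in csch X]eq_fun do rewrite scale1r.
Qed.

Lemma csch_reflect g y : csch g -> csch (fun u => g (y - u)).
Proof.
move=> hg; have n10 : (-1 : R) != 0 by rewrite oppr_eq0 oner_neq0.
have := csch_affine y n10 hg.
by under [X in csch X]eq_fun do rewrite scaleN1r addrC.
Qed.

Lemma csch_cinteg g : csch g -> cinteg mu g.
Proof.
move=> hg b; have [C C0 hC] := rsch_bound (2 * d) 0 (hg b).
by apply: (@rint_dom _ _ _ C); [exact: rsch_measurable|move=> x; exact: (hC [::])].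
Qed.

Lemma csch_measurable g b : csch g -> measurable_fun setT ((fun x => part b (g x)) : Rd -> measurableTypeR R).
Proof. by move=> hg; exact: rsch_measurable. Qed.

Lemma csch_bound g M n : csch g -> exists2 C, 0 <= C &
  forall b s x, (size s <= n)%N -> `|pderiv s (fun x => part b (g x)) x| * brk x ^+ M <= C.
Proof.
move=> hg.
have [C1 C10 h1] := rsch_bound M n (hg true).
have [C2 C20 h2] := rsch_bound M n (hg false).
exists (C1 + C2); first exact: addr_ge0.
move=> [] s x sn; first by rewrite (le_trans (h1 _ _ sn))// lerDl.
by rewrite (le_trans (h2 _ _ sn))// lerDr.
Qed.

Lemma csch_cabs g M : csch g -> exists2 C, 0 <= C & forall x, cabs (g x) * brk x ^+ M <= C.
Proof.
move=> hg; have [C C0 hC] := csch_bound M 0 hg.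
exists (2 * C) => [|x]; first exact: mulr_ge0.
rewrite -ler_pdivlMr ?brkX_gt0// -mulrA; apply: cabs_parts_le => b.
by rewrite ler_pdivlMr ?brkX_gt0//; exact: (hC b [::]).
Qed.

Definition cmol g k t u : R[i] := cintg mu (fun z => g (u - t *: z) * k z).

Lemma rint_partmol b c g k t u : csch g -> csch k ->
  rint (fun z => part b (g (u - t *: z)) * part c (k z)).
Proof. by move=> hg hk; exact: (rint_mol t u (hg b) (hk c)). Qed.

Lemma cinteg_mol g k t u : csch g -> csch k -> cinteg mu (fun z => g (u - t *: z) * k z).
Proof.
move=> hg hk b.
have -> : (fun z => part b (g (u - t *: z) * k z)) =
  (fun z => part true (g (u - t *: z)) * part b (k z) +
   (if b then - 1 else 1) * (part false (g (u - t *: z)) * part (~~ b) (k z))).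
  by apply/funext => z; rewrite partM; case: b; rewrite ?mulN1r ?mul1r ?mulNr.
by apply: rintD; [|apply: rintZ]; exact: rint_partmol.
Qed.

Lemma part_cmol b g k t u : csch g -> csch k -> part b (cmol g k t u) =
  mol (fun x => part true (g x)) (fun x => part b (k x)) t u +
  (if b then - 1 else 1) * mol (fun x => part false (g x)) (fun x => part (~~ b) (k x)) t u.
Proof.
move=> hg hk; rewrite part_cintg /mol.
transitivity (\int[mu]_z (part true (g (u - t *: z)) * part b (k z) +
   (if b then - 1 else 1) * (part false (g (u - t *: z)) * part (~~ b) (k z)))).
  by apply: eq_Rintegral => z _; rewrite partM; case: b; rewrite ?mulN1r ?mul1r ?mulNr.
rewrite RintegralD//; [|exact: rint_partmol|apply: rintZ; exact: rint_partmol].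
by rewrite RintegralZl//; exact: rint_partmol.
Qed.

Lemma csch_mol g k t : `|t| <= 1 -> csch g -> csch k -> csch (cmol g k t).
Proof.
move=> t1 hg hk b; under eq_fun do rewrite part_cmol//.
by apply: rschD; [|apply: rschZ]; exact: rsch_mol.
Qed.

Lemma pderiv_cmol s b g k t : `|t| <= 1 -> csch g -> csch k ->
  pderiv s (fun u => part b (cmol g k t u)) = (fun u =>
  mol (pderiv s (fun x => part true (g x))) (fun x => part b (k x)) t u +
  (if b then - 1 else 1) *
    mol (pderiv s (fun x => part false (g x))) (fun x => part (~~ b) (k x)) t u).
Proof.
move=> t1 hg hk.
rewrite (_ : (fun u => _) = (fun u => (if b then - 1 else 1) *
   mol (fun x => part false (g x)) (fun x => part (~~ b) (k x)) t u +
   mol (fun x => part true (g x)) (fun x => part b (k x)) t u)); last first.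
  by apply/funext => u; rewrite part_cmol// addrC.
rewrite pderiv_linear ?mol_pderiv//; first by apply/funext => u; rewrite addrC.
  by apply: rsch_smooth; exact: rsch_mol.
by apply: rsch_smooth; exact: rsch_mol.
Qed.

Definition ccancel k := forall b, cancellative (fun x => part b (k x)).


End complex_schwartz.

(** * Fourier transforms of convolutions and dilates *)

Section fourier_theory.
Context (R : realType) (d : nat).
Local Notation Rd := 'rV[R]_d.
Local Notation mu := (@leb R d).
Implicit Types (g k f : Rd -> R[i]) (u x xi : Rd) (t : R).

Definition fcst : R := (2 * pi) `^ (- (d%:R / 2)).

Lemma fcst_gt0 : 0 < fcst.
Proof. by rewrite powR_gt0// mulr_gt0// pi_gt0. Qed.

Lemma fcst_neq0 : (fcst%:C)%C != 0 :> R[i].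
Proof. by rewrite eq_complex /= negb_and gt_eqF ?fcst_gt0. Qed.

Definition char xi x : R[i] := cis (- dotp x xi).

Lemma fourierE f xi : fourier f xi = (fcst%:C)%C * cintg mu (fun x => char xi x * f x).
Proof. by []. Qed.

Lemma measurable_char b xi : measurable_fun setT ((fun x => part b (char xi x)) : Rd -> measurableTypeR R).
Proof.
case: b; rewrite /part /char /=.
  by under eq_fun do rewrite cosN dotpC; exact: measurable_cos_dotp.
under eq_fun do rewrite sinN dotpC.
by apply: measurable_funN; exact: measurable_sin_dotp.
Qed.

Lemma cabs_cis (s : R) : cabs (cis s) = 1.
Proof. by rewrite /cabs /= cos2Dsin2 sqrtr1. Qed.

Lemma charD xi x y : char xi (x + y) = char xi x * char xi y.
Proof. by rewrite /char dotpDl opprD cisD. Qed.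

Lemma char_Zl xi t x : char xi (t *: x) = char (t *: xi) x.
Proof. by rewrite /char dotpZl [in RHS]dotpC dotpZl dotpC. Qed.

Lemma rintMb (h b : Rd -> R) : rint h -> measurable_fun setT (b : Rd -> measurableTypeR R) ->
  (forall x, `|b x| <= 1) -> rint (fun x => b x * h x).
Proof.
move=> hi mb b1; have := rintM_bounded hi mb b1.
by congr rint; apply/funext => x; rewrite mulrC.
Qed.

Lemma cinteg_char f xi : cinteg mu f -> cinteg mu (fun x => char xi x * f x).
Proof.
move=> hf b.
have -> : (fun x => part b (char xi x * f x)) =
  (fun z => part true (char xi z) * part b (f z) +
   (if b then - 1 else 1) * (part false (char xi z) * part (~~ b) (f z))).
  by apply/funext => z; rewrite partM; case: b; rewrite ?mulN1r ?mul1r ?mulNr.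
have c1 c x : `|part c (char xi x)| <= 1 by rewrite -(cabs_cis (- dotp x xi)) part_cabs.
by apply: rintD; [|apply: rintZ]; apply: rintMb => //; (exact: hf || exact: measurable_char).
Qed.

Lemma fourierD f g xi : cinteg mu f -> cinteg mu g ->
  fourier (fun x => f x + g x) xi = fourier f xi + fourier g xi.
Proof.
move=> hf hg; rewrite !fourierE -mulrDr -cintgD; [|exact: cinteg_char|exact: cinteg_char].
by congr (_ * _); apply: eq_cintg => x; rewrite mulrDr.
Qed.

Lemma fourierZ (c : R[i]) f xi : cinteg mu f -> fourier (fun x => c * f x) xi = c * fourier f xi.
Proof.
move=> hf; rewrite !fourierE [RHS]mulrCA -[X in _ = _ * X]cintgZ; last exact: cinteg_char.
by congr (_ * _); apply: eq_cintg => x; rewrite mulrCA.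
Qed.

Lemma cintg_affine f (a : R) (b : Rd) : a != 0 -> cinteg mu f ->
  cintg mu (fun x => f (a *: x + b)) = ((`|a| ^- d)%:C)%C * cintg mu f.
Proof.
move=> a0 hf; apply: complex_eqP => c; rewrite part_realM !part_cintg.
exact: (Rintegral_affine b a0 (hf c)).
Qed.

Lemma cintg_translate f (b : Rd) : cinteg mu f -> cintg mu (fun x => f (x + b)) = cintg mu f.
Proof.
move=> hf; have := cintg_affine b (oner_neq0 R) hf.
rewrite normr1 expr1n invr1 mul1r => <-; apply: eq_cintg => x.
by rewrite scale1r.
Qed.

(** Replacing xi by - xi separates the contributions of the real and the imaginary
    part, and the real case applies to each. *)
Lemma fourier_eq0 f (C : R) : (forall b, continuous (fun x => part b (f x))) ->
  (forall x, cabs (f x) <= C) -> cinteg mu f -> fourier f =1 (fun=> 0) ->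
  forall x, f x = 0.
Proof.
move=> cf hC hf f0.
have z0 xi : cintg mu (fun x => char xi x * f x) = 0.
  by have /eqP := f0 xi; rewrite fourierE mulf_eq0 (negbTE fcst_neq0)/= => /eqP.
have ic b xi : rint (fun x => part b (f x) * cos (dotp xi x)).
  by apply: rintM_bounded; [exact: hf|exact: measurable_cos_dotp|move=> x; exact: cos_max].
have is_ b xi : rint (fun x => part b (f x) * sin (dotp xi x)).
  by apply: rintM_bounded; [exact: hf|exact: measurable_sin_dotp|move=> x; exact: sin_max].
pose Ic b xi := \int[mu]_x (part b (f x) * cos (dotp xi x)).
pose Is b xi := \int[mu]_x (part b (f x) * sin (dotp xi x)).
have Re0 xi : Ic true xi + Is false xi = 0.
  rewrite /Ic /Is -RintegralD//; [|exact: ic|exact: is_].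
  have := congr1 (part true) (z0 xi); rewrite part_cintg part0 => <-.
  apply: eq_Rintegral => x _; rewrite partM /part /char /= cosN sinN (dotpC x); ring.
have Im0 xi : Ic false xi - Is true xi = 0.
  rewrite /Ic /Is -RintegralB//; [|exact: ic|exact: is_].
  have := congr1 (part false) (z0 xi); rewrite part_cintg part0 => <-.
  apply: eq_Rintegral => x _; rewrite partM /part /char /= cosN sinN (dotpC x); ring.
have IcN b xi : Ic b (- xi) = Ic b xi.
  by apply: eq_Rintegral => x _; rewrite dotpNl cosN.
have IsN b xi : Is b (- xi) = - Is b xi.
  rewrite /Is -[RHS]mulN1r -RintegralZl//; last exact: is_.
  by apply: eq_Rintegral => x _; rewrite dotpNl sinN; ring.
have z b : trig_null (fun x => part b (f x)).
  split; first exact: hf.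
  move=> xi; have := Re0 xi; have := Im0 xi; have := Re0 (- xi); have := Im0 (- xi).
  rewrite !IcN !IsN -/(Ic b xi) -/(Is b xi) => h1 h2 h3 h4.
  by case: b; split; lra.
move=> x; apply: complex_eqP => b; rewrite part0.
apply: (trig_null_eq0 (C := C) (cf b) _ (z b)) => y.
exact: le_trans (part_cabs b _) (hC y).
Qed.

(** The bridge by which every convolution identity below is verified on the
    Fourier side, where convolutions and dilations become products and rescalings. *)
Lemma fourier_inj f g : csch f -> csch g -> fourier f =1 fourier g -> f = g.
Proof.
move=> hf hg E; apply/funext => x; apply/eqP; rewrite -subr_eq0; apply/eqP.
have hN : csch (fun x => -1 * g x) := cschZ (-1) hg.
have hD : csch (fun x => f x + -1 * g x) := cschD hf hN.
have [C C0 hC] := csch_cabs 0 hD.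
rewrite -mulN1r; apply: (fourier_eq0 (C := C) (f := fun x => f x + -1 * g x)).
- by move=> b; apply: rsch_continuous; exact: hD.
- by move=> y; have := hC y; rewrite expr0 mulr1.
- exact: csch_cinteg.
- move=> xi; rewrite fourierD; [|exact: csch_cinteg|exact: csch_cinteg].
  by rewrite fourierZ ?E ?mulN1r ?subrr//; exact: csch_cinteg.
Qed.

Lemma measurable_partM dT (T : measurableType dT) (F G : T -> R[i]) b :
  (forall b, measurable_fun setT ((fun y : T => part b (F y)) : T -> measurableTypeR R)) ->
  (forall b, measurable_fun setT ((fun y : T => part b (G y)) : T -> measurableTypeR R)) ->
  measurable_fun setT ((fun y : T => part b (F y * G y)) : T -> measurableTypeR R).
Proof.
move=> mF mG; rewrite (_ : (fun y => _) = (fun z => part true (F z) * part b (G z) +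
   (if b then - 1 else 1) * (part false (F z) * part (~~ b) (G z)))).
  apply: measurable_funD; first by apply: measurable_funM; [exact: mF|exact: mG].
  by apply: measurable_funM => //; apply: measurable_funM; [exact: mF|exact: mG].
by apply/funext => z; rewrite partM; case: b; rewrite ?mulN1r ?mul1r ?mulNr.
Qed.

(** The convolution theorem. *)
Lemma fourier_cmol g k t xi : `|t| <= 1 -> csch g -> csch k ->
  fourier (cmol g k t) xi = ((fcst^-1)%:C)%C * fourier g xi * fourier k (t *: xi).
Proof.
move=> t1 hg hk.
have [A A0 hA] := csch_cabs (2 * d) hg.
have [B B0 hB] := csch_cabs (2 * d + 2 * d) hk.
have gi := csch_cinteg hg; have ki := csch_cinteg hk.
have -> : fourier (cmol g k t) xi = (fcst%:C)%C * (cintg mu (fun x => char xi x * g x) *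
    cintg mu (fun z => char (t *: xi) z * k z)).
  rewrite fourierE; congr (_ * _).
  transitivity (cintg mu (fun u => cintg mu (fun z => char xi u * (g (u - t *: z) * k z)))).
    by apply: eq_cintg => u; rewrite cintgZ//; exact: cinteg_mol.
  rewrite (@cintg_fubini_dom _ _ _ _ _ mu mu _ (fun u => A * brk u ^- (2 * d))
     (fun z => B * brk z ^- (2 * d))).
  - rewrite -cintgZ; last exact: cinteg_char.
    apply: eq_cintg => z.
    transitivity (cintg mu (fun u => (char xi (t *: z) * k z) *
       (char xi (u + (- (t *: z))) * g (u + (- (t *: z)))))).
      apply: eq_cintg => u.
      have -> : char xi u = char xi (u - t *: z) * char xi (t *: z) by rewrite -charD subrK.
      ring.
    rewrite cintgZ; last first.
      by move=> b; have := rint_affine (- (t *: z)) (oner_neq0 R) (cinteg_char xi gi b);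
        under [X in rint X]eq_fun do rewrite scale1r.
    rewrite (cintg_translate (f := fun x => char xi x * g x)); last exact: cinteg_char.
    by rewrite char_Zl mulrC.
  - move=> b; apply: measurable_partM => c.
      exact: (measurableT_comp (measurable_char c xi) measurable_fst).
    apply: measurable_partM => e.
      apply: (measurableT_comp (csch_measurable e hg)).
      by apply: measurable_subZ => //.
    exact: (measurableT_comp (csch_measurable e hk) measurable_snd).
  - by apply: rintZ; exact: rint_brkV.
  - by apply: rintZ; exact: rint_brkV.
  - move=> u z; rewrite !cabsM cabs_cis mul1r.
    apply: (@le_trans _ _ (A * brk (u - t *: z) ^- (2 * d) * (B * brk z ^- (2 * d + 2 * d)))).
      by apply: ler_pM; rewrite ?cabs_ge0// ler_pdivlMr ?brkX_gt0.
    rewrite mulrACA [leRHS]mulrACA ler_wpM2l ?mulr_ge0//.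
    rewrite -!invfM lef_pV2 ?posrE ?mulr_gt0 ?brkX_gt0// exprD mulrA.
    by rewrite ler_wpM2r ?exprn_ge0 ?brk_ge0// brkZ_sub.
rewrite !fourierE; have := fcst_neq0.
rewrite (_ : ((fcst^-1)%:C)%C = ((fcst%:C)%C)^-1); last by rewrite fmorphV.
by move: (fcst%:C)%C => c c0; rewrite (mulrA c^-1) mulVf// mul1r [RHS]mulrCA.
Qed.

(** [L^1]-normalised dilation. *)
Definition dil g t u : R[i] := ((t ^- d)%:C)%C * g (t^-1 *: u).

Lemma csch_dil g t : t != 0 -> csch g -> csch (dil g t).
Proof.
move=> t0 hg; apply: cschZ.
have := csch_affine 0 (invr_neq0 t0) hg.
by under [X in csch X]eq_fun do rewrite addr0.
Qed.

Lemma fourier_dil g t xi : 0 < t -> csch g -> fourier (dil g t) xi = fourier g (t *: xi).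
Proof.
move=> t0 hg; have tn0 : t != 0 by rewrite gt_eqF.
have hgi : cinteg mu (fun u => g (t^-1 *: u)).
  apply: csch_cinteg; have := csch_affine 0 (invr_neq0 tn0) hg.
  by under [X in csch X]eq_fun do rewrite addr0.
rewrite fourierZ// !fourierE mulrCA; congr (_ * _).
have E x : char xi x * g (t^-1 *: x) = (fun y => char (t *: xi) y * g y) (t^-1 *: x + 0).
  by rewrite addr0 /= -char_Zl scalerA divff// scale1r.
rewrite (eq_cintg _ E) (cintg_affine (f := fun y => char (t *: xi) y * g y) 0 (invr_neq0 tn0)); last by apply: cinteg_char; exact: csch_cinteg.
rewrite mulrA -rmorphM/= normfV gtr0_norm// exprVn invrK mulVf ?mul1r//.
by rewrite expf_neq0.
Qed.

End fourier_theory.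

(** * Tempered functionals under the integral sign *)

Lemma ge0_le_lower_integral dT (T : measurableType dT) (R : realType)
    (m : {measure set T -> \bar R}) (D : set T) (f h : T -> \bar R) :
  (forall x, D x -> (0 <= f x)%E) -> (forall x, D x -> (f x <= h x)%E) ->
  (\int[m]_(x in D) f x <= \int[m]_(x in D) h x)%E.
Proof.
move=> f0 fh; have h0 x : D x -> (0 <= h x)%E by move=> Dx; apply: le_trans (f0 _ Dx) (fh _ Dx).
rewrite !ge0_integralE//; apply: le_ereal_sup => _ [g /= gf <-].
exists g => //= x; apply: le_trans (gf x) _.
by rewrite !patchE; case: ifPn => // /set_mem Dx; exact: fh.
Qed.

Section tempered.
Context (R : realType) (d : nat).
Local Notation Rd := 'rV[R]_d.
Implicit Types (g h : Rd -> R[i]) (F : (Rd -> R[i]) -> R[i]).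

Definition seminorm_le (N : nat) (A : R) g := forall b s x, (size s <= N)%N ->
  `|pderiv s (fun x => part b (g x)) x| * brk x ^+ N <= A.

(** The functionals that tempered distributions induce on functions with real
    and imaginary parts in [rsch]. *)
Record tempered F := {
  tempered_lin : forall c g h, csch g -> csch h -> F (fun x => c * g x + h x) = c * F g + F h;
  tempered_bd : exists N K, 0 <= K /\ forall g A, csch g -> seminorm_le N A g -> cabs (F g) <= K * A }.

Lemma csch0 : csch (fun _ : Rd => 0 : R[i]).
Proof. by move=> b; under eq_fun do rewrite part0; exact: rsch0. Qed.

Lemma tempered0 F : tempered F -> F (fun=> 0) = 0.
Proof.
move=> tF; have := tempered_lin tF (-1) csch0 csch0.
rewrite (_ : (fun x => _) = (fun=> 0)); last by apply/funext => x; rewrite mulr0 addr0.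
by rewrite mulN1r addNr.
Qed.

Lemma temperedZ F c g : tempered F -> csch g -> F (fun x => c * g x) = c * F g.
Proof.
move=> tF hg; have := tempered_lin tF c hg csch0.
rewrite tempered0// addr0 => <-; congr F; apply/funext => x.
by rewrite addr0.
Qed.

Lemma csch_sum n (c : nat -> R[i]) (g : nat -> Rd -> R[i]) : (forall i, csch (g i)) ->
  csch (fun x => \sum_(i < n) c i * g i x).
Proof.
move=> hg; elim: n => [|n ih].
  by under [X in csch X]eq_fun do rewrite big_ord0; exact: csch0.
by under [X in csch X]eq_fun do rewrite big_ord_recr; apply: cschD => //; exact: cschZ.
Qed.

Lemma tempered_sum F n (c : nat -> R[i]) (g : nat -> Rd -> R[i]) : tempered F ->
  (forall i, csch (g i)) ->
  F (fun x => \sum_(i < n) c i * g i x) = \sum_(i < n) c i * F (g i).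
Proof.
move=> tF hg; elim: n => [|n ih].
  by under [X in F X]eq_fun do rewrite big_ord0; rewrite big_ord0 tempered0.
under [X in F X]eq_fun do rewrite big_ord_recr /= addrC.
by rewrite (tempered_lin tF)//; [rewrite ih big_ord_recr addrC|exact: csch_sum].
Qed.

Lemma pderiv_part_sum s b n (c : nat -> R) (g : nat -> Rd -> R[i]) : (forall i, csch (g i)) ->
  pderiv s (fun x => part b (\sum_(i < n) ((c i)%:C)%C * g i x)) =
  fun x => \sum_(i < n) c i * pderiv s (fun x => part b (g i x)) x.
Proof.
move=> hg; elim: n => [|n ih].
  under eq_fun do rewrite big_ord0 part0; rewrite pderiv0.
  by apply/funext => x; rewrite big_ord0.
have -> : (fun x => part b (\sum_(i < n.+1) ((c i)%:C)%C * g i x)) =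
   (fun x => c n * part b (g n x) + part b (\sum_(i < n) ((c i)%:C)%C * g i x)).
  by apply/funext => x; rewrite big_ord_recr partD part_realM addrC.
rewrite pderiv_linear ?ih.
- by apply/funext => x; rewrite big_ord_recr addrC.
- by apply: rsch_smooth; exact: hg.
- by apply: rsch_smooth; exact: (csch_sum n (fun i => ((c i)%:C)%C) hg b).
Qed.

End tempered.

Section bochner.
Context (R : realType) (d : nat) dT (T : measurableType dT) (m : {measure set T -> \bar R}).
Local Notation Rd := 'rV[R]_d.
Variables (D : set T) (mD : measurable D) (F : (Rd -> R[i]) -> R[i]).
Variables (G : T -> Rd -> R[i]) (GI : Rd -> R[i]) (rho : T -> R).
Hypothesis tF : tempered F.
Hypothesis cI : csch GI.
Hypothesis cG : forall y, D y -> csch (G y).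
Hypothesis rho_int : m.-integrable D (EFin \o rho).

(** A countable cover by sets of finite measure on which [G] oscillates little
    compared with [rho], in all seminorms of order [N]. *)
Definition small_oscillation (N : nat) := forall eta, 0 < eta -> exists A : nat -> set T,
  [/\ forall i, measurable (A i), D `<=` \bigcup_i A i, forall i, (m (A i) < +oo)%E &
    forall i y z, A i y -> A i z -> D y -> D z -> forall b s x, (size s <= N)%N ->
    `|pderiv s (fun x => part b (G y x)) x - pderiv s (fun x => part b (G z x)) x| * brk x ^+ N
      <= eta * rho y].

Hypothesis int_D : forall b s x, m.-integrable D (EFin \o (fun y => pderiv s (fun x => part b (G y x)) x)) /\
  pderiv s (fun x => part b (GI x)) x = \int[m]_(y in D) pderiv s (fun x => part b (G y x)) x.
Hypothesis G_rho : forall N, exists2 C, 0 <= C & forall y, D y -> seminorm_le N (C * rho y) (G y).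
Hypothesis osc : forall N, small_oscillation N.

Lemma near_min (B : set T) (f : T -> R) (delta : R) : 0 < delta -> (forall y, 0 <= f y) ->
  B !=set0 -> exists2 y, B y & forall z, B z -> f y <= f z + delta.
Proof.
move=> d0 f0 [y0 By0].
have hi : has_inf (f @` B) by split; [exists (f y0), y0|exists 0 => _ [y _ <-]].
have [_ [y By <-] hy] := inf_adherent d0 hi.
exists y => // z Bz; apply: ltW; apply: lt_le_trans hy _; rewrite lerD2r.
by apply: ge_inf; [exact: hi.2|exists z].
Qed.

(** Riemann sums with sample points where [cabs (F (G _))] is almost minimal in the
    cell: they approximate [GI] in every seminorm, and stay below the integral. *)
Lemma tempered_le_integral : ((cabs (F GI))%:E <= \int[m]_(y in D) (cabs (F (G y)))%:E)%E.
Proof.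
have [N [K [K0 hK]]] := tempered_bd tF.
have [C C0 hC] := G_rho N.
have rho0 y : D y -> 0 <= C * rho y.
  by move=> Dy; have := hC y Dy true [::] 0 isT; apply: le_trans; rewrite mulr_ge0// exprn_ge0 ?brk_ge0.
apply/lee_addgt0Pr => eps eps0.
pose J := \int[m]_(y in D) `|rho y|.
have J0 : 0 <= J by apply: Rintegral_ge0.
(* One half of [eps] is spent on the oscillation in the cells and on the cells left
   out, the other half, through [delta] below, on the choice of the samples. *)
pose eta := eps / (2 * (K + 1) * (J + C + 1)).
have eta0 : 0 < eta by rewrite divr_gt0// !mulr_gt0// ltr_wpDl// addr_ge0.
have [A [mA DA fA oA]] := osc N eta0.
pose B i := seqDU A i `&` D.
have mB i : measurable (B i).
  apply: measurableI => //; apply: measurableD => //.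
  by apply: bigsetU_measurable.
have BD i : B i `<=` D by move=> y [].
have BA i : B i `<=` A i by move=> y [[]].
have fB i : (m (B i) < +oo)%E.
  by apply: le_lt_trans (fA i); apply: le_measure; rewrite ?inE//; exact: BA.
have DB y : D y -> exists i, B i y.
  move=> Dy; have := DA _ Dy; rewrite seqDU_bigcup_eq => -[i _ hi].
  by exists i.
have dB i j y : B i y -> B j y -> i = j.
  move=> [hi _] [hj _]; have := trivIset_seqDU A => /trivIsetP /(_ i j I I).
  by have [//|ij] := eqVneq i j; move=> /(_ isT) /seteqP[/(_ y (conj hi hj))].
have [n hn] : exists n, \int[m]_(y in D) (\1_(~` \bigcup_(i < n) B i) y * `|rho y|) <= eta.
  pose f_ (n : nat) y : \bar R := (\1_(~` \bigcup_(i < n) B i) y * `|rho y|)%:E.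
  have mU (n : nat) : measurable (~` \bigcup_(i < n) B i).
    by apply: measurableC; apply: bigcup_measurable.
  have mrho : measurable_fun D rho by apply/measurable_EFinP; exact: measurable_int rho_int.
  have one01 (n : nat) y : 0 <= (\1_(~` \bigcup_(i < n) B i) y : R) <= 1.
    by rewrite indicE; case: (_ \in _) => /=; rewrite ?lexx ?ler01.
  have [||||_ _ Z] := @dominated_convergence _ _ _ m D mD f_ (fun=> 0%E)
      (fun y => (`|rho y|)%:E) _ _ _ (integrable_norm rho_int).
  - move=> n; apply/measurable_EFinP; apply: measurable_funM.
      by apply: measurable_funTS; exact: measurable_indic.
    exact: measurableT_comp.
  - exact: measurable_cst.
  - apply: nearW => y Dy; have [i Biy] := DB _ Dy.
    apply: cvg_near_cst; near=> n; rewrite /f_ indicE memNset ?mul0r//= => -[].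
    by exists i => //=; near: n; exact: nbhs_infty_gt.
  - apply: nearW => y n Dy; rewrite /f_ lee_fin normrM normr_id.
    by have /andP[h0 h1] := one01 n y; rewrite ger0_norm// ler_piMl.
  move: Z; rewrite integral0 => /fine_cvgP[_ /cvgr_dist_le/(_ _ eta0)[n _ /(_ n (leqnn n))]].
  rewrite sub0r normrN /= => hn; exists n; apply: le_trans hn; exact: ler_norm.
pose c i := fine (m (B i)).
have c0 i : 0 <= c i by rewrite fine_ge0.
pose delta := eps / (2 * (\sum_(i < n) c i + 1)).
have delta0 : 0 < delta by rewrite divr_gt0// mulr_gt0// ltr_wpDl// sumr_ge0.
have gP i : exists g, [/\ csch g, forall y, B i y -> cabs (F g) <= cabs (F (G y)) + delta &
   forall y, B i y -> forall b s x, (size s <= N)%N ->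
    `|pderiv s (fun x => part b (G y x)) x - pderiv s (fun x => part b (g x)) x| * brk x ^+ N
      <= eta * rho y].
  have [Bi0|Bi0] := pselect (B i !=set0); last first.
    exists (fun=> 0); split=> [|y By|y By]; first exact: csch0.
      by exfalso; apply: Bi0; exists y.
    by exfalso; apply: Bi0; exists y.
  have [y By hy] := near_min delta0 (fun y => cabs_ge0 (F (G y))) Bi0.
  exists (G y); split=> [||z Bz b s x sN]; [exact/cG/(BD i)|exact: hy|].
  by apply: (oA i z y) => //; [exact: BA|exact: BA|exact: (BD i)|exact: (BD i)].
pose g i := projT1 (cid (gP i)).
have cg i : csch (g i) by have [] := projT2 (cid (gP i)).
have gF i y : B i y -> cabs (F (g i)) <= cabs (F (G y)) + delta.
  by have [_ + _] := projT2 (cid (gP i)); apply.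
have gG i y : B i y -> forall b s x, (size s <= N)%N ->
    `|pderiv s (fun x => part b (G y x)) x - pderiv s (fun x => part b (g i x)) x| * brk x ^+ N
      <= eta * rho y.
  by have [_ _] := projT2 (cid (gP i)); apply.
pose S x := \sum_(i < n) ((c i)%:C)%C * g i x.
have cS : csch S := csch_sum n (fun i => ((c i)%:C)%C) cg.
have FI : F GI = F (fun x => -1 * S x + GI x) + F S.
  by rewrite (tempered_lin tF)//; rewrite mulN1r addrAC addNr add0r.
have step b s x (y : T) : D y -> (size s <= N)%N ->
  `|pderiv s (fun x => part b (G y x)) x -
    \sum_(i < n) \1_(B i) y * pderiv s (fun x => part b (g i x)) x| * brk x ^+ N <=
  eta * `|rho y| + C * (\1_(~` \bigcup_(i < n) B i) y * `|rho y|).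
  move=> Dy sN; have [i Biy] := DB _ Dy.
  have oneB j : \1_(B j) y = (j == i)%:R :> R.
    rewrite indicE; have [->|ji] := eqVneq j i; first by rewrite mem_set.
    by rewrite memNset// => Bjy; move: ji; rewrite (dB _ _ _ Bjy Biy) eqxx.
  have [ilt|nlt] := ltnP i n.
    rewrite (bigD1 (Ordinal ilt))//= oneB eqxx mul1r big1 ?addr0 => [|j ji]; last first.
      by rewrite oneB (_ : (nat_of_ord j == i) = false) ?mul0r//; apply/negbTE.
    apply: le_trans (gG _ _ Biy _ _ _ sN) _.
    apply: (@le_trans _ _ (eta * `|rho y|)).
      by apply: ler_wpM2l; [exact: ltW|exact: ler_norm].
    by rewrite lerDl mulr_ge0// mulr_ge0.
  rewrite big1 ?subr0 => [|j _]; last first.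
    rewrite oneB (_ : (nat_of_ord j == i) = false) ?mul0r//; apply/negbTE.
    by rewrite neq_ltn (leq_trans (ltn_ord j) nlt).
  have -> : \1_(~` \bigcup_(i < n) B i) y = 1 :> R.
    rewrite indicE mem_set//= => -[j /= jn Bjy].
    by move: nlt; rewrite -(dB _ _ _ Bjy Biy) leqNgt jn.
  rewrite mul1r; apply: le_trans (hC y Dy b s x sN) _.
  apply: (@le_trans _ _ (C * `|rho y|)); first by rewrite ler_wpM2l// ler_norm.
  by rewrite lerDr mulr_ge0// ltW.
have E1 : cabs (F (fun x => -1 * S x + GI x)) <= eps / 2.
  apply: (@le_trans _ _ (K * (eta * J + C * eta))); last first.
    rewrite mulrC (mulrC C) -mulrDr /eta.
    set q := J + C; have q0 : 0 <= q by rewrite addr_ge0.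
    rewrite (_ : _ * q * K = eps / 2 * ((q / (q + 1)) * (K / (K + 1)))); last first.
      by field; rewrite !gt_eqF//; rewrite ltr_wpDl.
    have frac1 (a : R) : 0 <= a -> 0 <= a / (a + 1) <= 1.
      by move=> a0; rewrite divr_ge0 ?addr_ge0//= ler_pdivrMr ?ltr_wpDl// mul1r lerDl.
    have /andP[q1 q2] := frac1 _ q0; have /andP[k1 k2] := frac1 _ K0.
    apply: ler_piMr; first by rewrite divr_ge0 ?ltW.
    exact: mulr_ile1.
  apply: hK.
    exact: (cschD (cschZ (-1) cS) cI).
  move=> b s x sN.
  have iS i : m.-integrable D (EFin \o (fun y => \1_(B i) y * pderiv s (fun x => part b (g i x)) x)).
    rewrite (_ : _ \o _ = (fun y => (EFin \o \1_(B i)) y * (pderiv s (fun x => part b (g i x)) x)%:E)%E); last first.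
      by apply/funext => y; rewrite /= EFinM.
    apply: integrableZr => //; apply/integrableP; split.
      by apply/measurable_EFinP; apply: measurable_funTS; exact: measurable_indic.
    rewrite (eq_integral (fun y => (\1_(B i) y)%:E)) => [|y _]; last by rewrite /= ger0_norm.
    by rewrite integral_indic//; apply: le_lt_trans (fB i); apply: le_measure; rewrite ?inE//; exact: measurableI.
  have EB i : c i * pderiv s (fun x => part b (g i x)) x =
      \int[m]_(y in D) (\1_(B i) y * pderiv s (fun x => part b (g i x)) x).
    rewrite RintegralZr//.
      by rewrite /Rintegral integral_indic// setIidl.
    apply/integrableP; split.
      by apply/measurable_EFinP; apply: measurable_funTS; exact: measurable_indic.
    rewrite (eq_integral (fun y => (\1_(B i) y)%:E)) => [|y _]; last by rewrite /= ger0_norm.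
    by rewrite integral_indic//; apply: le_lt_trans (fB i); apply: le_measure; rewrite ?inE//; exact: measurableI.
  have [iG EG] := int_D b s x.
  have iSs (k : nat) : m.-integrable D (EFin \o (fun y => \sum_(i < k) \1_(B i) y * pderiv s (fun x => part b (g i x)) x)).
    rewrite (_ : _ \o _ = (fun y => \sum_(i < k) ((\1_(B i) y * pderiv s (fun x => part b (g i x)) x)%R)%:E)%E).
      by apply: integrable_sum => // i _; exact: iS.
    by apply/funext => y; rewrite /= sumEFin.
  have ES (k : nat) : \sum_(i < k) c i * pderiv s (fun x => part b (g i x)) x =
     \int[m]_(y in D) (\sum_(i < k) \1_(B i) y * pderiv s (fun x => part b (g i x)) x).
    elim: k => [|k ih].
      rewrite big_ord0 (@eq_Rintegral _ _ _ _ _ (fun=> 0)) ?Rintegral_cst ?mul0r// => y _.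
      by rewrite big_ord0.
    rewrite big_ord_recr /= ih EB -RintegralD//; apply: eq_Rintegral => y _.
    by rewrite big_ord_recr.
  have -> : pderiv s (fun x => part b (-1 * S x + GI x)) x =
     \int[m]_(y in D) (pderiv s (fun x => part b (G y x)) x -
       \sum_(i < n) \1_(B i) y * pderiv s (fun x => part b (g i x)) x).
    rewrite RintegralB//.
    have PS := congr1 (fun f : Rd -> R => f x) (pderiv_part_sum s b n c cg).
    rewrite -EG -ES -PS.
    rewrite (_ : (fun x => part b (-1 * S x + GI x)) = (fun x => -1 * part b (S x) + part b (GI x))).
      rewrite pderiv_linear; first by rewrite mulN1r addrC.
        by apply: rsch_smooth; exact: cS.
      by apply: rsch_smooth; exact: cI.
    by apply/funext => z; rewrite partD !mulN1r partN.
  have iB : m.-integrable D (EFin \o (fun y => pderiv s (fun x => part b (G y x)) x -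
       \sum_(i < n) \1_(B i) y * pderiv s (fun x => part b (g i x)) x)).
    exact: (integrableB mD iG (iSs n)).
  have mU : measurable (~` \bigcup_(i < n) B i).
    by apply: measurableC; apply: bigcup_measurable.
  have iR : m.-integrable D (EFin \o (fun y => `|rho y|)) := integrable_norm rho_int.
  have i1R : m.-integrable D (EFin \o (fun y => \1_(~` \bigcup_(i < n) B i) y * `|rho y|)).
    apply: (le_integrable mD _ _ iR).
      apply/measurable_EFinP; apply: measurable_funM.
        by apply: measurable_funTS; exact: measurable_indic.
      by apply/measurable_EFinP; exact: measurable_int iR.
    move=> y Dy /=; rewrite lee_fin normrM; apply: ler_piMl => //.
    by rewrite indicE; case: (_ \in _); rewrite ?normr1 ?normr0.
  have ie1 : m.-integrable D (EFin \o (fun y => eta * `|rho y|)) by exact: (integrableZl mD eta iR).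
  have ie2 : m.-integrable D (EFin \o (fun y => C * (\1_(~` \bigcup_(i < n) B i) y * `|rho y|))).
    exact: (integrableZl mD C i1R).
  have -> : eta * J + C * eta = (eta * J + C * eta) / brk x ^+ N * brk x ^+ N.
    by rewrite divfK// gt_eqF// brkX_gt0.
  rewrite ler_wpM2r ?exprn_ge0 ?brk_ge0//.
  apply: le_trans (le_normr_Rintegral mD iB) _.
  apply: (@le_trans _ _ (\int[m]_(y in D) ((brk x ^+ N)^-1 *
     (eta * `|rho y| + C * (\1_(~` \bigcup_(i < n) B i) y * `|rho y|))))).
    apply: le_Rintegral => //; first exact: integrable_norm.
      exact: (integrableZl mD ((brk x ^+ N)^-1) (integrableD mD ie1 ie2)).
    by move=> y Dy; rewrite mulrC ler_pdivlMr ?brkX_gt0// step.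
  rewrite RintegralZl//; last exact: (integrableD mD ie1 ie2).
  rewrite RintegralD// !RintegralZl// mulrC ler_wpM2r ?invr_ge0 ?exprn_ge0 ?brk_ge0//.
  by rewrite lerD2l ler_wpM2l.
have E2 : ((cabs (F S))%:E <= \int[m]_(y in D) (cabs (F (G y)))%:E + (eps / 2)%:E)%E.
  pose k i := Num.max (cabs (F (g i)) - delta) 0.
  have k0 i : 0 <= k i by rewrite le_max lexx orbT.
  have low : (\sum_(i < n) (k i * c i)%:E <= \int[m]_(y in D) (cabs (F (G y)))%:E)%E.
    have -> : (\sum_(i < n) (k i * c i)%:E = \int[m]_(y in D) \sum_(i < n) (k i)%:E * (\1_(B i) y)%:E)%E.
      rewrite ge0_integral_sum//.
      + apply: eq_bigr => i _; rewrite ge0_integralZl//; last 2 first.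
        * by apply/measurable_EFinP; apply: measurable_funTS; exact: measurable_indic.
        * by rewrite lee_fin.
        rewrite integral_indic// setIidl// EFinM /c fineK//.
        by rewrite ge0_fin_numE.
      + move=> i; apply: emeasurable_funM => //.
        by apply/measurable_EFinP; apply: measurable_funTS; exact: measurable_indic.
      + by move=> i y _; rewrite -EFinM lee_fin mulr_ge0.
    apply: ge0_le_lower_integral => y Dy.
      by apply: sume_ge0 => i _; rewrite -EFinM lee_fin mulr_ge0.
    have [i Biy] := DB _ Dy.
    have oneB j : \1_(B j) y = (j == i)%:R :> R.
      rewrite indicE; have [->|ji] := eqVneq j i; first by rewrite mem_set.
      by rewrite memNset// => Bjy; move: ji; rewrite (dB _ _ _ Bjy Biy) eqxx.
    under eq_bigr do rewrite -EFinM.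
    rewrite sumEFin lee_fin.
    have [ilt|nlt] := ltnP i n.
      rewrite (bigD1 (Ordinal ilt))//= oneB eqxx mulr1 big1 ?addr0 => [|j ji]; last first.
        by rewrite oneB (_ : (nat_of_ord j == i) = false) ?mulr0//; apply/negbTE.
      by rewrite ge_max cabs_ge0 andbT lerBlDr; exact: gF.
    rewrite big1 ?cabs_ge0// => j _.
    rewrite oneB (_ : (nat_of_ord j == i) = false) ?mulr0//; apply/negbTE.
    by rewrite neq_ltn (leq_trans (ltn_ord j) nlt).
  apply: le_trans (leeD2r _ low).
  rewrite sumEFin -EFinD lee_fin.
  rewrite (tempered_sum n (fun i => ((c i)%:C)%C) tF cg).
  apply: (@le_trans _ _ (\sum_(i < n) c i * cabs (F (g i)))).
    elim: (n) => [|l ih]; first by rewrite !big_ord0 cabs0.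
    rewrite !big_ord_recr; apply: le_trans (cabsD _ _) _.
    by apply: lerD => //; rewrite cabsM cabs_real ger0_norm.
  apply: (@le_trans _ _ (\sum_(i < n) (k i * c i + delta * c i))).
    apply: ler_sum => i _; rewrite -mulrDl mulrC ler_wpM2r// -lerBlDr.
    by rewrite le_max lexx.
  rewrite big_split /= lerD2l -mulr_sumr /delta.
  set q := \sum_(i < n) c i; have q0 : 0 <= q by apply: sumr_ge0.
  rewrite (_ : _ * q = eps / 2 * (q / (q + 1))).
    apply: ler_piMr; first by rewrite divr_ge0 ?ltW.
    by rewrite ler_pdivrMr ?ltr_wpDl// mul1r lerDl.
  by field; rewrite gt_eqF// ltr_wpDl.
rewrite FI; apply: (@le_trans _ _ ((eps / 2)%:E + (\int[m]_(y in D) (cabs (F (G y)))%:E + (eps / 2)%:E))%E).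
  have E1' : ((cabs (F (fun x => -1 * S x + GI x)))%:E <= (eps / 2)%:E)%E by rewrite lee_fin.
  apply: le_trans (leeD E1' E2).
  by rewrite -EFinD lee_fin cabsD.
by rewrite addeCA -EFinD -splitr.
Unshelve. all: by end_near. Qed.

End bochner.

(** * Derivatives and decay of complex convolutions *)

Section cpderiv_theory.
Context (R : realType) (d : nat).
Local Notation Rd := 'rV[R]_d.
Local Notation mu := (@leb R d).
Implicit Types (g k h : Rd -> R[i]) (u x xi : Rd) (t : R) (s : seq 'I_d).

Lemma csch_cpderiv s g : csch g -> csch (cpderiv s g).
Proof. by move=> hg b; under eq_fun do rewrite cpderiv_part; exact: rsch_pderiv. Qed.

Lemma pderiv_partZ s b c h x : csch h ->
  pderiv s (fun u => part b (c * h u)) x = part b (c * cpderiv s h x).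
Proof.
move=> hh.
have -> : (fun u => part b (c * h u)) = (fun x => complex.Re c * part b (h x) +
   (fun x => (if b then - complex.Im c else complex.Im c) * part (~~ b) (h x)) x).
  by apply/funext => u; rewrite partM; case: b.
rewrite pderiv_linear; [|exact: (rsch_smooth (hh b))|by apply: rsch_smooth; apply: rschZ; exact: hh].
rewrite partM cpderiv_part; congr (_ + _).
have -> : (fun x => (if b then - complex.Im c else complex.Im c) * part (~~ b) (h x)) =
   (fun x => (if b then - complex.Im c else complex.Im c) * part (~~ b) (h x) + (fun=> 0) x).
  by apply/funext => u; rewrite addr0.
rewrite pderiv_linear; [|exact: (rsch_smooth (hh _))|exact: (rsch_smooth (rsch0 R d))].
by rewrite pderiv0 addr0 -cpderiv_part; case: b.
Qed.

Lemma pderiv_part_cmol s b g k t x : `|t| <= 1 -> csch g -> csch k ->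
  pderiv s (fun u => part b (cmol g k t u)) x = part b (cmol (cpderiv s g) k t x).
Proof.
by move=> t1 hg hk; rewrite pderiv_cmol// part_cmol//; exact: csch_cpderiv.
Qed.

Lemma pderiv_part_translate s b h y x : csch h ->
  pderiv s (fun u => part b (h (u - y))) x = part b (cpderiv s h (x - y)).
Proof.
move=> hh; have := pderiv_affine s 1 (- y) (rsch_smooth (hh b)).
rewrite expr1n; under eq_fun do rewrite scale1r.
by move=> ->; rewrite mul1r scale1r cpderiv_part.
Qed.

Lemma cpderiv_translate s h y x : csch h ->
  cpderiv s (fun u => h (u - y)) x = cpderiv s h (x - y).
Proof.
by move=> hh; apply: complex_eqP => b; rewrite cpderiv_part pderiv_part_translate.
Qed.

Lemma csch_lip g M : csch g -> exists2 C, 0 <= C &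
  forall u v, cabs (g (u + v) - g u) * brk u ^+ M <= C * enorm v * brk v ^+ M.
Proof.
move=> hg.
have [C1 C10 h1] := taylor_rsch 1 M (hg true).
have [C2 C20 h2] := taylor_rsch 1 M (hg false).
exists (C1 + C2) => [|u v]; first exact: addr_ge0.
have := h1 u v; have := h2 u v; rewrite !taylor_rem1 expr1 => k2 k1.
apply: (@le_trans _ _ ((`|part true (g (u + v) - g u)| + `|part false (g (u + v) - g u)|) * brk u ^+ M)).
  by rewrite ler_wpM2r ?exprn_ge0 ?brk_ge0// cabs_parts.
by rewrite !partD !partN mulrDl !mulrDl lerD.
Qed.

Lemma cabs_cmol_le g k t u (A : R) : csch g -> csch k ->
  (forall b c, `|mol (fun x => part b (g x)) (fun x => part c (k x)) t u| <= A) ->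
  cabs (cmol g k t u) <= 4 * A.
Proof.
move=> hg hk h; apply: (@le_trans _ _ (2 * (A + A))).
  apply: cabs_parts_le => b; rewrite part_cmol//.
  apply: le_trans (ler_normD _ _) _; apply: lerD => //.
  by rewrite normrM (_ : `|if b then _ else _| = 1) ?mul1r//; case: b; rewrite ?normrN normr1.
by rewrite -mulr2n -(mulr_natl A 2) mulrA -natrM.
Qed.

Lemma cmol_decay g k M : csch g -> csch k -> exists2 C, 0 <= C &
  forall t u, `|t| <= 1 -> cabs (cmol g k t u) * brk u ^+ M <= C.
Proof.
move=> hg hk.
pose D b c := mol_decay M (hg b) (hk c).
have [C1 C10 h1] := D true true; have [C2 C20 h2] := D true false.
have [C3 C30 h3] := D false true; have [C4 C40 h4] := D false false.
exists (4 * (C1 + C2 + C3 + C4)) => [|t u t1]; first by rewrite mulr_ge0// !addr_ge0.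
rewrite -ler_pdivlMr ?brkX_gt0// -mulrA; apply: cabs_cmol_le => // b c.
rewrite ler_pdivlMr ?brkX_gt0//.
by case: b; case: c; [apply: le_trans (h1 t u t1) _|apply: le_trans (h2 t u t1) _|
  apply: le_trans (h3 t u t1) _|apply: le_trans (h4 t u t1) _]; lra.
Qed.

Lemma cmol_cancel g k N M : csch g -> csch k -> ccancel k -> exists2 C, 0 <= C &
  forall t u, `|t| <= 1 -> cabs (cmol g k t u) * brk u ^+ M <= C * `|t| ^+ N.
Proof.
move=> hg hk ck.
pose D b c := mol_cancel N M (hg b) (hk c) (ck c).
have [C1 C10 h1] := D true true; have [C2 C20 h2] := D true false.
have [C3 C30 h3] := D false true; have [C4 C40 h4] := D false false.
exists (4 * (C1 + C2 + C3 + C4)) => [|t u t1]; first by rewrite mulr_ge0// !addr_ge0.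
rewrite -ler_pdivlMr ?brkX_gt0// -2!mulrA; apply: cabs_cmol_le => // b c.
rewrite mulrA ler_pdivlMr ?brkX_gt0//.
have tN : 0 <= `|t| ^+ N by rewrite exprn_ge0.
by case: b; case: c; [apply: le_trans (h1 t u t1) _|apply: le_trans (h2 t u t1) _|
  apply: le_trans (h3 t u t1) _|apply: le_trans (h4 t u t1) _]; rewrite ler_wpM2r//; lra.
Qed.

Lemma cmol_lip g k M : csch g -> csch k -> exists2 C, 0 <= C &
  forall b t t' u, `|t| <= 1 -> `|t'| <= 1 ->
  `|part b (cmol g k t u) - part b (cmol g k t' u)| * brk u ^+ M <= C * `|t - t'|.
Proof.
move=> hg hk.
pose D b c := mol_lip M (hg b) (hk c).
have [C1 C10 h1] := D true true; have [C2 C20 h2] := D true false.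
have [C3 C30 h3] := D false true; have [C4 C40 h4] := D false false.
exists (C1 + C2 + C3 + C4) => [|b t t' u t1 t1']; first by rewrite !addr_ge0.
have tt : 0 <= `|t - t'| by [].
rewrite !part_cmol// opprD addrACA -mulrBr.
apply: (@le_trans _ _ ((`|mol (fun x => part true (g x)) (fun x => part b (k x)) t u -
   mol (fun x => part true (g x)) (fun x => part b (k x)) t' u| +
   `|mol (fun x => part false (g x)) (fun x => part (~~ b) (k x)) t u -
   mol (fun x => part false (g x)) (fun x => part (~~ b) (k x)) t' u|) * brk u ^+ M)).
  rewrite ler_wpM2r ?exprn_ge0 ?brk_ge0//; apply: le_trans (ler_normD _ _) _.
  rewrite lerD2l normrM (_ : `|if b then _ else _| = 1) ?mul1r//.
  by case: b; rewrite ?normrN normr1.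
rewrite mulrDl; case: b => /=.
  by apply: le_trans (lerD (h1 t t' u t1 t1') (h4 t t' u t1 t1')) _; rewrite -mulrDl ler_wpM2r//; lra.
by apply: le_trans (lerD (h2 t t' u t1 t1') (h3 t t' u t1 t1')) _; rewrite -mulrDl ler_wpM2r//; lra.
Qed.

Lemma cmol_continuous2 g k b : csch g -> csch k ->
  continuous (fun p : Rd * R => part b (cmol g k p.2 p.1)).
Proof.
move=> hg hk p.
pose G b c (p : Rd * R) := mol (fun x => part b (g x)) (fun x => part c (k x)) p.2 p.1.
rewrite (_ : (fun p : Rd * R => _) =
  (fun p => G true b p + (if b then - (1 : R) else 1) * G false (~~ b) p)); last first.
  by apply/funext => r; rewrite part_cmol.
have FF : Filter (nbhs p) by exact: nbhs_filter.
apply: cvgD; first exact: (mol_continuous2 (hg _) (hk _)).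
by apply: cvgMr; exact: (mol_continuous2 (hg _) (hk _)).
Qed.

Lemma cmol_cmol g k h t : `|t| <= 1 -> csch g -> csch k -> csch h ->
  cmol (cmol g k t) h t = cmol g (cmol k h 1) t.
Proof.
move=> t1 hg hk hh; have one : `|1 : R| <= 1 by rewrite normr1.
apply: fourier_inj.
- by apply: csch_mol => //; exact: csch_mol.
- by apply: csch_mol => //; exact: csch_mol.
move=> xi; rewrite !fourier_cmol//; try exact: csch_mol.
by rewrite scale1r; ring.
Qed.

(** Convolving with a product of two functions, one of which is cancellative,
    gains any power of the scale. *)
Lemma cmol_cancel2 g k h N M : csch g -> csch k -> csch h -> ccancel k -> exists2 C, 0 <= C &
  forall t u, `|t| <= 1 -> cabs (cmol g (cmol k h 1) t u) * brk u ^+ M <= C * `|t| ^+ N.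
Proof.
move=> hg hk hh ck.
have [C C0 hC] := cmol_cancel N M hg hk ck.
have [K1 K10 hK1] := rsch_weight M (hh true).
have [K2 K20 hK2] := rsch_weight M (hh false).
exists (4 * ((K1 + K2) * C)) => [|t u t1]; first by rewrite mulr_ge0// mulr_ge0// addr_ge0.
rewrite -cmol_cmol// -ler_pdivlMr ?brkX_gt0// -2!mulrA.
have hmol : csch (cmol g k t) by exact: csch_mol.
apply: cabs_cmol_le => // b c.
pose A := C * `|t| ^+ N / brk u ^+ M.
have A0 : 0 <= A by rewrite !mulr_ge0// ?invr_ge0 exprn_ge0// brk_ge0.
have G1 : measurable_fun setT ((fun z => part b (cmol g k t (u - t *: z))) : Rd -> measurableTypeR R).
  by apply: (measurable_comp_affine u (g := fun x => part b (cmol g k t x))); exact: csch_measurable.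
have G2 z : `|part b (cmol g k t (u - t *: z))| <= A * brk z ^+ M.
  apply: le_trans (part_cabs _ _) _.
  rewrite /A mulrAC ler_pdivlMr ?brkX_gt0//.
  apply: (@le_trans _ _ (cabs (cmol g k t (u - t *: z)) * (brk (u - t *: z) ^+ M * brk z ^+ M))).
    by rewrite ler_wpM2l ?cabs_ge0// brkZ_sub.
  by rewrite mulrA ler_wpM2r ?exprn_ge0 ?brk_ge0// hC.
rewrite -!mulrA [leRHS](_ : _ = (K1 + K2) * A); last by rewrite /A -!mulrA.
case: c; [have [_ hh'] := hK1 _ _ G1 G2|have [_ hh'] := hK2 _ _ G1 G2]; apply: le_trans hh' _.
  by rewrite ler_wpM2r// lerDl.
by rewrite ler_wpM2r// lerDr.
Qed.

End cpderiv_theory.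

(** * Spaces of scales *)

Section fourier_bounds.
Context (R : realType) (d : nat).
Local Notation Rd := 'rV[R]_d.
Local Notation mu := (@leb R d).
Implicit Types (g k l : Rd -> R[i]) (x xi : Rd).

Lemma cabs_char_sub xi xi' x : cabs (char xi x - char xi' x) <= 2 * (enorm (xi - xi') * enorm x).
Proof.
have H : `|dotp xi x - dotp xi' x| <= enorm (xi - xi') * enorm x.
  rewrite -dotpNl -dotpDl ler_norml; apply/andP; split; last exact: cauchy_schwarz.
  by rewrite lerNl -dotpNl -enormN; exact: cauchy_schwarz.
rewrite /char (dotpC x) (dotpC x).
apply: cabs_parts_le => b; rewrite partD partN; case: b; rewrite /part /cis /=.
  by rewrite !cosN; apply: le_trans (cos_lip _ _) H.
by rewrite !sinN -opprD normrN; apply: le_trans (sin_lip _ _) H.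
Qed.

Lemma cabs_cintg_dom : exists2 K : R, 0 < K & forall (f : Rd -> R[i]) (C : R),
  (forall b, measurable_fun setT ((fun x => part b (f x)) : Rd -> measurableTypeR R)) ->
  (forall x, cabs (f x) * brk x ^+ (2 * d) <= C) -> cabs (cintg mu f) <= K * C.
Proof.
have [K K0 hK] := @Rintegral_dom_bound R d; exists (2 * K) => [|f C mf hf]; first by rewrite mulr_gt0.
rewrite -mulrA; apply: cabs_parts_le => b; rewrite part_cintg; apply: hK; first exact: mf.
move=> x; apply: le_trans (hf x); rewrite ler_wpM2r ?exprn_ge0 ?brk_ge0//; exact: part_cabs.
Qed.

Lemma fourier_bounded g : csch g -> exists2 C, 0 <= C & forall xi, cabs (fourier g xi) <= C.
Proof.
move=> hg; have [K K0 hK] := cabs_cintg_dom; have [C C0 hC] := csch_cabs (2 * d) hg.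
exists (fcst R d * (K * C)) => [|xi]; first by rewrite !mulr_ge0// ltW// fcst_gt0.
have F0 := ltW (fcst_gt0 R d).
rewrite fourierE cabsM cabs_real ger0_norm// ler_wpM2l//.
apply: hK => [b|x]; last by rewrite cabsM cabs_cis mul1r.
by apply: measurable_partM => c; [exact: measurable_char|exact: csch_measurable].
Qed.

(** With the vanishing of the transform of a cancellative function at 0, this makes
    the Calderon integrand of the order of the scale, hence integrable. *)
Lemma fourier_lip g : csch g -> exists2 C, 0 <= C & forall xi xi',
  cabs (fourier g xi - fourier g xi') <= C * enorm (xi - xi').
Proof.
move=> hg; have [K K0 hK] := cabs_cintg_dom; have [C C0 hC] := csch_cabs (2 * d).+1 hg.
exists (fcst R d * (K * (2 * C))) => [|xi xi']; first by rewrite !mulr_ge0// ltW// fcst_gt0.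
have hi := csch_cinteg hg.
have -> : fourier g xi - fourier g xi' =
    (fcst R d)%:C%C * cintg mu (fun x => (char xi x - char xi' x) * g x).
  rewrite !fourierE -mulrBr -mulN1r.
  rewrite -(cintgZ (-1) (cinteg_char xi' hi)) -cintgD; [|exact: cinteg_char|by apply: cintegZ; exact: cinteg_char].
  by congr (_ * _); apply: eq_cintg => x; ring.
have F0 := ltW (fcst_gt0 R d).
rewrite cabsM cabs_real ger0_norm// -2!mulrA ler_wpM2l//.
apply: hK => [b|x].
  apply: measurable_partM => c; last exact: csch_measurable.
  under eq_fun do rewrite partD partN.
  by apply: measurable_funB; exact: measurable_char.
rewrite cabsM.
apply: (@le_trans _ _ (2 * (enorm (xi - xi') * enorm x) * cabs (g x) * brk x ^+ (2 * d))).
  rewrite ler_wpM2r ?exprn_ge0 ?brk_ge0// ler_wpM2r ?cabs_ge0//; exact: cabs_char_sub.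
rewrite [leLHS](_ : _ = 2 * enorm (xi - xi') * (cabs (g x) * (enorm x * brk x ^+ (2 * d)))); last by ring.
rewrite [leRHS](_ : _ = 2 * enorm (xi - xi') * C); last by ring.
rewrite ler_wpM2l ?mulr_ge0 ?enorm_ge0//; apply: le_trans (hC x).
by rewrite ler_wpM2l ?cabs_ge0// exprS ler_wpM2r ?exprn_ge0 ?brk_ge0// enorm_brk.
Qed.

Lemma ccancel_fourier0 k : ccancel k -> fourier k 0 = 0.
Proof.
move=> ck; rewrite fourierE (_ : cintg _ _ = 0) ?mulr0//.
apply: complex_eqP => b; rewrite part_cintg part0 -(ck b [::]).
apply: eq_Rintegral => x _; rewrite big_nil mulr1 /char (_ : dotp x 0 = 0).
  by rewrite oppr0 cis0 mul1r.
by rewrite /dotp big1// => i _; rewrite mxE mulr0.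
Qed.

Lemma fourier_continuous_line k xi b : csch k -> continuous (fun t : R => part b (fourier k (t *: xi))).
Proof.
move=> hk; have [C C0 hC] := fourier_lip hk.
apply: locally_lipschitz_continuous => t; exists (C * enorm xi) => s _.
rewrite -partN -partD; apply: le_trans (part_cabs _ _) _; apply: le_trans (hC _ _) _.
by rewrite -scalerBl enormZ mulrCA mulrC.
Qed.

End fourier_bounds.

Section scale_space.
Context (R : realType) (d : nat) dZ (Z : measurableType dZ)
  (m : {sigma_finite_measure set Z -> \bar R}) (e tau : Z -> R).
Local Notation Rd := 'rV[R]_d.

(** A measure space [e dm] of scales [tau], covering both [dt/t] on the unit
    interval and the dyadic scales. The cover field makes Riemann sums possible. *)
Record scale_space : Prop := ScaleSpace {
  ss_measurable_density : measurable_fun setT (e : Z -> measurableTypeR R);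
  ss_measurable_scale : measurable_fun setT (tau : Z -> measurableTypeR R);
  ss_density_ge0 : forall z, 0 <= e z;
  ss_scale01 : forall z, 0 < tau z < 1;
  ss_schur : exists2 A, 0 < A & forall s, 0 < s <= 1 ->
    (\int[m]_z (e z * Num.min (s / tau z) (tau z / s))%:E <= A%:E)%E;
  ss_cover : forall eta, 0 < eta -> exists A : nat -> set Z,
    [/\ forall i, measurable (A i), forall z, exists i, A i z, forall i, (m (A i) < +oo)%E &
      forall i y z, A i y -> A i z ->
      e y * `|tau y - tau z| + `|e y - e z| * tau z ^+ 2 <= eta * (e y * tau y)] }.

Hypothesis ss : scale_space.
Let te := ss_measurable_density ss.
Let tt := ss_measurable_scale ss.
Let e0 := ss_density_ge0 ss.
Let tau0 z : 0 < tau z. Proof. by have /andP[] := ss_scale01 ss z. Qed.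
Let tau1 z : tau z < 1. Proof. by have /andP[] := ss_scale01 ss z. Qed.
Let tauN z : `|tau z| <= 1. Proof. by rewrite gtr0_norm// ltW. Qed.

Lemma integrable_scale_density : m.-integrable setT (EFin \o (fun z => e z * tau z)).
Proof.
apply/integrableP; split; first by apply/measurable_EFinP; exact: measurable_funM.
have [A A0 hA] := ss_schur ss.
apply: le_lt_trans (ltry A); apply: le_trans (hA 1 _); last by rewrite ltr01 lexx.
apply: ge0_le_lower_integral => z _; first exact: abse_ge0.
have t0 := ltW (tau0 z).
rewrite /= lee_fin ger0_norm ?mulr_ge0// ler_wpM2l// le_min divr1 lexx andbT.
rewrite ler_pdivlMr//; apply: le_trans (ltW (tau1 z)).
by apply: ler_piMr => //; rewrite ltW.
Qed.

(** The first factor is of the order of [tau z], since a cancellative function has a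
    Lipschitz Fourier transform that vanishes at 0. *)
Lemma calderon_integrable (k l : Rd -> R[i]) xi : csch k -> csch l -> ccancel k ->
  cinteg m (fun z => (e z)%:C%C * (fourier k (tau z *: xi) * fourier l (tau z *: xi))).
Proof.
move=> hk hl ck b.
have [C C0 hC] := fourier_lip hk; have [B B0 hB] := fourier_bounded hl.
have := integrable_scale (C * enorm xi * B) integrable_scale_density.
apply: le_integrable => //.
  apply/measurable_EFinP; under eq_fun do rewrite part_realM.
  apply: measurable_funM => //; apply: measurable_partM => c.
    by apply: (measurableT_comp (f := fun t : measurableTypeR R => part c (fourier k (t *: xi)))) => //;
      apply: continuous_measurable_fun; exact: fourier_continuous_line.
  by apply: (measurableT_comp (f := fun t : measurableTypeR R => part c (fourier l (t *: xi)))) => //;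
    apply: continuous_measurable_fun; exact: fourier_continuous_line.
move=> z _; rewrite /= lee_fin part_realM normrM ger0_norm//.
rewrite (ger0_norm (x := C * enorm xi * B * _)); last first.
  by rewrite !mulr_ge0 ?enorm_ge0// ltW.
rewrite [leRHS](_ : _ = e z * (C * (tau z * enorm xi) * B)); last by ring.
rewrite ler_wpM2l//; apply: le_trans (part_cabs _ _) _; rewrite cabsM.
apply: ler_pM; rewrite ?cabs_ge0//.
have := hC (tau z *: xi) 0; rewrite ccancel_fourier0// !subr0 enormZ gtr0_norm//.
Qed.

End scale_space.

(** * The Calderon reproducing formula *)

Section reproduction.
Context (R : realType) (d : nat) dZ (Z : measurableType dZ)
  (m : {sigma_finite_measure set Z -> \bar R}) (e tau : Z -> R).
Local Notation Rd := 'rV[R]_d.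
Local Notation mu := (@leb R d).
Hypothesis ss : scale_space m e tau.
Variables kap0 kap lam0 lam : Rd -> R[i].
Hypotheses (hk0 : csch kap0) (hk : csch kap) (hl0 : csch lam0) (hl : csch lam).
Hypothesis ck : ccancel kap.
Hypothesis calderon : forall xi, fourier kap0 xi * fourier lam0 xi +
  cintg m (fun z => (e z)%:C%C * (fourier kap (tau z *: xi) * fourier lam (tau z *: xi))) =
  (fcst R d ^+ 2)%:C%C.

Let te := ss_measurable_density ss.
Let tt := ss_measurable_scale ss.
Let e0 := ss_density_ge0 ss.
Let tau0 z : 0 < tau z. Proof. by have /andP[] := ss_scale01 ss z. Qed.
Let tau1 z : tau z < 1. Proof. by have /andP[] := ss_scale01 ss z. Qed.
Let tauN z : `|tau z| <= 1. Proof. by rewrite gtr0_norm// ltW. Qed.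
Let oneN : `|1 : R| <= 1. Proof. by rewrite normr1. Qed.
Local Notation chi0 := (cmol kap0 lam0 1).
Local Notation chi := (cmol kap lam 1).
Let hchi : csch chi. Proof. exact: csch_mol. Qed.
Let hchi0 : csch chi0. Proof. exact: csch_mol. Qed.

Definition layer (g : Rd -> R[i]) z u : R[i] := (e z)%:C%C * cmol g chi (tau z) u.
Definition layers (g : Rd -> R[i]) u : R[i] := cintg m (fun z => layer g z u).

Lemma csch_layer g z : csch g -> csch (layer g z).
Proof. by move=> hg; apply: cschZ; exact: csch_mol. Qed.

(** The cancellation of [kap] makes a layer of the order of its scale, which is
    integrable against [e dm]. *)
Lemma layer_decay g M : csch g -> exists2 C, 0 <= C &
  forall z u, cabs (layer g z u) * brk u ^+ M <= C * (e z * tau z).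
Proof.
move=> hg; have [C C0 hC] := cmol_cancel2 1 M hg hk hl ck; exists C => // z u.
rewrite cabsM cabs_real ger0_norm// -mulrA [leRHS]mulrCA ler_wpM2l//.
by have := hC (tau z) u (tauN z); rewrite expr1 gtr0_norm.
Qed.

Lemma measurable_layer2 g b : csch g ->
  measurable_fun setT ((fun p : Rd * Z => part b (layer g p.2 p.1)) : _ -> measurableTypeR R).
Proof.
move=> hg; under eq_fun do rewrite part_realM; apply: measurable_funM.
  exact: (measurableT_comp te measurable_snd).
have mc : measurable_fun setT
    ((fun p : Rd * R => part b (cmol g chi p.2 p.1)) : (Rd * measurableTypeR R)%type -> measurableTypeR R).
  apply/measurable_EFinP; apply: lsc_measurable_rVR; first exact: openT.
  move=> r; rewrite setTI.
  rewrite (_ : [set x | _] = (fun p : Rd * R => part b (cmol g chi p.2 p.1)) @^-1` `]r, +oo[%classic).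
    by apply: open_comp; [move=> x _; exact: (cmol_continuous2 hg hchi)|exact: interval_open].
  by apply/seteqP; split => x /=; rewrite lte_fin in_itv/= andbT.
apply: (@measurableT_comp _ _ _ _ _ _ _ _ (fun p : Rd * Z => (p.1, tau p.2 : measurableTypeR R)) mc).
apply/measurable_fun_pairP; split; first exact: measurable_fst.
exact: (measurableT_comp tt measurable_snd).
Qed.

Lemma cinteg_layer g u : csch g -> cinteg m (fun z => layer g z u).
Proof.
move=> hg b; have [C C0 hC] := layer_decay 0 hg.
have := integrable_scale C (integrable_scale_density ss); apply: le_integrable => //.
  apply/measurable_EFinP.
  exact: (measurableT_comp (measurable_layer2 b hg) (pair1_measurable u)).
move=> z _; rewrite /= lee_fin; have := hC z u; rewrite expr0 mulr1 => h.
apply: le_trans (part_cabs b _) _; apply: le_trans h _; exact: ler_norm.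
Qed.

Lemma layers_decay g M : csch g -> exists2 C, 0 <= C &
  forall u, cabs (layers g u) * brk u ^+ M <= C.
Proof.
move=> hg; have [C C0 hC] := layer_decay M hg.
have iet := integrable_scale_density ss.
pose A := \int[m]_z (e z * tau z).
have A0 : 0 <= A by apply: Rintegral_ge0 => z _; rewrite mulr_ge0// ltW.
exists (2 * (C * A)) => [|u]; first by rewrite mulr_ge0// mulr_ge0.
rewrite -ler_pdivlMr ?brkX_gt0// -mulrA; apply: cabs_parts_le => b.
rewrite part_cintg; apply: le_trans (le_normr_Rintegral measurableT (cinteg_layer u hg b)) _.
have iB := integrable_scale (C / brk u ^+ M) iet.
rewrite mulrAC -RintegralZl//.
apply: le_Rintegral => //.
  by have := integrable_abse (cinteg_layer u hg b); apply: eq_integrable.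
move=> z _; apply: le_trans (part_cabs _ _) _.
by rewrite mulrAC ler_pdivlMr ?brkX_gt0// hC.
Qed.

Lemma layer_lip g : csch g -> exists2 C, 0 <= C &
  forall b z u v, `|part b (layer g z (u + v)) - part b (layer g z u)| <= C * enorm v * (e z * tau z).
Proof.
move=> hg.
have := @seq_uniform _ 'I_d (fun s C => forall z u, cabs (layer (cpderiv s g) z u) <= C * (e z * tau z)) 1.
case=> [s|s C C' CC' hC z u|C C0 hC].
- have [C C0 hC] := layer_decay 0 (csch_cpderiv s hg); exists C => z u.
  by have := hC z u; rewrite expr0 mulr1.
- apply: le_trans (hC z u) _; rewrite ler_wpM2r// mulr_ge0// ltW//.
exists (C * d%:R) => [|b z u v]; first by rewrite mulr_ge0.
have hL := csch_layer z hg.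
rewrite -(taylor_rem1 (fun x => part b (layer g z x))).
apply: le_trans (@taylor_bound _ _ 1 _ u v (C * (e z * tau z)) (rsch_smooth (hL b)) _ _) _.
- by rewrite !mulr_ge0// ltW.
- move=> s r s1 _; rewrite pderiv_partZ; last exact: csch_mol.
  have -> : cpderiv s (cmol g chi (tau z)) (u + r *: v) = cmol (cpderiv s g) chi (tau z) (u + r *: v).
    by apply: complex_eqP => c; rewrite cpderiv_part pderiv_part_cmol.
  by apply: le_trans (part_cabs _ _) _; apply: hC; rewrite s1.
- by rewrite expr1 [leRHS](_ : _ = C * (e z * tau z) * (d%:R * enorm v))//; ring.
Qed.

Lemma layers_continuous g b : csch g -> continuous (fun u => part b (layers g u)).
Proof.
move=> hg; have [C C0 hC] := layer_lip hg.
have iet := integrable_scale_density ss.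
pose A := \int[m]_z (e z * tau z).
have A0 : 0 <= A by apply: Rintegral_ge0 => z _; rewrite mulr_ge0// ltW.
apply: locally_lipschitz_continuous => u; exists (C * d%:R * A) => y _.
have -> : part b (layers g u) - part b (layers g y) =
    \int[m]_z (part b (layer g z u) - part b (layer g z y)).
  by rewrite (RintegralB measurableT (cinteg_layer u hg b) (cinteg_layer y hg b)) -!part_cintg.
have iD : m.-integrable setT (EFin \o (fun z => part b (layer g z u) - part b (layer g z y))).
  by have := integrableB measurableT (cinteg_layer u hg b) (cinteg_layer y hg b); apply: eq_integrable.
apply: le_trans (le_normr_Rintegral measurableT iD) _.
have iB := integrable_scale (C * d%:R * `|u - y|) iet.
rewrite mulrAC -RintegralZl//; apply: le_Rintegral => //.
  by have := integrable_abse iD; apply: eq_integrable.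
move=> z _; have := hC b z y (u - y); rewrite (addrC y) subrK => h.
apply: le_trans h _; rewrite ler_wpM2r ?mulr_ge0 ?(ltW (tau0 z))//.
by rewrite -mulrA ler_wpM2l//; exact: enorm_norm.
Qed.

(** Fubini, and the convolution theorem in each layer. *)
Lemma fourier_layers g xi : csch g -> fourier (layers g) xi =
  ((fcst R d)^-1 ^+ 2)%:C%C * fourier g xi *
  cintg m (fun z => (e z)%:C%C * (fourier kap (tau z *: xi) * fourier lam (tau z *: xi))).
Proof.
move=> hg; have [C C0 hC] := layer_decay (2 * d) hg.
have iC := calderon_integrable ss xi hk hl ck.
rewrite fourierE.
have -> : cintg mu (fun x => char xi x * layers g x) =
    cintg mu (fun x => cintg m (fun z => char xi x * layer g z x)).
  by apply: eq_cintg => x; rewrite -cintgZ//; exact: cinteg_layer.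
rewrite (@cintg_fubini_dom _ _ _ _ _ mu m _ (fun u => C * brk u ^- (2 * d)) (fun z => e z * tau z)).
- have -> : cintg m (fun z => cintg mu (fun x => char xi x * layer g z x)) =
    cintg m (fun z => (fcst R d)^-1%:C%C * (((fcst R d)^-1 ^+ 2)%:C%C * fourier g xi *
      ((e z)%:C%C * (fourier kap (tau z *: xi) * fourier lam (tau z *: xi))))).
    apply: eq_cintg => z.
    have hF : fourier (layer g z) xi = (fcst R d)%:C%C * cintg mu (fun x => char xi x * layer g z x).
      by rewrite fourierE.
    transitivity ((fcst R d)^-1%:C%C * fourier (layer g z) xi).
      by rewrite hF mulrA -rmorphM/= mulVf ?mul1r// gt_eqF// fcst_gt0.
    rewrite fourierZ; last by apply: csch_cinteg; exact: csch_mol.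
    rewrite (fourier_cmol xi (tauN z) hg hchi) (fourier_cmol _ oneN hk hl) scale1r rmorphXn/=.
    move: (fourier g xi) (fourier kap _) (fourier lam _) (_%:C)%C (_%:C)%C => G A B E F; ring.
  rewrite cintgZ; last exact: cintegZ.
  rewrite cintgZ; last exact: iC.
  have Fi : (fcst R d)%:C%C * ((fcst R d)^-1)%:C%C = 1.
    by rewrite -rmorphM/= mulfV ?gt_eqF ?fcst_gt0.
  by rewrite mulrA Fi mul1r.
- move=> b; apply: measurable_partM => c; last exact: measurable_layer2.
  exact: (measurableT_comp (measurable_char c xi) measurable_fst).
- by apply: rintZ; exact: rint_brkV.
- exact: integrable_scale_density.
- move=> x z; rewrite cabsM cabs_cis mul1r mulrAC ler_pdivlMr ?brkX_gt0//.
Qed.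

Lemma cinteg_decay (f : Rd -> R[i]) C : (forall b, continuous (fun x => part b (f x))) ->
  (forall u, cabs (f u) * brk u ^+ (2 * d) <= C) -> cinteg mu f.
Proof.
move=> cf hf b; apply: (rint_dom (C := C)); first by apply: continuous_measurable_rV; exact: cf.
by move=> u; apply: le_trans (hf u); rewrite ler_wpM2r ?exprn_ge0 ?brk_ge0// part_cabs.
Qed.

(** Both sides have the same Fourier transform, by the Calderon identity. *)
Lemma calderon_reproducing g u : csch g -> g u = cmol g chi0 1 u + layers g u.
Proof.
move=> hg; have [C C0 hC] := layers_decay (2 * d) hg.
have iL : cinteg mu (layers g).
  by apply: (cinteg_decay (C := C)) => //; move=> b; exact: layers_continuous.
have h0 : csch (cmol g chi0 1) by exact: csch_mol.
have hD : csch (fun x => g x + -1 * cmol g chi0 1 x) by apply: cschD => //; exact: cschZ.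
have [B B0 hB] := csch_cabs 0 hD.
have [C' C'0 hC'] := layers_decay 0 hg.
have H := @fourier_eq0 _ _ (fun x => (g x + -1 * cmol g chi0 1 x) + -1 * layers g x) (B + C').
have /eqP : (g u + -1 * cmol g chi0 1 u) + -1 * layers g u = 0.
  apply: H.
  - move=> b x; have FF : Filter (nbhs x) by exact: nbhs_filter.
    rewrite (_ : (fun x => part b _) = (fun x => part b (g x + -1 * cmol g chi0 1 x) - part b (layers g x))).
      apply: cvgB; first exact: (rsch_continuous (hD b)).
      exact: layers_continuous.
    by apply/funext => y; rewrite partD !mulN1r partN.
  - move=> x; apply: le_trans (cabsD _ _) _; rewrite lerD//.
      by have := hB x; rewrite expr0 mulr1.
    by rewrite mulN1r cabsN; have := hC' x; rewrite expr0 mulr1.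
  - by apply: cintegD; [exact: csch_cinteg|exact: cintegZ].
  - move=> xi; have i0 := csch_cinteg h0; have ig := csch_cinteg hg.
    rewrite fourierD; [|exact: csch_cinteg|exact: cintegZ].
    rewrite fourierD//; last exact: cintegZ.
    rewrite !fourierZ// fourier_layers// !fourier_cmol// !scale1r.
    have := calderon xi; set S := cintg _ _ => E.
    rewrite [LHS](_ : _ = fourier g xi * (1 - (fcst R d)^-1%:C%C ^+ 2 *
      (fourier kap0 xi * fourier lam0 xi + S))); last by rewrite rmorphXn/=; ring.
    rewrite E -rmorphXn -rmorphM/= -exprMn mulVf ?gt_eqF ?fcst_gt0// expr1n.
    by rewrite (_ : 1%:C%C = 1) ?subrr ?mulr0.
by rewrite !mulN1r -addrA -opprD subr_eq0 => /eqP.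
Qed.

Lemma layersE g : csch g -> layers g = fun u => -1 * cmol g chi0 1 u + g u.
Proof. by move=> hg; apply/funext => u; rewrite mulN1r (calderon_reproducing u hg) addKr. Qed.

(** The reproducing formula exhibits the superposition as a difference of two
    rapidly decreasing functions. *)
Lemma csch_layers g : csch g -> csch (layers g).
Proof. by move=> hg; rewrite layersE//; apply: cschD => //; apply: cschZ; exact: csch_mol. Qed.

Lemma pderiv_layer s b g z x : csch g ->
  pderiv s (fun u => part b (layer g z u)) x = part b (layer (cpderiv s g) z x).
Proof.
move=> hg; rewrite pderiv_partZ; last exact: csch_mol.
congr (part b (_ * _)); apply: complex_eqP => c.
by rewrite cpderiv_part pderiv_part_cmol.
Qed.

Lemma pderiv_layers s b g x : csch g ->
  pderiv s (fun u => part b (layers g u)) x = part b (layers (cpderiv s g) x).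
Proof.
move=> hg; have hs := csch_cpderiv s hg; have h0 : csch (cmol g chi0 1) by exact: csch_mol.
rewrite !layersE// (_ : (fun u => part b _) =
  (fun u => -1 * part b (cmol g chi0 1 u) + part b (g u))); last first.
  by apply/funext => u; rewrite partD mulN1r partN mulN1r.
rewrite pderiv_linear; [|exact: (rsch_smooth (h0 b))|exact: (rsch_smooth (hg b))].
by rewrite pderiv_part_cmol// partD !mulN1r partN -cpderiv_part.
Qed.

Lemma osc_product (B ey ez py pz qy qz C1 C2 t s : R) : qy = ey * py -> qz = ez * pz -> 0 <= ey -> 0 <= s -> 0 <= C1 -> 0 <= C2 -> 0 <= B ->
  `|py - pz| * B <= C1 * `|t| -> `|pz| * B <= C2 * s ->
  `|qy - qz| * B <= (C1 + C2) * (ey * `|t| + `|ey - ez| * s).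
Proof.
move=> -> -> ey0 s0 C10 C20 B0 A1 A2.
have -> : ey * py - ez * pz = ey * (py - pz) + (ey - ez) * pz by ring.
apply: (@le_trans _ _ (ey * (`|py - pz| * B) + `|ey - ez| * (`|pz| * B))).
  rewrite !mulrA -mulrDl ler_wpM2r//; apply: le_trans (ler_normD _ _) _.
  by rewrite !normrM (ger0_norm ey0).
rewrite mulrDr; apply: lerD.
  rewrite [leRHS]mulrCA ler_wpM2l//; apply: le_trans A1 _.
  by rewrite ler_wpM2r// lerDl.
rewrite [leRHS]mulrCA ler_wpM2l//; apply: le_trans A2 _.
by rewrite ler_wpM2r ?lerDr.
Qed.

(** Within a cell of scales a layer changes by the change of its convolution factor,
    Lipschitz in the scale, and by the change of the density, which multiplies a factor of
    the order of the square of the scale; the cover of a space of scales makes both small. *)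
Lemma layer_osc g N : csch g -> exists2 C, 0 <= C & forall b s x y z, (size s <= N)%N ->
  `|pderiv s (fun u => part b (layer g y u)) x - pderiv s (fun u => part b (layer g z u)) x| *
    brk x ^+ N <= C * (e y * `|tau y - tau z| + `|e y - e z| * tau z ^+ 2).
Proof.
move=> hg.
have := @seq_uniform _ 'I_d (fun s C => forall b x y z,
  `|pderiv s (fun u => part b (layer g y u)) x - pderiv s (fun u => part b (layer g z u)) x| *
    brk x ^+ N <= C * (e y * `|tau y - tau z| + `|e y - e z| * tau z ^+ 2)) N.
case=> [s|s C C' CC' hC b x y z|C C0 hC]; last by exists C => // b s x y z sN; exact: hC.
  have hs := csch_cpderiv s hg.
  have [C1 C10 hC1] := cmol_lip N hs hchi.
  have [C2 C20 hC2] := cmol_cancel2 2 N hs hk hl ck.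
  exists (C1 + C2) => b x y z;
  have pl w : pderiv s (fun u => part b (layer g w u)) x =
      e w * part b (cmol (cpderiv s g) chi (tau w) x).
    by rewrite pderiv_layer// part_realM.
  apply: (osc_product (pl y) (pl z)); [by []|exact: sqr_ge0|by []|by []|by rewrite exprn_ge0// brk_ge0| |].
    by apply: hC1.
  apply: le_trans (_ : cabs (cmol (cpderiv s g) chi (tau z) x) * brk x ^+ N <= _).
    by rewrite ler_wpM2r ?part_cabs// exprn_ge0// brk_ge0.
  by have := hC2 (tau z) x (tauN z); rewrite (gtr0_norm (tau0 z)).
apply: le_trans (hC b x y z) _; rewrite ler_wpM2r//.
by apply: addr_ge0; [exact: mulr_ge0|apply: mulr_ge0 => //; exact: sqr_ge0].
Qed.

Lemma layer_seminorm g N : csch g -> exists2 C, 0 <= C &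
  forall z, seminorm_le N (C * (e z * tau z)) (layer g z).
Proof.
move=> hg.
have := @seq_uniform _ 'I_d (fun s C => forall z u,
  cabs (layer (cpderiv s g) z u) * brk u ^+ N <= C * (e z * tau z)) N.
case=> [s|s C C' CC' hC z u|C C0 hC].
- by have [C C0 hC] := layer_decay N (csch_cpderiv s hg); exists C.
- by apply: le_trans (hC z u) _; rewrite ler_wpM2r// mulr_ge0// ltW.
exists C => // z b s x sN; rewrite pderiv_layer//; apply: le_trans (hC s sN z x).
by rewrite ler_wpM2r ?part_cabs// exprn_ge0// brk_ge0.
Qed.

(** The functional passes under the integral over the scales. *)
Lemma tempered_layers F g : tempered F -> csch g ->
  ((cabs (F (layers g)))%:E <= \int[m]_z (e z * cabs (F (cmol g chi (tau z))))%:E)%E.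
Proof.
move=> tF hg.
have -> : (\int[m]_z (e z * cabs (F (cmol g chi (tau z))))%:E =
    \int[m]_z (cabs (F (layer g z)))%:E)%E.
  apply: eq_integral => z _; rewrite temperedZ//; last exact: csch_mol.
  by rewrite cabsM cabs_real ger0_norm.
apply: (tempered_le_integral measurableT tF (csch_layers hg) (fun z _ => csch_layer z hg)
  (integrable_scale_density ss)).
- move=> b s x; under eq_fun do rewrite pderiv_layer//; split.
    exact: (cinteg_layer x (csch_cpderiv s hg) b).
  by rewrite pderiv_layers// part_cintg.
- by move=> N; have [C C0 hC] := layer_seminorm N hg; exists C => // z _.
- move=> N eta eta0; have [C C0 hC] := layer_osc N hg.
  have [|A [mA cA fA hA]] := ss_cover ss (eta := eta / (C + 1)).
    by rewrite divr_gt0// ltr_wpDl.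
  exists A; split=> // [z _|i y z Ay Az _ _ b s x sN]; first by have [i Ai] := cA z; exists i.
  apply: le_trans (hC b s x y z sN) _.
  apply: le_trans (_ : (C + 1) * (eta / (C + 1) * (e y * tau y)) <= _).
    apply: ler_pM => //; rewrite ?lerDl//.
      by apply: addr_ge0; [exact: mulr_ge0|apply: mulr_ge0 => //; exact: sqr_ge0].
    exact: hA Ay Az.
  by rewrite !mulrA (mulrAC _ eta) mulfV ?mul1r// gt_eqF// ltr_wpDl.
Qed.

End reproduction.

(** * Tempered functionals and convolutions *)

Section convolution_bound.
Context (R : realType) (d : nat).
Local Notation Rd := 'rV[R]_d.
Local Notation mu := (@leb R d).

Lemma norm_coord_le (x : Rd) (A : R) : 0 <= A -> (forall i, `|x ord0 i| <= A) -> `|x| <= A.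
Proof.
move=> A0 h; rewrite /Num.norm/= mx_normrE; apply: bigmax_le => // -[i j] _.
by rewrite ord1; exact: h.
Qed.

(** Translates of a cube of small side, centred at the points of a lattice. *)
Lemma small_cells (eta : R) : 0 < eta -> exists A : nat -> set Rd,
  [/\ forall i, measurable (A i), forall y, exists i, A i y, forall i, (mu (A i) < +oo)%E &
    forall i y z, A i y -> A i z -> enorm (y - z) <= eta].
Proof.
move=> eta0; pose de := eta / (2 * (d.+1)%:R).
have de0 : 0 < de by rewrite divr_gt0// mulr_gt0.
pose cell (k : 'rV[int]_d) : set Rd := [set y | forall i, `|y ord0 i - de * (k ord0 i)%:~R| <= de].
have mcell k : measurable (cell k).
  pose c : Rd := \row_i (de * (k ord0 i)%:~R).
  have mf : measurable_fun setT (fun y : Rd => y - 1 *: c).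
    exact: (measurable_subZ (f := id) (g := cst c) (t := cst 1)).
  have := mf measurableT _ (@measurable_cube R d de); rewrite setTI.
  congr measurable; apply/seteqP; split => y h i; have := h i; by rewrite !mxE mul1r.
exists (fun n => if unpickle n is Some k then cell k else set0); split.
- by move=> i; case: unpickle.
- move=> y; exists (pickle (\row_i Num.floor (y ord0 i / de) : 'rV[int]_d)).
  rewrite pickleK => i; rewrite mxE.
  have := floorD1_gt (y ord0 i / de); rewrite intrD ltr_pdivrMr// mulrDl mul1r => h1.
  have := floor_le (y ord0 i / de); rewrite ler_pdivlMr// => h2.
  by rewrite ler_norml mulrC; apply/andP; split; lra.
- move=> i; case: unpickle => [k|]; last by rewrite measure0.
  pose M := (Num.trunc (de + \sum_i `|de * (k ord0 i)%:~R|)).+1.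
  apply: le_lt_trans (leb_cube R d M); apply: le_measure; rewrite ?inE//.
    exact: measurable_cube.
  move=> y h i0; have := h i0 => h0.
  rewrite ltW//; apply: le_lt_trans (truncnS_gt _).
  rewrite -(subrK (de * (k ord0 i0)%:~R) (y ord0 i0)).
  apply: le_trans (ler_normD _ _) _; apply: lerD => //.
  by rewrite (bigD1 i0)//= lerDl sumr_ge0.
- move=> i y z; case: unpickle => [k|//] hy hz.
  apply: le_trans (enorm_norm _) _.
  apply: (@le_trans _ _ (d%:R * (2 * de))); last first.
    rewrite (_ : _ * _ = eta * (d%:R / d.+1%:R)); last first.
      have n0 : (d.+1)%:R != 0 :> R by rewrite pnatr_eq0.
      by rewrite /de; move: (d.+1%:R : R) n0 => n n0; field.
    by rewrite ler_piMr ?(ltW eta0)// ler_pdivrMr// mul1r ler_nat.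
  rewrite ler_wpM2l//; apply: norm_coord_le => [|i0]; first by rewrite mulr_ge0// ltW.
  rewrite !mxE; have := hy i0; have := hz i0; rewrite !ler_norml => /andP[] ? ? /andP[] ? ?.
  by apply/andP; split; lra.
Qed.

Lemma brk_le2 (v : Rd) M : enorm v <= 1 -> brk v ^+ M <= 2 ^+ M.
Proof. by move=> h; rewrite lerXn2r ?nnegrE ?brk_ge0// /brk; lra. Qed.

Variables (F : (Rd -> R[i]) -> R[i]) (l K : Rd -> R[i]).
Hypotheses (tF : tempered F) (hl : csch l) (hK : csch K).
Local Notation G := (fun (y u : Rd) => K y * l (u - y)).

Let hG y : csch (G y). Proof. by apply: cschZ; exact: csch_translate. Qed.

Lemma pderiv_translates s b y x : pderiv s (fun u => part b (G y u)) x =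
  part b (K y * cpderiv s l (x - y)).
Proof. by rewrite pderiv_partZ ?cpderiv_translate//; exact: csch_translate. Qed.

(** Moving the centre of a translate by at most 1 costs a Lipschitz constant, while
    the decay of the kernel [K] remains available. *)
Lemma translates_osc N : exists2 C, 0 <= C & forall b s x y z, (size s <= N)%N -> enorm (y - z) <= 1 ->
  `|pderiv s (fun u => part b (G y u)) x - pderiv s (fun u => part b (G z u)) x| * brk x ^+ N <=
  C * enorm (y - z) * brk y ^- (2 * d).
Proof.
have [C1 C10 hC1] := csch_lip (N + 2 * d) hK.
have [C2 C20 hC2] := csch_cabs (N + 2 * d) hK.
have := @seq_uniform _ 'I_d (fun s C => forall b x y z, enorm (y - z) <= 1 ->
  `|pderiv s (fun u => part b (G y u)) x - pderiv s (fun u => part b (G z u)) x| * brk x ^+ N <=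
  C * enorm (y - z) * brk y ^- (2 * d)) N.
case=> [s|s C C' CC' hC b x y z yz|C C0 hC]; last by exists C => // b s x y z sN; exact: hC.
  have hs := csch_cpderiv s hl.
  have [C3 C30 hC3] := csch_cabs N hs; have [C4 C40 hC4] := csch_lip N hs.
  exists (C1 * 2 ^+ (N + 2 * d) * C3 + C2 * 2 ^+ (N + 2 * d) * (C4 * 2 ^+ N)) => b x y z yz.
  rewrite !pderiv_translates -partN -partD ler_pdivlMr ?brkX_gt0//.
  apply: (@le_trans _ _ (cabs (K y * cpderiv s l (x - y) - K z * cpderiv s l (x - z)) * brk x ^+ N * brk y ^+ (2 * d))).
    by rewrite ler_wpM2r ?exprn_ge0 ?brk_ge0// ler_wpM2r ?exprn_ge0 ?brk_ge0// part_cabs.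
  have -> : K y * cpderiv s l (x - y) - K z * cpderiv s l (x - z) =
    (K (y + (z - y)) - K y) * - cpderiv s l (x - y) +
    K z * - (cpderiv s l ((x - y) + (y - z)) - cpderiv s l (x - y)).
    rewrite [y + _]addrC subrK (_ : x - y + (y - z) = x - z); first by ring.
    by rewrite addrA subrK.
  have zy : enorm (z - y) = enorm (y - z) by rewrite -enormN opprB.
  have h1 := hC1 y (z - y); rewrite zy in h1.
  have h2 := hC2 z; have h3 := hC3 (x - y); have h4 := hC4 (x - y) (y - z).
  have byz M : brk (y - z) ^+ M <= 2 ^+ M by exact: brk_le2.
  have bzy M : brk (z - y) ^+ M <= 2 ^+ M by apply: brk_le2; rewrite zy.
  have B0 M (u : Rd) : 0 <= brk u ^+ M by rewrite exprn_ge0 ?brk_ge0.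
  have bx : brk x ^+ N <= brk (x - y) ^+ N * brk y ^+ N by rewrite -{1}(subrK y x) brkXD.
  have by_ : brk y ^+ (N + 2 * d) <= 2 ^+ (N + 2 * d) * brk z ^+ (N + 2 * d).
    rewrite -{1}(subrK z y); apply: le_trans (brkXD _ _ _) _.
    by rewrite ler_wpM2r.
  set en := enorm (y - z) in h1 h4 *; have en0 : 0 <= en by exact: enorm_ge0.
  set T3 := cabs (cpderiv s l (x - y)) in h3.
  set T1 := cabs (_ - K y) in h1; set T4 := cabs (_ - cpderiv s l (x - y)) in h4.
  have L1 : cabs ((K (y + (z - y)) - K y) * - cpderiv s l (x - y)) * brk x ^+ N * brk y ^+ (2 * d)
     <= C1 * 2 ^+ (N + 2 * d) * C3 * en.
    rewrite cabsM cabsN -/T1 -/T3.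
    apply: (@le_trans _ _ ((T1 * brk y ^+ (N + 2 * d)) * (T3 * brk (x - y) ^+ N))).
      rewrite exprD [leRHS](_ : _ = T1 * T3 * (brk (x - y) ^+ N * brk y ^+ N) * brk y ^+ (2 * d)); last by ring.
      by rewrite ler_wpM2r// ler_wpM2l ?mulr_ge0 ?cabs_ge0.
    rewrite [leRHS]mulrAC; apply: ler_pM => //; rewrite ?mulr_ge0 ?cabs_ge0//.
    by apply: le_trans h1 _; rewrite mulrAC ler_wpM2r// ler_wpM2l.
  have L2 : cabs (K z * - (cpderiv s l (x - y + (y - z)) - cpderiv s l (x - y))) * brk x ^+ N * brk y ^+ (2 * d)
     <= C2 * 2 ^+ (N + 2 * d) * (C4 * 2 ^+ N) * en.
    rewrite cabsM cabsN -/T4.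
    apply: (@le_trans _ _ ((cabs (K z) * brk y ^+ (N + 2 * d)) * (T4 * brk (x - y) ^+ N))).
      rewrite exprD [leRHS](_ : _ = cabs (K z) * T4 * (brk (x - y) ^+ N * brk y ^+ N) * brk y ^+ (2 * d)); last by ring.
      by rewrite ler_wpM2r// ler_wpM2l ?mulr_ge0 ?cabs_ge0.
    rewrite -[leRHS]mulrA; apply: ler_pM => //; rewrite ?mulr_ge0 ?cabs_ge0//.
      apply: (@le_trans _ _ (cabs (K z) * brk z ^+ (N + 2 * d) * 2 ^+ (N + 2 * d))).
        by rewrite -mulrA ler_wpM2l ?cabs_ge0// mulrC.
      by rewrite ler_wpM2r.
    by apply: le_trans h4 _; rewrite mulrAC ler_wpM2r// ler_wpM2l.
  set U := (K (y + (z - y)) - K y) * _ in L1 *; set V := K z * - _ in L2 *.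
  rewrite (mulrDl _ _ en); apply: le_trans (lerD L1 L2).
  by rewrite -!(mulrDl _ _ (brk _ ^+ _)) ler_wpM2r// ler_wpM2r// cabsD.
apply: le_trans (hC b x y z yz) _; rewrite -!mulrA ler_wpM2r// mulr_ge0 ?enorm_ge0//.
by rewrite invr_ge0 exprn_ge0 ?brk_ge0.
Qed.

(** The convolution is an integral of translates of [l], over cells of positions. *)
Lemma tempered_cmol :
  ((cabs (F (cmol l K 1)))%:E <= \int[mu]_y (cabs (K y) * cabs (F (fun u => l (u - y))))%:E)%E.
Proof.
have one : `|1 : R| <= 1 by rewrite normr1.
have -> : (\int[mu]_y (cabs (K y) * cabs (F (fun u => l (u - y))))%:E =
    \int[mu]_y (cabs (F (G y)))%:E)%E.
  by apply: eq_integral => y _; rewrite temperedZ ?cabsM//; exact: csch_translate.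
apply: (tempered_le_integral (rho := fun y => brk y ^- (2 * d)) measurableT tF _ (fun y _ => hG y)).
- exact: csch_mol.
- exact: rint_brkV.
- move=> b s x; under eq_fun do rewrite pderiv_translates.
  rewrite pderiv_part_cmol// part_cintg.
  have E y : part b (cpderiv s l (x - 1 *: y) * K y) = part b (K y * cpderiv s l (x - y)).
    by rewrite scale1r mulrC.
  split; last exact: eq_Rintegral.
  have := cinteg_mol 1 x (csch_cpderiv s hl) hK b.
  by apply: eq_integrable => // y _; rewrite /= E.
- move=> N.
  have [C2 C20 hC2] := csch_cabs (N + 2 * d) hK.
  have := @seq_uniform _ 'I_d (fun s C => forall y b x,
    `|pderiv s (fun u => part b (G y u)) x| * brk x ^+ N <= C * brk y ^- (2 * d)) N.
  case=> [s|s C C' CC' hC y b x|C C0 hC]; last by exists C => // y _ b s x sN; exact: hC.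
    have [C3 C30 hC3] := csch_cabs N (csch_cpderiv s hl).
    exists (C2 * C3) => y b x; rewrite pderiv_translates ler_pdivlMr ?brkX_gt0//.
    apply: (@le_trans _ _ ((cabs (K y) * brk y ^+ (N + 2 * d)) * (cabs (cpderiv s l (x - y)) * brk (x - y) ^+ N))).
      rewrite exprD [leRHS](_ : _ = cabs (K y) * cabs (cpderiv s l (x - y)) *
        (brk (x - y) ^+ N * brk y ^+ N) * brk y ^+ (2 * d)); last by ring.
      rewrite -cabsM ler_wpM2r ?exprn_ge0 ?brk_ge0//; apply: ler_pM => //.
      - by rewrite exprn_ge0 ?brk_ge0.
      - exact: part_cabs.
      - by rewrite -{1}(subrK y x) brkXD.
    by apply: ler_pM; rewrite ?mulr_ge0 ?cabs_ge0 ?exprn_ge0 ?brk_ge0.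
  apply: le_trans (hC y b x) _; rewrite ler_wpM2r// invr_ge0 exprn_ge0 ?brk_ge0//.
- move=> N eta eta0; have [C C0 hC] := translates_osc N.
  pose del := Num.min 1 (eta / (C + 1)).
  have C1 : 0 < C + 1 by rewrite ltr_wpDl.
  have del0 : 0 < del by rewrite /del lt_min ltr01 divr_gt0.
  have [A [mA cA fA hA]] := small_cells del0.
  exists A; split=> // [y _|i y z Ay Az _ _ b s x sN]; first by have [i Ai] := cA y; exists i.
  have yz := hA i y z Ay Az.
  apply: le_trans (hC b s x y z sN _) _.
    by apply: le_trans yz _; rewrite /del ge_min lexx.
  rewrite ler_wpM2r ?invr_ge0 ?exprn_ge0 ?brk_ge0//.
  apply: (@le_trans _ _ ((C + 1) * (eta / (C + 1)))).
    apply: ler_pM; rewrite ?enorm_ge0 ?lerDl//.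
    by apply: le_trans yz _; rewrite /del ge_min lexx orbT.
  by rewrite mulrCA mulfV ?mulr1// gt_eqF.
Qed.

End convolution_bound.

(** * Continuity in translation and dilation *)

Section distributions.
Context (R : realType) (d : nat).
Local Notation Rd := 'rV[R]_d.
Implicit Types (F : (Rd -> R[i]) -> R[i]) (g h l : Rd -> R[i]).

(** The two families of seminorms, on complex functions and on their parts,
    dominate each other. *)
Lemma td_tempered (f : tempered_distribution R d) : tempered f.
Proof.
split=> [c g h hg hh|]; first by apply: td_linear; exact: csch_schwartz.
have [N [K hK]] := td_continuous f.
exists N, (2 * `|K|); split=> [|g A hg hA]; first by rewrite mulr_ge0.
have A0 : 0 <= A.
  by apply: le_trans (hA true [::] 0 isT); rewrite mulr_ge0// exprn_ge0// brk_ge0.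
have sA : (schwartz_seminorm N g <= (2 * A)%:E)%E.
  apply: ge_ereal_sup => _ [s [x [sN ->]]]; rewrite lee_fin mulrC -ler_pdivlMr ?brkX_gt0//.
  rewrite -mulrA; apply: cabs_parts_le => b; rewrite cpderiv_part ler_pdivlMr ?brkX_gt0//.
  exact: hA.
have s0 : (0 <= schwartz_seminorm N g)%E.
  apply: le_ereal_sup_tmp; exists ((1 + enorm (0 : Rd)) ^+ N * cabs (cpderiv [::] g 0))%:E.
    by exists [::], 0.
  by rewrite lee_fin mulr_ge0 ?cabs_ge0// exprn_ge0// (brk_ge0 (0 : Rd)).
rewrite -lee_fin; apply: le_trans (hK g (csch_schwartz hg)) _.
apply: (@le_trans _ _ (`|K|%:E * schwartz_seminorm N g)%E).
  by apply: lee_wpmul2r => //; rewrite lee_fin ler_norm.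
apply: (@le_trans _ _ (`|K|%:E * (2 * A)%:E)%E).
  by apply: lee_wpmul2l => //; rewrite lee_fin.
by rewrite -EFinM lee_fin mulrCA mulrA.
Qed.

Lemma tempered_reflect F x : tempered F -> tempered (fun h => F (fun u => h (x - u))).
Proof.
move=> tF; split=> [c g h hg hh|].
  by rewrite (tempered_lin tF)//; exact: csch_reflect.
have [N [K [K0 hK]]] := tempered_bd tF; exists N, (K * brk x ^+ N).
split=> [|g A hg hA]; first by rewrite mulr_ge0// exprn_ge0// brk_ge0.
rewrite -mulrA; apply: hK; first exact: csch_reflect.
move=> b s u sN.
have E : (fun v => part b (g (x - v))) = (fun v => part b (g (-1 *: v + x))).
  by apply/funext => v; rewrite scaleN1r addrC.
rewrite E (pderiv_affine s (-1) x (rsch_smooth (hg b))) normrM normrX normrN1 expr1n mul1r.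
rewrite scaleN1r addrC.
have bu : brk u ^+ N <= brk x ^+ N * brk (x - u) ^+ N.
  have := brkXD x (u - x) N; rewrite (addrC x) subrK => h.
  by apply: le_trans h _; rewrite -(brkN (u - x)) opprB.
apply: le_trans (ler_wpM2l (normr_ge0 _) bu) _.
by rewrite mulrCA ler_wpM2l ?exprn_ge0 ?brk_ge0// hA.
Qed.

Lemma powr_locally_lipschitz m (r0 : R) : 0 < r0 -> exists2 C, 0 <= C &
  forall r, `|r - r0| <= r0 / 2 -> `|r ^+ m - r0 ^+ m| <= C * `|r - r0|.
Proof.
move=> r00; elim: m => [|m [C C0 ih]]; first by exists 0 => // r _; rewrite subrr normr0 mul0r.
exists (2 * r0 * C + r0 ^+ m) => [|r hr]; first by rewrite addr_ge0 ?mulr_ge0 ?exprn_ge0// ltW.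
have r2 : `|r| <= 2 * r0.
  by move: hr; rewrite ler_norml => /andP[? ?]; rewrite ler_norml; apply/andP; split; lra.
have -> : r ^+ m.+1 - r0 ^+ m.+1 = r * (r ^+ m - r0 ^+ m) + (r - r0) * r0 ^+ m.
  by rewrite !exprS; ring.
apply: le_trans (ler_normD _ _) _; rewrite !normrM mulrDl; apply: lerD.
  rewrite (_ : 2 * r0 * C * `|r - r0| = 2 * r0 * (C * `|r - r0|)); last by ring.
  by apply: ler_pM => //; exact: ih.
by rewrite normrX (gtr0_norm r00) mulrC.
Qed.

(** The segment between two nearby affine images of [u] stays at a distance
    comparable to [brk u] from the origin. *)
Lemma affine_segment (r0 : R) (p0 : Rd) : 0 < r0 -> exists2 c, 1 <= c & forall p r u th,
  enorm (p - p0) <= 1 -> `|r - r0| <= r0 / 2 -> 0 <= th <= 1 ->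
  brk u <= c * brk ((p0 - r0 *: u) + th *: ((p - p0) - (r - r0) *: u)).
Proof.
move=> r00; pose P := enorm p0 + 1; have P0 : 0 <= P by rewrite addr_ge0 ?enorm_ge0.
exists (1 + (1 + P) * (2 / r0)) => [|p r u th hp hr /andP[th0 th1]].
  by rewrite lerDl; apply: mulr_ge0; [apply: addr_ge0|apply: divr_ge0 => //; exact: ltW].
pose pt := p0 + th *: (p - p0); pose rt := r0 + th * (r - r0).
have -> : (p0 - r0 *: u) + th *: ((p - p0) - (r - r0) *: u) = pt - rt *: u.
  by rewrite /pt /rt; apply/rowP => i; rewrite !mxE; ring.
have rt0 : r0 / 2 <= rt.
  have : `|th * (r - r0)| <= r0 / 2.
    by rewrite normrM ger0_norm//; apply: le_trans hr; rewrite ler_piMl.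
  by rewrite ler_norml /rt => /andP[? ?]; lra.
have ptP : enorm pt <= P.
  apply: le_trans (enormD _ _) _; rewrite lerD2l enormZ ger0_norm//.
  by apply: le_trans hp; rewrite ler_piMl// enorm_ge0.
have h : rt * enorm u <= P + enorm (pt - rt *: u).
  have -> : rt * enorm u = enorm (rt *: u) by rewrite enormZ ger0_norm//; lra.
  apply: le_trans (_ : enorm (pt - (pt - rt *: u)) <= _).
    by rewrite opprB [pt + _]addrC subrK.
  by apply: le_trans (enormD _ _) _; rewrite enormN lerD2r.
have e0 := enorm_ge0 u; set X := enorm (pt - rt *: u) in h *.
have X0 : 0 <= X by exact: enorm_ge0.
have h2 : enorm u <= (2 / r0) * (P + X).
  rewrite mulrAC ler_pdivlMr//.
  have := ler_wpM2r e0 rt0; lra.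
have i0 : 0 <= 2 / r0 by rewrite divr_ge0// ltW.
rewrite /brk -/X; move: (2 / r0) i0 h2 => q q0 h2.
have PX : 0 <= P * X by rewrite mulr_ge0.
have qPX : 0 <= q * (P * X) by rewrite mulr_ge0.
by rewrite [leRHS](_ : _ = 1 + X + q * (P + X) + q + q * (P * X)); [lra|ring].
Qed.

(** The mean value inequality along the segment of [affine_segment]. *)
Lemma affine_lip (g : Rd -> R) (r0 : R) (p0 : Rd) N : rsch g -> 0 < r0 -> exists2 C, 0 <= C &
  forall p r u, enorm (p - p0) <= 1 -> `|r - r0| <= r0 / 2 ->
  `|g (p - r *: u) - g (p0 - r0 *: u)| * brk u ^+ N <= C * (enorm (p - p0) + `|r - r0|) /\
  `|g (p - r *: u)| * brk u ^+ N <= C.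
Proof.
move=> hg r00; have [c c1 hc] := affine_segment p0 r00.
have c0 : 0 <= c by rewrite (le_trans _ c1).
have [B B0 hB] := rsch_bound N.+1 1 hg.
have key s p r u th : (size s <= 1)%N -> enorm (p - p0) <= 1 -> `|r - r0| <= r0 / 2 -> 0 <= th <= 1 ->
    `|pderiv s g ((p0 - r0 *: u) + th *: ((p - p0) - (r - r0) *: u))| * brk u ^+ N.+1 <= B * c ^+ N.+1.
  move=> s1 hp hr hth; set U := _ + _.
  apply: (@le_trans _ _ (`|pderiv s g U| * (c * brk U) ^+ N.+1)).
    rewrite ler_wpM2l// lerXn2r ?nnegrE ?brk_ge0 ?mulr_ge0 ?brk_ge0//; exact: hc.
  rewrite exprMn mulrCA mulrC ler_wpM2r ?exprn_ge0//; exact: hB.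
exists (B * c ^+ N.+1 * d%:R + B * c ^+ N.+1) => [|p r u hp hr].
  by rewrite addr_ge0 ?mulr_ge0// exprn_ge0.
have hN : brk u ^+ N <= brk u ^+ N.+1.
  by rewrite exprS ler_peMl ?exprn_ge0 ?brk_ge0 ?brk_ge1.
have BC : 0 <= B * c ^+ N.+1 by rewrite mulr_ge0 ?exprn_ge0.
split; last first.
  have := key [::] p r u 1 isT hp hr; rewrite lexx ler01 => /(_ isT).
  rewrite scale1r (_ : (p0 - r0 *: u) + ((p - p0) - (r - r0) *: u) = p - r *: u); last first.
    by apply/rowP => i; rewrite !mxE; ring.
  move=> h; apply: le_trans (_ : B * c ^+ N.+1 <= _); last by rewrite lerDr mulr_ge0.
  by apply: le_trans h; rewrite ler_wpM2l.
pose V := (p - p0) - (r - r0) *: u.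
have := @taylor_bound _ _ 1 g (p0 - r0 *: u) V (B * c ^+ N.+1 / brk u ^+ N.+1) (rsch_smooth hg) _ _.
rewrite taylor_rem1 (_ : p0 - r0 *: u + V = p - r *: u); last first.
  by rewrite /V; apply/rowP => i; rewrite !mxE; ring.
move=> /(_ _ _)-h.
have {h} h : `|g (p - r *: u) - g (p0 - r0 *: u)| <= B * c ^+ N.+1 / brk u ^+ N.+1 * (d%:R * enorm V) ^+ 1.
  apply: h; first by rewrite divr_ge0// exprn_ge0// brk_ge0.
  by move=> s th s1 hth; rewrite ler_pdivlMr ?brkX_gt0//; apply: key => //; rewrite s1.
have hV : enorm V <= (enorm (p - p0) + `|r - r0|) * brk u.
  apply: le_trans (enormD _ _) _; rewrite enormN enormZ mulrDl; apply: lerD.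
    by rewrite ler_peMr ?enorm_ge0 ?brk_ge1.
  by rewrite ler_wpM2l// enorm_brk.
set E := enorm (p - p0) + `|r - r0| in hV *.
have E0 : 0 <= E by rewrite addr_ge0 ?enorm_ge0.
apply: (@le_trans _ _ (B * c ^+ N.+1 * d%:R * E)); last by rewrite ler_wpM2r// lerDl.
rewrite -ler_pdivlMr ?brkX_gt0//; apply: le_trans h _; rewrite expr1.
apply: (@le_trans _ _ (B * c ^+ N.+1 / brk u ^+ N.+1 * (d%:R * (E * brk u)))).
  by rewrite ler_wpM2l ?divr_ge0 ?exprn_ge0 ?brk_ge0// ler_wpM2l.
rewrite (exprS (brk u)) le_eqVlt; apply/orP; left; apply/eqP.
have b0 : brk u != 0 by rewrite gt_eqF ?brk_gt0.
by move: (brk u) b0 (c ^+ N.+1) => b b0 cN; field; rewrite b0 expf_neq0.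
Qed.

Lemma pderiv_reflect (g : Rd -> R) s (p : Rd) r u : rsch g ->
  pderiv s (fun u => g (p - r *: u)) u = (- r) ^+ size s * pderiv s g (p - r *: u).
Proof.
move=> hg; have := pderiv_affine s (- r) p (rsch_smooth hg).
have -> : (fun x : Rd => g (- r *: x + p)) = (fun u => g (p - r *: u)).
  by apply/funext => v; rewrite scaleNr addrC.
by move=> ->; rewrite scaleNr addrC.
Qed.

Lemma power_product_lip (k : nat) (q q0 r r0 G G0 B C1 C3 X : R) :
  q = (- r) ^+ k * G -> q0 = (- r0) ^+ k * G0 -> 0 <= r0 -> 0 <= B -> 0 <= X -> 0 <= C1 -> 0 <= C3 ->
  `|r ^+ k - r0 ^+ k| <= C3 * `|r - r0| -> `|G - G0| * B <= C1 * (X + `|r - r0|) -> `|G| * B <= C1 ->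
  `|q - q0| * B <= (C3 * C1 + r0 ^+ k * C1) * (X + `|r - r0|).
Proof.
move=> -> -> r00 B0 X0 C10 C30 k3 k1 k2.
rewrite [in X in `|X|]exprNn [X in _ - X * _]exprNn -!mulrA -mulrBr normrM normrX normrN1 expr1n mul1r.
have -> : r ^+ k * G - r0 ^+ k * G0 = (r ^+ k - r0 ^+ k) * G + r0 ^+ k * (G - G0) by ring.
apply: (@le_trans _ _ (`|r ^+ k - r0 ^+ k| * (`|G| * B) + r0 ^+ k * (`|G - G0| * B))).
  rewrite !mulrA -mulrDl ler_wpM2r//; apply: le_trans (ler_normD _ _) _.
  by rewrite !normrM (ger0_norm (x := r0 ^+ _)) ?exprn_ge0.
rewrite mulrDl; apply: lerD.
  apply: (@le_trans _ _ (C3 * `|r - r0| * C1)).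
    by apply: ler_pM => //; rewrite mulr_ge0.
  by rewrite mulrAC ler_wpM2l ?mulr_ge0// lerDr.
by rewrite -mulrA ler_wpM2l// exprn_ge0.
Qed.

Lemma affine_seminorm_lip (g : Rd -> R) (r0 : R) (p0 : Rd) N : rsch g -> 0 < r0 -> exists2 C, 0 <= C &
  forall s p r u, (size s <= N)%N -> enorm (p - p0) <= 1 -> `|r - r0| <= r0 / 2 ->
  `|pderiv s (fun u => g (p - r *: u)) u - pderiv s (fun u => g (p0 - r0 *: u)) u| * brk u ^+ N
  <= C * (enorm (p - p0) + `|r - r0|).
Proof.
move=> hg r00.
have := @seq_uniform _ 'I_d (fun s C => forall p r u, enorm (p - p0) <= 1 -> `|r - r0| <= r0 / 2 ->
  `|pderiv s (fun u => g (p - r *: u)) u - pderiv s (fun u => g (p0 - r0 *: u)) u| * brk u ^+ N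
  <= C * (enorm (p - p0) + `|r - r0|)) N.
case=> [s|s C C' CC' hC p r u hp hr|C C0 hC].
- have [C1 C10 h1] := affine_lip p0 N (rsch_pderiv s hg) r00.
  have [C3 C30 h3] := powr_locally_lipschitz (size s) r00.
  exists (C3 * C1 + r0 ^+ size s * C1) => p r u hp hr.
  have [k1 k2] := h1 p r u hp hr; have k3 := h3 r hr.
  apply: (power_product_lip (pderiv_reflect s p r u hg) (pderiv_reflect s p0 r0 u hg)) => //.
  - exact: ltW.
  - by rewrite exprn_ge0 ?brk_ge0.
  - exact: enorm_ge0.
- by apply: le_trans (hC p r u hp hr) _; rewrite ler_wpM2r// addr_ge0 ?enorm_ge0.
by exists C => // s p r u sN; exact: hC.
Qed.

Lemma csch_reflect_scale l (p : Rd) r : r != 0 -> csch l -> csch (fun u => l (p - r *: u)).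
Proof.
move=> rn hl; have rn' : - r != 0 by rewrite oppr_eq0.
have := csch_affine p rn' hl; congr csch.
by apply/funext => u; rewrite scaleNr addrC.
Qed.

(** Distances between dilated translates of a rapidly decreasing function are
    Lipschitz in the parameters, in every seminorm; so [f] is continuous along them. *)
Lemma tempered_affine_lip F l (r0 : R) (p0 : Rd) : tempered F -> csch l -> 0 < r0 ->
  exists2 C, 0 <= C & forall p r, enorm (p - p0) <= 1 -> `|r - r0| <= r0 / 2 ->
  cabs (F (fun u => l (p - r *: u)) - F (fun u => l (p0 - r0 *: u))) <= C * (enorm (p - p0) + `|r - r0|).
Proof.
move=> tF hl r00; have [N [K [K0 hK]]] := tempered_bd tF.
have [C1 C10 h1] := affine_seminorm_lip p0 N (hl true) r00.
have [C2 C20 h2] := affine_seminorm_lip p0 N (hl false) r00.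
exists (K * (C1 + C2)) => [|p r hp hr]; first by rewrite mulr_ge0// addr_ge0.
have rn : r != 0.
  by move: hr; rewrite ler_norml => /andP[? ?]; rewrite gt_eqF//; lra.
have r0n : r0 != 0 by rewrite gt_eqF.
have hA := csch_reflect_scale p rn hl; have hA0 := csch_reflect_scale p0 r0n hl.
have -> : F (fun u => l (p - r *: u)) - F (fun u => l (p0 - r0 *: u)) =
    F (fun u => -1 * l (p0 - r0 *: u) + l (p - r *: u)).
  by rewrite (tempered_lin tF (-1) hA0 hA) mulN1r addrC.
rewrite -mulrA; apply: hK; first exact: (cschD (cschZ _ hA0) hA).
move=> b s u sN.
have -> : (fun x => part b (-1 * l (p0 - r0 *: x) + l (p - r *: x))) =
    (fun x => -1 * part b (l (p0 - r0 *: x)) + part b (l (p - r *: x))).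
  by apply/funext => x; rewrite partD !mulN1r partN.
rewrite (pderiv_linear _ _ (rsch_smooth (hA0 b)) (rsch_smooth (hA b))) mulN1r addrC.
have E0 : 0 <= enorm (p - p0) + `|r - r0| by rewrite addr_ge0 ?enorm_ge0.
case: b; [apply: le_trans (h1 s p r u sN hp hr) _|apply: le_trans (h2 s p r u sN hp hr) _].
  by rewrite ler_wpM2r// lerDl.
by rewrite ler_wpM2r// lerDr.
Qed.

End distributions.

(** * Peetre maximal functions *)

Section maximal_function.
Context (R : realType) (d : nat).
Local Notation Rd := 'rV[R]_d.
Implicit Types (f : (Rd -> R[i]) -> R[i]) (l h : Rd -> R[i]).

Definition tconv f h (x : Rd) : R[i] := f (fun u => h (x - u)).

(** Peetre maximal function of the convolution of [f] with the dilates of [l]. *)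
Definition pmax (a : R) f l (t : R) (x : Rd) : \bar R :=
  ereal_sup [set (cabs (tconv f (dil l t) (x + z)) / (1 + enorm z / t) `^ a)%:E | z in [set: Rd]].

Lemma cabs_sub (z w : R[i]) : `|cabs z - cabs w| <= cabs (z - w).
Proof.
rewrite ler_norml; apply/andP; split.
  rewrite lerNl opprB lerBlDl -{1}(subrK w z) [z - w + w]addrC.
  have := cabsD z (w - z); rewrite [z + _]addrC subrK => h; apply: le_trans h _.
  by rewrite -[w - z]opprB cabsN addrC subrK.
by rewrite lerBlDl -{1}(subrK w z) addrC cabsD.
Qed.

Lemma tempered_affine_cvg (T : Type) (G : set_system T) (FG : Filter G) f l (P : T -> Rd) (Q : T -> R)
    (p0 : Rd) (r0 : R) : tempered f -> csch l -> 0 < r0 -> P @ G --> p0 -> Q @ G --> r0 ->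
  (fun p => cabs (f (fun u => l (P p - Q p *: u)))) @ G --> cabs (f (fun u => l (p0 - r0 *: u))).
Proof.
move=> tf hl r00 cP cQ; have [C C0 hC] := tempered_affine_lip p0 tf hl r00.
pose dl : R := (d.+1)%:R; have dl0 : 0 < dl by rewrite ltr0n.
apply/cvgrPdist_lt => /= eps eps0.
pose e := Num.min (Num.min (dl^-1) (r0 / 2)) (eps / ((C + 1) * (2 * dl))).
have C1 : 0 < C + 1 by rewrite ltr_wpDl.
have e0 : 0 < e by rewrite /e !lt_min invr_gt0 dl0 divr_gt0//= divr_gt0// !mulr_gt0.
have nP : \forall p \near G, `|p0 - P p| < e by move/cvgrPdist_lt : cP; apply.
have nQ : \forall p \near G, `|r0 - Q p| < e by move/cvgrPdist_lt : cQ; apply.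
near=> p.
have hp' : `|p0 - P p| < e by near: p.
have hr' : `|r0 - Q p| < e by near: p.
move: (P p) (Q p) hp' hr' => p1 r hp'; rewrite distrC => hr.
have hp : enorm (p1 - p0) <= dl * e.
  apply: le_trans (enorm_norm _) _; apply: ler_pM => //; first by rewrite ler_nat.
  by rewrite distrC; apply: ltW.
have e1 : dl * e <= 1.
  by rewrite mulrC -ler_pdivlMr// mul1r /e !ge_min lexx.
have e2 : e <= r0 / 2 by rewrite /e !ge_min lexx orbT.
have e3 : e * ((C + 1) * (2 * dl)) <= eps by rewrite -ler_pdivlMr ?mulr_gt0// /e ge_min lexx orbT.
have k := hC p1 r (le_trans hp e1) (le_trans (ltW hr) e2).
rewrite distrC; apply: le_lt_trans (cabs_sub _ _) _; apply: le_lt_trans k _.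
apply: (@lt_le_trans _ _ ((C + 1) * (e * (2 * dl)))); last by rewrite mulrCA.
have X0 : 0 <= enorm (p1 - p0) + `|r - r0| by rewrite addr_ge0 ?enorm_ge0.
apply: (@le_lt_trans _ _ ((C + 1) * (enorm (p1 - p0) + `|r - r0|))).
  by rewrite ler_wpM2r// lerDl.
rewrite ltr_pM2l// mulrCA mulr_natl mulr2n; apply: ler_ltD; first by rewrite mulrC.
by apply: lt_le_trans hr _; rewrite ler_peMr ?(ltW e0)// ler1n.
Unshelve. all: by end_near.
Qed.

Lemma tconv_dil f l t y : tempered f -> csch l -> t != 0 ->
  tconv f (dil l t) y = (t ^- d)%:C%C * f (fun u => l (t^-1 *: y - t^-1 *: u)).
Proof.
move=> tf hl t0; rewrite /tconv /dil.
rewrite -temperedZ//; last by apply: csch_reflect_scale => //; rewrite invr_eq0.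
by congr f; apply/funext => u; rewrite scalerBr.
Qed.

Lemma pmax_term_cvg (T : Type) (G : set_system T) (FG : Filter G) (a : R) f l (z x0 : Rd) (t0 : R)
    (X : T -> Rd) (S : T -> R) : tempered f -> csch l -> 0 < t0 -> X @ G --> x0 -> S @ G --> t0 ->
  (fun p => cabs (tconv f (dil l (S p)) (X p + z)) / (1 + enorm z / S p) `^ a) @ G -->
    cabs (tconv f (dil l t0) (x0 + z)) / (1 + enorm z / t0) `^ a.
Proof.
move=> tf hl t00 cX cS.
have Ev t x : 0 < t -> (t ^+ d)^-1 * cabs (f (fun u => l (t^-1 *: (x + z) - t^-1 *: u))) *
    expR (- a * ln (1 + enorm z * t^-1)) = cabs (tconv f (dil l t) (x + z)) / (1 + enorm z / t) `^ a.
  move=> tt0; rewrite tconv_dil ?gt_eqF// cabsM cabs_real; congr (_ * _ * _).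
    by rewrite ger0_norm// invr_ge0 exprn_ge0// ltW.
  by rewrite -powRN /powR gt_eqF// ltr_wpDr// mulr_ge0 ?enorm_ge0// invr_ge0 ltW.
have nS : \forall p \near G, 0 < S p by apply: (cvgr_gt t0).
rewrite -(Ev t0 x0 t00); apply: cvg_trans (near_eq_cvg (f := fun p => (S p ^+ d)^-1 *
  cabs (f (fun u => l ((S p)^-1 *: (X p + z) - (S p)^-1 *: u))) * expR (- a * ln (1 + enorm z * (S p)^-1))) _) _.
  by apply: filterS nS => p Sp; rewrite Ev.
have ci : (S p)^-1 @[p --> G] --> t0^-1 by apply: cvgV => //; rewrite gt_eqF.
apply: cvgM; first apply: cvgM.
- apply: cvgV; first by rewrite expf_neq0// gt_eqF.
  by apply: (@continuous_cvg _ _ _ _ FG S (fun x : R => x ^+ d)) => //; exact: exprn_continuous.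
- have i0 : 0 < t0^-1 by rewrite invr_gt0.
  apply: (tempered_affine_cvg FG (P := fun p => (S p)^-1 *: (X p + z)) tf hl i0 _ ci).
  by apply: cvgZ => //; apply: cvgD => //; exact: cvg_cst.
- apply: (@continuous_cvg _ _ _ _ FG _ (@expR R)); first exact: continuous_expR.
  apply: cvgMr; apply: (@continuous_cvg _ _ _ _ FG _ (@ln R)).
    by apply: continuous_ln; rewrite ltr_wpDr// mulr_ge0 ?enorm_ge0// invr_ge0 ltW.
  by apply: cvgD; [exact: cvg_cst|apply: cvgMr].
Qed.

Lemma pmax_gt a f l t x (c r : R) : 0 < c -> (r%:E < c%:E * pmax a f l t x)%E ->
  exists z, r < c * (cabs (tconv f (dil l t) (x + z)) / (1 + enorm z / t) `^ a).
Proof.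
move=> c0 h; apply: contrapT => hn.
suff : (pmax a f l t x <= (r / c)%:E)%E.
  move=> k; have := lt_le_trans h (lee_wpmul2l (ltW c0 : (0 <= c%:E)%E) k).
  by rewrite -EFinM mulrC divfK ?ltxx// gt_eqF.
apply: ge_ereal_sup => _ [z _ <-]; rewrite lee_fin ler_pdivlMr// mulrC leNgt; apply/negP => rz.
by apply: hn; exists z.
Qed.

Lemma pmax_ge a f l t x z : ((cabs (tconv f (dil l t) (x + z)) / (1 + enorm z / t) `^ a)%:E <= pmax a f l t x)%E.
Proof. by apply: ereal_sup_ubound; exists z. Qed.

Lemma pmax_ge0 a f l t x : (0 <= pmax a f l t x)%E.
Proof.
by apply: le_trans (pmax_ge a f l t x 0); rewrite lee_fin divr_ge0 ?cabs_ge0// powR_ge0.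
Qed.

(** Each term of the supremum is continuous in the point and the scale. The
    weight is bounded below near each point by a continuous function that agrees with it
    there, so a superlevel set is a neighbourhood of each of its points. *)
Lemma weighted_pmax_open (a : R) f l (W : Rd * R -> R) (D : set (Rd * R)) :
  tempered f -> csch l -> open D -> (forall p, D p -> 0 < p.2) -> (forall p, D p -> 0 < W p) ->
  (forall p0, D p0 -> exists L : Rd * R -> R,
     [/\ {for p0, continuous L}, L p0 = 1 & forall p, D p -> W p0 * L p <= W p]) ->
  forall r : R, open (D `&` [set p | (r%:E < (W p)%:E * pmax a f l p.2 p.1)%E]).
Proof.
move=> tf hl oD D0 W0 hL r; rewrite openE => p0 [Dp0 rp].
have [L [cL L1 hW]] := hL p0 Dp0.
have [z hz] := pmax_gt (W0 _ Dp0) rp.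
pose T (p : Rd * R) := cabs (tconv f (dil l p.2) (p.1 + z)) / (1 + enorm z / p.2) `^ a.
have FF : Filter (nbhs p0) by exact: nbhs_filter.
have cT : {for p0, continuous T}.
  by apply: pmax_term_cvg => //; [exact: D0|exact: cvg_fst|exact: cvg_snd].
have c : (W p0 * L p * T p) @[p --> p0] --> W p0 * L p0 * T p0.
  by apply: cvgM; [apply: cvgMr; exact: cL|exact: cT].
have rT : r < W p0 * L p0 * T p0 by rewrite L1 mulr1.
have nr : \forall p \near p0, r < W p0 * L p * T p by move/cvgr_gt : c; apply.
have nD : \forall p \near p0, D p by apply: open_nbhs_nbhs; split.
near=> p; have Dp : D p by near: p.
split => //=; have rp' : r < W p0 * L p * T p by near: p.
have T0 : 0 <= T p by rewrite divr_ge0 ?cabs_ge0// powR_ge0.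
apply: lt_le_trans (_ : ((W p0 * L p * T p)%:E <= _)%E); first by rewrite lte_fin.
apply: (@le_trans _ _ ((W p)%:E * (T p)%:E)%E); first by rewrite lee_fin ler_wpM2r// hW.
by apply: lee_wpmul2l; [rewrite lee_fin ltW// W0|exact: pmax_ge].
Unshelve. all: by end_near.
Qed.

End maximal_function.

(** * Weights, and measurability of weighted maximal functions *)

Section ratio.
Context (R : realType).
Implicit Types s t : R.

(** The distance of two scales on the multiplicative half-line, as a number in
    ]0, 1]. *)
Definition ratio s t := Num.min (s / t) (t / s).

Lemma ratioC s t : ratio s t = ratio t s.
Proof. by rewrite /ratio minC. Qed.

Lemma ratio_gt0 s t : 0 < s -> 0 < t -> 0 < ratio s t.
Proof. by move=> s0 t0; rewrite /ratio lt_min !divr_gt0. Qed.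

Lemma ratio_le s t : 0 < t -> t <= s -> ratio s t = t / s.
Proof.
move=> t0 ts; have s0 := lt_le_trans t0 ts; rewrite /ratio; apply/min_idPr.
by rewrite (@le_trans _ _ 1)// ?ler_pdivrMr ?ler_pdivlMr// mul1r.
Qed.

Lemma ratio_le1 s t : 0 < s -> 0 < t -> ratio s t <= 1.
Proof.
move=> s0 t0; rewrite /ratio ge_min !ler_pdivrMr// !mul1r; exact: le_total.
Qed.

Lemma ratio1 t : 0 < t <= 1 -> ratio 1 t = t.
Proof. by move=> /andP[t0 t1]; rewrite ratio_le// divr1. Qed.

Lemma ratio_mul_le s t : 0 < s -> 0 < t -> ratio s t * s <= t.
Proof. by move=> s0 t0; rewrite -ler_pdivlMr// /ratio ge_min lexx orbT. Qed.

End ratio.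

Section weights.
Context (R : realType) (d : nat).
Local Notation Rd := 'rV[R]_d.

(** The weight class with natural exponents: integer powers commute with the powers of
    the ratio that the kernels provide. *)
Record scale_weight (nA nB : nat) (w : Rd -> R -> R) (w0 : Rd -> R) : Prop := {
  sw_pos : forall x t, 0 < t <= 1 -> 0 < w x t;
  sw_pos0 : forall x, 0 < w0 x;
  sw_scale : forall x s t, 0 < s <= 1 -> 0 < t <= 1 -> w x s * ratio s t ^+ nA <= w x t;
  sw_up : forall x t, 0 < t <= 1 -> w0 x * t ^+ nA <= w x t;
  sw_down : forall x t, 0 < t <= 1 -> w x t * t ^+ nA <= w0 x;
  sw_translate : forall x y t, 0 < t <= 1 -> w x t <= w y t * (1 + enorm (x - y) / t) ^+ nB;
  sw_translate0 : forall x y, w0 x <= w0 y * (1 + enorm (x - y)) ^+ nB }.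

Lemma expr_le_powR (r al : R) n : 0 < r <= 1 -> al <= n%:R -> r ^+ n <= r `^ al.
Proof. by move=> /andP[r0 r1] h; rewrite -powR_mulrn ?(ltW r0)// ger_powR// r0. Qed.

Lemma powR_le_expr (r al : R) n : 1 <= r -> al <= n%:R -> r `^ al <= r ^+ n.
Proof. by move=> r1 h; rewrite -powR_mulrn ?ler_powR// (le_trans _ r1). Qed.

(** Rounding the exponents up keeps the inequalities, since the ratios of
    scales are at most 1 and the translation factors at least 1. *)
Lemma weight_class_scale (al1 al2 al3 : R) (w : Rd -> \bar R -> R) :
  0 <= al1 -> 0 <= al2 -> weight_class al1 al2 al3 w ->
  exists nA nB, scale_weight nA nB (fun x t => w x t%:E) (fun x => w x +oo%E).
Proof.
move=> a1 a2 hw; exists (Num.trunc (al1 + al2)).+1, (Num.trunc al3).+1.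
have al12 := ltW (truncnS_gt (al1 + al2)); have al3n := ltW (truncnS_gt al3).
set nA := (Num.trunc (al1 + al2)).+1 in al12 *; set nB := (Num.trunc al3).+1 in al3n *.
have h1 : al1 <= nA%:R by apply: le_trans al12; rewrite lerDl.
have h2 : al2 <= nA%:R by apply: le_trans al12; rewrite lerDr.
have pw x t : 0 < t <= 1 -> 0 < w x t%:E by move=> ht; exact: (wc_pos_fin hw).
have inv (r al X Y : R) : 0 < r -> X <= r `^ (- al) * Y -> X * r `^ al <= Y.
  by move=> r0; rewrite powRN ler_pdivlMl ?powR_gt0// mulrC.
split=> //.
- exact: wc_pos_oo hw.
- move=> x s t hs ht; have /andP[s0 s1] := hs; have /andP[t0 t1] := ht.
  have [ts|/ltW st] := leP t s.
    have /andP[k _] := wc_W1_fin hw x t0 ts s1; apply: le_trans k.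
    rewrite ratio_le// mulrC ler_wpM2r ?(ltW (pw _ _ hs))// expr_le_powR// divr_gt0//=.
    by rewrite ler_pdivrMr// mul1r.
  have /andP[_ k] := wc_W1_fin hw x s0 st t1.
  have r0 : 0 < s / t by rewrite divr_gt0.
  apply: (le_trans _ (inv _ _ _ _ r0 k)).
  rewrite ratioC ratio_le// ler_wpM2l ?(ltW (pw _ _ hs))// expr_le_powR// r0/=.
  by rewrite ler_pdivrMr// mul1r.
- move=> x t ht; have /andP[t0 t1] := ht; have /andP[k _] := wc_W1_oo hw x t0 t1.
  apply: le_trans k; rewrite mulrC ler_wpM2r ?expr_le_powR//.
  by rewrite ltW//; exact: wc_pos_oo hw _.
- move=> x t ht; have /andP[t0 t1] := ht; have /andP[_ k] := wc_W1_oo hw x t0 t1.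
  apply: (le_trans _ (inv _ _ _ _ t0 k)).
  by rewrite ler_wpM2l ?expr_le_powR// ltW// pw.
- move=> x y t ht; have /andP[t0 t1] := ht.
  apply: le_trans (wc_W2_fin hw x y t0 t1) _; rewrite ler_wpM2l ?(ltW (pw _ _ ht))//.
  by rewrite powR_le_expr// lerDl divr_ge0 ?enorm_ge0// ltW.
- move=> x y; apply: le_trans (wc_W2_oo hw x y) _.
  by rewrite ler_wpM2l ?powR_le_expr// ?lerDl ?enorm_ge0// ltW//; exact: wc_pos_oo hw _.
Qed.

End weights.

Section measurability.
Context (R : realType) (d : nat) dZ (Z : measurableType dZ) (tau : Z -> R).
Local Notation Rd := 'rV[R]_d.
Hypothesis mtau : measurable_fun setT (tau : Z -> measurableTypeR R).
Hypothesis tau01 : forall z, 0 < tau z < 1.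
Variables (nA nB : nat) (w : Rd -> R -> R) (w0 : Rd -> R).
Hypothesis hw : scale_weight nA nB w w0.
Variables (a : R) (f : (Rd -> R[i]) -> R[i]) (l : Rd -> R[i]).
Hypotheses (tf : tempered f) (hl : csch l).

Lemma translate_factor_cvg (T : Type) (G : set_system T) (FG : Filter G) (X : T -> Rd) (S : T -> R)
    (x0 : Rd) (t0 : R) : 0 < t0 -> X @ G --> x0 -> S @ G --> t0 ->
  ((1 + enorm (x0 - X p) / S p) ^+ nB)^-1 @[p --> G] --> (1 : R).
Proof.
move=> t00 cX cS.
have e0 : ((1 + enorm (x0 - x0) / t0) ^+ nB)^-1 = 1 by rewrite subrr enorm0 mul0r addr0 expr1n invr1.
rewrite -[X in _ --> X]e0.
apply: cvgV; first by rewrite subrr enorm0 mul0r addr0 expr1n oner_neq0.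
apply: (@continuous_cvg _ _ _ _ FG _ (fun x : R => x ^+ nB)); first exact: exprn_continuous.
apply: cvgD; first exact: cvg_cst.
apply: cvgM; last by apply: cvgV => //; rewrite gt_eqF.
apply: (@continuous_cvg _ _ _ _ FG _ (@enorm R d)); first exact: enorm_continuous.
by apply: cvgB => //; exact: cvg_cst.
Qed.

(** Along the scales the weight is bounded below by powers of their ratio, and
    along translations by (W2): both bounds are continuous, as the semicontinuity
    argument requires. *)
Lemma measurable_weighted_pmax : measurable_fun setT
  (fun p : Rd * Z => (w p.1 (tau p.2))%:E * pmax a f l (tau p.2) p.1)%E.
Proof.
pose D : set (Rd * R) := [set p | 0 < p.2 < 1].
have oD : open D.
  rewrite (_ : D = snd @^-1` `]0, 1[%classic).
    by apply: open_comp => [p _|]; [exact: cvg_snd|exact: interval_open].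
  by apply/seteqP; split => p; rewrite /D /= in_itv.
pose F (p : Rd * R) := ((w p.1 p.2)%:E * pmax a f l p.2 p.1)%E.
have mF : measurable_fun (D : set (Rd * measurableTypeR R)) (F : (Rd * measurableTypeR R)%type -> \bar R).
  apply: lsc_measurable_rVR => //.
  apply: (@weighted_pmax_open _ _ a f l (fun p => w p.1 p.2) D tf hl oD).
  - by move=> p /andP[].
  - by move=> p /andP[p0 p1]; apply: (sw_pos hw); rewrite p0 ltW.
  move=> [x0 t0] /= /andP[t00 t01].
  exists (fun p => (Num.min (t0 / p.2) (p.2 / t0)) ^+ nA * ((1 + enorm (x0 - p.1) / p.2) ^+ nB)^-1).
  have FF : Filter (nbhs (x0, t0)) by exact: nbhs_filter.
  have L1 : ratio t0 t0 ^+ nA * ((1 + enorm (x0 - x0) / t0) ^+ nB)^-1 = 1.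
    by rewrite ratio_le// divff ?gt_eqF// subrr enorm0 mul0r addr0 !expr1n invr1 mul1r.
  split => //=.
    rewrite /prop_for /continuous_at/= -/(ratio t0 t0) L1 -[X in _ --> X](mulr1 1).
    apply: cvgM; last first.
      by have := @translate_factor_cvg _ _ FF fst snd x0 t0 t00; apply; [exact: cvg_fst|exact: cvg_snd].
    have E : ratio t0 t0 ^+ nA = 1 by rewrite ratio_le// divff ?gt_eqF// expr1n.
    rewrite -[X in _ --> X]E.
    apply: (@continuous_cvg _ _ _ _ FF _ (fun x : R => x ^+ nA)); first exact: exprn_continuous.
    apply: (@continuous_min R (Rd * R)%type (fun p => t0 / p.2) (fun p => p.2 / t0) (x0, t0)).
      by apply: cvgMr; apply: cvgV; [rewrite gt_eqF|exact: cvg_snd].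
    by apply: cvgMl; exact: cvg_snd.
  move=> [x t] /= /andP[t_0 t_1].
  rewrite mulrA ler_pdivrMr; last by rewrite exprn_gt0// ltr_wpDr// divr_ge0 ?enorm_ge0// ltW.
  apply: le_trans (sw_translate hw x0 x _); last by rewrite t_0 ltW.
  by apply: (sw_scale hw); rewrite ?t00 ?t_0 ltW.
have mt : measurable_fun setT (fun p : Rd * Z => (p.1, tau p.2 : measurableTypeR R)).
  apply/measurable_fun_pairP; split; first exact: measurable_fst.
  exact: (measurableT_comp mtau measurable_snd).
apply: (measurable_comp _ _ mF mt).
  by have := oD; apply: open_measurable_rVR.
by move=> _ [[x z] _ <-] /=; rewrite /D/=; exact: tau01.
Qed.

Lemma measurable_weighted_pmax0 : measurable_fun setT (fun x : Rd => (w0 x)%:E * pmax a f l 1 x)%E.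
Proof.
apply: lsc_measurable_rV => r.
pose D : set (Rd * R) := [set p | 0 < p.2].
have oD : open D.
  rewrite (_ : D = snd @^-1` `]0, +oo[%classic).
    by apply: open_comp => [p _|]; [exact: cvg_snd|exact: interval_open].
  by apply/seteqP; split => p; rewrite /D /= in_itv/= andbT.
have := @weighted_pmax_open _ _ a f l (fun p => w0 p.1) D tf hl oD _ _ _ r.
move=> /(_ _ _ _)-h.
have {h}h : open (D `&` [set p | (r%:E < (w0 p.1)%:E * pmax a f l p.2 p.1)%E]).
  apply: h => // [p _|[x0 t0] /= _]; first exact: sw_pos0 hw _.
  have FF : Filter (nbhs (x0, t0)) by exact: nbhs_filter.
  exists (fun p => ((1 + enorm (x0 - p.1) / 1) ^+ nB)^-1); split => /=.
  - have E : ((1 + enorm (x0 - x0) / 1) ^+ nB)^-1 = 1.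
      by rewrite subrr enorm0 mul0r addr0 expr1n invr1.
    rewrite /prop_for /continuous_at /= E.
    by have := @translate_factor_cvg _ _ FF fst (fun=> 1) x0 1 ltr01; apply; [exact: cvg_fst|exact: cvg_cst].
  - by rewrite subrr enorm0 mul0r addr0 expr1n invr1.
  - move=> [x t] /= _; rewrite divr1 ler_pdivrMr; last by rewrite exprn_gt0// ltr_wpDr// enorm_ge0.
    exact: sw_translate0 hw _ _.
have -> : [set x | (r%:E < (w0 x)%:E * pmax a f l 1 x)%E] =
    (fun x => (x, 1 : R)) @^-1` (D `&` [set p | (r%:E < (w0 p.1)%:E * pmax a f l p.2 p.1)%E]).
  by apply/seteqP; split => x /= => [hx|[]//]; split => //; rewrite /D/=.
apply: open_comp => // x _; have FF : Filter (nbhs x) by exact: nbhs_filter.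
have F1 : Filter (nbhs (1 : R)) by exact: nbhs_filter.
by apply: (@cvg_pair Rd Rd R (nbhs x) (nbhs x) (nbhs (1 : R)) FF FF F1 id (fun=> 1)); [exact: cvg_id|exact: cvg_cst].
Qed.

End measurability.

(** * The pointwise estimate between two analysing functions *)

Section kernels.
Context (R : realType) (d : nat).
Local Notation Rd := 'rV[R]_d.
Local Notation mu := (@leb R d).
Implicit Types (g k l : Rd -> R[i]) (u y : Rd) (s t : R).

Lemma cmol_dil g k s t u : csch g -> csch k -> s != 0 ->
  cmol (dil g s) k t u = (s ^- d)%:C%C * cmol g k (t / s) (s^-1 *: u).
Proof.
move=> hg hk s0; rewrite /cmol -cintgZ; last exact: cinteg_mol.
apply: eq_cintg => z; rewrite /dil -mulrA; congr (_ * (g _ * _)).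
by rewrite scalerBr scalerA mulrC.
Qed.

(** The roles of the two dilates are exchanged so that the cancellation can be taken from
    the function at the smaller scale. *)
Lemma cmol_swap g k s t : csch g -> csch k -> 0 < s <= 1 -> 0 < t <= 1 ->
  cmol (dil g s) k t = cmol (dil k t) g s.
Proof.
move=> hg hk /andP[s0 s1] /andP[t0 t1].
have hs := csch_dil (lt0r_neq0 s0) hg; have ht := csch_dil (lt0r_neq0 t0) hk.
have sN : `|s| <= 1 by rewrite gtr0_norm.
have tN : `|t| <= 1 by rewrite gtr0_norm.
apply: fourier_inj; [exact: csch_mol|exact: csch_mol|move=> xi].
by rewrite !fourier_cmol// !fourier_dil// mulrAC.
Qed.

(** After rescaling by [s], the cancellation of [k] at the relative scale
    [t / s] yields the power of the ratio. At [s = t = 1] the ratio is 1 and plain decay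
    is enough, which covers the smooth parts of a system. *)
Lemma kernel_bound_le g k N M : csch g -> csch k -> exists2 C, 0 <= C & forall s t u,
  0 < t -> t <= s -> s <= 1 -> ccancel k \/ t = 1 ->
  cabs (cmol (dil g s) k t u) * brk (s^-1 *: u) ^+ M <= C * ratio s t ^+ N * s ^- d.
Proof.
move=> hg hk.
have [ck|nck] := pselect (ccancel k).
  have [C C0 hC] := cmol_cancel N M hg hk ck; exists C => // s t u t0 ts s1 _.
  have s0 := lt_le_trans t0 ts.
  rewrite cmol_dil ?gt_eqF// cabsM cabs_real ger0_norm ?invr_ge0 ?exprn_ge0 ?(ltW s0)//.
  rewrite ratio_le// -mulrA mulrC ler_wpM2r ?invr_ge0 ?exprn_ge0 ?(ltW s0)//.
  have q0 : 0 < t / s by rewrite divr_gt0.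
  have := hC (t / s) (s^-1 *: u); rewrite gtr0_norm//; apply.
  by rewrite ler_pdivrMr// mul1r.
have [C C0 hC] := cmol_decay M hg hk; exists C => // s t u t0 ts s1 [//|t1].
have s1' : s = 1 by apply/eqP; rewrite eq_le s1 -t1 ts.
rewrite s1' t1 cmol_dil ?oner_neq0// ratio_le ?ltr01// divr1 !expr1n invr1 !mulr1.
by rewrite (_ : 1%:C%C = 1 :> R[i])// mul1r hC// normr1.
Qed.

(** Almost orthogonality of the dilates of cancellative functions. *)
Lemma kernel_bound g k N M : csch g -> csch k -> exists2 C, 0 <= C & forall s t u,
  0 < s <= 1 -> 0 < t <= 1 -> ccancel g \/ s = 1 -> ccancel k \/ t = 1 ->
  cabs (cmol (dil g s) k t u) * brk ((Num.max s t)^-1 *: u) ^+ M <=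
    C * ratio s t ^+ N * (Num.max s t) ^- d.
Proof.
move=> hg hk.
have [C1 C10 h1] := kernel_bound_le N M hg hk; have [C2 C20 h2] := kernel_bound_le N M hk hg.
exists (C1 + C2) => [|s t u hs ht cg ck]; first exact: addr_ge0.
have /andP[s0 s1] := hs; have /andP[t0 t1] := ht.
have r0 : 0 <= ratio s t ^+ N by rewrite exprn_ge0// ltW// ratio_gt0.
have [ts|/ltW st] := leP t s.
  apply: le_trans (h1 s t u t0 ts s1 ck) _.
  by rewrite ler_wpM2r ?invr_ge0 ?exprn_ge0 ?(ltW s0)// ler_wpM2r// lerDl.
rewrite cmol_swap//; apply: le_trans (h2 t s u s0 st t1 cg) _.
by rewrite ratioC ler_wpM2r ?invr_ge0 ?exprn_ge0 ?(ltW t0)// ler_wpM2r// lerDr.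
Qed.

Lemma brk_ratio s t y : 0 < s -> 0 < t -> ratio s t * brk (t^-1 *: y) <= brk ((Num.max s t)^-1 *: y).
Proof.
move=> s0 t0; have m0 : 0 < Num.max s t by rewrite lt_max s0.
rewrite /brk !enormZ !gtr0_norm ?invr_gt0// mulrDr mulr1; apply: lerD; first exact: ratio_le1.
rewrite mulrA ler_wpM2r ?enorm_ge0// ler_pdivrMr// ler_pdivlMl//.
by rewrite /Num.max; case: ifP => _; [rewrite mulrC ler_piMl ?(ltW t0)// ratio_le1|rewrite mulrC ratio_mul_le].
Qed.

(** The decay of the kernel at the larger scale is compared with growth at the
    scale [t]: each power of [brk] exchanged between them costs one power of the ratio, and
    [n] of the [N + n] available powers pay for it. *)
Lemma pointwise_kernel g k l N n : csch g -> csch k -> csch l -> exists2 C, 0 < C &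
  forall F s t Q, tempered F -> 0 < s <= 1 -> 0 < t <= 1 ->
  ccancel g \/ s = 1 -> ccancel k \/ t = 1 -> 0 <= Q ->
  (forall y, cabs (F (fun u => dil l t (u - y))) <= Q * brk (t^-1 *: y) ^+ n) ->
  cabs (F (cmol (dil g s) (cmol k l 1) t)) <= C * ratio s t ^+ N * Q.
Proof.
move=> hg hk hl; have one : `|1 : R| <= 1 by rewrite normr1.
have [C C0 hC] := kernel_bound (N + n) (n + 2 * d) hg hk.
pose J := \int[mu]_y (brk y ^- (2 * d)).
have J0 : 0 <= J by apply: Rintegral_ge0 => y _; rewrite invr_ge0 exprn_ge0// brk_ge0.
exists ((C + 1) * (J + 1)) => [|F s t Q tF hs ht cg ck Q0 hQ].
  by apply: mulr_gt0; rewrite ltr_wpDl.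
have /andP[s0 s1] := hs; have /andP[t0 t1] := ht.
have tN : `|t| <= 1 by rewrite gtr0_norm.
pose K := cmol (dil g s) k t.
have hds := csch_dil (lt0r_neq0 s0) hg; have hdt := csch_dil (lt0r_neq0 t0) hl.
have hK : csch K by exact: csch_mol.
have -> : cmol (dil g s) (cmol k l 1) t = cmol (dil l t) K 1.
  apply: fourier_inj; [by apply: csch_mol => //; exact: csch_mol|exact: csch_mol|move=> xi].
  rewrite (fourier_cmol _ tN hds) ?(fourier_cmol _ one hk hl); last exact: csch_mol.
  rewrite (fourier_cmol _ one hdt hK) (fourier_cmol _ tN hds hk) !scale1r fourier_dil// fourier_dil//.
  by move: (fourier g _) (fourier k _) (fourier l _) => G A B; ring.
pose mx := Num.max s t; have m0 : 0 < mx by rewrite lt_max s0.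
pose r := ratio s t; have r0 : 0 < r by exact: ratio_gt0.
have B0 y m : 0 <= brk y ^+ m by rewrite exprn_ge0 ?brk_ge0.
have bound y : cabs (K y) * cabs (F (fun u => dil l t (u - y))) <=
    (C * r ^+ N * Q * mx ^- d) * brk (mx^-1 *: y + 0) ^- (2 * d).
  rewrite addr0 ler_pdivlMr ?brkX_gt0//.
  apply: (@le_trans _ _ (cabs (K y) * (Q * brk (t^-1 *: y) ^+ n) * brk (mx^-1 *: y) ^+ (2 * d))).
    by rewrite ler_wpM2r// ler_wpM2l ?cabs_ge0.
  have rn0 : 0 < r ^+ n by rewrite exprn_gt0.
  rewrite -(ler_pM2r rn0).
  apply: (@le_trans _ _ (cabs (K y) * brk (mx^-1 *: y) ^+ (n + 2 * d) * Q)).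
    rewrite exprD [leLHS](_ : _ = cabs (K y) * Q * brk (mx^-1 *: y) ^+ (2 * d) * (r * brk (t^-1 *: y)) ^+ n).
      rewrite [leRHS](_ : _ = cabs (K y) * Q * brk (mx^-1 *: y) ^+ (2 * d) * brk (mx^-1 *: y) ^+ n); last by ring.
      rewrite ler_wpM2l ?mulr_ge0 ?cabs_ge0// lerXn2r ?nnegrE ?brk_ge0 ?mulr_ge0 ?brk_ge0 ?(ltW r0)//.
      exact: brk_ratio.
    by rewrite exprMn; ring.
  apply: le_trans (ler_wpM2r Q0 (hC s t y hs ht cg ck)) _.
  by rewrite exprD le_eqVlt; apply/orP; left; apply/eqP; rewrite -/mx -/r; ring.
have := tempered_cmol tF hdt hK.
move=> h; rewrite -lee_fin; apply: le_trans h _.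
have mi : mx^-1 != 0 by rewrite invr_eq0 gt_eqF.
have iB := rintZ (C * r ^+ N * Q * mx ^- d) (rint_affine 0 mi (rint_brkV R d)).
apply: (@le_trans _ _ (\int[mu]_y ((C * r ^+ N * Q * mx ^- d) * brk (mx^-1 *: y + 0) ^- (2 * d))%:E)%E).
  apply: ge0_le_lower_integral => y _; first by rewrite lee_fin mulr_ge0 ?cabs_ge0.
  by rewrite lee_fin; exact: bound.
rewrite -[leLHS]fineK ?lee_fin; last by have := integrable_fin_num measurableT iB.
rewrite -[leLHS]/(\int[mu]_y ((C * r ^+ N * Q * mx ^- d) * brk (mx^-1 *: y + 0) ^- (2 * d))).
rewrite RintegralZl//; last exact: (rint_affine 0 mi (rint_brkV R d)).
rewrite (Rintegral_affine 0 mi (rint_brkV R d)) -/J.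
rewrite gtr0_norm ?invr_gt0// exprVn invrK.
have md : mx ^+ d != 0 by rewrite expf_neq0// gt_eqF.
have rN0 : 0 <= r ^+ N by rewrite exprn_ge0// ltW.
rewrite -/r; move: (mx ^+ d) md (r ^+ N) rN0 => q q0 rN rN0.
rewrite (_ : C * rN * Q / q * (q * J) = C * J * (rN * Q)); last by field.
rewrite -[leRHS]mulrA ler_wpM2r ?mulr_ge0//; apply: ler_pM => //; by rewrite lerDl.
Qed.

End kernels.

Section pointwise.
Context (R : realType) (d : nat) dZ (Z : measurableType dZ)
  (m : {sigma_finite_measure set Z -> \bar R}) (e tau : Z -> R).
Local Notation Rd := 'rV[R]_d.
Hypothesis ss : scale_space m e tau.
Variables kap0 kap lam0 lam g : Rd -> R[i].
Hypotheses (hk0 : csch kap0) (hk : csch kap) (hl0 : csch lam0) (hl : csch lam) (hg : csch g).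
Hypothesis ck : ccancel kap.
Hypothesis calderon : forall xi, fourier kap0 xi * fourier lam0 xi +
  cintg m (fun z => (e z)%:C%C * (fourier kap (tau z *: xi) * fourier lam (tau z *: xi))) =
  (fcst R d ^+ 2)%:C%C.
Variables (a : R) (a0 : 0 <= a).

(** A finite maximal function at [x] bounds the convolution everywhere, with
    polynomial growth; changing the unit of length from [t] to [s] costs powers of the
    ratio. *)
Lemma pmax_fin_growth f l (s t P : R) (n : nat) (x v y : Rd) : tempered f -> 0 < s <= 1 -> 0 < t <= 1 ->
  a <= n%:R -> pmax a f l t x = P%:E ->
  cabs (f (fun u => dil l t (x + v - u - y))) <=
    (ratio s t ^- n * P * (1 + enorm v / s) `^ a) * brk (t^-1 *: y) ^+ n.
Proof.
move=> tf /andP[s0 s1] /andP[t0 t1] an hP.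
have := pmax_ge a f l t x (v - y); rewrite hP lee_fin.
have p0 : 0 < 1 + enorm (v - y) / t by rewrite ltr_wpDr// divr_ge0 ?enorm_ge0// ltW.
rewrite ler_pdivrMr ?powR_gt0//.
have P0 : 0 <= P by have := pmax_ge0 a f l t x; rewrite hP.
have -> : tconv f (dil l t) (x + (v - y)) = f (fun u => dil l t (x + v - u - y)).
  by congr f; apply/funext => u; congr (dil l t _); apply/rowP => i; rewrite !mxE; ring.
move=> h; apply: le_trans h _.
rewrite [leRHS](_ : _ = P * (ratio s t ^- n * (1 + enorm v / s) `^ a * brk (t^-1 *: y) ^+ n)); last by ring.
rewrite ler_wpM2l//.
have r0 : 0 < ratio s t by exact: ratio_gt0.
have r1 : ratio s t <= 1 by exact: ratio_le1.
have i1 : 1 <= (ratio s t)^-1 by rewrite -[leLHS]invr1 lef_pV2 ?posrE.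
have A0 : 0 <= enorm v / s by rewrite divr_ge0 ?enorm_ge0// ltW.
have b1 : 1 <= brk (t^-1 *: y) by exact: brk_ge1.
have key : 1 + enorm (v - y) / t <= (ratio s t)^-1 * (1 + enorm v / s) * brk (t^-1 *: y).
  apply: (@le_trans _ _ ((1 + enorm v / t) * brk (t^-1 *: y))).
    rewrite /brk enormZ gtr0_norm ?invr_gt0// [_^-1 * _]mulrC.
    have := enormD v (- y); rewrite enormN => h.
    have vt : 0 <= enorm v / t by rewrite divr_ge0 ?enorm_ge0// ltW.
    have yt : 0 <= enorm y / t by rewrite divr_ge0 ?enorm_ge0// ltW.
    have h2 : enorm (v - y) / t <= enorm v / t + enorm y / t by rewrite -mulrDl ler_pM2r ?invr_gt0.
    have := mulr_ge0 vt yt; nra.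
  rewrite ler_wpM2r ?brk_ge0// mulrDr mulr1; apply: lerD => //.
  rewrite mulrCA ler_wpM2l ?enorm_ge0// -invfM lef_pV2 ?posrE ?mulr_gt0//.
  exact: ratio_mul_le.
apply: (@le_trans _ _ (((ratio s t)^-1 * (1 + enorm v / s) * brk (t^-1 *: y)) `^ a)).
  by apply: ge0_ler_powR => //; rewrite nnegrE ?(ltW p0)// !mulr_ge0 ?brk_ge0 ?invr_ge0 ?(ltW r0)// addr_ge0.
have q0 : 0 <= (ratio s t)^-1 by rewrite invr_ge0 ltW.
have q1 : 0 <= 1 + enorm v / s by rewrite addr_ge0.
rewrite !powRM ?mulr_ge0 ?brk_ge0//.
apply: ler_pM; rewrite ?mulr_ge0 ?powR_ge0//.
  by rewrite ler_wpM2r ?powR_ge0// -exprVn; exact: powR_le_expr.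
exact: powR_le_expr.
Qed.

(** The estimate of one layer of the reproducing formula. *)
Lemma layer_pmax k l (N : nat) : csch k -> csch l -> exists2 C, 0 < C & forall f x v s t,
  tempered f -> 0 < s <= 1 -> 0 < t <= 1 -> ccancel g \/ s = 1 -> ccancel k \/ t = 1 ->
  ((cabs (f (fun u => cmol (dil g s) (cmol k l 1) t (x + v - u))))%:E <=
   ((1 + enorm v / s) `^ a)%:E * ((C * ratio s t ^+ N)%:E * pmax a f l t x))%E.
Proof.
move=> hk' hl'; pose n := (Num.trunc a).+1.
have an : a <= n%:R by exact: ltW (truncnS_gt a).
(* [n] exceeds the growth exponent [a] of the maximal function and pays for it. *)
have [C C0 hC] := pointwise_kernel (N + n) n hg hk' hl'; exists C => // f x v s t tf hs ht cg ck'.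
have /andP[s0 s1] := hs; have /andP[t0 t1] := ht.
have r0 : 0 < ratio s t by exact: ratio_gt0.
have B0 : 0 < (1 + enorm v / s) `^ a by rewrite powR_gt0// ltr_wpDr// divr_ge0 ?enorm_ge0// ltW.
have := pmax_ge0 a f l t x; case E : (pmax a f l t x) => [P| |] // P0; last first.
  have c0 : (0 < ((1 + enorm v / s) `^ a)%:E)%E by rewrite lte_fin.
  have c1 : (0 < (C * ratio s t ^+ N)%:E)%E by rewrite lte_fin mulr_gt0// exprn_gt0.
  by rewrite gt0_muley// gt0_muley// leey.
rewrite -!EFinM lee_fin.
have tF := tempered_reflect (x + v) tf.
have := hC _ s t (ratio s t ^- n * P * (1 + enorm v / s) `^ a) tF hs ht cg ck'.
move=> /(_ _ _)-h; apply: le_trans (h _ _) _.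
- by rewrite !mulr_ge0 ?invr_ge0 ?exprn_ge0// ?(ltW B0)// ltW.
- by move=> y; exact: pmax_fin_growth.
rewrite exprD; move: ((1 + enorm v / s) `^ a) => B.
have rn : ratio s t ^+ n != 0 by rewrite expf_neq0// gt_eqF.
move: (ratio s t ^+ n) rn (ratio s t ^+ N) => q q0 rN.
by rewrite [leLHS](_ : _ = B * (C * rN * P))//; field.
Qed.

Let tau01 z : 0 < tau z <= 1.
Proof. by have /andP[h1 h2] := ss_scale01 ss z; rewrite h1 ltW. Qed.

Lemma scale_weight1 : scale_weight 0 0 (fun (_ : Rd) (_ : R) => 1) (fun=> 1).
Proof. by split=> *; rewrite ?expr0 ?mulr1// ltr01. Qed.

Lemma measurable_pmax_section f x : tempered f ->
  measurable_fun setT (fun z => pmax a f lam (tau z) x).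
Proof.
move=> tf; have := measurable_weighted_pmax (ss_measurable_scale ss) (ss_scale01 ss) scale_weight1 a tf hl.
move=> mf; have := measurableT_comp mf (pair1_measurable x).
by apply: eq_measurable_fun => z _ /=; rewrite mul1e.
Qed.

Lemma measurable_ratio s : 0 < s -> measurable_fun setT ((fun z => ratio s (tau z)) : Z -> measurableTypeR R).
Proof.
move=> s0; have mt := ss_measurable_scale ss; apply: measurable_minr.
  have mi : measurable_fun setT ((fun z => s * expR (- ln (tau z))) : Z -> measurableTypeR R).
    apply: measurable_funM; first exact: measurable_cst.
    apply: (measurableT_comp (@measurable_expR R)); 
    exact: (measurable_funN (measurableT_comp (@measurable_ln R) mt)).
  apply: eq_measurable_fun mi => z _.
  by rewrite -lnV ?posrE ?lnK ?posrE ?invr_gt0//; have /andP[] := tau01 z.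
by apply: measurable_funM => //; exact: measurable_cst.
Qed.

Lemma combine_bounds (B C1 C2 q : R) (X J : \bar R) :
  0 <= B -> 0 <= C1 -> 0 <= C2 -> 0 <= q -> (0 <= X)%E -> (0 <= J)%E ->
  (B%:E * ((C1 * q)%:E * X) + B%:E * (C2%:E * J) <= B%:E * ((C1 + C2)%:E * (q%:E * X + J)))%E.
Proof.
move=> B0 C10 C20 q0 X0 J0.
have qX : (0 <= q%:E * X)%E by rewrite mule_ge0// lee_fin.
rewrite -ge0_muleDr; [|by rewrite EFinM -muleA mule_ge0// lee_fin|by rewrite mule_ge0// lee_fin].
apply: lee_wpmul2l; first by rewrite lee_fin.
rewrite (ge0_muleDr _ qX J0) EFinM -muleA; apply: leeD; apply: lee_wpmul2r => //; rewrite lee_fin.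
  by rewrite lerDl.
by rewrite lerDr.
Qed.

(** The reproducing formula splits the dilate of [g] by [s] into its layers; each
    one is estimated by [layer_pmax], and the factor [(1 + |v| / s)^a] is common to all of
    them, so that the supremum over [v] can be taken at the end. *)
Theorem pmax_bound (N : nat) : exists2 C, 0 < C & forall f x s,
  tempered f -> 0 < s <= 1 -> ccancel g \/ s = 1 ->
  (pmax a f g s x <= C%:E * ((s ^+ N)%:E * pmax a f lam0 1 x +
     \int[m]_z ((e z * ratio s (tau z) ^+ N)%:E * pmax a f lam (tau z) x)))%E.
Proof.
have [C1 C10 h1] := layer_pmax N hk0 hl0; have [C2 C20 h2] := layer_pmax N hk hl.
exists (C1 + C2) => [|f x s tf hs cg]; first exact: addr_gt0.
have /andP[s0 s1] := hs; have one : 0 < (1 : R) <= 1 by rewrite ltr01/=.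
have hds := csch_dil (lt0r_neq0 s0) hg.
have e0 := ss_density_ge0 ss.
apply: ge_ereal_sup => _ [v _ <-].
have B0 : 0 < (1 + enorm v / s) `^ a by rewrite powR_gt0// ltr_wpDr// divr_ge0 ?enorm_ge0// ltW.
set B := (1 + enorm v / s) `^ a in B0 *.
have tF := tempered_reflect (x + v) tf.
pose F h := f (fun u => h (x + v - u)).
pose chi0 := cmol kap0 lam0 1; pose chi := cmol kap lam 1.
have one' : `|1 : R| <= 1 by rewrite normr1.
have cc0 : csch (cmol (dil g s) chi0 1) by apply: csch_mol => //; exact: csch_mol.
have cl : csch (layers m e tau kap lam (dil g s)) by exact: (csch_layers ss hk0 hk hl0 hl ck calderon).
pose A0 := pmax a f lam0 1 x; pose A z := pmax a f lam (tau z) x.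
have A00 : (0 <= A0)%E by exact: pmax_ge0.
have A_0 z : (0 <= A z)%E by exact: pmax_ge0.
have mA : measurable_fun setT (fun z => ((e z * ratio s (tau z) ^+ N)%:E * A z)%E).
  apply: emeasurable_funM; last exact: measurable_pmax_section.
  apply/measurable_EFinP; apply: measurable_funM; first exact: ss_measurable_density ss.
  by apply: measurable_funX; exact: measurable_ratio.
have r0 z : 0 <= ratio s (tau z) by have /andP[? ?] := tau01 z; rewrite ltW// ratio_gt0.
have K0 z : (0 <= (e z * ratio s (tau z) ^+ N)%:E * A z)%E.
  by rewrite mule_ge0// lee_fin mulr_ge0 ?exprn_ge0.
pose I := (\int[m]_z ((e z * ratio s (tau z) ^+ N)%:E * A z))%E.
have I0 : (0 <= I)%E by exact: integral_ge0.
have split_F : cabs (F (dil g s)) <= cabs (F (cmol (dil g s) chi0 1)) +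
    cabs (F (layers m e tau kap lam (dil g s))).
  have EF : F (dil g s) = F (fun u => 1 * cmol (dil g s) chi0 1 u + layers m e tau kap lam (dil g s) u).
    congr F; apply/funext => u; rewrite mul1r.
    exact: (calderon_reproducing ss hk0 hk hl0 hl ck calderon).
  by rewrite EF /F (tempered_lin tF 1 cc0 cl) mul1r; exact: cabsD.
have E1 : ((cabs (F (cmol (dil g s) chi0 1)))%:E <= B%:E * ((C1 * s ^+ N)%:E * A0))%E.
  have rs : ratio s 1 = s by rewrite ratioC ratio1.
  by have := h1 f x v s 1 tf hs one cg (or_intror erefl); rewrite rs.
have E2 : ((cabs (F (layers m e tau kap lam (dil g s))))%:E <= B%:E * (C2%:E * I))%E.
  apply: le_trans (tempered_layers ss hk0 hk hl0 hl ck calderon tF hds) _.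
  apply: (@le_trans _ _ (\int[m]_z ((B * C2)%:E * ((e z * ratio s (tau z) ^+ N)%:E * A z)))%E).
    apply: ge0_le_lower_integral => z _; first by rewrite lee_fin mulr_ge0 ?cabs_ge0.
    rewrite EFinM; apply: le_trans (lee_wpmul2l _ (h2 f x v s (tau z) tf hs (tau01 z) cg (or_introl ck))) _.
      by rewrite lee_fin.
    rewrite -/B -/(A z) !muleA -!EFinM (_ : e z * B * (C2 * ratio s (tau z) ^+ N) =
      B * C2 * (e z * ratio s (tau z) ^+ N)) ?lexx//; ring.
  rewrite ge0_integralZl//; last by rewrite lee_fin mulr_ge0// ltW.
  by rewrite EFinM muleA.
have E3 : ((cabs (F (dil g s)))%:E <= B%:E * ((C1 + C2)%:E * ((s ^+ N)%:E * A0 + I)))%E.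
  apply: (@le_trans _ _ (B%:E * ((C1 * s ^+ N)%:E * A0) + B%:E * (C2%:E * I))%E).
    by apply: le_trans (leeD E1 E2); rewrite -EFinD lee_fin.
  by apply: combine_bounds => //; [exact: ltW|exact: ltW|exact: ltW|rewrite exprn_ge0// ltW].
rewrite -/B mulrC EFinM; apply: (@le_trans _ _ (B^-1%:E * (B%:E * ((C1 + C2)%:E * ((s ^+ N)%:E * A0 + I))))%E).
  by apply: lee_wpmul2l => //; rewrite lee_fin invr_ge0 ltW.
by rewrite muleA -EFinM mulVf ?gt_eqF// mul1e.
Qed.

End pointwise.

(** * Weighted Lebesgue norms *)

Section jensen.
Context dT (T : measurableType dT) (R : realType) (m : {measure set T -> \bar R}).
Local Open Scope ereal_scope.

Lemma powR_sub1 (y s : R) : (0 < y)%R -> (y `^ (s - 1) * y = y `^ s)%R.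
Proof.
move=> y0; rewrite -[X in (_ * X)%R](powRr1 (ltW y0)) -powRD ?subrK//.
by apply/implyP => _; rewrite gt_eqF.
Qed.

(** Up to constants, [x ^ r] lies above its tangent at [b]; integrated, with the best
    [b], this gives Jensen's inequality. *)
Lemma le_tangent_power (r b x : R) : (1 <= r)%R -> (0 < b)%R -> (0 <= x)%R ->
  (x <= b + b `^ (1 - r) * x `^ r)%R.
Proof.
move=> r1 b0 x0; have [xb|/ltW bx] := leP x b.
  by rewrite (le_trans xb)// lerDl mulr_ge0// powR_ge0.
have x_gt0 := lt_le_trans b0 bx.
rewrite -(powR_sub1 r x_gt0) mulrA.
have E : (b `^ (1 - r) * b `^ (r - 1) = 1)%R.
  rewrite -powRD; last by apply/implyP => _; rewrite gt_eqF.
  by rewrite (_ : 1 - r + (r - 1) = 0)%R ?powRr0//; ring.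
have k1 : (1 <= b `^ (1 - r) * x `^ (r - 1))%R.
  apply: (@le_trans _ _ (b `^ (1 - r) * b `^ (r - 1))%R); first by rewrite E.
  rewrite ler_wpM2l ?powR_ge0//.
  by rewrite ge0_ler_powR ?subr_ge0// nnegrE; exact: ltW.
apply: (@le_trans _ _ (b `^ (1 - r) * x `^ (r - 1) * x)%R); first by rewrite ler_peMl.
by rewrite lerDr ltW.
Qed.

(** Jensen's inequality for a measure of total mass at most [B], up to a power of 2. *)
Lemma power_integral_le (k : T -> R) (g : T -> \bar R) (B r : R) : (1 <= r)%R -> (0 < B)%R ->
  measurable_fun setT (k : T -> measurableTypeR R) -> (forall z, (0 <= k z)%R) ->
  measurable_fun setT g -> (forall z, 0 <= g z) -> \int[m]_z (k z)%:E <= B%:E ->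
  (\int[m]_z ((k z)%:E * g z)) `^ r <=
    (2 `^ r * B `^ (r - 1))%:E * \int[m]_z ((k z)%:E * (g z `^ r)).
Proof.
move=> r1 B0 mk k0 mg g0 hB.
have r0 : (0 < r)%R by exact: lt_le_trans r1.
have c0 : (0 < 2 `^ r * B `^ (r - 1))%R by rewrite mulr_gt0 ?powR_gt0.
have mkE : measurable_fun setT (fun z => (k z)%:E) by exact/measurable_EFinP.
have mgr : measurable_fun setT (fun z => (k z)%:E * (g z `^ r)).
  by apply: emeasurable_funM => //; exact: (measurableT_comp (measurable_poweR r)).
have gr0 z : 0 <= (k z)%:E * (g z `^ r) by rewrite mule_ge0 ?poweR_ge0// lee_fin.
have I0 : 0 <= \int[m]_z ((k z)%:E * (g z `^ r)) by exact: integral_ge0.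
have key b : (0 < b)%R -> \int[m]_z ((k z)%:E * g z) <=
    b%:E * B%:E + (b `^ (1 - r))%:E * \int[m]_z ((k z)%:E * (g z `^ r)).
  move=> b0; have bn : (0 <= b `^ (1 - r))%R by exact: powR_ge0.
  apply: (@le_trans _ _ (\int[m]_z (b%:E * (k z)%:E + (b `^ (1 - r))%:E * ((k z)%:E * (g z `^ r))))).
    apply: ge0_le_lower_integral => z _; first by rewrite mule_ge0// lee_fin.
    have := g0 z; case: (g z) => [x||//] => x0.
      rewrite poweR_EFin -!EFinM -EFinD lee_fin.
      rewrite [leRHS](_ : _ = k z * (b + b `^ (1 - r) * x `^ r))%R; last by ring.
      by rewrite ler_wpM2l// le_tangent_power.
    have [kz|kz] := eqVneq (k z) 0%R.
      by rewrite kz !mul0e mule0 add0e mule0.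
    have kp : (0 < k z)%R by rewrite lt0r kz k0.
    have E1 : (k z)%:E * +oo = +oo by rewrite gt0_muley ?lte_fin.
    have E2 : (b `^ (1 - r))%:E * +oo = +oo by rewrite gt0_muley ?lte_fin ?powR_gt0.
    by rewrite poweRyr ?gt_eqF// E1 E2 -EFinM addey// leey.
  rewrite ge0_integralD//; last 4 first.
  - by move=> z _; rewrite -EFinM lee_fin mulr_ge0// ltW.
  - by apply: emeasurable_funM => //; exact: measurable_cst.
  - by move=> z _; rewrite mule_ge0// lee_fin.
  - by apply: emeasurable_funM => //; exact: measurable_cst.
  rewrite ge0_integralZl//; [|by move=> z _; rewrite lee_fin|by rewrite lee_fin ltW].
  rewrite ge0_integralZl//.
  by rewrite leeD2r//; apply: lee_wpmul2l => //; rewrite lee_fin ltW.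
move: I0 key; case: (\int[m]_z ((k z)%:E * (g z `^ r))) => [i||//] i0 key; last first.
  by rewrite gt0_muley ?lte_fin// leey.
rewrite lee_fin in i0.
have [i_0|i_0] := eqVneq i 0%R.
  have : \int[m]_z ((k z)%:E * g z) <= 0.
    apply/lee_addgt0Pr => eps eps0; have := key (eps / B)%R; rewrite divr_gt0// => /(_ isT) h.
    by apply: le_trans h _; rewrite i_0 mule0 adde0 add0e -EFinM divfK// gt_eqF.
  move=> h; have -> : \int[m]_z ((k z)%:E * g z) = 0.
    by apply/eqP; rewrite eq_le h/= integral_ge0// => z _; rewrite mule_ge0// lee_fin.
  by rewrite poweR0r ?gt_eqF// mule_ge0 ?lee_fin// ltW.
have ip : (0 < i)%R by rewrite lt0r i_0.
(* The minimiser, up to a constant, of b * B + b ^ (1 - r) * i. *)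
pose b := ((i / B) `^ r^-1)%R.
have b0 : (0 < b)%R by rewrite powR_gt0// divr_gt0.
have br : (b `^ r = i / B)%R by rewrite -powRrM mulVf ?gt_eqF// powRr1// divr_ge0// ltW.
have := key b b0; rewrite -!EFinM -EFinD => h.
have E : (b * B + b `^ (1 - r) * i = 2 * b * B)%R.
  rewrite powRD; last by apply/implyP => _; rewrite gt_eqF.
  rewrite powRr1 ?(ltW b0)// powRN br invf_div -mulrA divfK//; ring.
rewrite E in h.
apply: (@le_trans _ _ ((2 * b * B)%:E `^ r)).
  apply: gt0_ler_poweR => //; rewrite ?(ltW r0)// in_itv/= ?leey ?andbT.
    by apply: integral_ge0 => z _; rewrite mule_ge0// lee_fin.
  by rewrite lee_fin !mulr_ge0// ltW.
rewrite poweR_EFin lee_fin !powRM ?mulr_ge0 ?(ltW b0) ?(ltW B0)// br.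
have -> : (B `^ r = B `^ (r - 1) * B)%R.
  by rewrite powR_sub1.
by rewrite le_eqVlt; apply/orP; left; apply/eqP; field; rewrite gt_eqF.
Qed.

End jensen.

Section weighted_space.
Context dT (T : measurableType dT) (R : realType).
Variables (m : {sigma_finite_measure set T -> \bar R}) (D : set T) (rho : T -> R).
Local Open Scope ereal_scope.

(** The norms [wLnorm m D rho q] for which the weight [rho] vanishes off [D], so that
    their integrals can be taken over the whole space. *)
Record weighted_space : Prop := WeightedSpace {
  ws_measurable : measurable D;
  ws_measurable_weight : measurable_fun setT (rho : T -> measurableTypeR R);
  ws_weight_ge0 : forall x, (0 <= rho x)%R;
  ws_support : forall x, ~ D x -> rho x = 0%R;
  ws_nontrivial : 0 < m setT }.

Hypothesis ws : weighted_space.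
Let rho0 := ws_weight_ge0 ws.
Let mrho := ws_measurable_weight ws.
Implicit Types (F G : T -> \bar R) (q : \bar R).
Local Notation N q := (wLnorm m D rho q).

Lemma wLnormE (r : R) F : (0 < r)%R -> N r%:E F = (\int[m]_x (`|F x| `^ r * (rho x)%:E)) `^ r^-1.
Proof.
move=> r0; rewrite /wLnorm integral_mkcond; congr (_ `^ _); apply: eq_integral => x _.
rewrite patchE; case: ifPn => //; rewrite notin_setE => Dx.
by rewrite ws_support// mule0.
Qed.

Lemma wLnorm_le q F G : 1 <= q -> (forall x, 0 <= F x) -> (forall x, F x <= G x) -> N q F <= N q G.
Proof.
move=> q1 F0 FG; have G0 x : 0 <= G x by exact: le_trans (FG x).
case: q q1 => [r|_|//].
  rewrite lee_fin => r1; have r0 : (0 < r)%R by exact: lt_le_trans r1.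
  rewrite !wLnormE//; apply: gt0_ler_poweR; rewrite ?invr_ge0 ?(ltW r0)//.
  - rewrite in_itv/= leey andbT; apply: integral_ge0 => x _.
    by rewrite mule_ge0 ?poweR_ge0// lee_fin.
  - rewrite in_itv/= leey andbT; apply: integral_ge0 => x _.
    by rewrite mule_ge0 ?poweR_ge0// lee_fin.
  apply: ge0_le_lower_integral => x _; first by rewrite mule_ge0 ?poweR_ge0// lee_fin.
  apply: lee_wpmul2r; first by rewrite lee_fin.
  by apply: gt0_ler_poweR; rewrite ?(ltW r0)// ?in_itv/= ?leey ?abse_ge0// !gee0_abs.
apply: le_ess_sup; apply: nearW => x; rewrite !patchE; case: ifP => // _ /=.
by rewrite !gee0_abs.
Qed.

Lemma wLnorm_ge0 q F : 1 <= q -> 0 <= N q F.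
Proof.
case: q => [r|_|//] => [_|]; first exact: poweR_ge0.
apply: ess_sup_gee; first exact: ws_nontrivial.
by apply: nearW => x; rewrite patchE; case: ifP => //= _; rewrite abse_ge0.
Qed.

Lemma wLnormZ_le q (c : R) F : 1 <= q -> (0 <= c)%R -> measurable_fun setT F -> (forall x, 0 <= F x) ->
  N q (fun x => c%:E * F x) <= c%:E * N q F.
Proof.
move=> q1 c0 mF F0; case: q q1 => [r|_|//].
  rewrite lee_fin => r1; have r0 : (0 < r)%R by exact: lt_le_trans r1.
  rewrite !wLnormE//.
  have -> : \int[m]_x (`|c%:E * F x| `^ r * (rho x)%:E) =
      (c `^ r)%:E * \int[m]_x (`|F x| `^ r * (rho x)%:E).
    rewrite -ge0_integralZl//.
    - apply: eq_integral => x _; rewrite abseM gee0_abs ?lee_fin//.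
      by rewrite poweRM ?abse_ge0// muleA.
    - apply: emeasurable_funM; last exact/measurable_EFinP.
      by apply: (measurableT_comp (measurable_poweR r)); exact: measurableT_comp.
    - by move=> x _; rewrite mule_ge0 ?poweR_ge0// lee_fin.
    - by rewrite lee_fin powR_ge0.
  rewrite poweRM ?lee_fin ?powR_ge0//; last first.
    by apply: integral_ge0 => x _; rewrite mule_ge0 ?poweR_ge0// lee_fin.
  by rewrite poweR_EFin -powRrM mulfV ?gt_eqF// powRr1.
apply/ess_supP; have := ess_sup_ge m (patch (fun=> 0) D (abse \o F)).
apply: filterS => x; rewrite !patchE; case: ifP => _ h; last first.
  by rewrite mule_ge0 ?lee_fin// (le_trans _ (wLnorm_ge0 F (lexx _)))//; exact: wLnorm_ge0.
by rewrite /= abseM gee0_abs ?lee_fin//; apply: lee_wpmul2l => //; rewrite lee_fin.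
Qed.

Lemma poweR_quasi (r : R) (x y : \bar R) : (0 <= r)%R -> 0 <= x -> 0 <= y ->
  (x + y) `^ r <= (2 `^ r)%:E * (x `^ r + y `^ r).
Proof.
move=> r0 x0 y0.
wlog xy : x y x0 y0 / x <= y.
  move=> H; have [xy|/ltW yx] := leP x y; first exact: H.
  by rewrite addeC [x `^ r + _]addeC; exact: H.
apply: (@le_trans _ _ ((2%:E * y) `^ r)).
  apply: gt0_ler_poweR => //; rewrite ?in_itv/= ?leey ?andbT ?adde_ge0 ?mule_ge0 ?lee_fin//.
  by rewrite mule_natl mule2n leeD2r.
rewrite poweRM ?lee_fin// poweR_EFin; apply: lee_wpmul2l; first by rewrite lee_fin powR_ge0.
by rewrite leeDr// poweR_ge0.
Qed.

(** A quasi-triangle inequality with an absolute constant is enough for equivalent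
    norms. *)
Lemma wLnormD_le q F G : 1 <= q -> measurable_fun setT F -> measurable_fun setT G ->
  (forall x, 0 <= F x) -> (forall x, 0 <= G x) -> N q (fun x => F x + G x) <= 4%:E * (N q F + N q G).
Proof.
move=> q1 mF mG F0 G0.
have NF : 0 <= N q F + N q G by rewrite adde_ge0// wLnorm_ge0.
case: q q1 NF => [r|_ NF|//].
  rewrite lee_fin => r1 NF; have r0 : (0 < r)%R by exact: lt_le_trans r1.
  rewrite !wLnormE//.
  have mp (H : T -> \bar R) : measurable_fun setT H -> measurable_fun setT (fun x => `|H x| `^ r * (rho x)%:E).
    move=> mH; apply: emeasurable_funM; last exact/measurable_EFinP.
    by apply: (measurableT_comp (measurable_poweR r)); exact: measurableT_comp.
  have p0 (H : T -> \bar R) x : 0 <= `|H x| `^ r * (rho x)%:E by rewrite mule_ge0 ?poweR_ge0// lee_fin.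
  set I := \int[m]_x (`|F x| `^ r * _); set J := \int[m]_x (`|G x| `^ r * _).
  have I0 : 0 <= I by exact: integral_ge0.
  have J0 : 0 <= J by exact: integral_ge0.
  have h : \int[m]_x (`|F x + G x| `^ r * (rho x)%:E) <= (2 `^ r)%:E * (I + J).
    rewrite /I /J -ge0_integralD//; [|exact: mp|exact: mp].
    rewrite -ge0_integralZl//; first last.
      all: try by rewrite lee_fin powR_ge0.
      all: try by move=> x _; rewrite adde_ge0.
      all: try by apply: emeasurable_funD; exact: mp.
    apply: ge0_le_lower_integral => x _; first exact: (p0 (fun x => F x + G x)).
    rewrite -ge0_muleDl ?poweR_ge0// muleA; apply: lee_wpmul2r; first by rewrite lee_fin.
    by rewrite !gee0_abs ?adde_ge0//; apply: poweR_quasi => //; exact: ltW.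
  have i0 : (0 <= r^-1)%R by rewrite invr_ge0 ltW.
  apply: (@le_trans _ _ (((2 `^ r)%:E * (I + J)) `^ r^-1)).
    apply: gt0_ler_poweR => //; rewrite in_itv/= leey andbT.
      by apply: integral_ge0 => x _; exact: (p0 (fun x => F x + G x)).
    by apply: mule_ge0; [rewrite lee_fin powR_ge0|exact: adde_ge0].
  have pn : 0 <= (2 `^ r)%:E by rewrite lee_fin powR_ge0.
  rewrite (poweRM _ pn (adde_ge0 I0 J0)) poweR_EFin -powRrM mulfV ?gt_eqF// powRr1//.
  apply: le_trans (lee_wpmul2l _ (poweR_quasi i0 I0 J0)) _; first by rewrite lee_fin.
  rewrite muleA -EFinM; apply: lee_wpmul2r; first by rewrite adde_ge0 ?poweR_ge0.
  rewrite lee_fin (_ : 4 = 2 * 2)%R; last by rewrite -natrM.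
  rewrite ler_wpM2l//; have -> : (2 = 2 `^ 1 :> R)%R by rewrite powRr1.
  by rewrite -[leLHS]/(2 `^ 1 `^ r^-1)%R -powRrM mul1r ler_powR ?ler1n// invf_le1.
apply: (@le_trans _ _ (N +oo F + N +oo G)); last first.
  rewrite -[leLHS]mul1e; apply: lee_wpmul2r => //; by rewrite lee_fin ler1n.
apply: le_trans (ess_supD _ _ _); apply: le_ess_sup; apply: nearW => x; rewrite !patchE.
by case: ifP => _ /=; [exact: lee_abs_add|rewrite adde0].
Qed.

End weighted_space.

(** * Minkowski's inequality *)

Section norm_section.
Context d1 d2 (T1 : measurableType d1) (T2 : measurableType d2) (R : realType).
Variables (m : {sigma_finite_measure set T2 -> \bar R}) (D : set T2) (rho : T2 -> R).
Local Open Scope ereal_scope.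
Hypothesis ws : weighted_space m D rho.
Variable f : T1 * T2 -> \bar R.
Hypotheses (mf : measurable_fun setT f).

(** For an infinite exponent, the superlevel set is the set of sections in
    which the function exceeds the level on a set of positive measure, and Tonelli makes
    that measure a measurable function. *)
Lemma measurable_wLnorm_section q : 1 <= q ->
  measurable_fun setT (fun x => wLnorm m D rho q (fun y => f (x, y))).
Proof.
case: q => [r|_|//].
  rewrite lee_fin => r1; have r0 : (0 < r)%R by exact: lt_le_trans r1.
  under eq_fun do rewrite (wLnormE ws)//.
  apply: (measurableT_comp (measurable_poweR r^-1)).
  apply: (@measurable_fun_fubini_tonelli_F _ _ _ _ _ m (fun p => `|f p| `^ r * (rho p.2)%:E)).
  - apply: emeasurable_funM.
      by apply: (measurableT_comp (measurable_poweR r)); exact: measurableT_comp.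
    apply/measurable_EFinP; exact: (measurableT_comp (ws_measurable_weight ws) measurable_snd).
  - by move=> p; rewrite mule_ge0 ?poweR_ge0// lee_fin (ws_weight_ge0 ws).
apply: (measurability _ (ErealGenOInfty.measurableE R)).
move=> _ [_ [y ->] <-]; rewrite setTI.
pose g (p : T1 * T2) := if p.2 \in D then `|f p| else 0.
have mg : measurable_fun setT g.
  apply: measurable_fun_if => //.
  - apply: (measurable_fun_bool true); rewrite setTI.
    rewrite (_ : _ @^-1` _ = snd @^-1` D); last first.
      by apply/seteqP; split => p /= => [/set_mem|/mem_set].
    by rewrite -[X in measurable X]setTI; apply: measurable_snd => //; exact: ws_measurable ws.
  - by apply: measurable_funTS; exact: measurableT_comp.
pose S := [set p | y%:E < g p].
have mS : measurable S.
  have := mg measurableT _ (emeasurable_itv `]y%:E, +oo[); rewrite setTI.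
  by congr measurable; apply/seteqP; split => p; rewrite /S /= in_itv/= andbT.
have := measurable_fun_xsection m mS; move=> h.
have := h measurableT _ (emeasurable_itv `]0, +oo[); rewrite setTI; congr measurable.
apply/seteqP; split => x /=; rewrite !in_itv/= !andbT => hx.
  rewrite ltNge; apply/negP => /ess_supP le.
  move: hx; rewrite ltNge; move/negP; apply.
  have : {ae m, forall z, g (x, z) <= y%:E}.
    by apply: filterS le => z; rewrite patchE /g/=; case: ifP.
  rewrite (ae_le_measureP); last exact: (measurableT_comp mg (pair1_measurable x)).
  move=> e; rewrite (_ : xsection S x = (fun z => g (x, z)) @^-1` `]y%:E, +oo[) ?e//.
  by apply/seteqP; split => z; rewrite /xsection /= inE /S/= in_itv/= andbT.
rewrite ltNge; apply/negP => le; move: hx; rewrite ltNge; move/negP; apply.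
have /ess_supP : {ae m, forall z, g (x, z) <= y%:E}.
  apply/ae_le_measureP; first exact: (measurableT_comp mg (pair1_measurable x)).
  apply/eqP; rewrite -measure_le0; move: le.
  rewrite (_ : xsection S x = (fun z => g (x, z)) @^-1` `]y%:E, +oo[)//.
  by apply/seteqP; split => z; rewrite /xsection /= inE /S/= in_itv/= andbT.
move=> h'; apply: le_trans h'; apply: le_ess_sup; apply: nearW => z.
by rewrite patchE /g /=; case: ifP.
Qed.

End norm_section.

Section minkowski.
Context d1 d2 (X : measurableType d1) (Z : measurableType d2) (R : realType).
Variables (mu : {sigma_finite_measure set X -> \bar R}) (D : set X) (rho : X -> R).
Variable (m : {sigma_finite_measure set Z -> \bar R}).
Local Open Scope ereal_scope.
Hypothesis ws : weighted_space mu D rho.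
Variables (k : Z -> R) (kap : R) (A : X * Z -> \bar R).
Hypotheses (mk : measurable_fun setT (k : Z -> measurableTypeR R)) (k0 : forall z, (0 <= k z)%R).
Hypotheses (kap0 : (0 < kap)%R) (hk : \int[m]_z (k z)%:E <= kap%:E).
Hypotheses (mA : measurable_fun setT A) (A0 : forall p, 0 <= A p).
Local Notation N q := (wLnorm mu D rho q).
Local Notation c p z := (N p (fun x => A (x, z))).

Lemma measurable_norm_slice p : 1 <= p -> measurable_fun setT (fun z => c p z).
Proof.
move=> p1; apply: (@measurable_wLnorm_section _ _ _ _ _ _ _ _ ws (fun q => A (q.2, q.1))) => //.
apply: (measurableT_comp (f := A) mA).
by apply/measurable_fun_pairP; split; [exact: measurable_snd|exact: measurable_fst].
Qed.

Let c0 p z : 1 <= p -> 0 <= c p z. Proof. by move=> p1; exact: wLnorm_ge0. Qed.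
Let mkE : measurable_fun setT (fun z => (k z)%:E). Proof. exact/measurable_EFinP. Qed.
Let mkA x : measurable_fun setT (fun z => (k z)%:E * A (x, z)).
Proof. by apply: emeasurable_funM => //; exact: (measurableT_comp mA (pair1_measurable x)). Qed.

(** Integral form of Minkowski's inequality, from Jensen's inequality for the
    measure of density [k z * (c z + delta)]. *)
Lemma minkowski_finite (r : R) : (1 <= r)%R ->
  N r%:E (fun x => \int[m]_z ((k z)%:E * A (x, z))) <= 2%:E * \int[m]_z ((k z)%:E * c r%:E z).
Proof.
move=> r1; have r1E : 1 <= r%:E by rewrite lee_fin.
have r0 : (0 < r)%R by exact: lt_le_trans r1.
have mc := measurable_norm_slice r1E.
have mkc : measurable_fun setT (fun z => (k z)%:E * c r%:E z) by exact: emeasurable_funM.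
have kc0 z : 0 <= (k z)%:E * c r%:E z by rewrite mule_ge0 ?lee_fin// c0.
have S0 : 0 <= \int[m]_z ((k z)%:E * c r%:E z) by exact: integral_ge0.
case ES : (\int[m]_z ((k z)%:E * c r%:E z)) => [S||].
- apply/lee_addgt0Pr => eps eps0; rewrite ES lee_fin in S0.
  (* The shift by [del] keeps [w] positive where the norm of a slice vanishes. *)
  pose del := (eps / (2 * kap))%R; have del0 : (0 < del)%R by rewrite divr_gt0// mulr_gt0.
  pose w z := (fine (c r%:E z) + del)%R.
  have w0 z : (0 < w z)%R by rewrite ltr_wpDl// fine_ge0// c0.
  have mw : measurable_fun setT (w : Z -> measurableTypeR R).
    apply: measurable_funD; last exact: measurable_cst.
    by apply: (@measurableT_comp _ _ _ _ _ _ (@fine R)).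
  pose B := (S + del * kap)%R; have B0 : (0 < B)%R by rewrite ltr_wpDl// mulr_gt0.
  have mkw : measurable_fun setT ((fun z => (k z * w z)%R) : Z -> measurableTypeR R) by exact: measurable_funM.
  have kw0 z : (0 <= k z * w z)%R by rewrite mulr_ge0// ltW.
  have kwB : \int[m]_z (k z * w z)%:E <= B%:E.
    apply: (@le_trans _ _ (\int[m]_z ((k z)%:E * c r%:E z + del%:E * (k z)%:E))).
      apply: ge0_le_lower_integral => z _; first by rewrite lee_fin.
      rewrite mulrDr EFinD (mulrC (k z) del) EFinM; apply: leeD => //.
      apply: lee_wpmul2l; first by rewrite lee_fin.
      by have := c0 z r1E; case: (c r%:E z) => [x||]//= _; rewrite leey.
    rewrite ge0_integralD//; last 2 first.
    - by move=> z _; rewrite -EFinM lee_fin mulr_ge0// ltW.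
    - by apply: emeasurable_funM => //; exact: measurable_cst.
    rewrite ge0_integralZl//; [|by move=> z _; rewrite lee_fin|by rewrite lee_fin ltW].
    rewrite ES EFinD; apply: leeD => //; rewrite (EFinM del kap); apply: lee_wpmul2l => //.
    by rewrite lee_fin ltW.
  pose g x z := (w z)^-1%:E * A (x, z).
  have mwi : measurable_fun setT (fun z => (w z)^-1%:E).
    apply/measurable_EFinP; have := measurableT_comp (@measurable_expR R)
      (measurable_funN (measurableT_comp (@measurable_ln R) mw)).
    by apply: eq_measurable_fun => z _ /=; rewrite -lnV ?posrE ?lnK ?posrE ?invr_gt0.
  have mg x : measurable_fun setT (g x).
    by apply: emeasurable_funM => //; exact: (measurableT_comp mA (pair1_measurable x)).
  have g0 x z : 0 <= g x z by rewrite mule_ge0// lee_fin invr_ge0 ltW.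
  have Eg x : \int[m]_z ((k z)%:E * A (x, z)) = \int[m]_z ((k z * w z)%:E * g x z).
    apply: eq_integral => z _; rewrite /g muleA -EFinM -mulrA mulfV ?mulr1// gt_eqF//.
  have J x := power_integral_le r1 B0 mkw kw0 (mg x) (g0 x) kwB.
  pose cst := (2 `^ r * B `^ (r - 1))%R.
  have cst0 : (0 <= cst)%R by rewrite mulr_ge0 ?powR_ge0.
  pose h (p : X * Z) := (k p.2 * w p.2)%:E * (g p.1 p.2 `^ r) * (rho p.1)%:E.
  have rho0 x : 0 <= (rho x)%:E by rewrite lee_fin (ws_weight_ge0 ws).
  have mrho : measurable_fun setT (fun x => (rho x)%:E) by apply/measurable_EFinP; exact: ws_measurable_weight ws.
  have h0 p : 0 <= h p by rewrite !mule_ge0 ?poweR_ge0// lee_fin.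
  have mh : measurable_fun setT h.
    apply: emeasurable_funM; last exact: (measurableT_comp mrho measurable_fst).
    apply: emeasurable_funM.
      apply/measurable_EFinP; exact: (measurableT_comp mkw measurable_snd).
    apply: (measurableT_comp (measurable_poweR r)); apply: emeasurable_funM.
      exact: (measurableT_comp mwi measurable_snd).
    by rewrite (_ : (fun x => A (x.1, x.2)) = A)//; apply/funext => -[].
  have step : \int[mu]_x (`|\int[m]_z ((k z)%:E * A (x, z))| `^ r * (rho x)%:E) <= (2 `^ r * B `^ r)%:E.
    apply: (@le_trans _ _ (\int[mu]_x (cst%:E * \int[m]_z h (x, z)))).
      apply: ge0_le_lower_integral => x _; first by rewrite mule_ge0 ?poweR_ge0.
      rewrite gee0_abs; last by apply: integral_ge0 => z _; rewrite mule_ge0 ?lee_fin.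
      have -> : \int[m]_z h (x, z) = (\int[m]_z ((k z * w z)%:E * (g x z `^ r))) * (rho x)%:E.
        rewrite -ge0_integralZr//.
          apply: emeasurable_funM; first exact/measurable_EFinP.
          exact: (measurableT_comp (measurable_poweR r)).
        by move=> z _; rewrite mule_ge0 ?poweR_ge0// lee_fin.
      rewrite Eg muleA; apply: lee_wpmul2r => //; exact: J.
    have mFh : measurable_fun setT (fun x => \int[m]_z h (x, z)).
      exact: (@measurable_fun_fubini_tonelli_F _ _ _ _ _ m h mh h0).
    have Fh0 x : 0 <= \int[m]_z h (x, z) by exact: integral_ge0.
    rewrite ge0_integralZl ?lee_fin//.
    rewrite (@fubini_tonelli _ _ _ _ _ mu m h mh h0).
    have B1 : (B `^ r = B `^ (r - 1) * B)%R by rewrite powR_sub1.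
    have -> : (2 `^ r * B `^ r)%:E = cst%:E * B%:E by rewrite B1 mulrA EFinM.
    apply: lee_wpmul2l; first by rewrite lee_fin.
    apply: le_trans kwB.
    have Eh z : \int[mu]_x h (x, z) = (k z * w z)%:E * ((w z)^-1%:E `^ r * (c r%:E z `^ r)).
      have -> : c r%:E z `^ r = \int[mu]_x (A (x, z) `^ r * (rho x)%:E).
        rewrite (wLnormE ws)// -poweRrM mulVf ?gt_eqF// poweRe1.
          by apply: eq_integral => x _; rewrite gee0_abs.
        by apply: integral_ge0 => x _; rewrite mule_ge0 ?poweR_ge0.
      have mAz : measurable_fun setT (fun x => A (x, z) `^ r * (rho x)%:E).
        apply: emeasurable_funM => //; apply: (measurableT_comp (measurable_poweR r)).
        exact: (measurableT_comp mA (pair2_measurable z)).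
      have Az0 x : 0 <= A (x, z) `^ r * (rho x)%:E by rewrite mule_ge0 ?poweR_ge0.
      rewrite muleA -ge0_integralZl//; last by rewrite mule_ge0 ?poweR_ge0// lee_fin.
      apply: eq_integral => x _; rewrite /h /g poweRM ?lee_fin ?invr_ge0 ?(ltW (w0 z))//.
      by rewrite !muleA.
    have ikc : m.-integrable setT (fun z => (k z)%:E * c r%:E z).
      apply/integrableP; split => //; under eq_integral do rewrite gee0_abs//.
      by rewrite ES ltry.
    apply: ae_ge0_le_integral => //.
    - by move=> z _; exact: integral_ge0.
    - exact: (@measurable_fun_fubini_tonelli_G _ _ _ _ _ mu h mh h0).
    - by move=> z _; rewrite lee_fin.
    - exact/measurable_EFinP.
    have := integrable_ae measurableT ikc; apply: filterS => z hz _; rewrite Eh.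
    have {}hz := hz I.
    have [kz|kz] := eqVneq (k z) 0%R; first by rewrite kz mul0r mul0e.
    rewrite -[leRHS]mule1; apply: lee_wpmul2l; first by rewrite lee_fin.
    have fc : c r%:E z \is a fin_num.
      move: hz; have := c0 z r1E; case: (c r%:E z) => [x||//]// _.
      by rewrite gt0_muley// lte_fin lt0r kz k0.
    rewrite -poweRM ?lee_fin ?invr_ge0 ?(ltW (w0 z)) ?c0//.
    have e1 : (1 = 1 `^ r :> R)%R by rewrite powR1.
    rewrite -(fineK fc) -EFinM poweR_EFin lee_fin [leRHS]e1.
    rewrite ge0_ler_powR ?(ltW r0)// ?nnegrE ?mulr_ge0 ?invr_ge0 ?(ltW (w0 z)) ?fine_ge0 ?c0//.
    by rewrite mulrC ler_pdivrMr// mul1r lerDl ltW.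
  rewrite (wLnormE ws)//; apply: (@le_trans _ _ ((2 `^ r * B `^ r)%:E `^ r^-1)).
    apply: gt0_ler_poweR => //; rewrite ?invr_ge0 ?(ltW r0)// in_itv/= leey andbT.
      by apply: integral_ge0 => x _; rewrite mule_ge0 ?poweR_ge0.
    by rewrite lee_fin mulr_ge0 ?powR_ge0.
  rewrite poweR_EFin powRM ?powR_ge0// -!powRrM !mulfV ?gt_eqF// !powRr1 ?(ltW B0)//.
  rewrite -EFinM -EFinD lee_fin /B mulrDr lerD2l /del.
  by rewrite le_eqVlt; apply/orP; left; apply/eqP; field; rewrite gt_eqF.
- by rewrite gt0_muley ?leey// lte_fin.
- by rewrite ES in S0.
Qed.

(** The set where [A] exceeds its essential supremum in the first variable has
    null sections in one direction, hence in the other. *)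
Lemma minkowski_oo :
  N +oo (fun x => \int[m]_z ((k z)%:E * A (x, z))) <= \int[m]_z ((k z)%:E * c +oo z).
Proof.
have p1 : (1 <= +oo :> \bar R) by rewrite leey.
have mc := measurable_norm_slice p1.
have mkc : measurable_fun setT (fun z => (k z)%:E * c +oo z) by exact: emeasurable_funM.
have kc0 z : 0 <= (k z)%:E * c +oo z by rewrite mule_ge0 ?lee_fin// c0.
pose Nl := [set p : X * Z | D p.1 /\ c +oo p.2 < A p].
have mNl : measurable Nl.
  have mc2 : measurable_fun setT (fun p : X * Z => c +oo p.2) by exact: (measurableT_comp mc measurable_snd).
  have m1 : measurable [set p : X * Z | c +oo p.2 < A p].
    by rewrite -[X in measurable X]setTI; exact: emeasurable_fun_lt.
  have m2 : measurable (fst @^-1` D : set (X * Z)).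
    by rewrite -[X in measurable X]setTI; apply: measurable_fst => //; exact: ws_measurable ws.
  exact: measurableI.
have mi : measurable_fun setT (fun p => (\1_Nl p : R)%:E).
  by apply/measurable_EFinP; exact: measurable_indic.
have i0 p : 0 <= (\1_Nl p : R)%:E by rewrite lee_fin.
have z0 : \int[mu]_x \int[m]_z (\1_Nl (x, z) : R)%:E = 0.
  rewrite (@fubini_tonelli _ _ _ _ _ mu m _ mi i0) integral0_eq// => z _.
  have -> : \int[mu]_x (\1_Nl (x, z) : R)%:E = \int[mu]_x (\1_(ysection Nl z) x : R)%:E.
    by apply: eq_integral => x _; rewrite !indicE mem_ysection.
  rewrite integral_indic ?setIT//; last exact: measurable_ysection.
  have := ess_sup_ge mu ((abse \o (fun x => A (x, z))) \_ D).
  move=> [M [mM M0 hM]]; apply: subset_measure0 M0 => //; first exact: measurable_ysection.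
  move=> x; rewrite /ysection/= inE /Nl/= => -[Dx lt]; apply: hM => /= le.
  move: lt; rewrite ltNge; move/negP; apply; apply: le_trans le.
  by rewrite patchE mem_set//= gee0_abs.
have mF : measurable_fun setT (fun x => \int[m]_z (\1_Nl (x, z) : R)%:E).
  exact: (@measurable_fun_fubini_tonelli_F _ _ _ _ _ m _ mi i0).
apply/ess_supP.
have /(ae_eq_integral_abs mu measurableT mF).1 : \int[mu]_x `|\int[m]_z (\1_Nl (x, z) : R)%:E| = 0.
  by rewrite -[RHS]z0; apply: eq_integral => x _; rewrite gee0_abs// integral_ge0.
apply: filterS => x /(_ I) hx; rewrite patchE; case: ifPn => [|_]; last exact: integral_ge0.
rewrite inE => Dx /=; rewrite gee0_abs; last first.
  by apply: integral_ge0 => z _; rewrite mule_ge0 ?lee_fin.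
apply: ae_ge0_le_integral => //.
- by move=> z _; rewrite mule_ge0 ?lee_fin.
have mx : measurable_fun setT (fun z => (\1_Nl (x, z) : R)%:E) by exact: (measurableT_comp mi (pair1_measurable x)).
have /(ae_eq_integral_abs m measurableT mx).1 : \int[m]_z `|(\1_Nl (x, z) : R)%:E| = 0.
  by rewrite -[RHS]hx; apply: eq_integral => z _; rewrite gee0_abs.
apply: filterS => z /(_ I) hz _; apply: lee_wpmul2l; first by rewrite lee_fin.
rewrite leNgt; apply/negP => lt; move: hz; rewrite indicE mem_set//= => -[] /eqP.
by rewrite oner_eq0.
Qed.

Lemma minkowski_le p : 1 <= p ->
  N p (fun x => \int[m]_z ((k z)%:E * A (x, z))) <= 2%:E * \int[m]_z ((k z)%:E * c p z).
Proof.
case: p => [r|_|//]; first by rewrite lee_fin; exact: minkowski_finite.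
apply: le_trans minkowski_oo _; rewrite -[leLHS]mul1e; apply: lee_wpmul2r; last by rewrite lee_fin ler1n.
by apply: integral_ge0 => z _; rewrite mule_ge0 ?lee_fin// c0// leey.
Qed.

End minkowski.

(** * Schur's test *)

Lemma powR_split (R : realType) (M r : R) : 0 < M -> 2 `^ r * M `^ (r - 1) * M = 2 `^ r * M `^ r.
Proof. by move=> M0; rewrite -(powR_sub1 r M0) mulrA. Qed.

Section schur.
Context d1 d2 (Z : measurableType d1) (Z' : measurableType d2) (R : realType).
Variables (m : {sigma_finite_measure set Z -> \bar R}) (D : set Z) (e : Z -> R).
Variables (m' : {sigma_finite_measure set Z' -> \bar R}) (D' : set Z') (e' : Z' -> R).
Local Open Scope ereal_scope.
Hypothesis ws : weighted_space m D e.
Hypothesis ws' : weighted_space m' D' e'.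
Variables (M : R) (H : Z -> \bar R).
Hypotheses (M1 : (1 <= M)%R) (mH : measurable_fun setT H) (H0 : forall z, 0 <= H z).

Let M0 : (0 < M)%R. Proof. exact: lt_le_trans M1. Qed.
Let e0 := ws_weight_ge0 ws.
Let e0' := ws_weight_ge0 ws'.

Lemma kernel_le_sup (k : Z -> R) : measurable_fun setT (k : Z -> measurableTypeR R) ->
  (forall z, (0 <= k z)%R) -> \int[m]_z (e z * k z)%:E <= M%:E ->
  \int[m]_z ((e z * k z)%:E * H z) <= M%:E * wLnorm m D e +oo H.
Proof.
move=> mk k0 hk; have N0 : 0 <= wLnorm m D e +oo H by apply: wLnorm_ge0 => //; exact: leey.
have mek : measurable_fun setT (fun z => (e z * k z)%:E).
  by apply/measurable_EFinP; apply: measurable_funM => //; exact: ws_measurable_weight ws.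
have ek0 z : 0 <= (e z * k z)%:E by rewrite lee_fin mulr_ge0.
apply: (@le_trans _ _ (\int[m]_z ((e z * k z)%:E * wLnorm m D e +oo H))); last first.
  by rewrite ge0_integralZr//; exact: lee_wpmul2r.
apply: ae_ge0_le_integral => //.
- by move=> z _; exact: mule_ge0.
- exact: emeasurable_funM.
- by move=> z _; exact: mule_ge0.
- by apply: emeasurable_funM => //; exact: measurable_cst.
have := ess_sup_ge m ((abse \o H) \_ D); apply: filterS => z hz _.
have [Dz|nDz] := pselect (D z); last by rewrite (ws_support ws nDz) mul0r !mul0e.
apply: lee_wpmul2l => //; apply: le_trans hz.
by rewrite patchE mem_set//= gee0_abs.
Qed.

Let mHr r : measurable_fun setT (fun z => H z `^ r).
Proof. exact: (measurableT_comp (measurable_poweR r)). Qed.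
Let meE : measurable_fun setT (fun z => (e z)%:E).
Proof. by apply/measurable_EFinP; exact: ws_measurable_weight ws. Qed.

(** Jensen's inequality; the kernel that it leaves inside the integral is at most 1. *)
Lemma kernel_le_norm q (k : Z -> R) : 1 <= q -> measurable_fun setT (k : Z -> measurableTypeR R) ->
  (forall z, (0 <= k z <= 1)%R) -> \int[m]_z (e z * k z)%:E <= M%:E ->
  \int[m]_z ((e z * k z)%:E * H z) <= (2 * M)%:E * wLnorm m D e q H.
Proof.
move=> q1 mk k01 hk.
have k0 z : (0 <= k z)%R by have /andP[] := k01 z.
have k1 z : (k z <= 1)%R by have /andP[] := k01 z.
have mek : measurable_fun setT ((fun z => e z * k z)%R : Z -> measurableTypeR R).
  by apply: measurable_funM => //; exact: ws_measurable_weight ws.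
have ek0 z : (0 <= e z * k z)%R by rewrite mulr_ge0.
case: q q1 => [r|_|//]; last first.
  apply: le_trans (kernel_le_sup mk k0 hk) _; apply: lee_wpmul2r.
    by apply: wLnorm_ge0 => //; exact: leey.
  by rewrite lee_fin ler_peMl ?(ltW M0)// ler1n.
rewrite lee_fin => r1; have r0 : (0 < r)%R by exact: lt_le_trans r1.
have J := power_integral_le r1 M0 mek ek0 mH H0 hk.
set I := \int[m]_z ((e z * k z)%:E * H z) in J *.
have I0 : 0 <= I by apply: integral_ge0 => z _; rewrite mule_ge0// lee_fin.
have Hr0 : 0 <= \int[m]_z (`|H z| `^ r * (e z)%:E).
  by apply: integral_ge0 => z _; rewrite mule_ge0 ?poweR_ge0// lee_fin.
have J2 : I `^ r <= (2 `^ r * M `^ r)%:E * \int[m]_z (`|H z| `^ r * (e z)%:E).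
  apply: le_trans J _; apply: (@le_trans _ _ ((2 `^ r * M `^ (r - 1))%:E * \int[m]_z (`|H z| `^ r * (e z)%:E))).
    apply: lee_wpmul2l; first by rewrite lee_fin mulr_ge0 ?powR_ge0.
    apply: ge0_le_lower_integral => z _; first by rewrite mule_ge0 ?poweR_ge0 ?lee_fin.
    rewrite gee0_abs// muleC; apply: lee_wpmul2l; first exact: poweR_ge0.
    by rewrite lee_fin ler_piMr.
  apply: lee_wpmul2r => //; rewrite lee_fin ler_wpM2l ?powR_ge0// ler_powR//.
  by rewrite gerBl.
have i0 : (0 <= r^-1)%R by rewrite invr_ge0 ltW.
have -> : I = (I `^ r) `^ r^-1 by rewrite -poweRrM mulfV ?gt_eqF// poweRe1.
apply: (@le_trans _ _ (((2 `^ r * M `^ r)%:E * \int[m]_z (`|H z| `^ r * (e z)%:E)) `^ r^-1)).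
  apply: gt0_ler_poweR => //; rewrite in_itv/= leey andbT ?poweR_ge0//.
  by apply: mule_ge0 => //; rewrite lee_fin mulr_ge0 ?powR_ge0.
have pn : 0 <= (2 `^ r * M `^ r)%:E by rewrite lee_fin mulr_ge0 ?powR_ge0.
rewrite (poweRM _ pn Hr0) (wLnormE ws)// poweR_EFin powRM ?powR_ge0//.
by rewrite -!powRrM !mulfV ?gt_eqF// !powRr1// ltW.
Qed.

(** Jensen's inequality in [z] for the row sums, then Tonelli and the column sums. *)
Lemma schur_le q (K : Z' * Z -> R) : 1 <= q ->
  measurable_fun setT (K : (Z' * Z)%type -> measurableTypeR R) -> (forall p, (0 <= K p)%R) ->
  (forall z', \int[m]_z (e z * K (z', z))%:E <= M%:E) ->
  (forall z, \int[m']_z' (e' z' * K (z', z))%:E <= M%:E) ->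
  wLnorm m' D' e' q (fun z' => \int[m]_z ((e z * K (z', z))%:E * H z)) <=
    (2 * M)%:E * wLnorm m D e q H.
Proof.
move=> q1 mK K0 hK hK'.
have mKz z' : measurable_fun setT ((fun z => K (z', z)) : Z -> measurableTypeR R).
  exact: (measurableT_comp mK (pair1_measurable z')).
have mKz' z : measurable_fun setT ((fun z' => K (z', z)) : Z' -> measurableTypeR R).
  exact: (measurableT_comp mK (pair2_measurable z)).
have I0 z' : 0 <= \int[m]_z ((e z * K (z', z))%:E * H z).
  by apply: integral_ge0 => z _; rewrite mule_ge0// lee_fin mulr_ge0.
case: q q1 => [r|_|//]; last first.
  have N0 : 0 <= wLnorm m D e +oo H by apply: wLnorm_ge0 => //; exact: leey.
  apply: (@le_trans _ _ (M%:E * wLnorm m D e +oo H)); last first.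
    by apply: lee_wpmul2r => //; rewrite lee_fin ler_peMl ?(ltW M0)// ler1n.
  apply/ess_supP; apply: nearW => z'; rewrite patchE; case: ifP => _; last first.
    by apply: mule_ge0 => //; rewrite lee_fin ltW.
  by rewrite /= gee0_abs//; apply: kernel_le_sup => // z; exact: K0.
rewrite lee_fin => r1; have r0 : (0 < r)%R by exact: lt_le_trans r1.
have mek z' : measurable_fun setT ((fun z => e z * K (z', z))%R : Z -> measurableTypeR R).
  by apply: measurable_funM; [exact: ws_measurable_weight ws|exact: mKz].
have ek0 z' z : (0 <= e z * K (z', z))%R by rewrite mulr_ge0.
have J z' := power_integral_le r1 M0 (mek z') (ek0 z') mH H0 (hK z').
pose cst := (2 `^ r * M `^ (r - 1))%R.
have cst0 : (0 <= cst)%R by rewrite mulr_ge0 ?powR_ge0.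
pose h (p : Z' * Z) := (e' p.1)%:E * ((e p.2 * K p)%:E * (H p.2 `^ r)).
have h0 p : 0 <= h p by rewrite !mule_ge0 ?poweR_ge0 ?lee_fin ?mulr_ge0.
have me' : measurable_fun setT (fun z' => (e' z')%:E).
  by apply/measurable_EFinP; exact: ws_measurable_weight ws'.
have mh : measurable_fun setT h.
  apply: emeasurable_funM; first exact: (measurableT_comp me' measurable_fst).
  apply: emeasurable_funM; last exact: (measurableT_comp (mHr r) measurable_snd).
  apply/measurable_EFinP; apply: measurable_funM => //.
  exact: (measurableT_comp (ws_measurable_weight ws) measurable_snd).
have mF : measurable_fun setT (fun z' => \int[m]_z h (z', z)).
  exact: (@measurable_fun_fubini_tonelli_F _ _ _ _ _ m h mh h0).
have F0 z' : 0 <= \int[m]_z h (z', z) by exact: integral_ge0.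
have Hr0 : 0 <= \int[m]_z (`|H z| `^ r * (e z)%:E).
  by apply: integral_ge0 => z _; rewrite mule_ge0 ?poweR_ge0// lee_fin.
have step : \int[m']_z' (`|\int[m]_z ((e z * K (z', z))%:E * H z)| `^ r * (e' z')%:E) <=
    (2 `^ r * M `^ r)%:E * \int[m]_z (`|H z| `^ r * (e z)%:E).
  apply: (@le_trans _ _ (\int[m']_z' (cst%:E * \int[m]_z h (z', z)))).
    apply: ge0_le_lower_integral => z' _; first by rewrite mule_ge0 ?poweR_ge0// lee_fin.
    rewrite gee0_abs//.
    have -> : \int[m]_z h (z', z) = (e' z')%:E * \int[m]_z ((e z * K (z', z))%:E * (H z `^ r)).
      rewrite -ge0_integralZl ?lee_fin//.
        by apply: emeasurable_funM; [apply/measurable_EFinP; exact: mek|exact: mHr].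
      by move=> z _; rewrite mule_ge0 ?poweR_ge0 ?lee_fin.
    rewrite muleCA muleC; apply: lee_wpmul2l; first by rewrite lee_fin.
    exact: J.
  rewrite ge0_integralZl ?lee_fin// (@fubini_tonelli _ _ _ _ _ m' m h mh h0).
  have B1 : (2 `^ r * M `^ r = cst * M)%R by exact: (esym (powR_split r M0)).
  rewrite [X in _ <= X * _](_ : _ = cst%:E * M%:E); last by rewrite B1 EFinM.
  rewrite -muleA; apply: lee_wpmul2l; first by rewrite lee_fin.
  have mHe : measurable_fun setT (fun z => `|H z| `^ r * (e z)%:E).
    apply: emeasurable_funM => //; apply: (measurableT_comp (measurable_poweR r)).
    exact: measurableT_comp.
  have He0 z : 0 <= `|H z| `^ r * (e z)%:E by rewrite mule_ge0 ?poweR_ge0// lee_fin.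
  rewrite -ge0_integralZl ?lee_fin ?(ltW M0)//.
  apply: ge0_le_lower_integral => z _; first exact: integral_ge0.
  have -> : \int[m']_z' h (z', z) = \int[m']_z' ((e' z' * K (z', z))%:E) * (`|H z| `^ r * (e z)%:E).
    rewrite -ge0_integralZr//.
    - apply: eq_integral => z' _; rewrite /h/= gee0_abs// !EFinM.
      by rewrite -!muleA; congr (_ * _); rewrite muleCA; congr (_ * _); rewrite muleC.
    - by apply/measurable_EFinP; apply: measurable_funM; [exact: ws_measurable_weight ws'|exact: mKz'].
    - by move=> z' _; rewrite lee_fin mulr_ge0.
  by apply: lee_wpmul2r => //; exact: hK'.
have i0 : (0 <= r^-1)%R by rewrite invr_ge0 ltW.
have pn : 0 <= (2 `^ r * M `^ r)%:E by rewrite lee_fin mulr_ge0 ?powR_ge0.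
rewrite (wLnormE ws')//.
apply: (@le_trans _ _ (((2 `^ r * M `^ r)%:E * \int[m]_z (`|H z| `^ r * (e z)%:E)) `^ r^-1)).
  apply: gt0_ler_poweR => //; rewrite in_itv/= leey andbT.
    by apply: integral_ge0 => z' _; rewrite mule_ge0 ?poweR_ge0// lee_fin.
  exact: mule_ge0.
rewrite (poweRM _ pn Hr0) (wLnormE ws)// poweR_EFin powRM ?powR_ge0//.
by rewrite -!powRrM !mulfV ?gt_eqF// !powRr1// ltW.
Qed.

End schur.

Section scale_factor.
Context d1 (Z : measurableType d1) (R : realType).
Variables (m : {sigma_finite_measure set Z -> \bar R}) (D : set Z) (e : Z -> R).
Local Open Scope ereal_scope.
Hypothesis ws : weighted_space m D e.

Lemma wLnorm_scale_le q (M : R) (t : Z -> R) (c : \bar R) : 1 <= q -> (1 <= M)%R ->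
  measurable_fun setT (t : Z -> measurableTypeR R) -> (forall z, (0 <= t z <= 1)%R) ->
  \int[m]_z (e z * t z)%:E <= M%:E -> 0 <= c ->
  wLnorm m D e q (fun z => (t z)%:E * c) <= M%:E * c.
Proof.
move=> q1 M1 mt t01 hM c0; have M0 : (0 < M)%R by exact: lt_le_trans M1.
have t0 z : (0 <= t z)%R by have /andP[] := t01 z.
have t1 z : (t z <= 1)%R by have /andP[] := t01 z.
have e0 := ws_weight_ge0 ws.
case: q q1 => [r|_|//]; last first.
  apply/ess_supP; apply: nearW => z; rewrite patchE; case: ifP => _; last first.
    by apply: mule_ge0 => //; rewrite lee_fin ltW.
  rewrite /= gee0_abs; last by rewrite mule_ge0// lee_fin.
  by apply: lee_wpmul2r => //; rewrite lee_fin (le_trans (t1 z)).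
rewrite lee_fin => r1; have r0 : (0 < r)%R by exact: lt_le_trans r1.
have step : \int[m]_z (`|(t z)%:E * c| `^ r * (e z)%:E) <= (M `^ r)%:E * (c `^ r).
  apply: (@le_trans _ _ (\int[m]_z ((e z * t z)%:E * (c `^ r)))).
    apply: ge0_le_lower_integral => z _; first by rewrite mule_ge0 ?poweR_ge0// lee_fin.
    rewrite gee0_abs; last by rewrite mule_ge0// lee_fin.
    rewrite poweRM ?lee_fin// poweR_EFin muleAC -EFinM; apply: lee_wpmul2r; first exact: poweR_ge0.
    rewrite lee_fin mulrC ler_wpM2l//.
    have [tz|tz] := eqVneq (t z) 0%R; first by rewrite tz powR0 ?gt_eqF.
    have tp : (0 < t z)%R by rewrite lt0r tz t0.
    by rewrite -[leRHS](powRr1 (t0 z)); apply: ger_powR => //; rewrite tp t1.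
  rewrite ge0_integralZr ?poweR_ge0//; last 2 first.
  - apply/measurable_EFinP; apply: measurable_funM => //; exact: ws_measurable_weight ws.
  - by move=> z _; rewrite lee_fin mulr_ge0.
  apply: lee_wpmul2r; first exact: poweR_ge0.
  apply: le_trans hM _; rewrite lee_fin -[leLHS](powRr1 (ltW M0)); exact: ler_powR.
have pn : 0 <= (M `^ r)%:E by rewrite lee_fin powR_ge0.
rewrite (wLnormE ws)//; apply: (@le_trans _ _ (((M `^ r)%:E * (c `^ r)) `^ r^-1)).
  apply: gt0_ler_poweR; rewrite ?invr_ge0 ?(ltW r0)// in_itv/= leey andbT.
    by apply: integral_ge0 => z _; rewrite mule_ge0 ?poweR_ge0// lee_fin.
  by rewrite mule_ge0 ?poweR_ge0.
rewrite (poweRM _ pn (poweR_ge0 _ _)) poweR_EFin -powRrM -poweRrM mulfV ?gt_eqF//.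
by rewrite powRr1 ?(ltW M0)// poweRe1.
Qed.

End scale_factor.

(** * Norm estimates between two spaces of scales *)

Section transfer.
Context d0 d1 d2 (X : measurableType d0) (Z : measurableType d1) (Z' : measurableType d2) (R : realType).
Variables (mu : {sigma_finite_measure set X -> \bar R}) (DX : set X) (v : X -> R).
Variables (m : {sigma_finite_measure set Z -> \bar R}) (D : set Z) (e tau : Z -> R).
Variables (m' : {sigma_finite_measure set Z' -> \bar R}) (D' : set Z') (e' tau' : Z' -> R).
Local Open Scope ereal_scope.
Hypothesis wX : weighted_space mu DX v.
Hypothesis ws : weighted_space m D e.
Hypothesis ws' : weighted_space m' D' e'.
Hypothesis ss : scale_space m e tau.
Hypothesis ss' : scale_space m' e' tau'.
Variables (p q : \bar R).
Hypotheses (p1 : 1 <= p) (q1 : 1 <= q).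
Local Notation Np := (wLnorm mu DX v p).
Local Notation Nq := (wLnorm m D e q).
Local Notation Nq' := (wLnorm m' D' e' q).

Lemma lee_lincomb (a b c : R) (x y : \bar R) : (a <= c)%R -> (b <= c)%R -> (0 <= a)%R ->
  (0 <= b)%R -> 0 <= x -> 0 <= y -> a%:E * x + b%:E * y <= c%:E * (x + y).
Proof.
move=> ac bc a0 b0 x0 y0; rewrite ge0_muleDr//.
by apply: leeD; apply: lee_wpmul2r => //; rewrite lee_fin.
Qed.

Let t01 z : (0 <= tau z <= 1)%R.
Proof. by have /andP[h1 h2] := ss_scale01 ss z; rewrite !ltW. Qed.
Let t01' z : (0 <= tau' z <= 1)%R.
Proof. by have /andP[h1 h2] := ss_scale01 ss' z; rewrite !ltW. Qed.
Let tp z : (0 < tau z)%R. Proof. by have /andP[] := ss_scale01 ss z. Qed.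
Let tp' z : (0 < tau' z)%R. Proof. by have /andP[] := ss_scale01 ss' z. Qed.
Local Notation K p := (ratio (tau' p.1) (tau p.2)).

Let mK : measurable_fun setT ((fun p : Z' * Z => K p) : _ -> measurableTypeR R).
Proof.
have m1 := measurableT_comp (ss_measurable_scale ss') (@measurable_fst _ _ Z' Z).
have m2 := measurableT_comp (ss_measurable_scale ss) (@measurable_snd _ _ Z' Z).
have inv (t : Z' * Z -> R) : measurable_fun setT (t : _ -> measurableTypeR R) -> (forall p, 0 < t p)%R ->
    measurable_fun setT ((fun p => (t p)^-1)%R : _ -> measurableTypeR R).
  move=> mt t0; have := measurableT_comp (@measurable_expR R)
    (measurable_funN (measurableT_comp (@measurable_ln R) mt)).
  by apply: eq_measurable_fun => z _ /=; rewrite -lnV ?posrE ?lnK ?posrE ?invr_gt0.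
by apply: measurable_minr; apply: measurable_funM => //; apply: inv.
Qed.

(** One constant for the row and column sums of the kernel [ratio]; at the scale 1
    the kernel is the scale itself, whence the last two bounds. *)
Lemma schur_constant : exists2 M : R, (1 <= M)%R &
  [/\ forall s, (0 < s <= 1)%R -> \int[m]_z (e z * ratio s (tau z))%:E <= M%:E,
      forall s, (0 < s <= 1)%R -> \int[m']_z (e' z * ratio s (tau' z))%:E <= M%:E,
      \int[m]_z (e z * tau z)%:E <= M%:E & \int[m']_z (e' z * tau' z)%:E <= M%:E].
Proof.
have [A A0 hA] := ss_schur ss; have [A' A'0 hA'] := ss_schur ss'.
have one : (0 < (1 : R) <= 1)%R by rewrite ltr01/=.
have lA : A%:E <= (A + A' + 1)%:E by rewrite lee_fin; lra.
have lA' : A'%:E <= (A + A' + 1)%:E by rewrite lee_fin; lra.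
exists (A + A' + 1)%R; first by rewrite lerDr addr_ge0// ltW.
split.
- by move=> s hs; apply: le_trans lA; exact: hA.
- by move=> s hs; apply: le_trans lA'; exact: hA'.
- apply: le_trans lA; apply: le_trans (hA 1%R one); rewrite le_eqVlt; apply/orP; left; apply/eqP.
  apply: eq_integral => z _; congr (_ * _)%:E; rewrite -/(ratio 1 (tau z)) ratio1// tp/=.
  by have /andP[] := t01 z.
- apply: le_trans lA'; apply: le_trans (hA' 1%R one); rewrite le_eqVlt; apply/orP; left; apply/eqP.
  apply: eq_integral => z _; congr (_ * _)%:E; rewrite -/(ratio 1 (tau' z)) ratio1// tp'/=.
  by have /andP[] := t01' z.
Qed.

Variables (A : X * Z -> \bar R) (A0 : X -> \bar R) (T : X * Z' -> \bar R) (T0 : X -> \bar R) (c M : R).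
Hypotheses (mA : measurable_fun setT A) (mA0 : measurable_fun setT A0).
Hypotheses (pA : forall x, 0 <= A x) (pA0 : forall x, 0 <= A0 x).
Hypotheses (pT : forall x, 0 <= T x) (pT0 : forall x, 0 <= T0 x) (c0 : (0 <= c)%R) (M1 : (1 <= M)%R).
Hypothesis hM : forall s, (0 < s <= 1)%R -> \int[m]_z (e z * ratio s (tau z))%:E <= M%:E.
Hypothesis hM' : forall s, (0 < s <= 1)%R -> \int[m']_z (e' z * ratio s (tau' z))%:E <= M%:E.
Hypothesis hM1 : \int[m]_z (e z * tau z)%:E <= M%:E.
Hypothesis hM1' : \int[m']_z (e' z * tau' z)%:E <= M%:E.
Hypothesis hT : forall x z', T (x, z') <= c%:E * ((tau' z')%:E * A0 x +
  \int[m]_z ((e z * ratio (tau' z') (tau z))%:E * A (x, z))).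
Hypothesis hT0 : forall x, T0 x <= c%:E * (A0 x + \int[m]_z ((e z * tau z)%:E * A (x, z))).

Let M0 : (0 < M)%R. Proof. exact: lt_le_trans M1. Qed.
Let e0 := ws_weight_ge0 ws.
Let e0' := ws_weight_ge0 ws'.
Let me := ws_measurable_weight ws.
Let K0 r : (0 <= K r)%R. Proof. by rewrite ltW// ratio_gt0. Qed.
Let K1 r : (K r <= 1)%R. Proof. exact: ratio_le1. Qed.
Let mKz z' : measurable_fun setT ((fun z => ratio (tau' z') (tau z)) : Z -> measurableTypeR R).
Proof. exact: (measurableT_comp mK (pair1_measurable z')). Qed.
Let hMz z' : \int[m]_z (e z * K (z', z))%:E <= M%:E.
Proof. by have := @hM (tau' z'); apply; rewrite tp'/=; have /andP[] := t01' z'. Qed.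
Let hMz' z : \int[m']_z' (e' z' * K (z', z))%:E <= M%:E.
Proof.
have ht : (0 < tau z <= 1)%R by rewrite tp/=; have /andP[] := t01 z.
apply: le_trans (hM' ht); rewrite le_eqVlt; apply/orP; left; apply/eqP.
by apply: eq_integral => z' _; rewrite ratioC.
Qed.

Let mint (k : Z -> R) : measurable_fun setT (k : Z -> measurableTypeR R) -> (forall z, (0 <= k z)%R) ->
  measurable_fun setT (fun x => \int[m]_z ((e z * k z)%:E * A (x, z))).
Proof.
move=> mk k0; apply: (@measurable_fun_fubini_tonelli_F _ _ _ _ _ m (fun p => (e p.2 * k p.2)%:E * A p)).
  apply: emeasurable_funM => //; apply/measurable_EFinP; apply: measurable_funM.
    exact: (measurableT_comp me measurable_snd).
  exact: (measurableT_comp mk measurable_snd).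
by move=> r; rewrite mule_ge0// lee_fin mulr_ge0.
Qed.

Let pint (k : Z -> R) x : (forall z, (0 <= k z)%R) -> 0 <= \int[m]_z ((e z * k z)%:E * A (x, z)).
Proof. by move=> k0; apply: integral_ge0 => z _; rewrite mule_ge0// lee_fin mulr_ge0. Qed.

(** One application of Minkowski's inequality at a fixed target scale. *)
Lemma norm_at_scale (k : Z -> R) (s : R) (F : X -> \bar R) : (0 <= s)%R -> (forall x, 0 <= F x) ->
  measurable_fun setT (k : Z -> measurableTypeR R) -> (forall z, (0 <= k z)%R) ->
  \int[m]_z (e z * k z)%:E <= M%:E ->
  (forall x, F x <= c%:E * (s%:E * A0 x + \int[m]_z ((e z * k z)%:E * A (x, z)))) ->
  Np F <= (8 * c)%:E * (s%:E * Np A0 + \int[m]_z ((e z * k z)%:E * Np (fun x => A (x, z)))).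
Proof.
move=> s0 F0 mk k0 hk hF.
have mek : measurable_fun setT ((fun z => e z * k z)%R : Z -> measurableTypeR R) by exact: measurable_funM.
have ek0 z : (0 <= e z * k z)%R by rewrite mulr_ge0.
have mi := mint mk k0; have pi x := pint x k0.
have ms : measurable_fun setT (fun x => s%:E * A0 x) by apply: emeasurable_funM => //; exact: measurable_cst.
have ps x : 0 <= s%:E * A0 x by rewrite mule_ge0// lee_fin.
have NA0 : 0 <= Np A0 by exact: wLnorm_ge0.
have pN z : 0 <= (e z * k z)%:E * Np (fun x => A (x, z)).
  by rewrite mule_ge0 ?lee_fin// wLnorm_ge0.
have pNi : 0 <= \int[m]_z ((e z * k z)%:E * Np (fun x => A (x, z))) by exact: integral_ge0.
apply: le_trans (wLnorm_le wX p1 F0 hF) _.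
apply: le_trans (wLnormZ_le wX p1 c0 (emeasurable_funD ms mi) _) _; first by move=> x; exact: adde_ge0.
rewrite (mulrC 8%R) EFinM -muleA; apply: lee_wpmul2l; first by rewrite lee_fin.
apply: le_trans (wLnormD_le wX p1 ms mi ps pi) _.
have h1 := wLnormZ_le wX p1 s0 mA0 pA0.
have h2 := minkowski_le wX mek ek0 M0 hk mA pA p1.
apply: (@le_trans _ _ (4%:E * (s%:E * Np A0 + 2%:E * \int[m]_z ((e z * k z)%:E * Np (fun x => A (x, z)))))).
  by apply: lee_wpmul2l => //; apply: leeD.
rewrite (_ : 8 = 4 * 2)%R; last by rewrite -natrM.
rewrite EFinM -muleA; apply: lee_wpmul2l => //.
rewrite -[s%:E * Np A0 in leLHS]mul1e; apply: lee_lincomb => //; first by rewrite ler1n.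
by rewrite mule_ge0// lee_fin.
Qed.

(** Minkowski's inequality at each target scale moves the inner norm inside the
    integral; Schur's test for the kernel [ratio] does the rest. *)
Theorem transfer_mixed : Np T0 + Nq' (fun z' => Np (fun x => T (x, z'))) <=
  (200 * M * c)%:E * (Np A0 + Nq (fun z => Np (fun x => A (x, z)))).
Proof.
pose a z := Np (fun x => A (x, z)).
have ma : measurable_fun setT a by exact: measurable_norm_slice.
have a0 z : 0 <= a z by exact: wLnorm_ge0.
have NA0 : 0 <= Np A0 by exact: wLnorm_ge0.
have Na : 0 <= Nq a by exact: wLnorm_ge0.
have B0 : Np T0 <= (16 * M * c)%:E * (Np A0 + Nq a).
  have h := norm_at_scale ler01 pT0 (ss_measurable_scale ss) (fun z => ltW (tp z)) hM1.
  apply: le_trans (h _) _; first by move=> x; rewrite mul1e.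
  rewrite mul1e; apply: (@le_trans _ _ ((8 * c)%:E * (Np A0 + (2 * M)%:E * Nq a))).
    apply: lee_wpmul2l; first by rewrite lee_fin mulr_ge0.
    apply: leeD => //; apply: (kernel_le_norm ws M1 ma a0 q1) => //.
    exact: ss_measurable_scale ss.
  rewrite (_ : 16 * M * c = (8 * c) * (2 * M))%R; last by ring.
  rewrite (EFinM (8 * c) (2 * M)) -(muleA (8 * c)%:E); apply: lee_wpmul2l; first by rewrite lee_fin mulr_ge0.
  rewrite -[Np A0 in leLHS]mul1e; apply: lee_lincomb => //; last by rewrite mulr_ge0// ltW.
  by rewrite (le_trans M1)// ler_peMl ?ler1n// ltW.
pose L z' := \int[m]_z ((e z * K (z', z))%:E * a z).
have mL : measurable_fun setT L.
  apply: (@measurable_fun_fubini_tonelli_F _ _ _ _ _ m (fun p : Z' * Z => (e p.2 * K p)%:E * a p.2)).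
    apply: emeasurable_funM; last exact: (measurableT_comp ma measurable_snd).
    by apply/measurable_EFinP; apply: measurable_funM; [exact: (measurableT_comp me measurable_snd)|exact: mK].
  by move=> r; rewrite mule_ge0// lee_fin mulr_ge0.
have L0 z' : 0 <= L z' by apply: integral_ge0 => z _; rewrite mule_ge0// lee_fin mulr_ge0.
have mS : measurable_fun setT (fun z' => (tau' z')%:E * Np A0).
  apply: emeasurable_funM; last exact: measurable_cst.
  by apply/measurable_EFinP; exact: ss_measurable_scale ss'.
have S0 z' : 0 <= (tau' z')%:E * Np A0 by rewrite mule_ge0// lee_fin ltW.
have B1 : Nq' (fun z' => Np (fun x => T (x, z'))) <= (64 * M * c)%:E * (Np A0 + Nq a).
  apply: (@le_trans _ _ (Nq' (fun z' => (8 * c)%:E * ((tau' z')%:E * Np A0 + L z')))).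
    apply: (wLnorm_le ws' q1) => z'; first exact: wLnorm_ge0.
    by apply: (norm_at_scale (ltW (tp' z')) _ (mKz z') (fun z => K0 (z', z)) (hMz z')).
  have c8 : (0 <= 8 * c)%R by rewrite mulr_ge0.
  apply: le_trans (wLnormZ_le ws' q1 c8 (emeasurable_funD mS mL) _) _; first by move=> z'; exact: adde_ge0.
  rewrite (_ : 64 * M * c = (8 * c) * (4 * (2 * M)))%R; last by ring.
  rewrite (EFinM (8 * c)) -(muleA (8 * c)%:E); apply: lee_wpmul2l; first by rewrite lee_fin.
  apply: le_trans (wLnormD_le ws' q1 mS mL S0 L0) _.
  rewrite (EFinM 4) -(muleA 4%:E); apply: lee_wpmul2l => //.
  have h1 := wLnorm_scale_le ws' q1 M1 (ss_measurable_scale ss') t01' hM1' NA0.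
  have h2 := schur_le ws ws' M1 ma a0 q1 mK K0 hMz hMz'.
  apply: le_trans (leeD h1 h2) _; apply: lee_lincomb => //; first by rewrite ler_peMl ?ler1n// ltW.
    exact: ltW.
  by rewrite mulr_ge0// ltW.
apply: le_trans (leeD B0 B1) _; rewrite -ge0_muleDl; [|by rewrite lee_fin !mulr_ge0// ltW..].
apply: lee_wpmul2r; first exact: adde_ge0.
rewrite -EFinD lee_fin -mulrDl -mulrDl; apply: ler_wpM2r => //; apply: ler_wpM2r; first exact: ltW.
by rewrite -natrD ler_nat.
Qed.

(** Here the inner norm is over the scales: Schur's test is applied at each
    point, and the outer norm enters by monotonicity and its quasi-triangle inequality. *)
Theorem transfer_nested : Np T0 + Np (fun x => Nq' (fun z' => T (x, z'))) <=
  (200 * M * c)%:E * (Np A0 + Np (fun x => Nq (fun z => A (x, z)))).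
Proof.
pose b x := Nq (fun z => A (x, z)).
have mb : measurable_fun setT b by exact: (measurable_wLnorm_section ws mA q1).
have b0 x : 0 <= b x by exact: wLnorm_ge0.
have NA0 : 0 <= Np A0 by exact: wLnorm_ge0.
have Nb : 0 <= Np b by exact: wLnorm_ge0.
have mAx x : measurable_fun setT (fun z => A (x, z)) by exact: (measurableT_comp mA (pair1_measurable x)).
have combine (C : R) (F : X -> \bar R) : (0 <= C)%R -> (forall x, 0 <= F x) ->
    (forall x, F x <= C%:E * (A0 x + b x)) -> Np F <= (4 * C)%:E * (Np A0 + Np b).
  move=> C0 F0 hF; apply: le_trans (wLnorm_le wX p1 F0 hF) _.
  apply: le_trans (wLnormZ_le wX p1 C0 (emeasurable_funD mA0 mb) _) _; first by move=> x; exact: adde_ge0.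
  rewrite (mulrC 4%R) (EFinM C) -(muleA C%:E); apply: lee_wpmul2l; first by rewrite lee_fin.
  exact: wLnormD_le.
have M20 : (0 <= 2 * M)%R by rewrite mulr_ge0// ltW.
have M21 : (1 <= 2 * M)%R by rewrite (le_trans M1)// ler_peMl ?ler1n// ltW.
have B0 : Np T0 <= (4 * (c * (2 * M)))%:E * (Np A0 + Np b).
  apply: combine => //; first by rewrite mulr_ge0.
  move=> x; apply: le_trans (hT0 x) _; rewrite (EFinM c) -(muleA c%:E); apply: lee_wpmul2l; first by rewrite lee_fin.
  rewrite -[A0 x in leLHS]mul1e; apply: (@le_trans _ _ (1%:E * A0 x + (2 * M)%:E * b x)).
    apply: leeD => //; apply: (kernel_le_norm ws M1 (mAx x) _ q1) => //.
    exact: ss_measurable_scale ss.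
  exact: lee_lincomb.
have B1 : Np (fun x => Nq' (fun z' => T (x, z'))) <= (4 * (c * (4 * (2 * M))))%:E * (Np A0 + Np b).
  apply: combine => //; [by rewrite !mulr_ge0// ltW|by move=> x; exact: wLnorm_ge0|move=> x].
  pose L z' := \int[m]_z ((e z * K (z', z))%:E * A (x, z)).
  have mL : measurable_fun setT L.
    apply: (@measurable_fun_fubini_tonelli_F _ _ _ _ _ m (fun r : Z' * Z => (e r.2 * K r)%:E * A (x, r.2))).
      apply: emeasurable_funM; last exact: (measurableT_comp (mAx x) measurable_snd).
      by apply/measurable_EFinP; apply: measurable_funM; [exact: (measurableT_comp me measurable_snd)|exact: mK].
    by move=> r; rewrite mule_ge0// lee_fin mulr_ge0.
  have L0 z' : 0 <= L z' by apply: integral_ge0 => z _; rewrite mule_ge0// lee_fin mulr_ge0.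
  have mS : measurable_fun setT (fun z' => (tau' z')%:E * A0 x).
    apply: emeasurable_funM; last exact: measurable_cst.
    by apply/measurable_EFinP; exact: ss_measurable_scale ss'.
  have S0 z' : 0 <= (tau' z')%:E * A0 x by rewrite mule_ge0// lee_fin ltW.
  apply: le_trans (wLnorm_le ws' q1 (fun z' => pT (x, z')) (hT x)) _.
  apply: le_trans (wLnormZ_le ws' q1 c0 (emeasurable_funD mS mL) _) _; first by move=> z'; exact: adde_ge0.
  rewrite (EFinM c) -(muleA c%:E); apply: lee_wpmul2l; first by rewrite lee_fin.
  apply: le_trans (wLnormD_le ws' q1 mS mL S0 L0) _.
  rewrite (EFinM 4) -(muleA 4%:E); apply: lee_wpmul2l => //.
  have h1 := wLnorm_scale_le ws' q1 M1 (ss_measurable_scale ss') t01' hM1' (pA0 x).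
  have h2 := schur_le ws ws' M1 (mAx x) (fun z => pA (x, z)) q1 mK K0 hMz hMz'.
  apply: le_trans (leeD h1 h2) _; apply: lee_lincomb => //; first by rewrite ler_peMl ?ler1n// ltW.
    exact: ltW.
  exact: (b0 x).
apply: le_trans (leeD B0 B1) _; rewrite -ge0_muleDl; [|by rewrite lee_fin !mulr_ge0// ltW..].
apply: lee_wpmul2r; first exact: adde_ge0.
rewrite -EFinD lee_fin.
rewrite (_ : _ + _ = 40 * M * c)%R; last by ring.
by apply: ler_wpM2r => //; apply: ler_wpM2r; [exact: ltW|rewrite ler_nat].
Qed.

End transfer.

(** * The continuous and the dyadic scales *)

Section continuous_scales.
Context (R : realType).
Local Notation lm := (@lebesgue_measure R).
Local Notation R0 := (measurableTypeR R).

(** Extended by zero, so that dt/t on the unit interval has a density on the whole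
    line. *)
Definition unit_density (t : R0) : R := if 0 < t < 1 then t^-1 else 0.
(** The value 1/2 off the unit interval keeps the scale inside ]0, 1[; the density
    vanishes there. *)
Definition unit_scale (t : R0) : R := if 0 < t < 1 then t else 2^-1.

Lemma measurable_unit_if (f : R0 -> R) (c : R) :
  measurable_fun (`]0%R, 1%R[%classic : set R0) (f : R0 -> R0) ->
  measurable_fun setT ((fun t => if 0 < t < 1 then f t else c) : R0 -> R0).
Proof.
move=> mf; have E : (fun t : R0 => 0 < t < 1) @^-1` [set true] = (`]0%R, 1%R[%classic : set R0).
  by apply/seteqP; split => t; rewrite /= in_itv.
apply: measurable_fun_if => //.
- by apply: (measurable_fun_bool true); rewrite setTI E.
- by rewrite setTI E.
Qed.

Lemma measurable_unit_density : measurable_fun setT (unit_density : R0 -> R0).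
Proof.
apply: measurable_unit_if; apply: open_continuous_measurable_fun; first exact: interval_open.
by move=> t; rewrite inE/= in_itv/= => /andP[t0 _]; apply: inv_continuous; rewrite gt_eqF.
Qed.

Lemma measurable_unit_scale : measurable_fun setT (unit_scale : R0 -> R0).
Proof. by apply: measurable_unit_if; exact: measurable_id. Qed.

Lemma within_inv_sqr (s : R) : 0 < s -> {within `[s, 1%R], continuous (fun t : R => s / t ^+ 2)}.
Proof.
move=> s0; apply: continuous_in_subspaceT => t; rewrite inE/= in_itv/= => /andP[st _].
have t0 : t != 0 by rewrite gt_eqF// (lt_le_trans s0).
have FF : Filter (nbhs t) by exact: nbhs_filter.
by apply: cvgMr; apply: cvgV; [rewrite expf_neq0|exact: exprn_continuous].
Qed.

Lemma integral_inv_sqr (s : R) : 0 < s <= 1 ->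
  (\int[lm]_(t in `[s, 1%R]) (s / t ^+ 2)%:E <= 1%:E)%E.
Proof.
move=> /andP[s0]; rewrite le_eqVlt => /orP[/eqP ->|s1].
  by rewrite set_itv1 integral_set1 lee_fin.
have dF (t : R) : t != 0 -> is_derive t 1 (fun t : R => - s * t^-1) (s / t ^+ 2).
  move=> t0; have dv := @is_deriveV R id t 1 1 t0 (is_derive_id t 1).
  have -> : (fun t : R => - s * t^-1) = (- s) *: (fun y : R => (id y)^-1) by [].
  by apply: is_derive_eq; rewrite /GRing.scale/= mulr1 mulrNN.
have st (t : R) : s <= t -> t != 0 by move=> h; rewrite gt_eqF// (lt_le_trans s0).
have cF (t : R) : s <= t -> {for t, continuous (fun t : R => - s * t^-1)}.
  by move=> h; apply/differentiable_continuous/derivable1_diffP; have [] := dF t (st t h).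
rewrite (@continuous_FTC2 _ (fun t => s / t ^+ 2) (fun t => - s * t^-1) s 1 s1).
- by rewrite -EFinB lee_fin invr1 mulr1 mulNr mulfV ?gt_eqF// opprK; lra.
- exact: within_inv_sqr.
- split=> [t||].
  + by rewrite in_itv/= => /andP[/ltW h _]; have [] := dF t (st t h).
  + by apply/cvg_at_right_filter/cF.
  + by apply/cvg_at_left_filter/cF; exact: ltW.
- by move=> t; rewrite in_itv/= => /andP[/ltW h _]; rewrite derive1E; have hd := dF t (st t h); exact: derive_val.
Qed.

(** The kernel is at most 1/s below s and at most s/t^2 above it; both bounds have
    integrals at most 1. *)
Lemma unit_schur (s : R) : 0 < s <= 1 ->
  (\int[lm]_t (unit_density t * Num.min (s / unit_scale t) (unit_scale t / s))%:E <= 2%:E)%E.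
Proof.
move=> hs; have /andP[s0 s1] := hs.
pose f1 : R0 -> \bar R := (cst (s^-1)%:E) \_ `[0%R, s].
pose f2 : R0 -> \bar R := (fun t : R => (s / t ^+ 2)%:E) \_ `[s, 1%R].
have mf1 : measurable_fun setT f1.
  by apply/(measurable_restrictT _ _).1 => //; exact: measurable_cst.
have mf2 : measurable_fun setT f2.
  apply/(measurable_restrictT _ _).1 => //; apply/measurable_EFinP.
  apply: subspace_continuous_measurable_fun => //; exact: within_inv_sqr.
have f10 t : (0 <= f1 t)%E.
  by rewrite /f1 patchE; case: ifP => // _; rewrite lee_fin invr_ge0 ltW.
have f20 t : (0 <= f2 t)%E.
  by rewrite /f2 patchE; case: ifP => // _; rewrite lee_fin divr_ge0 ?sqr_ge0// ltW.
apply: (@le_trans _ _ (\int[lm]_t (f1 t + f2 t))%E).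
  apply: ge0_le_lower_integral => t _.
    rewrite lee_fin /unit_density /unit_scale; case: ifP => [/andP[t0 t1]|_]; last by rewrite mul0r.
    by rewrite mulr_ge0 ?invr_ge0 ?(ltW t0)// le_min !divr_ge0// ltW.
  rewrite /unit_density /unit_scale; case: ifP => [/andP[t0 t1]|_]; last by rewrite mul0r adde_ge0.
  have [ts|/ltW st] := leP t s.
    apply: (@le_trans _ _ (f1 t)); last by rewrite leeDl.
    rewrite /f1 patchE mem_set; last by rewrite /= in_itv/= (ltW t0) ts.
    rewrite lee_fin (@le_trans _ _ (t^-1 * (t / s)))//.
      by rewrite ler_wpM2l ?invr_ge0 ?(ltW t0)// ge_min lexx orbT.
    by rewrite mulrA mulVf ?gt_eqF// mul1r.
  apply: (@le_trans _ _ (f2 t)); last by rewrite leeDr.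
  rewrite /f2 patchE mem_set; last by rewrite /= in_itv/= st ltW.
  rewrite lee_fin (@le_trans _ _ (t^-1 * (s / t)))//.
    by rewrite ler_wpM2l ?invr_ge0 ?(ltW t0)// ge_min lexx.
  by rewrite mulrCA expr2 invfM.
rewrite ge0_integralD// (_ : 2 = 1 + 1)// EFinD; apply: leeD.
  rewrite /f1 -integral_mkcond integral_cst//= lebesgue_measure_itv/= lte_fin s0.
  by rewrite sube0 -EFinM mulVf ?gt_eqF.
by rewrite /f2 -integral_mkcond; exact: integral_inv_sqr.
Qed.

(** On the part of the unit interval above 1/(n+1), intervals of length comparable to
    eta/(n+1): 1/t is Lipschitz there with the constant required. The remaining cells cover
    the complement, where the density vanishes. *)
Definition unit_cell (eta : R) (i : nat) : set R0 :=
  match unpickle i : option (nat + nat * nat) with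
  | Some (inl n) => `[(- n%:R)%R, n%:R]%classic `\` `]0%R, 1%R[%classic
  | Some (inr (n, k)) => let de := eta / (4 * n.+1%:R) in
      `]0%R, 1%R[%classic `&` `[(n.+1%:R^-1)%R, 1%R]%classic `&` `[(k%:R * de - de)%R, (k%:R * de + de)%R]%classic
  | None => set0
  end.

Lemma unit_scale_space : scale_space lm unit_density unit_scale.
Proof.
split.
- exact: measurable_unit_density.
- exact: measurable_unit_scale.
- by move=> t; rewrite /unit_density; case: ifP => // /andP[t0 _]; rewrite invr_ge0 ltW.
- move=> t; rewrite /unit_scale; case: ifP => // _.
  by rewrite invr_gt0 ltr0n/= invf_lt1// ltr1n.
- by exists 2 => //; exact: unit_schur.
move=> eta eta0; exists (unit_cell eta).
have de0 n : 0 < eta / (4 * n.+1%:R) by rewrite divr_gt0// mulr_gt0.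
split.
- move=> i; rewrite /unit_cell; case: unpickle => [[n|[n k]]|//]; first exact: measurableD.
  by apply: measurableI => //; exact: measurableI.
- move=> t; have [t01|t01] := boolP (0 < t < 1).
    have /andP[t0 t1] := t01.
    pose n := Num.trunc t^-1; pose de := eta / (4 * n.+1%:R).
    exists (pickle (inr (n, Num.trunc (t / de)) : nat + nat * nat)).
    rewrite /unit_cell pickleK /=; split; first split.
    + by rewrite /= in_itv.
    + rewrite /= in_itv/= (ltW t1) andbT -[leRHS]invrK lef_pV2 ?posrE ?invr_gt0//.
      by rewrite ltW// truncnS_gt.
    + have td : 0 <= t / de by rewrite divr_ge0 ?(ltW t0)// ltW// de0.
      rewrite /= in_itv/= -/de; have := truncnS_gt (t / de); rewrite ltr_pdivrMr ?de0// => h1.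
      have /andP[] := truncn_itv td; rewrite ler_pdivlMr ?de0// => h2 _.
      rewrite (le_trans _ h2) ?gerBl ?(ltW (de0 _))//=.
      by rewrite ltW// (lt_le_trans h1)// -natr1 mulrDl mul1r.
  exists (pickle (inl (Num.trunc `|t|).+1 : nat + nat * nat)).
  rewrite /unit_cell pickleK; split; last by rewrite /= in_itv/=; exact/negP.
  by rewrite /= in_itv/= -ler_norml ltW// truncnS_gt.
- move=> i; rewrite /unit_cell; case: unpickle => [[n|[n k]]|]; last by rewrite measure0.
    apply: (@le_lt_trans _ _ (lm `[(- n%:R)%R, n%:R%R]%classic)).
      by apply: le_measure; rewrite ?inE//; exact: measurableD.
    by rewrite lebesgue_measure_itv/=; case: ifP => _; rewrite ?ltry// -EFinB ltry.
  apply: (@le_lt_trans _ _ (lm `]0%R, 1%R[%classic)).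
    apply: le_measure; rewrite ?inE//; last by move=> t [[]].
    by apply: measurableI => //; exact: measurableI.
  by rewrite lebesgue_measure_itv/=; case: ifP => _; rewrite ?ltry// -EFinB ltry.
- move=> i y z; rewrite /unit_cell; case: unpickle => [[n|[n k]]|//].
    move=> [_ /negP hy] [_ /negP hz]; rewrite /unit_density /unit_scale.
    move: hy hz; rewrite /= !in_itv/= => /negbTE -> /negbTE ->.
    by rewrite !subrr normr0 !mul0r mulr0 addr0.
  move=> [[/= hy hyn] hyk] [[/= hz _] hzk].
  move: hy hyn hyk hz hzk; rewrite /= !in_itv/= => hy /andP[hyn _] /andP[y1 y2] hz /andP[z1 z2].
  rewrite /unit_density /unit_scale hy hz.
  have /andP[y0 yl1] := hy; have /andP[z0 zl1] := hz.
  rewrite mulVf ?gt_eqF// mulr1.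
  have yz : `|y - z| <= 2 * (eta / (4 * n.+1%:R)).
    set de := eta / _ in y1 y2 z1 z2 *; set kd := k%:R * de in y1 y2 z1 z2.
    by rewrite ler_norml; apply/andP; split; lra.
  have yn : eta / n.+1%:R <= eta * y by rewrite ler_wpM2l// ltW.
  have -> : `|y^-1 - z^-1| * z ^+ 2 = y^-1 * `|y - z| * z.
    have -> : y^-1 - z^-1 = (z - y) * (y^-1 * z^-1) by field; rewrite ?gt_eqF.
    rewrite normrM (ger0_norm (x := y^-1 * z^-1)) ?mulr_ge0 ?invr_ge0 ?(ltW y0) ?(ltW z0)// distrC.
    by field; rewrite !gt_eqF.
  apply: (@le_trans _ _ (y^-1 * (2 * `|y - z|))).
    rewrite [leLHS](_ : _ = y^-1 * ((1 + z) * `|y - z|)); last by ring.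
    by rewrite ler_wpM2l ?invr_ge0 ?(ltW y0)// ler_wpM2r//; lra.
  rewrite ler_pdivrMl// (mulrC y); apply: le_trans yn.
  apply: (@le_trans _ _ (2 * (2 * (eta / (4 * n.+1%:R))))); first by rewrite ler_wpM2l.
  have n0 : (n.+1)%:R != 0 :> R by rewrite pnatr_eq0.
  by rewrite le_eqVlt; apply/orP; left; apply/eqP; move: (n.+1%:R : R) n0 => N N0; field.
Qed.

Lemma unit_weighted_space : weighted_space lm (`]0%R, 1%R[%classic : set R0) unit_density.
Proof.
split => //.
- exact: measurable_unit_density.
- by move=> t; rewrite /unit_density; case: ifP => // /andP[t0 _]; rewrite invr_ge0 ltW.
- by move=> t; rewrite /= in_itv/= /unit_density => /negP/negbTE ->.
- apply: (@lt_le_trans _ _ (lm `]0%R, 1%R[%classic)); last by apply: le_measure; rewrite ?inE.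
  by rewrite lebesgue_measure_itv/= lte_fin ltr01 sube0 lte_fin.
Qed.

End continuous_scales.

Section dyadic_scales.
Context (R : realType).

(** A copy of the counting measure that carries a sigma-finite structure. *)
Definition count : set nat -> \bar R := @counting nat R.

HB.instance Definition _ := Measure.copy count (@counting nat R).
HB.instance Definition _ := @Measure_isSigmaFinite.Build _ _ _ count (sigma_finite_counting R).

Local Notation cm := count.

Definition dyadic_scale (k : nat) : R := 2 ^- k.+1.

Lemma dyadic_scale_gt0 k : 0 < dyadic_scale k.
Proof. by rewrite invr_gt0 exprn_gt0. Qed.

(** The potential that bounds the two geometric sums on either side of [s]. *)
Lemma dyadic_partial_sum (s : R) n : 0 < s <= 1 ->
  \sum_(0 <= k < n) Num.min (s / dyadic_scale k) (dyadic_scale k / s) <=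
  if s <= 2 ^- n then 2 * (s * 2 ^+ n) else 4 - 2 * (2 ^- n / s).
Proof.
move=> /andP[s0 s1]; elim: n => [|n ih].
  by rewrite big_geq// expr0 invr1 s1 mulr1 mulr_ge0// ltW.
rewrite big_nat_recr//=; apply: le_trans (lerD ih (lexx _)) _.
have p0 : 0 < (2 : R) ^+ n by rewrite exprn_gt0.
have E1 : s / dyadic_scale n = 2 * (s * 2 ^+ n).
  by rewrite /dyadic_scale invrK exprS; ring.
have E2 : dyadic_scale n / s = 2^-1 * (2 ^- n / s).
  by rewrite /dyadic_scale exprS invfM mulrA.
rewrite E1 E2 exprS invfM.
move: (2 ^+ n : R) p0 {ih E1 E2} => P P0.
pose x := s * P; have x0 : 0 < x by rewrite mulr_gt0.
have Ex : P^-1 / s = x^-1 by rewrite /x invfM mulrC.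
have E4 : s * (2 * P) = 2 * x by rewrite /x; ring.
have c1 : (s <= P^-1) = (x <= 1) by rewrite /x -ler_pdivlMr// mul1r.
have c2 : (s <= 2^-1 * P^-1) = (2 * x <= 1).
  by rewrite -invfM /x mulrCA (mulrC 2) -ler_pdivlMr ?mulr_gt0// mul1r mulrC.
rewrite c1 c2 Ex E4 -/x.
have i0 : 0 < x^-1 by rewrite invr_gt0.
have xi : x * x^-1 = 1 by rewrite mulfV ?gt_eqF.
case: ifP => h1; case: ifP => h2.
- have : Num.min (2 * x) (2^-1 / x) <= 2 * x by rewrite ge_min lexx.
  lra.
- have h3 : 1 < 2 * x by rewrite ltNge h2.
  have : Num.min (2 * x) (2^-1 / x) <= 2^-1 / x by rewrite ge_min lexx orbT.
  have : x^-1 < 2 by rewrite invf_plt ?posrE//; lra.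
  nra.
- by exfalso; lra.
- have : Num.min (2 * x) (2^-1 / x) <= 2^-1 / x by rewrite ge_min lexx orbT.
  lra.
Qed.

Lemma dyadic_schur (s : R) : 0 < s <= 1 ->
  (\int[cm]_k (1 * Num.min (s / dyadic_scale k) (dyadic_scale k / s))%:E <= 4%:E)%E.
Proof.
move=> hs; have /andP[s0 s1] := hs.
have a0 k : 0 <= Num.min (s / dyadic_scale k) (dyadic_scale k / s).
  by rewrite le_min !divr_ge0 ?(ltW (dyadic_scale_gt0 _))// ltW.
rewrite ge0_integral_count; last by move=> k; rewrite mul1r lee_fin.
apply: lime_le; first by apply: is_cvg_nneseries => k _ _; rewrite mul1r lee_fin.
apply: nearW => n; under eq_bigr do rewrite mul1r.
rewrite sumEFin lee_fin; apply: le_trans (dyadic_partial_sum n hs) _.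
have p0 : 0 < (2 : R) ^+ n by rewrite exprn_gt0.
case: ifP => h.
  have : s * 2 ^+ n <= 1 by rewrite -ler_pdivlMr// mul1r.
  lra.
have : 0 <= 2 ^- n / s :> R by rewrite divr_ge0 ?invr_ge0// ltW.
lra.
Qed.

Lemma dyadic_scale_space : scale_space cm (fun=> 1) dyadic_scale.
Proof.
split => //.
- move=> k; rewrite dyadic_scale_gt0/= /dyadic_scale invf_lt1 ?exprn_gt0//.
  by rewrite exprn_egt1// ltr1n.
- by exists 4 => //; exact: dyadic_schur.
- move=> eta eta0; exists (fun i => [set i]); split => //.
  + by move=> z; exists z.
  + move=> i; have h : (@counting nat R [set i] < +oo)%E by rewrite /counting asboolT// ltry.
    exact: h.
  + move=> i y z -> ->; rewrite !subrr normr0 mul0r mulr0 addr0.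
    by rewrite mulr_ge0 ?(ltW eta0)// mul1r ltW// dyadic_scale_gt0.
Qed.

Lemma dyadic_weighted_space : weighted_space cm (setT : set nat) (fun=> 1).
Proof.
have h : (0 < @counting nat R setT)%E.
  by rewrite /counting asboolF ?ltry//; exact: infinite_nat.
by split => // x /(_ I).
Qed.

End dyadic_scales.

(** * Conjugate reflections and vanishing moments *)

Section reflection.
Context (R : realType) (d : nat).
Local Notation Rd := 'rV[R]_d.
Local Notation mu := (@leb R d).
Implicit Types (g : Rd -> R[i]) (xi x : Rd).

(** The pairing with the translates of [g] is the convolution with this function. *)
Definition creflect g (y : Rd) : R[i] := conjc (g (- y)).

Lemma part_conj b (z : R[i]) : part b (conjc z) = (if b then 1 else -1) * part b z.
Proof. by case: z => x y; case: b; rewrite /part /conjc/= ?mul1r ?mulN1r. Qed.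

Lemma csch_creflect g : csch g -> csch (creflect g).
Proof.
move=> hg b; have h0 := csch_reflect 0 hg.
rewrite (_ : (fun x => _) = (fun x => (if b then 1 else -1) * part b (g (0 - x)))).
  by apply: rschZ; exact: h0.
by apply/funext => x; rewrite /creflect part_conj sub0r.
Qed.

Lemma cintg_conj (f : Rd -> R[i]) : cinteg mu f -> cintg mu (fun x => conjc (f x)) = conjc (cintg mu f).
Proof.
move=> hf; apply: complex_eqP => b; rewrite part_conj !part_cintg -(RintegralZl _ measurableT (hf b)).
by apply: eq_Rintegral => x _; rewrite part_conj.
Qed.

Lemma conjc_realM (r : R) (z : R[i]) : conjc (r%:C%C * z) = r%:C%C * conjc z.
Proof. by apply: complex_eqP => b; rewrite part_conj !part_realM part_conj mulrCA. Qed.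

Lemma fourier_creflect g xi : csch g -> fourier (creflect g) xi = conjc (fourier g xi).
Proof.
move=> hg; have hi := csch_cinteg hg.
rewrite !fourierE conjc_realM; congr (_ * _).
have n1 : (-1 : R) != 0 by rewrite oppr_eq0 oner_neq0.
have hc := cinteg_char xi hi.
have hcc : cinteg mu (fun y => conjc (char xi y * g y)).
  move=> b; have := integrable_scale (if b then 1 else -1) (hc b).
  by apply: eq_integrable => // x _; rewrite /= part_conj.
rewrite -cintg_conj//.
have := cintg_affine 0 n1 hcc; rewrite normrN1 expr1n invr1 (_ : 1%:C%C = 1 :> R[i])// mul1r => <-.
apply: eq_cintg => x; rewrite rmorphM/= /creflect scaleN1r addr0 /char; congr (_ * _).
rewrite (_ : dotp (- x) xi = - dotp x xi); last by rewrite dotpNl.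
by rewrite /cis /conjc /= opprK cosN sinN.
Qed.

(** A moment of the reflection is a moment of the function, up to sign. *)
Lemma ccancel_creflect g : csch g -> ccancel g -> ccancel (creflect g).
Proof.
move=> hg cg b l.
have n1 : (-1 : R) != 0 by rewrite oppr_eq0 oner_neq0.
have hi : rint (fun x => part b (g x) * \prod_(i <- l) x ord0 i).
  have := rint_pgrow (@pgrow_prod R d l) (hg b).
  by apply: eq_integrable => // x _; rewrite /= mulrC.
pose c : R := (if b then 1 else -1) * (-1) ^+ size l.
have E x : part b (creflect g x) * \prod_(i <- l) x ord0 i =
    c * (part b (g (-1 *: x + 0)) * \prod_(i <- l) (-1 *: x + 0) ord0 i).
  rewrite /creflect part_conj addr0 scaleN1r /c.
  have -> : \prod_(i <- l) (- x) ord0 i = (-1) ^+ size l * \prod_(i <- l) x ord0 i.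
    elim: l {hi c} => [|i l ih]; first by rewrite !big_nil mulr1.
    by rewrite !big_cons ih mxE /= exprS; ring.
  rewrite !mulrA; congr (_ * _); rewrite -!mulrA; congr (_ * _).
  by rewrite mulrCA -exprMn mulrNN mulr1 expr1n mulr1.
rewrite (@eq_Rintegral _ _ _ mu _ (fun x => c * (part b (g (-1 *: x + 0)) * \prod_(i <- l) (-1 *: x + 0) ord0 i))).
  rewrite RintegralZl//; last exact: (rint_affine 0 n1 hi).
  by rewrite (Rintegral_affine 0 n1 hi) cg !mulr0.
by move=> x _; exact: E.
Qed.

End reflection.

Section moments.
Context (R : realType) (d : nat).
Local Notation Rd := 'rV[R]_d.
Local Notation mu := (@leb R d).
Implicit Types (k : Rd -> R[i]) (xi x : Rd).

Lemma prod_seq_powers (l : seq 'I_d) x : \prod_(i <- l) x ord0 i = \prod_i x ord0 i ^+ count_mem i l.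
Proof.
elim: l => [|i l ih]; first by rewrite big_nil big1// => i _; rewrite expr0.
rewrite big_cons ih (bigD1 i)//= [RHS](bigD1 i)//= eqxx add1n exprS mulrA; congr (_ * _).
by apply: eq_bigr => j /negbTE ji; rewrite eq_sym ji add0n.
Qed.

(** Products of coordinates along a list are monomials, with exponents the
    multiplicities in the list. *)
Lemma moments_ccancel k : (forall m : 'I_d -> nat,
    cintegral (fun x => (\prod_i x ord0 i ^+ m i)%:C%C * k x) = 0) -> ccancel k.
Proof.
move=> h b l; have := congr1 (part b) (h (fun i => count_mem i l)); rewrite part0 => <-.
have -> : cintegral (fun x => (\prod_i x ord0 i ^+ count_mem i l)%:C%C * k x) =
    cintg mu (fun x => (\prod_i x ord0 i ^+ count_mem i l)%:C%C * k x) by [].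
rewrite part_cintg; apply: eq_Rintegral => x _.
by rewrite part_realM prod_seq_powers mulrC.
Qed.

Lemma sin_sub_id_le (v : R) : `|sin v - v| <= v ^+ 2.
Proof.
wlog v0 : v / 0 <= v.
  move=> h; have [/h//|/ltW v0] := leP 0 v.
  by have := h (- v); rewrite sinN -opprB opprK normrN addrC sqrrN oppr_ge0; exact.
have dF (z : R) : is_derive z 1 (fun z : R => sin z - z) (cos z - 1).
  exact: (is_deriveB (is_derive_sin z) (is_derive_id z 1)).
have [|c + E] := @MVT_segment R (fun z => sin z - z) (fun z => cos z - 1) 0 v v0 (fun z _ => dF z).
  apply: continuous_subspaceT => z; have FF : Filter (nbhs z) by exact: nbhs_filter.
  by apply: cvgB; [exact: continuous_sin|exact: cvg_id].
rewrite in_itv/= => /andP[c0 cv].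
have -> : sin v - v = (cos c - 1) * v by have := E; rewrite sin0 !subr0.
rewrite normrM (ger0_norm v0) expr2 ler_wpM2r//.
have := cos_lip c 0; rewrite cos0 subr0 (ger0_norm c0) => /le_trans; exact.
Qed.

Lemma cos_sub1_le (v : R) : `|cos v - 1| <= v ^+ 2.
Proof.
have E : cos v = 1 - 2 * sin (v / 2) ^+ 2.
  have -> : cos v = cos (v / 2 *+ 2) by rewrite -mulr_natr divfK.
  by rewrite cos_mulr2n sin2cos2; ring.
have h : sin (v / 2) ^+ 2 <= (v / 2) ^+ 2.
  have := sin_lip (v / 2) 0; rewrite sin0 !subr0 -(@ler_pXn2r _ 2)// ?nnegrE//.
  by rewrite !real_normK ?num_real.
rewrite E addrAC subrr add0r normrN ger0_norm; last by apply: mulr_ge0 => //; exact: sqr_ge0.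
apply: (@le_trans _ _ (2 * (v / 2) ^+ 2)); first by rewrite ler_pM2l.
have := sqr_ge0 v; rewrite expr_div_n; lra.
Qed.

(** The second order bound that makes the difference quotients of characters
    converge at a rate. *)
Lemma cis_second_order (v : R) : cabs (cis v - 1 - 'i%C * (v%:C)%C) <= 2 * v ^+ 2.
Proof.
apply: cabs_parts_le => -[]; rewrite /part/= ?mul0r ?mul1r ?mulr0 ?subr0 ?addr0 ?oppr0 ?add0r.
  exact: cos_sub1_le.
exact: sin_sub_id_le.
Qed.

Lemma char0 x : char 0 x = 1.
Proof. by rewrite /char dotpC -(scale0r x) dotpZl mul0r oppr0 /cis cos0 sin0. Qed.

(** Moments are derivatives of the Fourier transform at the origin. Differentiating
    in one coordinate multiplies by that coordinate, so the vanishing near 0 propagates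
    along the list of coordinates. *)
Lemma flat_ccancel k (eps : R) : csch k -> 0 < eps ->
  (forall xi, enorm xi < eps -> fourier k xi = 0) -> ccancel k.
Proof.
move=> hk eps0 hF.
pose M (l : seq 'I_d) x : R := \prod_(i <- l) x ord0 i.
have iM l : cinteg mu (fun x => (M l x)%:C%C * k x).
  move=> b; have := rint_pgrow (@pgrow_prod R d l) (hk b).
  by apply: eq_integrable => // x _; rewrite /= part_realM.
suff H : forall l xi, enorm xi < eps -> cintg mu (fun x => char xi x * ((M l x)%:C%C * k x)) = 0.
  move=> b l; have := congr1 (part b) (H l 0 _); rewrite enorm0 part0 part_cintg => /(_ eps0) <-.
  apply: eq_Rintegral => x _.
  by rewrite char0 mul1r part_realM mulrC.
elim=> [|i l ih] xi xe.
  have := hF xi xe; rewrite fourierE => /eqP; rewrite mulf_eq0 (negbTE (fcst_neq0 R d))/= => /eqP <-.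
  by apply: eq_cintg => x; rewrite /M big_nil mul1r.
set J := cintg _ _; have [K K0 hK] := @cabs_cintg_dom R d.
have [_ [A [m hA]]] := @pgrow_prod R d l; rewrite -/(M l) in hA.
have [C C0 hC] := csch_cabs (2 + m + 2 * d) hk.
have A0 : 0 <= A by have := le_trans (normr_ge0 _) (hA 0); rewrite pmulr_lge0// brkX_gt0.
have key (t : R) : 0 < t -> t < eps - enorm xi -> cabs J <= K * (2 * A * C) * t.
  move=> t0 te; pose e : Rd := delta_mx ord0 i.
  have ee : enorm e = 1.
    rewrite /enorm /dotp (bigD1 i)//= big1 ?mxE ?eqxx ?mulr1 ?addr0 ?sqrtr1// => j ji.
    by rewrite !mxE eqxx /= (negbTE ji) mulr0.
  have xte : enorm (xi + t *: e) < eps.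
    by apply: le_lt_trans (enormD _ _) _; rewrite enormZ ee mulr1 gtr0_norm//; lra.
  pose r x := (char (xi + t *: e) x * ((M l x)%:C%C * k x) + -1 * (char xi x * ((M l x)%:C%C * k x))) +
    ('i%C * (t%:C)%C) * (char xi x * ((M (i :: l) x)%:C%C * k x)).
  have i1 := cinteg_char (xi + t *: e) (iM l); have i2 := cintegZ (-1) (cinteg_char xi (iM l)).
  have i3 := cinteg_char xi (iM (i :: l)).
  have i4 := cintegZ ('i%C * (t%:C)%C) i3.
  have ir : cinteg mu r := cintegD (cintegD i1 i2) i4.
  have E : cintg mu r = 'i%C * (t%:C)%C * J.
    rewrite (cintgD (cintegD i1 i2) i4) (cintgD i1 i2) (cintgZ _ (cinteg_char xi (iM l))) (cintgZ _ i3).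
    by rewrite !ih// mulr0 !add0r.
  have Er x : r x = char xi x * ((M l x)%:C%C * k x) *
      (cis (- (t * x ord0 i)) - 1 - 'i%C * ((- (t * x ord0 i))%:C)%C).
    rewrite /r; have -> : char (xi + t *: e) x = char xi x * cis (- (t * x ord0 i)).
      rewrite /char -cisD; congr cis; rewrite (dotpC x) dotpDl opprD dotp_delta.
      by rewrite dotpC.
    rewrite /M big_cons rmorphN !rmorphM/=; ring.
  have := hK r (2 * t ^+ 2 * A * C) _ _; rewrite E !cabsM cabs_real (gtr0_norm t0).
  have -> : cabs 'i%C = 1 :> R by rewrite /cabs/= expr0n expr1n/= add0r sqrtr1.
  rewrite mul1r => H; rewrite -(ler_pM2l t0); apply: le_trans (H _ _) _; last by rewrite [leRHS](_ : _ = K * (2 * t ^+ 2 * A * C)) ?lexx//; ring.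
    by move=> b; have /measurable_int/measurable_EFinP := ir b.
  move=> x; rewrite Er !cabsM cabs_cis mul1r cabs_real.
  have h1 := cis_second_order (- (t * x ord0 i)); rewrite sqrrN exprMn in h1.
  have h2 : x ord0 i ^+ 2 <= brk x ^+ 2.
    rewrite -[leLHS]real_normK ?num_real// ler_pXn2r ?nnegrE ?brk_ge0//.
    exact: le_trans (coord_enorm _ _) (enorm_brk _).
  apply: (@le_trans _ _ ((A * brk x ^+ m * cabs (k x)) * (2 * (t ^+ 2 * brk x ^+ 2)) * brk x ^+ (2 * d))).
    rewrite ler_wpM2r ?exprn_ge0 ?brk_ge0//; apply: ler_pM; rewrite ?mulr_ge0 ?cabs_ge0//.
      by apply: ler_wpM2r; [exact: cabs_ge0|exact: hA].
    by apply: le_trans h1 _; rewrite ler_pM2l// ler_wpM2l// exprn_ge0// ltW.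
  rewrite [leLHS](_ : _ = 2 * t ^+ 2 * A * (cabs (k x) * brk x ^+ (2 + m + 2 * d))); last by rewrite !exprD; ring.
  by apply: ler_wpM2l; [rewrite mulr_ge0// mulr_ge0// exprn_ge0// ltW|exact: hC].
have J0 : cabs J = 0.
  apply/le_anti; rewrite cabs_ge0 andbT; apply/ler_addgt0Pl => z z0; rewrite addr0.
  pose B := K * (2 * A * C) + 1; have B1 : 0 < B by rewrite ltr_wpDl// !mulr_ge0// ltW.
  (* Small enough to stay in the ball of radius [eps], and to beat the target [z]. *)
  pose t := Num.min ((eps - enorm xi) / 2) (z / B).
  have t0 : 0 < t by rewrite lt_min !divr_gt0// subr_gt0.
  have te : t < eps - enorm xi.
    by rewrite gt_min; apply/orP; left; have : 0 < eps - enorm xi by [rewrite subr_gt0]; lra.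
  apply: le_trans (key t t0 te) _; apply: (@le_trans _ _ (B * t)); first by rewrite ler_pM2r// lerDl.
  by rewrite mulrC -ler_pdivlMr// ge_min lexx orbT.
exact: (@ComplexField.Normc.eq0_normc R).
Qed.

End moments.

(** * The dyadic system *)

Section systems.
Context (R : realType) (d : nat) dZ (Z : measurableType dZ)
  (m : {sigma_finite_measure set Z -> \bar R}) (e tau : Z -> R).
Local Notation Rd := 'rV[R]_d.

(** Analysing pairs [lam0], [lam] and synthesising pairs [kap0], [kap] tied by the
    Calderon formula on the scale space [e dm]. *)
Record calderon_system (kap0 kap lam0 lam : Rd -> R[i]) : Prop := CalderonSystem {
  cs_scale : scale_space m e tau;
  cs_kap0 : csch kap0;
  cs_kap : csch kap;
  cs_lam0 : csch lam0;
  cs_lam : csch lam;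
  cs_cancel_kap : ccancel kap;
  cs_cancel_lam : ccancel lam;
  cs_calderon : forall xi, fourier kap0 xi * fourier lam0 xi +
    cintg m (fun z => (e z)%:C%C * (fourier kap (tau z *: xi) * fourier lam (tau z *: xi))) =
    (fcst R d ^+ 2)%:C%C }.

End systems.

Section dyadic_system.
Context (R : realType) (d : nat).
Local Notation Rd := 'rV[R]_d.
Local Notation mu := (@leb R d).
Local Notation cm := (@count R).
Implicit Types (g : Rd -> R[i]) (xi eta x : Rd).

Lemma Rintegral_count (f : nat -> R) (l : R) : cm.-integrable setT (EFin \o f) ->
  (fun n => \sum_(0 <= k < n) f k) @ \oo --> l -> \int[cm]_k f k = l.
Proof.
move=> /integrableP[_ hf] hl; rewrite /Rintegral.
have sf : summable setT (EFin \o f).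
  rewrite /summable -nneseries_esumT//.
  by rewrite -ge0_integral_count; [exact: hf|move=> k; exact: abse_ge0].
have -> : (\int[cm]_k (f k)%:E = \sum_(k <oo) (f k)%:E)%E by exact: (integral_count sf).
have h : (fun n => \sum_(0 <= k < n) (f k)%:E)%E @ \oo --> l%:E.
  by under eq_fun do rewrite sumEFin; apply/fine_cvgP; split => //; exact: nearW.
by rewrite (cvg_lim _ h).
Qed.

(** By continuity, a Fourier transform does not survive on the boundary sphere of its support. *)
Lemma fourier_support_strict g (r : R) : csch g -> 0 < r ->
  (forall xi, fourier g xi != 0 -> enorm xi <= r) -> forall xi, fourier g xi != 0 -> enorm xi < r.
Proof.
move=> hg r0 h xi nz; rewrite lt_neqAle h// andbT; apply/eqP => xr.
have [C C0 hC] := fourier_lip hg.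
have c0 : 0 < cabs (fourier g xi).
  rewrite lt_neqAle cabs_ge0 andbT eq_sym; apply: contra nz => /eqP E.
  by apply/eqP; exact: (@ComplexField.Normc.eq0_normc R).
pose s := cabs (fourier g xi) / (2 * (C * r + 1)).
have B0 : 0 < C * r + 1 by rewrite ltr_wpDl// mulr_ge0// ltW.
have s0 : 0 < s by rewrite divr_gt0// mulr_gt0.
have nz' : fourier g ((1 + s) *: xi) != 0.
  apply/negP => /eqP E; have := hC xi ((1 + s) *: xi); rewrite E subr0.
  rewrite scalerDl scale1r opprD addrA subrr sub0r enormN enormZ xr gtr0_norm//.
  move=> H; have : cabs (fourier g xi) <= s * (C * r + 1).
    by apply: le_trans H _; rewrite mulrCA ler_pM2l// lerDl.
  by rewrite /s invfM mulrA divfK ?gt_eqF//; lra.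
have := h _ nz'; rewrite enormZ xr gtr0_norm ?addr_gt0// => H.
have : s * r > 0 by rewrite mulr_gt0.
lra.
Qed.

Variables (phi0 phi : Rd -> R[i]) (theta : nat -> Rd -> R[i]).
Hypothesis hr : resolution_of_unity phi0 phi theta.

(** The generator of the dyadic family, with [phi] as Fourier transform. *)
Definition dyadic_gen := dil (theta 1) 2.

Lemma csch_theta j : csch (theta j).
Proof. exact/schwartz_csch/(ru_theta_schwartz hr). Qed.

Lemma csch_dyadic_gen : csch dyadic_gen.
Proof. by apply: csch_dil; [rewrite pnatr_eq0|exact: csch_theta]. Qed.

Lemma fourier_dyadic_gen xi : fourier dyadic_gen xi = phi xi.
Proof.
rewrite fourier_dil//; last exact: csch_theta.
by rewrite (ru_theta hr) /= scalerA mulVf ?scale1r// expr1 pnatr_eq0.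
Qed.

Lemma theta_dil k : theta k.+1 = dil dyadic_gen (dyadic_scale R k).
Proof.
have s0 := dyadic_scale_gt0 R k.
apply: fourier_inj; [exact: csch_theta|apply: csch_dil; [by rewrite gt_eqF|exact: csch_dyadic_gen]|].
move=> xi; rewrite (ru_theta hr) fourier_dil//; last exact: csch_dyadic_gen.
by rewrite fourier_dyadic_gen.
Qed.

Lemma theta0_dil : theta 0 = dil (theta 0) 1.
Proof. by apply/funext => x; rewrite /dil expr1n invr1 scale1r (_ : 1%:C%C = 1)// mul1r. Qed.

Lemma phi_supp xi : phi xi != 0 -> 2^-1 <= enorm xi < 2.
Proof.
move=> nz; have hs eta : phi eta != 0 -> 2^-1 <= enorm eta <= 2.
  by move=> h; apply: (ru_supp hr); exact: subset_closure.
have /andP[-> _] /= := hs _ nz.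
apply: (fourier_support_strict csch_dyadic_gen) => [//|eta|]; rewrite fourier_dyadic_gen//.
by move=> /hs/andP[].
Qed.

Lemma phi0_supp xi : phi0 xi != 0 -> enorm xi < 2.
Proof.
move=> nz; have hs eta : phi0 eta != 0 -> enorm eta <= 2.
  by move=> h; apply: (ru_supp0 hr); exact: subset_closure.
apply: (fourier_support_strict (csch_theta 0)) => [//|eta|]; rewrite (ru_theta hr)//=.
exact: hs.
Qed.

(** A series that is eventually constant equals its limit. *)
Lemma dyadic_finite_sum N xi : (forall j, (N <= j)%N -> dyadic phi0 phi j xi = 0) ->
  \sum_(0 <= j < N) dyadic phi0 phi j xi = 1.
Proof.
move=> h; have [hR hI] := ru_sum hr xi.
have E n : (N <= n)%N -> \sum_(0 <= j < n) dyadic phi0 phi j xi = \sum_(0 <= j < N) dyadic phi0 phi j xi.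
  move=> Nn; rewrite (big_cat_nat _ Nn)//= [X in _ + X]big1_seq ?addr0// => j /=.
  by rewrite mem_index_iota => /andP[Nj _]; exact: h.
have K (F : R[i] -> R) (l : R) : (fun n => F (\sum_(0 <= j < n) dyadic phi0 phi j xi)) @ \oo --> l ->
    F (\sum_(0 <= j < N) dyadic phi0 phi j xi) = l.
  move=> /cvg_lim <-//; apply/esym; apply: cvg_lim => //; apply: cvg_near_cst.
  by exists N => // n /= Nn; rewrite E.
by apply: complex_eqP => -[]; rewrite /part /=; [exact: (K (@complex.Re R) 1 hR)|exact: (K (@complex.Im R) 0 hI)].
Qed.

Lemma phi_small xi : enorm xi < 2^-1 -> phi xi = 0.
Proof. by move=> h; apply/eqP/negPn/negP => /phi_supp/andP[]; rewrite leNgt h. Qed.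

Lemma dyadic_tail xi (r : R) j : (0 < j)%N -> enorm xi < r -> r <= 2 ^+ j / 2 -> phi (2 ^- j *: xi) = 0.
Proof.
move=> j0 xr rj; apply: phi_small; rewrite enormZ ger0_norm ?invr_ge0 ?exprn_ge0//.
rewrite mulrC ltr_pdivrMr ?exprn_gt0// mulrC; exact: lt_le_trans xr rj.
Qed.

(** At a point of the support of [phi], the resolution of unity at 4 times the point
    reduces to three terms: the others vanish by the strict support bounds. *)
Lemma phi_neighbours xi : phi xi != 0 -> phi (2 *: xi) + phi xi + phi (2^-1 *: xi) = 1.
Proof.
move=> nz; have /andP[x1 x2] := phi_supp nz.
have e4 : enorm (4 *: xi) = 4 * enorm xi by rewrite enormZ ger0_norm.
have := @dyadic_finite_sum 4 (4 *: xi); rewrite !big_nat_recr//= big_geq// add0r.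
have -> : phi0 (4 *: xi) = 0.
  by apply/eqP/negPn/negP => /phi0_supp; rewrite e4; lra.
rewrite add0r !scalerA (_ : 2 ^- 1 * 4 = 2 :> R); last by lra.
rewrite (_ : 2 ^- 2 * 4 = 1 :> R) ?scale1r; last by lra.
rewrite (_ : 2 ^- 3 * 4 = 2^-1 :> R); last by lra.
apply=> -[//|j] h /=; apply: (@dyadic_tail _ 8) => //; first by rewrite e4; lra.
rewrite ler_pdivlMr// (_ : 8 * 2 = 2 ^+ 4 :> R); last by lra.
by rewrite ler_weXn2l// ler1n.
Qed.

(** On the support of [phi0] the dilates of [phi] beyond the first vanish, again
    by the strict bounds. *)
Lemma phi0_neighbours xi : phi0 xi != 0 -> phi0 xi + phi (2^-1 *: xi) = 1.
Proof.
move=> nz; have x2 := phi0_supp nz.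
have := @dyadic_finite_sum 2 xi; rewrite !big_nat_recr//= big_geq// add0r expr1.
apply=> -[//|j] h /=; apply: (@dyadic_tail _ 2) => //.
rewrite ler_pdivlMr// (_ : 2 * 2 = 2 ^+ 2 :> R); last by lra.
by rewrite ler_weXn2l// ler1n.
Qed.

Definition dyadic_dual0 x : R[i] := (fcst R d ^+ 2)%:C%C * (theta 0 x + theta 1 x).
(** Its transform is constant on the support of [phi], by [phi_neighbours]: the
    Calderon sum then collapses to the resolution of unity. *)
Definition dyadic_dual x : R[i] := (fcst R d ^+ 2)%:C%C *
  ((dil dyadic_gen 2 x + dyadic_gen x) + dil dyadic_gen 2^-1 x).

Let t2 : (2 : R) != 0. Proof. by rewrite pnatr_eq0. Qed.
Let t2V : (2^-1 : R) != 0. Proof. by rewrite invr_eq0. Qed.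
Let g2 : csch (dil dyadic_gen 2). Proof. exact: csch_dil csch_dyadic_gen. Qed.
Let g2V : csch (dil dyadic_gen 2^-1). Proof. exact: csch_dil csch_dyadic_gen. Qed.

Lemma csch_dyadic_dual0 : csch dyadic_dual0.
Proof. by apply: cschZ; apply: cschD; exact: csch_theta. Qed.

Lemma csch_dyadic_dual : csch dyadic_dual.
Proof. by apply: cschZ; apply: cschD g2V; exact: cschD g2 csch_dyadic_gen. Qed.

Lemma fourier_dyadic_dual0 xi : fourier dyadic_dual0 xi = (fcst R d ^+ 2)%:C%C * (phi0 xi + phi (2^-1 *: xi)).
Proof.
rewrite fourierZ; last by apply: csch_cinteg; apply: cschD; exact: csch_theta.
by rewrite fourierD ?(ru_theta hr)//=; apply: csch_cinteg; exact: csch_theta.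
Qed.

Lemma fourier_dyadic_dual xi : fourier dyadic_dual xi =
  (fcst R d ^+ 2)%:C%C * (phi (2 *: xi) + phi xi + phi (2^-1 *: xi)).
Proof.
have gg := csch_dyadic_gen; have i2 := csch_cinteg g2; have i3 := csch_cinteg g2V.
have i1 := csch_cinteg gg.
rewrite fourierZ; last exact: cintegD (cintegD i2 i1) i3.
rewrite (fourierD _ (cintegD i2 i1) i3) (fourierD _ i2 i1).
by rewrite !(@fourier_dil _ _ dyadic_gen) ?invr_gt0//; rewrite !fourier_dyadic_gen.
Qed.

(** Multiplying by the duals leaves [phi0] and the dilates of [phi]
    unchanged up to one constant, so the identity is the resolution of unity itself. *)
Lemma dyadic_calderon_system :
  calderon_system cm (fun=> 1) (dyadic_scale R) dyadic_dual0 dyadic_dual (theta 0) dyadic_gen.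
Proof.
(* The three dilates of [phi] vanish on the ball of radius 1/4. *)
have ck : ccancel dyadic_dual.
  apply: (@flat_ccancel _ _ _ 4^-1) => [|//|xi h]; first exact: csch_dyadic_dual.
  have e0 := enorm_ge0 xi.
  rewrite fourier_dyadic_dual !phi_small ?addr0 ?mulr0// ?enormZ ?ger0_norm ?invr_ge0//; lra.
split => //.
- exact: dyadic_scale_space.
- exact: csch_dyadic_dual0.
- exact: csch_dyadic_dual.
- exact: csch_theta.
- exact: csch_dyadic_gen.
- apply: (@flat_ccancel _ _ _ 2^-1) => [|//|xi h]; first exact: csch_dyadic_gen.
  by rewrite fourier_dyadic_gen phi_small.
move=> xi; set c := (fcst R d ^+ 2)%:C%C.
have := @calderon_integrable _ _ _ _ _ _ _ (dyadic_scale_space R) dyadic_dual dyadic_gen xi csch_dyadic_dual csch_dyadic_gen ck.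
have E k : (1%:C%C : R[i]) * (fourier dyadic_dual (dyadic_scale R k *: xi) * fourier dyadic_gen (dyadic_scale R k *: xi)) =
    c * phi (dyadic_scale R k *: xi).
  rewrite (_ : 1%:C%C = 1)// mul1r fourier_dyadic_dual fourier_dyadic_gen -mulrA; congr (_ * _).
  have [->|nz] := eqVneq (phi (dyadic_scale R k *: xi)) 0; first by rewrite mulr0.
  by rewrite phi_neighbours// mul1r.
have E0 : fourier dyadic_dual0 xi * fourier (theta 0) xi = c * phi0 xi.
  rewrite fourier_dyadic_dual0 (ru_theta hr)/= -mulrA; congr (_ * _).
  have [->|nz] := eqVneq (phi0 xi) 0; first by rewrite mulr0.
  by rewrite phi0_neighbours// mul1r.
rewrite E0 (eq_cintg _ E).
under [X in cinteg cm X]eq_fun do rewrite E.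
move=> hi; apply: complex_eqP => b; rewrite partD part_cintg part_realM.
apply/eqP; rewrite addrC eq_sym -subr_eq; apply/eqP/esym; apply: Rintegral_count; first exact: hi.
have hb : (fun n => part b (\sum_(0 <= j < n.+1) dyadic phi0 phi j xi)) @ \oo --> part b (1 : R[i]).
  have [hR hI] := ru_sum hr xi.
  rewrite (cvg_shiftS (fun n => part b (\sum_(0 <= j < n) dyadic phi0 phi j xi))).
  by case: b {hi}; [exact: hR|exact: hI].
have -> : part b c - fcst R d ^+ 2 * part b (phi0 xi) = fcst R d ^+ 2 * (part b 1 - part b (phi0 xi)).
  by rewrite -[c]mulr1 part_realM mulrBr.
have -> : (fun n => \sum_(0 <= k < n) part b (c * phi (dyadic_scale R k *: xi))) =
    (fun n => fcst R d ^+ 2 * (part b (\sum_(0 <= j < n.+1) dyadic phi0 phi j xi) - part b (phi0 xi))).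
  apply/funext => n; rewrite big_nat_recl//= partD [in RHS]addrAC subrr add0r.
  rewrite (big_morph (part b) (partD b) (part0 _ b)) mulr_sumr.
  by apply: eq_bigr => k _; rewrite part_realM.
by apply: cvgMr; apply: cvgB => //; exact: cvg_cst.
Qed.

End dyadic_system.

(** * The wavelet system *)

Section wavelet_system.
Context (R : realType) (d : nat).
Local Notation Rd := 'rV[R]_d.
Local Notation mu := (@leb R d).
Local Notation lm := (@lebesgue_measure R).
Variables (Phi0 Phi : Rd -> R[i]).
Hypothesis hF : admissible_frame Phi0 Phi.
Implicit Types (xi x y : Rd).

Let hPhi0 : csch Phi0 := schwartz_csch (af_schwartz0 hF).
Let hPhi : csch Phi := schwartz_csch (af_schwartz hF).

Lemma mul_conjc (z : R[i]) : z * conjc z = (cabs z ^+ 2)%:C%C.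
Proof.
case: z => x y; apply: complex_eqP => b; rewrite /cabs/= sqr_sqrtr ?addr_ge0 ?sqr_ge0//.
by case: b; rewrite /part/=; ring.
Qed.

Lemma fcst_sqr : fcst R d ^+ 2 = (2 * pi) ^- d.
Proof.
have p0 : 0 < 2 * pi :> R by rewrite mulr_gt0// pi_gt0.
rewrite /fcst expr2 -powRD; last by apply/implyP => _; rewrite gt_eqF.
rewrite -powR_mulrn ?ltW// -powRN; congr (_ `^ _); lra.
Qed.

Lemma integral_unit_density (f : measurableTypeR R -> R) :
  (\int[lm]_(t in `]0%R, 1%R[%classic) (f t / t)%:E =
   \int[lm]_t (unit_density t * f (unit_scale t))%:E)%E.
Proof.
rewrite integral_mkcond; apply: eq_integral => t _.
rewrite patchE /unit_density /unit_scale mem_setE in_itv/=.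
by case: ifP => _; rewrite ?mul0r// mulrC.
Qed.

(** With the frame as its own dual, the products of transforms are squared
    moduli, and the identity is the tightness of the inhomogeneous frame. *)
Lemma wavelet_calderon_system :
  calderon_system lm (@unit_density R) (@unit_scale R) Phi0 Phi (creflect Phi0) (creflect Phi).
Proof.
have ck : ccancel Phi := moments_ccancel (af_moments hF).
have us := unit_scale_space R.
have h0 := csch_creflect hPhi0; have h1 := csch_creflect hPhi.
split => //; first exact: ccancel_creflect.
move=> xi; have hi := calderon_integrable us xi hPhi h1 ck.
rewrite fourier_creflect// mul_conjc.
have E t : (unit_density t)%:C%C * (fourier Phi (unit_scale t *: xi) * fourier (creflect Phi) (unit_scale t *: xi)) =
    (unit_density t * cabs (fourier Phi (unit_scale t *: xi)) ^+ 2)%:C%C.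
  by rewrite fourier_creflect// mul_conjc -rmorphM.
rewrite (eq_cintg _ E); have /= hR := hi true.
have hr : lm.-integrable setT (EFin \o (fun t => unit_density t * cabs (fourier Phi (unit_scale t *: xi)) ^+ 2)).
  by apply: eq_integrable (hi true) => // t _; congr (_%:E); exact: (congr1 (@complex.Re R) (E t)).
have := af_tight0 hF xi.
rewrite (integral_unit_density (fun t => cabs (fourier Phi (t *: xi)) ^+ 2)).
have -> : (\int[lm]_t (unit_density t * cabs (fourier Phi (unit_scale t *: xi)) ^+ 2)%:E)%E =
   (\int[lm]_t (unit_density t * cabs (fourier Phi (unit_scale t *: xi)) ^+ 2))%:E.
  by rewrite /Rintegral fineK//; exact: integrable_fin_num hr.
rewrite -EFinD => -[hE]; rewrite fcst_sqr -hE.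
apply: complex_eqP => b; rewrite partD part_cintg; case: b; rewrite /part//=.
rewrite (@eq_Rintegral _ _ _ lm _ (cst 0)) ?Rintegral_cst ?mul0r ?addr0//.
Qed.

(** The L^2-normalised wavelets are the L^1-normalised dilates multiplied by
    t^(d/2). *)
Lemma voice_scale (f : tempered_distribution R d) x t : 0 < t ->
  voice Phi0 Phi f x t%:E = (t `^ (d%:R / 2))%:C%C * tconv f (dil (creflect Phi) t) x.
Proof.
move=> t0; have hc := csch_creflect hPhi.
have tn : t != 0 by rewrite gt_eqF.
rewrite /voice /tconv -temperedZ; [|exact: td_tempered|].
  congr (td_eval f _); apply/funext => y; rewrite /wavelet conjc_realM /dil /creflect mulrA -rmorphM/=.
  congr (_%:C%C * conjc (Phi _)); last by rewrite -scalerN opprB.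
  rewrite -powR_mulrn ?ltW// -powRN -powRD; last by apply/implyP => _.
  by congr (_ `^ _); lra.
by apply: csch_reflect; exact: csch_dil.
Qed.

Lemma voice_infty (f : tempered_distribution R d) x :
  voice Phi0 Phi f x +oo%E = tconv f (dil (creflect Phi0) 1) x.
Proof.
rewrite /voice /tconv; congr (td_eval f _); apply/funext => y.
by rewrite /wavelet /dil /creflect expr1n invr1 scale1r opprB (_ : 1%:C%C = 1)// mul1r.
Qed.

End wavelet_system.

(** * Change of system *)

Section maximal_norms.
Context (R : realType) (d : nat) dZ (Z : measurableType dZ).
Local Notation Rd := 'rV[R]_d.
Variables (m : {sigma_finite_measure set Z -> \bar R}) (D : set Z) (e tau : Z -> R).
Variables (lam0 lam : Rd -> R[i]) (w : Rd -> R -> R) (w0 v : Rd -> R) (p q : \bar R) (a : R).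
Local Notation Np := (wLnorm (@leb R d) setT v p).
Local Notation Nq := (wLnorm m D e q).
Implicit Types f : (Rd -> R[i]) -> R[i].
Local Open Scope ereal_scope.

Definition smooth_part f : \bar R := Np (fun x => (w0 x)%:E * pmax a f lam0 1 x).
Definition scale_part f z x : \bar R := (w x (tau z))%:E * pmax a f lam (tau z) x.

Definition mixed_norm f := smooth_part f + Nq (fun z => Np (scale_part f z)).
Definition nested_norm f := smooth_part f + Np (fun x => Nq (fun z => scale_part f z x)).

End maximal_norms.

Section change_of_system.
Context (R : realType) (d : nat) d1 d2 (Z : measurableType d1) (Z' : measurableType d2).
Local Notation Rd := 'rV[R]_d.
Variables (m : {sigma_finite_measure set Z -> \bar R}) (D : set Z) (e tau : Z -> R).
Variables (m' : {sigma_finite_measure set Z' -> \bar R}) (D' : set Z') (e' tau' : Z' -> R).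
Variables (kap0 kap lam0 lam kap0' kap' lam0' lam' : Rd -> R[i]).
Hypothesis S : calderon_system m e tau kap0 kap lam0 lam.
Hypothesis S' : calderon_system m' e' tau' kap0' kap' lam0' lam'.
Hypotheses (ws : weighted_space m D e) (ws' : weighted_space m' D' e').
Variables (nA nB : nat) (w : Rd -> R -> R) (w0 v : Rd -> R) (p q : \bar R) (a : R).
Hypothesis hw : scale_weight nA nB w w0.
Hypothesis wX : weighted_space (@leb R d) setT v.
Hypotheses (p1 : (1 <= p)%E) (q1 : (1 <= q)%E) (a0 : 0 <= a).
Let ss := cs_scale S.
Let ss' := cs_scale S'.
Let tp z : 0 < tau z. Proof. by have /andP[] := ss_scale01 ss z. Qed.
Let t01 z : 0 < tau z <= 1. Proof. by have /andP[-> /ltW] := ss_scale01 ss z. Qed.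
Let t01' z : 0 < tau' z <= 1. Proof. by have /andP[-> /ltW] := ss_scale01 ss' z. Qed.
Let one : 0 < (1 : R) <= 1. Proof. by rewrite ltr01/=. Qed.

(** The growth of the weight is absorbed by [nA] of the [nA + 1] powers of the scale ratio. *)
Lemma weighted_pmax_bound : exists2 C, 0 < C & forall f, tempered f ->
  (forall x z', scale_part tau' lam' w a f z' x <= C%:E * ((tau' z')%:E * ((w0 x)%:E * pmax a f lam0 1 x) +
     \int[m]_z ((e z * ratio (tau' z') (tau z))%:E * scale_part tau lam w a f z x)))%E /\
  (forall x, (w0 x)%:E * pmax a f lam0' 1 x <= C%:E * ((w0 x)%:E * pmax a f lam0 1 x +
     \int[m]_z ((e z * tau z)%:E * scale_part tau lam w a f z x)))%E.
Proof.
have [C1 C10 hC1] := pmax_bound ss (cs_kap0 S) (cs_kap S) (cs_lam0 S) (cs_lam S) (cs_lam S')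
  (cs_cancel_kap S) (cs_calderon S) a0 nA.+1.
have [C2 C20 hC2] := pmax_bound ss (cs_kap0 S) (cs_kap S) (cs_lam0 S) (cs_lam S) (cs_lam0 S')
  (cs_cancel_kap S) (cs_calderon S) a0 nA.+1.
have e0 := ss_density_ge0 ss.
have key (C W s c : R) (k : Z -> R) (G P0 : \bar R) f x : tempered f -> 0 < C -> C <= C1 + C2 -> 0 <= W ->
    0 < s -> (forall z, 0 <= k z) -> (0 <= P0)%E -> (forall z, 0 < ratio s (tau z)) ->
    W * s ^+ nA.+1 <= c * w0 x ->
    (forall z, W * ratio s (tau z) ^+ nA.+1 <= k z * w x (tau z)) ->
    (G <= C%:E * ((s ^+ nA.+1)%:E * P0 +
     \int[m]_z ((e z * ratio s (tau z) ^+ nA.+1)%:E * pmax a f lam (tau z) x)))%E ->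
    (W%:E * G <= (C1 + C2)%:E * (c%:E * ((w0 x)%:E * P0) +
     \int[m]_z ((e z * k z)%:E * scale_part tau lam w a f z x)))%E.
  move=> tf C0 CC W0 s_gt0 k0 P00 r0 hs hk hG.
  have mP := measurable_pmax_section ss (cs_lam S) a x tf; have s0 := ltW s_gt0.
  have mr : measurable_fun setT ((fun z => e z * ratio s (tau z) ^+ nA.+1) : Z -> measurableTypeR R).
    apply: measurable_funM; first exact: ss_measurable_density ss.
    exact: (measurable_funX _ (measurable_ratio ss s_gt0)).
  have r00 z : 0 <= e z * ratio s (tau z) ^+ nA.+1 by rewrite mulr_ge0// exprn_ge0// ltW.
  have I0 : (0 <= \int[m]_z ((e z * ratio s (tau z) ^+ nA.+1)%:E * pmax a f lam (tau z) x))%E.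
    by apply: integral_ge0 => z _; rewrite mule_ge0 ?pmax_ge0// lee_fin.
  have s00 : (0 <= (s ^+ nA.+1)%:E * P0)%E by rewrite mule_ge0// lee_fin exprn_ge0.
  apply: (@le_trans _ _ (W%:E * ((C1 + C2)%:E * ((s ^+ nA.+1)%:E * P0 +
     \int[m]_z ((e z * ratio s (tau z) ^+ nA.+1)%:E * pmax a f lam (tau z) x))))%E).
    apply: lee_wpmul2l; first by rewrite lee_fin.
    by apply: le_trans hG _; apply: lee_wpmul2r; [exact: adde_ge0|rewrite lee_fin].
  rewrite muleCA; apply: lee_wpmul2l; first by rewrite lee_fin addr_ge0// ltW.
  rewrite ge0_muleDr//; apply: leeD.
    rewrite (muleA W%:E) -(EFinM W) (muleA c%:E) -(EFinM c).
    by apply: lee_wpmul2r => //; rewrite lee_fin.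
  rewrite -ge0_integralZl//; last 2 first.
  - by apply: emeasurable_funM => //; exact/measurable_EFinP.
  - by move=> z _; rewrite mule_ge0 ?pmax_ge0// lee_fin.
  apply: ge0_le_lower_integral => z _.
    by rewrite mule_ge0 ?lee_fin// mule_ge0 ?pmax_ge0// lee_fin.
  rewrite /scale_part (muleA W%:E) -(EFinM W) (muleA (e z * k z)%:E) -(EFinM (e z * k z)).
  apply: lee_wpmul2r; first exact: pmax_ge0.
  by rewrite lee_fin -(mulrA (e z)) mulrCA ler_wpM2l.
exists (C1 + C2); first exact: addr_gt0.
move=> f tf; split=> [x z'|x].
  have tz := t01' z'; have /andP[tz0 tz1] := tz; have tz2 := ltW tz0.
  apply: (key C1 _ (tau' z')) => //.
  - by rewrite lerDl ltW.
  - by rewrite ltW// (sw_pos hw).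
  - by move=> z; rewrite ltW// ratio_gt0.
  - exact: pmax_ge0.
  - by move=> z; rewrite ratio_gt0.
  - by rewrite exprS mulrCA; apply: ler_wpM2l => //; exact: (sw_down hw).
  - move=> z; rewrite exprS mulrCA; apply: ler_wpM2l; first by rewrite ltW// ratio_gt0.
    exact: (sw_scale hw).
  - by apply: hC1 => //; left; exact: cs_cancel_lam S'.
have h := ltW (sw_pos0 hw x).
rewrite -[X in (_ * (X + _))%E]mul1e; apply: (key C2 _ 1) => //.
- by rewrite lerDr ltW.
- by move=> z; rewrite ltW.
- exact: pmax_ge0.
- by move=> z; rewrite ratio_gt0.
- by rewrite expr1n mulr1 mul1r.
- move=> z; rewrite ratio1// exprS mulrCA; apply: ler_wpM2l; first by rewrite ltW.
  exact: (sw_up hw).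
- by apply: hC2 => //; right.
Qed.

(** The pointwise bound has a kernel of Schur type on the scales, so it passes to
    both kinds of norm. *)
Theorem change_of_system : exists2 C, 0 < C & forall f, tempered f ->
  (mixed_norm m' D' e' tau' lam0' lam' w w0 v p q a f <=
     C%:E * mixed_norm m D e tau lam0 lam w w0 v p q a f)%E /\
  (nested_norm m' D' e' tau' lam0' lam' w w0 v p q a f <=
     C%:E * nested_norm m D e tau lam0 lam w w0 v p q a f)%E.
Proof.
have [C C0 hC] := weighted_pmax_bound.
have [M M1 [hM hM' hM1 hM1']] := schur_constant ss ss'.
have M0 : 0 < M by exact: lt_le_trans M1.
exists (200 * M * C); first by rewrite !mulr_gt0.
move=> f tf; have [hT hT0] := hC f tf.
pose A (r : Rd * Z) := scale_part tau lam w a f r.2 r.1.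
pose T (r : Rd * Z') := scale_part tau' lam' w a f r.2 r.1.
have mA : measurable_fun setT A.
  exact: (measurable_weighted_pmax (ss_measurable_scale ss) (ss_scale01 ss) hw a tf (cs_lam S)).
have mA0 : measurable_fun setT (fun x => (w0 x)%:E * pmax a f lam0 1 x)%E.
  exact: (measurable_weighted_pmax0 hw a tf (cs_lam0 S)).
have pw0 l x : (0 <= (w0 x)%:E * pmax a f l 1 x)%E.
  by rewrite mule_ge0 ?pmax_ge0// lee_fin ltW// (sw_pos0 hw).
have pA r : (0 <= A r)%E.
  by rewrite mule_ge0 ?pmax_ge0// lee_fin ltW// (sw_pos hw).
have pT r : (0 <= T r)%E.
  by rewrite mule_ge0 ?pmax_ge0// lee_fin ltW// (sw_pos hw).
split.
  exact: (transfer_mixed wX ws ws' ss ss' p1 q1 mA mA0 pA (pw0 lam0) pT (pw0 lam0') (ltW C0) M1 hM hM' hM1 hM1'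
    hT hT0).
exact: (transfer_nested wX ws ws' ss ss' p1 q1 mA mA0 pA (pw0 lam0) pT (pw0 lam0') (ltW C0) M1 hM hM' hM1 hM1'
    hT hT0).
Qed.

End change_of_system.

(** * Function space norms and coorbit norms *)

Section sequence_norm.
Context (R : realType).
Local Notation cm := (@count R).
Local Notation N := (wLnorm cm (setT : set nat) (fun=> 1)).
Local Open Scope ereal_scope.
Implicit Types u : nat -> \bar R.

(** Only the empty set is null for the counting measure. *)
Lemma ae_count (P : nat -> Prop) : (\forall k \ae cm, P k) -> forall k, P k.
Proof.
move=> [A [mA A0 hA]] k; apply: contrapT => nP; have Ak : A k by exact: hA.
have : cm [set k] <= cm A by apply: le_measure; rewrite ?inE// => _ ->.
have -> : cm [set k] = 1.
  have -> : cm [set k] = @counting nat R [set k] by [].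
  by rewrite /counting asboolT// fset_set1 finmap.cardfs1.
by rewrite A0 leNgt lte01.
Qed.

Lemma Lnorm_count u q : (forall k, 0 <= u k) -> 1 <= q -> Lnorm counting q u = N q u.
Proof.
move=> u0; rewrite Lnorm.unlock; case: q => [r|_|//] => [r1|].
  by rewrite /wLnorm; congr (_ `^ _); apply: eq_integral => k _; rewrite mule1.
rewrite /wLnorm patch_setT; case: ifP => //.
by have := ws_nontrivial (dyadic_weighted_space R); rewrite /count => ->.
Qed.

Lemma count_norm_fin u (r : R) : (0 < r)%R -> (forall k, 0 <= u k) ->
  N r%:E u = (u 0%N `^ r + \sum_(k <oo) (u k.+1 `^ r)) `^ r^-1.
Proof.
move=> r0 u0; rewrite /wLnorm; congr (_ `^ _).
have -> : \int[cm]_(k in setT) (`|u k| `^ r * 1%:E) = \int[cm]_k (u k `^ r).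
  by apply: eq_integral => k _; rewrite mule1 gee0_abs.
have -> : \int[cm]_k (u k `^ r) = \sum_(k <oo) (u k `^ r).
  by apply: ge0_integral_count => k; exact: poweR_ge0.
rewrite nneseries_recl//; last by move=> k _; exact: poweR_ge0.
congr (_ + _); rewrite -(@nneseries_addn _ (fun k => u k `^ r) 1%N); last by move=> k; exact: poweR_ge0.
by congr (limn _); apply/funext => n; apply: eq_bigr => k _; rewrite addn1.
Qed.

Lemma count_norm_shift u (r : R) : (0 < r)%R -> (forall k, 0 <= u k) ->
  N r%:E (fun k => u k.+1) = (\sum_(k <oo) (u k.+1 `^ r)) `^ r^-1.
Proof.
move=> r0 u0; rewrite /wLnorm; congr (_ `^ _).
have -> : \int[cm]_(k in setT) (`|u k.+1| `^ r * 1%:E) = \int[cm]_k (u k.+1 `^ r).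
  by apply: eq_integral => k _; rewrite mule1 gee0_abs.
by apply: ge0_integral_count => k; exact: poweR_ge0.
Qed.

Lemma count_norm_sup u y : (N +oo u <= y) <-> (forall k, `|u k| <= y).
Proof.
rewrite /wLnorm patch_setT; split; last by move=> h; apply/ess_supP; apply: nearW.
by move=> /ess_supP/ae_count.
Qed.

Lemma poweR_mono (r : R) (x y : \bar R) : (0 < r)%R -> 0 <= x -> x <= y -> x `^ r <= y `^ r.
Proof.
move=> r0 x0 xy; apply: gt0_ler_poweR => //; [exact: ltW| |]; rewrite in_itv/= leey andbT//.
exact: le_trans xy.
Qed.

Lemma poweRVK (r : R) (x : \bar R) : (0 < r)%R -> 0 <= x -> (x `^ r) `^ r^-1 = x.
Proof. by move=> r0 x0; rewrite -poweRrM mulfV ?gt_eqF// poweRe1. Qed.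

(** Splitting off the term of index 0, which carries the weight at infinity. *)
Lemma count_norm_split u q : 1 <= q -> (forall k, 0 <= u k) ->
  [/\ u 0%N <= N q u, N q (fun k => u k.+1) <= N q u & N q u <= 2%:E * (u 0%N + N q (fun k => u k.+1))].
Proof.
case: q => [r|_|//] => [r1 u0|u0].
  have r0 : (0 < r)%R by rewrite lee_fin in r1; exact: lt_le_trans r1.
  have rV : (0 < r^-1)%R by rewrite invr_gt0.
  rewrite count_norm_fin// count_norm_shift//; set S := limn _; set b := _ `^ r.
  have S0 : 0 <= S by apply: nneseries_ge0 => k _ _; exact: poweR_ge0.
  have b0 : 0 <= b by exact: poweR_ge0.
  have Eb : b `^ r^-1 = u 0%N by exact: poweRVK.
  split; [by rewrite -[leLHS]Eb; apply: poweR_mono => //; rewrite leeDl|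
    by apply: poweR_mono => //; rewrite leeDr|].
  have key x : 0 <= x -> b <= x -> S <= x -> (b + S) `^ r^-1 <= 2%:E * x `^ r^-1.
    move=> x0 bx Sx; apply: (@le_trans _ _ ((2%:E * x) `^ r^-1)).
      apply: poweR_mono; [by []|exact: adde_ge0|].
      by rewrite (_ : 2%:E = 1 + 1)// ge0_muleDl// mul1e; exact: leeD.
    rewrite poweRM// poweR_EFin; apply: lee_wpmul2r; first exact: poweR_ge0.
    rewrite lee_fin -[leRHS]powRr1//; apply: ler_powR; first by rewrite ler1n.
    by rewrite invf_le1.
  case: (leP b S) => [bS|/ltW Sb].
    apply: le_trans (key S _ _ _) _ => //; apply: lee_wpmul2l => //; rewrite leeDr//.
  by apply: le_trans (key b _ _ _) _ => //; apply: lee_wpmul2l => //; rewrite Eb leeDl// poweR_ge0.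
have hu k : u k <= N +oo u by have /(_ k) := (count_norm_sup u (N +oo u)).1 (lexx _); rewrite gee0_abs.
have hs k : u k.+1 <= N +oo (fun k => u k.+1).
  by have /(_ k) := (count_norm_sup (fun k => u k.+1) _).1 (lexx _); rewrite gee0_abs.
have X0 : 0 <= u 0%N + N +oo (fun k => u k.+1) by rewrite adde_ge0// (le_trans (u0 1%N)).
have X1 : u 0%N + N +oo (fun k => u k.+1) <= 2%:E * (u 0%N + N +oo (fun k => u k.+1)).
  by rewrite -[leLHS]mul1e; apply: lee_wpmul2r => //; rewrite lee_fin ler1n.
split => //; first by apply/count_norm_sup => k; rewrite gee0_abs.
apply/count_norm_sup => k; rewrite gee0_abs//; apply: le_trans X1.
case: k => [|k]; first by rewrite leeDl// (le_trans (u0 1%N)).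
by apply: le_trans (hs k) _; rewrite leeDr.
Qed.

End sequence_norm.

Section unit_scale_norm.
Context (R : realType).
Local Notation lm := (@lebesgue_measure R).
Local Open Scope ereal_scope.

(** The factor [t^(d/q)] turns [dt / t^(d+1)] into [dt / t]. *)
Lemma scaleLnormE (d : nat) (q : \bar R) (g h : R -> \bar R) : 1 <= q ->
  (forall t, (0 < t < 1)%R -> g t = (t `^ (d%:R * einv q))%R%:E * h t) ->
  scaleLnorm d q g = wLnorm lm `]0%R, 1%R[%classic (@unit_density R) q h.
Proof.
move=> q1 E; rewrite /scaleLnorm /wLnorm; case: q q1 E => [r|_|//] => [r1|] E.
  have r0 : (0 < r)%R by rewrite lee_fin in r1; exact: lt_le_trans r1.
  congr (_ `^ _); apply: eq_integral => t; rewrite inE/= in_itv/= => t01.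
  have /andP[t0 _] := t01; rewrite E// /unit_density t01.
  have k0 : (0 <= t `^ (d%:R * einv r%:E))%R by exact: powR_ge0.
  rewrite abseM gee0_abs// poweRM ?abse_ge0//= -powRrM -(mulrA d%:R%R) mulVf ?gt_eqF// mulr1.
  rewrite powR_mulrn ?ltW// muleAC -EFinM muleC; congr (_ * _%:E).
  by rewrite exprS invfM mulrCA mulfV ?mulr1// expf_neq0// gt_eqF.
congr (ess_sup _ _); apply/funext => t; rewrite !patchE; case: ifP => //.
rewrite inE/= in_itv/= => t01; have /andP[t0 _] := t01.
by rewrite /= E//= mulr0 powRr0 mul1e.
Qed.

End unit_scale_norm.

Section function_space_norms.
Context (R : realType) (d : nat).
Local Notation Rd := 'rV[R]_d.
Local Notation lm := (@lebesgue_measure R).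
Variables (w : Rd -> \bar R -> R) (v : Rd -> R) (p q : \bar R) (a : R) (nA nB : nat).
Local Notation wf := (fun x t => w x t%:E).
Local Notation w0 := (fun x => w x +oo%E).
Hypothesis hw : scale_weight nA nB wf w0.
Hypothesis wX : weighted_space (@leb R d) setT v.
Hypotheses (p1 : (1 <= p)%E) (q1 : (1 <= q)%E).
Implicit Types f : tempered_distribution R d.
Local Notation Np := (wLnorm (@leb R d) setT v p).
Local Open Scope ereal_scope.

Section dyadic_norms.
Variables (phi0 phi : Rd -> R[i]) (theta : nat -> Rd -> R[i]).
Hypothesis hr : resolution_of_unity phi0 phi theta.
Local Notation mixedD := (mixed_norm (@count R) setT (fun=> 1%R) (dyadic_scale R) (theta 0) (dyadic_gen theta) wf w0 v p q a).
Local Notation nestedD := (nested_norm (@count R) setT (fun=> 1%R) (dyadic_scale R) (theta 0) (dyadic_gen theta) wf w0 v p q a).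

Lemma peetre_seq0 f x : peetre_seq theta a f 0 x = pmax a f (theta 0) 1 x.
Proof.
rewrite /peetre_seq /pmax; congr ereal_sup; apply/seteqP; split=> _ [z _ <-]; exists z => //;
  by rewrite /convolution /tconv -theta0_dil expr0 mul1r divr1.
Qed.

Lemma peetre_seqS f k x : peetre_seq theta a f k.+1 x = pmax a f (dyadic_gen theta) (dyadic_scale R k) x.
Proof.
rewrite /peetre_seq /pmax; congr ereal_sup; apply/seteqP; split=> _ [z _ <-]; exists z => //;
  by rewrite /convolution /tconv -(theta_dil hr) /dyadic_scale invrK (mulrC (enorm z)).
Qed.

Let term f j x := (wseq w j x)%:E * peetre_seq theta a f j x.

Let term0 f x : term f 0 x = (w x +oo)%:E * pmax a f (theta 0) 1 x.
Proof. by rewrite /term peetre_seq0. Qed.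

Let termS f k x : term f k.+1 x = scale_part (dyadic_scale R) (dyadic_gen theta) wf a f k x.
Proof. by rewrite /term peetre_seqS. Qed.

Let dyadic01 k : (0 < dyadic_scale R k <= 1)%R.
Proof. by have /andP[-> /ltW] := ss_scale01 (dyadic_scale_space R) k. Qed.

Let pterm f j x : 0 <= term f j x.
Proof.
case: j => [|k]; [rewrite term0|rewrite termS]; rewrite mule_ge0 ?pmax_ge0// lee_fin ltW//.
  exact: (sw_pos0 hw).
exact: (sw_pos hw).
Qed.

Let mterm0 f : measurable_fun setT (term f 0).
Proof.
rewrite (_ : term f 0 = (fun x => (w x +oo)%:E * pmax a f (theta 0) 1 x)); last exact/funext.
exact: (measurable_weighted_pmax0 hw a (td_tempered f) (csch_theta hr 0)).
Qed.

Let mtermS f : measurable_fun setT (fun r : Rd * nat => term f r.2.+1 r.1).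
Proof.
rewrite (_ : (fun r => _) = (fun r : Rd * nat => scale_part (dyadic_scale R) (dyadic_gen theta) wf a f r.2 r.1)); last exact/funext.
exact: (measurable_weighted_pmax (ss_measurable_scale (dyadic_scale_space R)) (ss_scale01 (dyadic_scale_space R))
  hw a (td_tempered f) (csch_dyadic_gen hr)).
Qed.

(** The outer norm being over the index, the splitting applies once. *)
Lemma Bnorm_mixed f : Bnorm theta w v p q a f <= 2%:E * mixedD f /\ mixedD f <= 2%:E * Bnorm theta w v p q a f.
Proof.
pose b j := Np (term f j).
have b0 j : 0 <= b j by exact: wLnorm_ge0.
have E : Bnorm theta w v p q a f = wLnorm (@count R) setT (fun=> 1%R) q b := Lnorm_count b0 q1.
have E0 : smooth_part (theta 0) w0 v p a f = b 0%N := congr1 Np (funext (fun x => esym (term0 f x))).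
have E1 : (fun k => Np (scale_part (dyadic_scale R) (dyadic_gen theta) wf a f k)) = (fun k => b k.+1).
  by apply/funext => k; exact: (congr1 Np (funext (fun x => esym (termS f k x)))).
have EM : mixedD f = b 0%N + wLnorm (@count R) setT (fun=> 1%R) q (fun k => b k.+1).
  exact: (f_equal2 adde E0 (congr1 (wLnorm (@count R) setT (fun=> 1%R) q) E1)).
rewrite E EM; move: (b) b0 => {E E0 E1 EM} b' b0.
have [h1 h2 h3] := count_norm_split q1 b0; split; first exact: h3.
by rewrite (_ : 2%:E = 1 + 1)// ge0_muleDl// mul1e; exact: leeD.
Qed.

(** The splitting applies at each point; the outer norm then costs a quasi-triangle
    inequality. *)
Lemma Fnorm_nested f : Fnorm theta w v p q a f <= 8%:E * nestedD f /\ nestedD f <= 2%:E * Fnorm theta w v p q a f.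
Proof.
pose X x := wLnorm (@count R) setT (fun=> 1%R) q (fun j => term f j x).
pose Y x := wLnorm (@count R) setT (fun=> 1%R) q (fun k => term f k.+1 x).
have E : Fnorm theta w v p q a f = Np X :=
  congr1 Np (funext (fun x => Lnorm_count (fun j => pterm f j x) q1)).
have E0 : smooth_part (theta 0) w0 v p a f = Np (term f 0) := congr1 Np (funext (fun x => esym (term0 f x))).
have E1 : (fun x => wLnorm (@count R) setT (fun=> 1%R) q
    (fun k => scale_part (dyadic_scale R) (dyadic_gen theta) wf a f k x)) = Y.
  apply/funext => x; apply: (congr1 (wLnorm (@count R) setT (fun=> 1%R) q)).
  by apply/funext => k; rewrite termS.
have EN : nestedD f = Np (term f 0) + Np Y := f_equal2 adde E0 (congr1 Np E1).
rewrite E EN => {E E0 E1 EN}.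
have ws := dyadic_weighted_space R.
have X0 x : 0 <= X x by exact: wLnorm_ge0.
have Y0 x : 0 <= Y x by exact: wLnorm_ge0.
have mY : measurable_fun setT Y by exact: (measurable_wLnorm_section ws (mtermS f)).
have hs x := count_norm_split q1 (fun j => pterm f j x).
have h1 x : term f 0 x <= X x by have [] := hs x.
have h2 x : Y x <= X x by have [] := hs x.
have h3 x : X x <= 2%:E * (term f 0 x + Y x) by have [] := hs x.
have t0 := pterm f 0; have mt := mterm0 f.
move: (term f 0) X Y t0 mt X0 Y0 mY h1 h2 h3 => T0 X Y T00 mT X0 Y0 mY h1 h2 h3 {hs}; split.
  apply: le_trans (wLnorm_le wX p1 X0 h3) _.
  have mD : measurable_fun setT (fun x => T0 x + Y x) by exact: emeasurable_funD.
  apply: le_trans (wLnormZ_le wX p1 _ mD _) _ => //; first by move=> x; exact: adde_ge0.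
  rewrite (_ : 8 = 2 * 4)%R; last by rewrite -natrM.
  rewrite EFinM -muleA; apply: lee_wpmul2l => //.
  exact: wLnormD_le.
rewrite (_ : 2%:E = 1 + 1)// ge0_muleDl ?(wLnorm_ge0 wX)// mul1e.
by apply: leeD; [exact: (wLnorm_le wX p1 T00 h1)|exact: (wLnorm_le wX p1 Y0 h2)].
Qed.

End dyadic_norms.

Section coorbit_norms.
Variables (Phi0 Phi : Rd -> R[i]).
Hypothesis hF : admissible_frame Phi0 Phi.
Let wt := wtilde q w.
Let B := LpRd v p.
Local Notation lam0 := (creflect Phi0).
Local Notation lam := (creflect Phi).
Local Notation ud := (@unit_density R).
Local Notation us := (@unit_scale R).
Local Notation mixedC := (mixed_norm lm `]0%R, 1%R[%classic ud us lam0 lam wf w0 v p q a).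
Local Notation nestedC := (nested_norm lm `]0%R, 1%R[%classic ud us lam0 lam wf w0 v p q a).

Lemma peetre_voice_infty f x : peetre a (voice Phi0 Phi f) x +oo = pmax a f lam0 1 x.
Proof.
rewrite /peetre /pmax; congr ereal_sup; apply/seteqP; split=> _ [z _ <-]; exists z => //;
  by rewrite voice_infty.
Qed.

Lemma peetre_voice f x (t : R) : (0 < t)%R ->
  peetre a (voice Phi0 Phi f) x t%:E = (t `^ (d%:R / 2))%R%:E * pmax a f lam t x.
Proof.
move=> t0; have k0 : (0 < t `^ (d%:R / 2))%R by exact: powR_gt0.
have E z : (cabs (voice Phi0 Phi f (x + z) t%:E) / (1 + enorm z / t) `^ a)%R%:E =
    (t `^ (d%:R / 2))%R%:E * (cabs (tconv f (dil lam t) (x + z)) / (1 + enorm z / t) `^ a)%R%:E.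
  by rewrite (voice_scale hF f (x + z) t0) cabsM cabs_real gtr0_norm// -mulrA EFinM.
apply/le_anti/andP; split.
  apply: ub_ereal_sup => _ [z _ <-]; rewrite E; apply: lee_wpmul2l; first by rewrite lee_fin ltW.
  exact: pmax_ge.
rewrite -lee_pdivlMl//; apply: ub_ereal_sup => _ [z _ <-]; rewrite lee_pdivlMl// -E.
by apply: ereal_sup_ubound; exists z.
Qed.

(** The t^(d/2) of the wavelets cancels the t^(-d/2) of the modified weight;
    what remains is the factor that turns dt/t^(d+1) into dt/t. *)
Lemma weighted_peetre_voice f x (t : R) : (0 < t < 1)%R ->
  (wt x t%:E)%:E * peetre a (voice Phi0 Phi f) x t%:E =
  (t `^ (d%:R * einv q))%R%:E * scale_part us lam wf a f t x.
Proof.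
move=> t01; have /andP[t0 _] := t01; rewrite peetre_voice// /scale_part /unit_scale t01 /wt /wtilde.
rewrite !muleA -!EFinM; congr (_%:E * _).
rewrite mulrAC -powRD; last by apply/implyP => _; rewrite gt_eqF.
by rewrite subrK.
Qed.

Let smoothE f : B (fun x => (wt x +oo)%:E * peetre a (voice Phi0 Phi f) x +oo) = smooth_part lam0 w0 v p a f.
Proof.
apply: (congr1 Np); apply/funext => x.
by rewrite (peetre_voice_infty f x).
Qed.

Lemma PXnorm_nested f : Conorm Phi0 Phi (PXnorm B q a wt) f = nestedC f.
Proof.
rewrite /Conorm /PXnorm smoothE /nested_norm; congr (_ + Np _); apply/funext => x.
by apply: scaleLnormE => // t t01; exact: weighted_peetre_voice.
Qed.

(** The power of t is pulled out of the inner norm by homogeneity, before the outer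
    one absorbs it. *)
Lemma LXnorm_mixed f : Conorm Phi0 Phi (LXnorm B q a wt) f = mixedC f.
Proof.
suff key t : (0 < t < 1)%R -> B (fun x => (wt x t%:E)%:E * peetre a (voice Phi0 Phi f) x t%:E) =
    (t `^ (d%:R * einv q))%R%:E * Np (scale_part us lam wf a f t).
  exact: (f_equal2 adde (smoothE f) (scaleLnormE q1 key)).
move=> t01; have /andP[t0 _] := t01.
have -> : B (fun x => (wt x t%:E)%:E * peetre a (voice Phi0 Phi f) x t%:E) =
    Np (fun x => (t `^ (d%:R * einv q))%R%:E * scale_part us lam wf a f t x).
  by apply: (congr1 Np); apply/funext => x; exact: weighted_peetre_voice.
have k0 : (0 < t `^ (d%:R * einv q))%R by exact: powR_gt0.
have ss := unit_scale_space R.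
have ms : measurable_fun setT (scale_part us lam wf a f t).
  have := measurable_weighted_pmax (ss_measurable_scale ss) (ss_scale01 ss) hw a (td_tempered f)
    (csch_creflect (schwartz_csch (af_schwartz hF))).
  by move=> /(fun k => measurableT_comp k (pair2_measurable t)).
have ps x : 0 <= scale_part us lam wf a f t x.
  rewrite mule_ge0 ?pmax_ge0// lee_fin ltW// (sw_pos hw)//.
  by have /andP[-> /ltW] := ss_scale01 ss t.
apply/le_anti/andP; split; first exact: (wLnormZ_le wX p1 (ltW k0)).
rewrite -lee_pdivlMl//.
rewrite {1}(_ : scale_part us lam wf a f t =
  (fun x => ((t `^ (d%:R * einv q))^-1)%R%:E * ((t `^ (d%:R * einv q))%R%:E * scale_part us lam wf a f t x))).
  apply: (wLnormZ_le wX p1); first by rewrite invr_ge0 ltW.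
    by apply: emeasurable_funM => //; exact: measurable_cst.
  by move=> x; rewrite mule_ge0// lee_fin ltW.
by apply/funext => x; rewrite muleA -EFinM mulVf ?mul1e// gt_eqF.
Qed.

End coorbit_norms.

End function_space_norms.

Section equivalence.
Context (R : realType) (d : nat).
Implicit Types N : tempered_distribution R d -> \bar R.

Lemma equivalent_of_le N1 N2 (K1 K2 : R) : 0 < K1 -> 0 < K2 ->
  (forall f, (N2 f <= K1%:E * N1 f)%E) -> (forall f, (N1 f <= K2%:E * N2 f)%E) ->
  equal_with_equivalent_norms N1 N2.
Proof.
move=> K10 K20 h1 h2.
have fin (K : R) (x : \bar R) : 0 < K -> (x < +oo)%E -> (K%:E * x < +oo)%E.
  by case: x => [r||] K0 // _; rewrite ?ltry// gt0_muleNy.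
split.
  apply/seteqP; split => f; rewrite /space/= => hf.
    by apply: le_lt_trans (h1 f) _; exact: fin.
  by apply: le_lt_trans (h2 f) _; exact: fin.
exists K2^-1, K1; split => //; first by rewrite invr_gt0.
by move=> f _; rewrite h1 andbT lee_pdivrMl.
Qed.

End equivalence.

Section weight.
Context (R : realType) (d : nat).

Lemma doubling_weighted_space (C : R) (v : 'rV[R]_d -> R) : doubling_weight C v ->
  weighted_space (@leb R d) setT v.
Proof.
move=> [mv v0 _]; split => //; [by move=> x; exact: ltW|by move=> x /(_ Logic.I)|].
exact: (@leb_open_gt0 R d setT 0 openT Logic.I).
Qed.

End weight.

Theorem theorem5p17 (R : realType) (d : nat) (d_gt0 : (0 < d)%N)
    (al1 al2 al3 : R) (al1_ge0 : 0 <= al1) (al2_ge0 : 0 <= al2)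
    (al3_ge0 : 0 <= al3)
    (w : 'rV[R]_d -> \bar R -> R) (hw : weight_class al1 al2 al3 w)
    (C : R) (C_gt1 : 1 < C)
    (v : 'rV[R]_d -> R) (hv : doubling_weight C v)
    (Phi0 Phi : 'rV[R]_d -> R[i]) (hPhi : admissible_frame Phi0 Phi)
    (p q : \bar R) (p_ge1 : (1 <= p)%E) (q_ge1 : (1 <= q)%E)
    (a : R) (a_gt0 : 0 < a)
    (phi0 phi : 'rV[R]_d -> R[i]) (theta : nat -> 'rV[R]_d -> R[i])
    (htheta : resolution_of_unity phi0 phi theta) :
  let wt := wtilde q w in
  let B := LpRd v p in
  equal_with_equivalent_norms (Bnorm theta w v p q a)
    (Conorm Phi0 Phi (LXnorm B q a wt)) /\
  ((p < +oo)%E ->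
   equal_with_equivalent_norms (Fnorm theta w v p q a)
     (Conorm Phi0 Phi (PXnorm B q a wt))).
Proof.
move=> wt B; have [nA [nB sw]] := weight_class_scale al1_ge0 al2_ge0 hw.
have wX := doubling_weighted_space hv.
have SD := dyadic_calderon_system htheta; have SC := wavelet_calderon_system hPhi.
have wD := dyadic_weighted_space R; have wC := unit_weighted_space R.
have a0 := ltW a_gt0.
have [K1 K10 hK1] := change_of_system SD SC wD wC sw wX p_ge1 q_ge1 a0.
have [K2 K20 hK2] := change_of_system SC SD wC wD sw wX p_ge1 q_ge1 a0.
have chain (k l : R) (x y z : \bar R) : 0 < k -> (x <= k%:E * y)%E -> (y <= l%:E * z)%E ->
    (x <= (k * l)%:E * z)%E.
  move=> k0 xy yz; apply: le_trans xy _; rewrite EFinM -muleA.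
  by apply: lee_wpmul2l => //; rewrite lee_fin ltW.
split=> [|_].
  apply: (@equivalent_of_le _ _ _ _ (K1 * 2) (2 * K2)) => [||f|f]; rewrite ?mulr_gt0//.
    have [_ h] := Bnorm_mixed w a wX p_ge1 q_ge1 htheta f.
    rewrite (LXnorm_mixed a sw wX p_ge1 q_ge1 hPhi f).
    exact: (chain _ _ _ _ _ K10 (hK1 f (td_tempered f)).1 h).
  have [h _] := Bnorm_mixed w a wX p_ge1 q_ge1 htheta f.
  rewrite (LXnorm_mixed a sw wX p_ge1 q_ge1 hPhi f).
  exact: (chain _ _ _ _ _ _ h (hK2 f (td_tempered f)).1).
apply: (@equivalent_of_le _ _ _ _ (K1 * 2) (8 * K2)) => [||f|f]; rewrite ?mulr_gt0//.
  have [_ h] := Fnorm_nested a sw wX p_ge1 q_ge1 htheta f.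
  rewrite (PXnorm_nested w v p a q_ge1 hPhi f).
  exact: (chain _ _ _ _ _ K10 (hK1 f (td_tempered f)).2 h).
have [h _] := Fnorm_nested a sw wX p_ge1 q_ge1 htheta f.
rewrite (PXnorm_nested w v p a q_ge1 hPhi f).
exact: (chain _ _ _ _ _ _ h (hK2 f (td_tempered f)).2).
Qed.
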